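(* Let $d\ge5$ and let $u_\infty$ be the (positive, spatially decaying) singular radial solution of $$-\Delta u+|x|^2u=\omega u+u^3\quad\text{in }\mathbb{R}^d$$ for some $\omega=\omega_\infty\in(d-4,d)$, satisfying $$u_\infty(x)=\frac{\sqrt{d-3}}{|x|}\big[1+\mathcal{O}(|x|^2)\big]\quad\text{as }|x|\to0.$$ Then the Morse index $\mathfrak{m}(u_\infty)$ satisfies $$\mathfrak{m}(u_\infty)=\begin{cases}\infty,&5\le d\le12,\\ 1\text{ or }2,&13\le d\le15,\\ 1,&d\ge16.\end{cases}$$
   Context: $X\subset L^2(\mathbb{R}^d)$ is the form domain of $-\Delta+|x|^2$ with norm $\|u\|_X=\big(\int_{\mathbb{R}^d}(|\nabla u|^2+|x|^2|u|^2)\,dx\big)^{1/2}$, and $X_{\rm rad}=\{f\in X: f\text{ is radial}\}$. The existence of such $(\omega_\infty,u_\infty)$ is known; $u_\infty$ is smooth as a function of $r=|x|\in(0,\infty)$ and decays exponentially fast as $r\to\infty$. The Morse index $\mathfrak{m}(u_\infty)$ is the number of negative eigenvalues in $X_{\rm rad}$ of the linearized operator $$L_\infty:=-\Delta+|x|^2-\omega_\infty-3u_\infty^2,$$ where $L_\infty$ is considered in the form domain $X_{\rm rad}$.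
   Formalization: For 5≤d≤12 the quadratic form of L_∞ on X_rad is unbounded below and L_∞ has no eigenfunctions in X_rad, so the Morse index is taken there as the largest dimension of a subspace of X_rad on which the form is negative; for d≥13 it is the number of negative eigenvalues. *)

(* Defs.v *)
From HB Require Import structures.
From mathcomp Require Import all_boot all_order all_algebra.
From mathcomp Require Import all_classical all_reals all_analysis.

Set Implicit Arguments.
Unset Strict Implicit.
Unset Printing Implicit Defensive.

Import Order.TTheory GRing.Theory Num.Theory.
Import numFieldNormedType.Exports.

Local Open Scope classical_set_scope.
Local Open Scope ring_scope.

(* Lebesgue measure on the Borel sets of R^n, carried by n-tuples because
   these (unlike row vectors) have a product sigma-algebra in the library:
   mu_0 is the unit mass, mu_(n+1) the image of mu_1 \x mu_n under cons. *)
Section cons_measure.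
Context (R : realType) (n : nat).
Local Notation T := (measurableTypeR R).
Variable m : {sigma_finite_measure set (n.-tuple T) -> \bar R}.

Definition tuple_cons (x : T * n.-tuple T) : n.+1.-tuple T :=
  [the n.+1.-tuple T of x.1 :: x.2].

Lemma measurable_tuple_cons : measurable_fun [set: T * n.-tuple T] tuple_cons.
Proof. exact: (measurable_cons measurable_fst measurable_snd). Qed.

Definition cons_measure : set (n.+1.-tuple T) -> \bar R :=
  pushforward (lebesgue_measure \x m)%E tuple_cons.

Let cons_measurable A : measurable A -> measurable (tuple_cons @^-1` A).
Proof.
by move=> mA; rewrite -[X in measurable X]setTI; exact: measurable_tuple_cons.
Qed.

Let cons0 : cons_measure set0 = 0%E.
Proof. by rewrite /cons_measure /pushforward preimage_set0 measure0. Qed.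

Let cons_ge0 A : (0 <= cons_measure A)%E.
Proof. exact: (measure_ge0 (lebesgue_measure \x m)%E). Qed.

Let cons_sigma_additive : semi_sigma_additive cons_measure.
Proof.
move=> F mF tF mUF; rewrite /cons_measure /pushforward preimage_bigcup.
apply: measure_semi_sigma_additive.
- by move=> k; exact: cons_measurable.
- apply/trivIsetP => /= i j _ _ ij; rewrite -preimage_setI.
  by move/trivIsetP : tF => /(_ _ _ _ _ ij) ->//; rewrite preimage_set0.
- by rewrite -preimage_bigcup; exact: cons_measurable.
Qed.

HB.instance Definition _ := isMeasure.Build _ _ _
  cons_measure cons0 cons_ge0 cons_sigma_additive.

Let cons_sigma_finite : sigma_finite setT cons_measure.
Proof.
have /sigma_finiteP[F [TF ndF mF]] := sigma_finiteT (@lebesgue_measure R).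
have /sigma_finiteP[G [TG ndG mG]] := sigma_finiteT m.
pose un (t : n.+1.-tuple T) : T * n.-tuple T := (thead t, [tuple of behead t]).
have mun : measurable_fun setT un.
  apply/measurable_fun_pairP; split => /=; last exact: measurable_behead.
  exact: measurable_tnth.
have unK x : un (tuple_cons x) = x.
  by case: x => a t; congr pair; apply/val_inj.
exists (fun k => un @^-1` (F k `*` G k)).
  rewrite -preimage_bigcup; apply/esym/seteqP; split => // t _.
  have : setT (thead t) by [].
  rewrite TF => -[i _ Fi].
  have : setT [tuple of behead t] by [].
  rewrite TG => -[j _ Gj].
  exists (maxn i j) => //=; split => /=.
    by move: Fi; exact/subsetPset/ndF/leq_maxl.
  by move: Gj; exact/subsetPset/ndG/leq_maxr.
move=> k; have [mFk Fk] := mF k; have [mGk Gk] := mG k; split.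
  by rewrite -[X in measurable X]setTI; apply: mun => //; exact: measurableX.
rewrite /cons_measure /pushforward.
have -> : tuple_cons @^-1` (un @^-1` (F k `*` G k)) = F k `*` G k.
  by rewrite -comp_preimage (_ : un \o tuple_cons = id)//; exact/funext.
by rewrite product_measure1E// lte_mul_pinfty// ge0_fin_numE.
Qed.

HB.instance Definition _ := @Measure_isSigmaFinite.Build _ _ _
  cons_measure cons_sigma_finite.

End cons_measure.

Fixpoint lebesgue_tuple (R : realType) (n : nat) :
    {sigma_finite_measure set (n.-tuple (measurableTypeR R)) -> \bar R} :=
  match n with
  | 0 => [the {sigma_finite_measure set (0.-tuple (measurableTypeR R)) -> \bar R}
          of dirac [tuple]]
  | k.+1 => [the {sigma_finite_measure set (k.+1.-tuple (measurableTypeR R)) -> \bar R}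
          of cons_measure (lebesgue_tuple R k)]
  end.

Lemma lebesgue_tuple_box (R : realType) (n : nat)
    (A : nat -> set (measurableTypeR R)) : (forall i, measurable (A i)) ->
  lebesgue_tuple R n [set t : n.-tuple _ | forall i : 'I_n, A i (tnth t i)] =
  (\prod_(i < n) lebesgue_measure (A i))%E.
Proof.
elim: n A => [|n IH] A mA.
  by rewrite big_ord0 /= diracE mem_set// => -[].
rewrite big_ord_recl /= /cons_measure /pushforward.
pose B := [set t : n.-tuple (measurableTypeR R) |
  forall i : 'I_n, A i.+1 (tnth t i)].
rewrite (_ : _ @^-1` _ = A 0%N `*` B); last first.
  apply/seteqP; split=> -[a t] /=.
    move=> H; split; first exact: (H ord0).
    by move=> i; have := H (lift ord0 i); rewrite tnthS.
  by move=> [H1 H2] i; case: (unliftP ord0 i) => [j|] ->//; rewrite tnthS; exact: H2.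
have mB : measurable B.
  rewrite (_ : B = \bigcap_(i in [set: 'I_n])
      ((fun t => @tnth n (measurableTypeR R) t i) @^-1` A i.+1)).
    apply: fin_bigcap_measurable; first exact: finite_finset.
    by move=> i _; rewrite -[X in measurable X]setTI; exact: measurable_tnth.
  by apply/seteqP; split=> t H i //=; exact: H.
rewrite product_measure1E//; congr (_ * _)%E; exact: (IH (fun i => A i.+1)).
Qed.

Section euclidean.
Context (R : realType) (d : nat).
Implicit Types (x y : 'rV[R]_d) (f g : 'rV[R]_d -> R).

Definition vec (t : d.-tuple (measurableTypeR R)) : 'rV[R]_d :=
  \row_i (tnth t i : R).

(* the Euclidean norm; the library's norm on 'rV[R]_d is the sup norm *)
Definition enorm x : R := Num.sqrt (\sum_i x 0 i ^+ 2).

Definition integral_Rd f : R := \int[lebesgue_tuple R d]_t f (vec t).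

Definition inL2 f : Prop :=
  measurable_fun [set: d.-tuple (measurableTypeR R)] (f \o vec) /\
  finite_norm (lebesgue_tuple R d) 2%:E (f \o vec).

Definition ae_zero f : Prop := {ae lebesgue_tuple R d, forall t, f (vec t) = 0}.

Definition radial f : Prop := forall x y, enorm x = enorm y -> f x = f y.

Definition partial (i : 'I_d) f x : R := 'D_(delta_mx 0 i) f x.

Definition laplacian f x : R := \sum_i partial i (partial i f) x.

(* for open D *)
Definition smooth_on (D : set 'rV[R]_d) f : Prop :=
  forall (s : seq 'I_d) x, D x -> differentiable (foldr partial f s) x.

Definition test_function (phi : 'rV[R]_d -> R) : Prop :=
  smooth_on setT phi /\ exists M : R, forall x, M < enorm x -> phi x = 0.

Definition weak_gradient f (G : 'I_d -> 'rV[R]_d -> R) : Prop :=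
  forall i, inL2 (G i) /\
    forall phi, test_function phi ->
      integral_Rd (fun x => f x * partial i phi x) =
      - integral_Rd (fun x => G i x * phi x).

(* the weak gradient, if there is one in L^2 (it is unique a.e.) *)
Definition wgrad f : 'I_d -> 'rV[R]_d -> R :=
  xget (fun _ _ => 0) [set G | weak_gradient f G].

Definition inX f : Prop :=
  [/\ inL2 f, inL2 (fun x => enorm x * f x) & exists G, weak_gradient f G].

Definition inXrad f : Prop := inX f /\ radial f.

Definition L2_dot f g : R := integral_Rd (fun x => f x * g x).

End euclidean.

Section singular_solution.
Context (R : realType) (d : nat) (omega : R) (u : 'rV[R]_d -> R).
Implicit Types x : 'rV[R]_d.

(* The equation is imposed on R^d minus the origin, where u is smooth; the
   value of u at the origin is irrelevant. *)
Record singular_solution : Prop := SingularSolution {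
  sing_radial : radial u;
  sing_pos : forall x, x != 0 -> 0 < u x;
  sing_smooth : smooth_on [set x | x != 0] u;
  sing_eq : forall x, x != 0 ->
    - laplacian u x + enorm x ^+ 2 * u x = omega * u x + u x ^+ 3;
  sing_decay : exists C a : R, 0 < a /\
    forall x, 1 <= enorm x -> u x <= C * expR (- a * enorm x);
  sing_origin :
    (fun x : 'rV[R]_d => u x * enorm x / Num.sqrt (d%:R - 3) - 1 : R^o)
      =O_ ((0 : 'rV[R]_d)^') (fun x : 'rV[R]_d => enorm x ^+ 2 : R^o)
}.

(* f, g |-> <L f, g> for L = -Delta + |x|^2 - omega - 3 u^2 *)
Definition Lform (f g : 'rV[R]_d -> R) : R :=
  integral_Rd (fun x =>
    (\sum_i wgrad f i x * wgrad g i x) + enorm x ^+ 2 * (f x * g x)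
    - omega * (f x * g x) - 3 * u x ^+ 2 * (f x * g x)).

Definition L_eigenfunction (lambda : R) (f : 'rV[R]_d -> R) : Prop :=
  [/\ inXrad f, ~ ae_zero f &
    forall g, inXrad g -> Lform f g = lambda * L2_dot f g].

Definition lincomb k (c : 'I_k -> R) (f : 'I_k -> 'rV[R]_d -> R) :
    'rV[R]_d -> R :=
  fun x => \sum_j c j * f j x.

Definition L2_free k (f : 'I_k -> 'rV[R]_d -> R) : Prop :=
  forall c, ae_zero (lincomb c f) -> forall j, c j = 0.

(* number of negative eigenvalues of L in X_rad, with multiplicity *)
Definition negative_eigenvalue_count : \bar R :=
  ereal_sup [set z | exists (k : nat) (f : 'I_k -> 'rV[R]_d -> R)
      (lambda : 'I_k -> R),
    [/\ z = k%:R%:E, L2_free f &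
        forall j, lambda j < 0 /\ L_eigenfunction (lambda j) (f j)]].

(* largest dimension of a subspace of X_rad on which the form is negative *)
Definition form_negative_index : \bar R :=
  ereal_sup [set z | exists (k : nat) (f : 'I_k -> 'rV[R]_d -> R),
    [/\ z = k%:R%:E, forall j, inXrad (f j) &
        forall c, (exists j, c j != 0) ->
          Lform (lincomb c f) (lincomb c f) < 0]].

Definition form_bounded_below : Prop :=
  exists C : R, forall f, inXrad f -> - C * L2_dot f f <= Lform f f.

(* If the form is bounded below on X_rad (13 <= d), it defines a self-adjoint
   operator with form domain X_rad, whose negative eigenvalues are counted.
   Otherwise (5 <= d <= 12) there is no such operator and a literal count of
   eigenvalues in X_rad would give 0: 3 u^2 exceeds the Hardy potential
   (d-2)^2/(4|x|^2) at the origin, so that radial solutions of L f = lambda f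
   behave like |x|^(-(d-2)/2) cos(nu ln |x| + c) there and are not in X_rad.
   The number of negative eigenvalues is then taken in the min-max sense, as
   the negative index of the form on X_rad. *)
Definition morse_index : \bar R :=
  if `[< form_bounded_below >] then negative_eigenvalue_count
  else form_negative_index.

End singular_solution.

(* Main.v *)
From HB Require Import structures.
Require Import Defs.
From mathcomp Require Import fingroup perm.
From mathcomp Require Import all_boot all_order all_algebra.
From mathcomp Require Import all_classical all_reals all_analysis.
From mathcomp Require Import measurable_realfun ring lra.
Set Implicit Arguments.
Unset Strict Implicit.
Unset Printing Implicit Defensive.
Import Order.TTheory GRing.Theory Num.Theory.
Import numFieldNormedType.Exports.
Local Open Scope classical_set_scope.
Local Open Scope ring_scope.

(* With t = ln |x| and u = sqrt(d-3) f(t) / |x|, the form of L on a radial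
   function F(ln |x|) is, up to a constant, the integral of
   (F'^2 + V F^2) e^{(d-2)t}, where V = e^{4t} - omega e^{2t} - 3(d-3) f^2 and
   f -> 1 at minus infinity. The limit -3(d-3) of V is to be compared with the
   Hardy constant (d-2)^2/4.

   If d <= 12, then 3(d-3) > (d-2)^2/4 and there are test functions of negative
   energy, with disjoint supports, arbitrarily close to the origin: the form is
   unbounded below and negative on subspaces of every dimension.

   If 13 <= d, then 3(d-3) < (d-2)^2/4, and f < 1 makes the form bounded below.
   The solution of the eigenvalue equation that is regular at minus infinity
   stays positive and decays for a suitable lambda < 0 (shooting, and comparison
   with f by a Wronskian for the sign): this is one negative eigenvalue.
   Conversely, f^-2 is bounded below by an explicit barrier, hence V by an
   explicit rational function of e^{2t}, for which there are explicit solutions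
   of the Riccati inequality P' + P^2 + (d-2) P <= V; the derivative of f gives
   one near plus infinity. They make the form nonnegative on the functions that
   vanish at the two points where the pieces meet, and the first of these
   conditions is superfluous if 16 <= d. So there are at most two negative
   eigenvalues, and at most one if 16 <= d. *)

(** * One-variable calculus *)

(** The definition of X_rad only provides weak gradients in L^2(R^d). No differential equation is
    derived for an element of X_rad: each one gets a profile [Gam] in t whose increments are
    integrals of the radial derivative over annuli, and the integrations by parts behind Hardy's
    inequality, the Riccati bounds and the eigenvalue equation are Fubini's theorem for two such
    integrals. The sign of (d-2)^2 - 12 (d-3) = d^2 - 16 d + 40 separates d <= 12 from 13 <= d; for
    13 <= d its square root is the exponent [frob_exp]. The singular solution is not explicit, and
    of [omega] only d - 4 < omega < d is known, so the inequalities have to hold uniformly in d -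
    omega, between 0 and 4. The comparison is made for f^-2 because in its equation the nonlinear
    term is a square with a favourable sign, which leaves a linear inequality. The threshold 16
    comes from gluing at e^{2t} = d/4: the inner Riccati solution is at least the outer one there
    exactly if 6 / (2 + d/4) <= 1. *)

Section pointwise_derivatives.
Context {R : realType}.
Implicit Types (f g : R -> R) (x a b c : R).

(** Rules for [is_derive] on functions in applied form. A derivative is obtained by composing them
    and then identified with the intended expression by [ring] or [field]. *)
Lemma drv_cst c x : is_derive x 1 (fun _ : R => c) 0.
Proof. exact: is_derive_cst. Qed.

Lemma drv_id x : is_derive x 1 (fun y : R => y) 1.
Proof. exact: is_derive_id. Qed.

Lemma drv_add f g x a b : is_derive x 1 f a -> is_derive x 1 g b ->
  is_derive x 1 (fun y => f y + g y) (a + b).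
Proof. exact: is_deriveD. Qed.

Lemma drv_opp f x a : is_derive x 1 f a -> is_derive x 1 (fun y => - f y) (- a).
Proof. exact: is_deriveN. Qed.

Lemma drv_mul f g x a b : is_derive x 1 f a -> is_derive x 1 g b ->
  is_derive x 1 (fun y => f y * g y) (a * g x + f x * b).
Proof.
by move=> fa gb; apply: (is_derive_eq (is_deriveM fa gb)); rewrite /GRing.scale /= addrC mulrC.
Qed.

Lemma drv_pow f n x a : is_derive x 1 f a ->
  is_derive x 1 (fun y => f y ^+ n) (n%:R * f x ^+ n.-1 * a).
Proof.
move=> fa; have -> : (fun y => f y ^+ n) = f ^+ n.
  by apply/funext => y; elim: n => // n IH; rewrite !exprS IH.
exact: is_deriveX.
Qed.

Lemma drv_comp f g x a b : is_derive x 1 g b -> is_derive (g x) 1 f a ->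
  is_derive x 1 (fun y => f (g y)) (a * b).
Proof.
by move=> gb fa; exact: (is_derive1_comp fa gb).
Qed.

Lemma drv_expR f x a : is_derive x 1 f a ->
  is_derive x 1 (fun y => expR (f y)) (expR (f x) * a).
Proof. by move=> fa; apply: drv_comp => //; exact: is_derive_expR. Qed.

Lemma drv_inv f x a : f x != 0 -> is_derive x 1 f a ->
  is_derive x 1 (fun y => (f y)^-1) (- (f x) ^- 2 * a).
Proof.
by move=> fx0 fa; exact: (is_deriveV fx0 fa).
Qed.

Lemma der_cont f x a : is_derive x 1 f a -> {for x, continuous f}.
Proof. by move=> [df _]; exact/differentiable_continuous/derivable1_diffP. Qed.

Lemma der_within f f' a b : (forall x, a <= x <= b -> is_derive x 1 f (f' x)) ->
  {within `[a, b], continuous f}.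
Proof.
move=> df; apply: derivable_within_continuous => x; rewrite in_itv /=.
by move=> /df[].
Qed.

Lemma der_MVT f f' a b : a < b ->
  (forall x, a <= x <= b -> is_derive x 1 f (f' x)) ->
  exists2 c, a < c < b & f b - f a = f' c * (b - a).
Proof.
move=> ab df.
have df' x : x \in `]a, b[ -> is_derive x 1 f (f' x).
  by rewrite in_itv /= => /andP[ax xb]; apply: df; rewrite !ltW.
have [c] := MVT ab df' (der_within df).
by rewrite in_itv /= => ? ?; exists c.
Qed.

Lemma der_nondec f f' a b : a <= b ->
  (forall x, a <= x <= b -> is_derive x 1 f (f' x)) ->
  (forall x, a < x < b -> 0 <= f' x) -> f a <= f b.
Proof.
rewrite le_eqVlt => /predU1P[->//|ab] df f0.
have [c /f0 c0 e] := der_MVT ab df.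
by rewrite -subr_ge0 e mulr_ge0// subr_ge0 ltW.
Qed.

Lemma der_inc f f' a b : a < b ->
  (forall x, a <= x <= b -> is_derive x 1 f (f' x)) ->
  (forall x, a < x < b -> 0 < f' x) -> f a < f b.
Proof.
move=> ab df f0; have [c /f0 c0 e] := der_MVT ab df.
by rewrite -subr_gt0 e mulr_gt0// subr_gt0.
Qed.

Lemma der_is_cst f a b : a <= b -> (forall x, a <= x <= b -> is_derive x 1 f 0) ->
  f a = f b.
Proof.
move=> ab df; apply/eqP; rewrite eq_le; apply/andP; split.
  exact: (der_nondec (f' := fun=> 0)).
rewrite -lerN2; apply: (der_nondec (f := fun x => - f x) (f' := fun=> 0)) => //.
by move=> x /df dx; have := drv_opp dx; rewrite oppr0.
Qed.

Lemma der_uniq f x a b : is_derive x 1 f a -> is_derive x 1 f b -> a = b.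
Proof. by move=> [_ <-] [_ <-]. Qed.

Lemma der_ext f g x a : (forall y, f y = g y) -> is_derive x 1 f a ->
  is_derive x 1 g a.
Proof. by move=> /funext ->. Qed.

Lemma der_near f g x a : (\forall y \near x, f y = g y) -> is_derive x 1 f a ->
  is_derive x 1 g a.
Proof. exact: near_eq_is_derive. Qed.

(** The integral from a base point is a primitive to the right of that point only. Primitives on the
    half-lines above -n, normalized to vanish at 0, agree where both are defined, and are glued. *)
Lemma antiderivative f : continuous f ->
  exists F, forall x, is_derive x 1 F (f x).
Proof.
move=> cf.
pose F x := \int[lebesgue_measure]_(t in `[0, x]) f t.
have intf a b : lebesgue_measure.-integrable `[a, b] (EFin \o f).
  apply: continuous_compact_integrable; first exact: segment_compact.
  exact: continuous_subspaceT.
have G a : exists F, forall x, a < x -> is_derive x 1 F (f x).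
  exists (fun x => \int[lebesgue_measure]_(t in `[a, x]) f t) => x ax.
  have x1 : x < x + 1 by rewrite ltrDl.
  have [d e] := continuous_FTC1_closed x1 (intf a (x + 1)) ax (cf x).
  by apply: (DeriveDef d); rewrite -derive1E; exact: e.
have /choice[H HP] : forall n : nat, exists F : R -> R, forall x : R, - n%:R < x ->
    is_derive x 1 F (f x) by move=> n; exact: G.
pose K n x := H n x - H n 0.
have KP n (x : R) : - n%:R < x -> is_derive x 1 (K n) (f x).
  move=> /HP h; rewrite /K.
  by have := drv_add h (drv_cst (- H n 0) x); rewrite addr0.
have Kle n m (x : R) : (0 < n)%N -> (n <= m)%N -> - n%:R < x -> K m x = K n x.
  move=> n0 nm nx.
  have n0' : - n%:R < 0 :> R by rewrite oppr_lt0 ltr0n.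
  have mn : - m%:R <= - n%:R :> R by rewrite lerN2 ler_nat.
  have D (y : R) : - n%:R < y -> is_derive y 1 (fun x => K m x - K n x) 0.
    move=> ny; have := drv_add (KP _ _ (le_lt_trans mn ny)) (drv_opp (KP _ _ ny)).
    by rewrite subrr.
  have K0 : K m 0 - K n 0 = 0 by rewrite /K !subrr.
  apply/eqP; rewrite -subr_eq0 -K0; apply/eqP.
  have [x0|x0] := leP x 0.
    by apply: (@der_is_cst (fun x => K m x - K n x)) => // y /andP[xy _];
      apply: D; exact: lt_le_trans xy.
  apply/esym/(@der_is_cst (fun x => K m x - K n x)) => [|y /andP[xy _]].
    exact: ltW.
  by apply: D; exact: lt_le_trans xy.
pose N (x : R) := (Num.truncn `|x|).+1.
have NP x : - (N x)%:R < x.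
  by rewrite ltrNl (le_lt_trans (ler_norm _))// normrN truncnS_gt.
exists (fun x => K (N x) x) => x.
apply: (@der_near (K (N x).+1)); last first.
  apply: KP; apply: le_lt_trans (NP x).
  by rewrite lerN2 ler_nat.
have xI : x \in `](- (N x)%:R), (N x).+1%:R[.
  rewrite in_itv /= NP /=.
  by rewrite (le_lt_trans (ler_norm _))// (lt_le_trans (truncnS_gt _))// ler_nat.
near=> y.
have : y \in `](- (N x)%:R), (N x).+1%:R[.
  near: y; exact: near_in_itvoo.
rewrite in_itv /= => /andP[y1 y2].
case: (leqP (N y) (N x).+1) => h; first by rewrite (@Kle (N y)).
apply/esym; apply: Kle => //; first exact: ltnW.
by apply: le_lt_trans y1; rewrite lerN2 ler_nat.
Unshelve. all: by end_near. Qed.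

End pointwise_derivatives.

Section pointwise_continuity.
Context {R : realType}.
Implicit Types f g : R -> R.

Lemma cont_cst (c : R) : continuous (fun _ : R => c).
Proof. by move=> x; exact: cst_continuous. Qed.

Lemma cont_id : continuous (fun x : R => x).
Proof. by move=> x; exact: cvg_id. Qed.

Lemma cont_add f g : continuous f -> continuous g -> continuous (fun x => f x + g x).
Proof. by move=> cf cg x; exact: (@continuousD _ _ _ f g x (cf x) (cg x)). Qed.

Lemma cont_opp f : continuous f -> continuous (fun x => - f x).
Proof. by move=> cf x; exact: (@continuousN _ _ _ f x (cf x)). Qed.

Lemma cont_mul f g : continuous f -> continuous g -> continuous (fun x => f x * g x).
Proof. by move=> cf cg x; exact: (@continuousM _ _ f g x (cf x) (cg x)). Qed.

Lemma cont_comp f g : continuous f -> continuous g -> continuous (fun x => g (f x)).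
Proof. by move=> cf cg x; apply: (@continuous_comp _ _ _ f g); [exact: cf|exact: cg]. Qed.

Lemma cont_exp f : continuous f -> continuous (fun x => expR (f x)).
Proof. by move=> cf; apply: cont_comp cf _; exact: continuous_expR. Qed.

Lemma cont_pow f n : continuous f -> continuous (fun x => f x ^+ n).
Proof. by move=> cf; elim: n => [|n IH]; [exact: cont_cst|under eq_fun do rewrite exprS; exact: cont_mul]. Qed.

Lemma cont_norm f : continuous f -> continuous (fun x => `|f x|).
Proof. by move=> cf x; apply: (continuous_comp (cf x)); exact: norm_continuous. Qed.

Lemma cont_inv f : continuous f -> (forall x, f x != 0) -> continuous (fun x => (f x)^-1).
Proof. by move=> cf f0 x; apply: (@continuousV _ _ f x (f0 x)); exact: cf. Qed.

End pointwise_continuity.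

Ltac cont := repeat lazymatch goal with
  | |- forall x, continuous_at x (fun _ => ?c) => exact: cont_cst
  | |- forall x, continuous_at x (fun y => y) => exact: cont_id
  | |- forall x, continuous_at x (fun y => (_ + _)%R) => apply: cont_add
  | |- forall x, continuous_at x (+%R _) => apply: cont_add
  | |- forall x, continuous_at x (fun y => (- _)%R) => apply: cont_opp
  | |- forall x, continuous_at x (fun y => (_ * _)%R) => apply: cont_mul
  | |- forall x, continuous_at x ( *%R _) => apply: cont_mul
  | |- forall x, continuous_at x (fun y => (_ ^+ _)%R) => apply: cont_pow
  | |- forall x, continuous_at x (fun y => expR _) => apply: cont_exp
  | |- forall x, continuous_at x (fun y => `|_|%R) => apply: cont_norm
  | |- forall x, continuous_at x (fun y => (_^-1)%R) => apply: cont_inv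
  | _ => assumption
  end.

(** * Smooth bumps and test functions *)

Section smooth1.
Context {R : realType}.
Implicit Types (f g : R -> R) (B : set (R -> R)).

(** Smoothness as membership in some set of functions closed under differentiation: a proof exhibits
    such a set, and no iterated derivative has to be computed. *)
Definition smooth1 f := exists C : set (R -> R), C f /\
  forall g, C g -> exists2 g', C g' & forall x : R, is_derive x 1 g (g' x).

Inductive func_alg B : (R -> R) -> Prop :=
| func_alg_base f : B f -> func_alg B f
| func_alg_cst c : func_alg B (fun=> c)
| func_alg_add f g : func_alg B f -> func_alg B g ->
    func_alg B (fun x => f x + g x)
| func_alg_mul f g : func_alg B f -> func_alg B g ->
    func_alg B (fun x => f x * g x).

(** By the Leibniz rule, the algebra generated by [B] is itself a set closed under
    differentiation. *)
Lemma func_alg_smooth B :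
  (forall f, B f -> exists2 f', func_alg B f' &
    forall x : R, is_derive x 1 f (f' x)) ->
  forall f, func_alg B f -> smooth1 f.
Proof.
move=> hB f Af; exists (func_alg B); split => // {f Af}.
move=> _ [f /hB//|c|f g Af Ag|f g Af Ag].
- by exists (fun=> 0); [exact: func_alg_cst|move=> x; exact: (drv_cst c x)].
- have IH h : func_alg B h -> exists2 h', func_alg B h' &
    forall x : R, is_derive x 1 h (h' x).
    elim=> {f g Af Ag}[f /hB//|c|f g _ [f' Bf ff'] _ [g' Bg gg']
        |f g Af [f' Bf ff'] Ag [g' Bg gg']].
    + by exists (fun=> 0); [exact: func_alg_cst|move=> x; exact: (drv_cst c x)].
    + exists (fun x => f' x + g' x); first exact: func_alg_add.
      by move=> x; exact: drv_add.
    + exists (fun x => f' x * g x + f x * g' x).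
        by apply: func_alg_add; exact: func_alg_mul.
      by move=> x; exact: drv_mul.
  by apply: IH; exact: func_alg_add.
- have IH h : func_alg B h -> exists2 h', func_alg B h' &
    forall x : R, is_derive x 1 h (h' x).
    elim=> {f g Af Ag}[f /hB//|c|f g _ [f' Bf ff'] _ [g' Bg gg']
        |f g Af [f' Bf ff'] Ag [g' Bg gg']].
    + by exists (fun=> 0); [exact: func_alg_cst|move=> x; exact: (drv_cst c x)].
    + exists (fun x => f' x + g' x); first exact: func_alg_add.
      by move=> x; exact: drv_add.
    + exists (fun x => f' x * g x + f x * g' x).
        by apply: func_alg_add; exact: func_alg_mul.
      by move=> x; exact: drv_mul.
  by apply: IH; exact: func_alg_mul.
Qed.

Lemma smooth1_der f : smooth1 f ->
  exists2 f', smooth1 f' & forall x : R, is_derive x 1 f (f' x).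
Proof.
move=> [C [Cf hC]]; have [f' Cf' ff'] := hC _ Cf.
by exists f' => //; exists C.
Qed.

Lemma smooth1_cont f : smooth1 f -> continuous f.
Proof. by move=> /smooth1_der[f' _ ff'] x; exact: der_cont (ff' x). Qed.

Lemma smooth1_alg f : func_alg smooth1 f -> smooth1 f.
Proof.
apply: func_alg_smooth => {}f /smooth1_der[f' sf' ff'].
by exists f' => //; exact: func_alg_base.
Qed.

Lemma smooth1_cst (c : R) : smooth1 (fun=> c).
Proof. by apply/smooth1_alg/func_alg_cst. Qed.

Lemma smooth1_add f g : smooth1 f -> smooth1 g -> smooth1 (fun x => f x + g x).
Proof. by move=> *; apply/smooth1_alg/func_alg_add; exact: func_alg_base. Qed.

Lemma smooth1_mul f g : smooth1 f -> smooth1 g -> smooth1 (fun x => f x * g x).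
Proof. by move=> *; apply/smooth1_alg/func_alg_mul; exact: func_alg_base. Qed.

Lemma smooth1_anti f F : (forall x : R, is_derive x 1 F (f x)) ->
  smooth1 f -> smooth1 F.
Proof.
move=> dF [C [Cf hC]]; exists (C `|` [set F]); split; first by right.
move=> g [/hC[g' Cg' gg']|->]; first by exists g' => //; left.
by exists f => //; left.
Qed.

Lemma smooth1_id : smooth1 (fun x : R => x).
Proof. exact: (smooth1_anti (fun x => drv_id x) (smooth1_cst 1)). Qed.

Lemma smooth1_exp : smooth1 (@expR R).
Proof.
by exists [set @expR R]; split => // _ ->; exists (@expR R) => // x;
  exact: is_derive_expR.
Qed.

(** By the chain rule, the algebra generated by the smooth functions and by all [k \o g] with [k]
    smooth is closed under differentiation. *)
Lemma smooth1_comp f g : smooth1 f -> smooth1 g -> smooth1 (fun x => f (g x)).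
Proof.
move=> sf sg; pose B := [set h | exists2 k, smooth1 k & h = k \o g] `|` smooth1.
apply: (@func_alg_smooth B); last by apply: func_alg_base; left; exists f.
move=> h0 [[k /smooth1_der[k' sk' kk'] ->]|]; last first.
  move=> /smooth1_der[h' sh' hh']; exists h' => //.
  by apply: func_alg_base; right.
have [g' sg' gg'] := smooth1_der sg.
exists (fun x => k' (g x) * g' x); last first.
  by move=> x; exact: (drv_comp (gg' x) (kk' (g x))).
apply: func_alg_mul; apply: func_alg_base; last by right.
by left; exists k'.
Qed.

(** Serves at the points where a piecewise formula changes. *)
Lemma der_of_quad f (x a C : R) : (forall y, `|f y - f x - a * (y - x)| <= C * (y - x) ^+ 2) ->
  is_derive x 1 f a.
Proof.
move=> H.
have C0 : 0 <= C.
  have := le_trans (normr_ge0 _) (H (x + 1)).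
  by rewrite addrAC subrr add0r expr1n mulr1.
have L : h^-1 *: ((f \o shift x) (h *: 1) - f x) @[h --> 0^'] --> a.
  apply/cvgrPdist_lt => e e0; near=> h.
  have h0 : h != 0 by near: h; exact: nbhs_dnbhs_neq.
  rewrite /= /GRing.scale /= mulr1.
  have -> : a - h^-1 * (f (h + x) - f x) =
            - (h^-1 * (f (h + x) - f x - a * (h + x - x))).
    by field.
  rewrite normrN normrM normrV ?unitfE//.
  rewrite ltr_pdivrMl ?normr_gt0//.
  apply: le_lt_trans (H _) _; rewrite addrK.
  rewrite -real_normK ?num_real// expr2 mulrCA ltr_pM2l ?normr_gt0//.
  have : `|h| < e / (C + 1).
    near: h; apply: dnbhs0_lt; apply: divr_gt0 => //.
    by rewrite ltr_wpDl.
  rewrite ltr_pdivlMr ?ltr_wpDl//; apply: le_lt_trans.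
  by rewrite mulrC ler_wpM2l// lerDl.
by apply: DeriveDef; [exact: cvgP L|exact: cvg_lim L].
Unshelve. all: by end_near. Qed.

(** The usual flat function e^{-1/x}. The factor [x ^- k] makes the family closed under
    differentiation up to linear combinations, as [smooth1] asks. *)
Definition bump_germ (k : nat) (x : R) : R :=
  if 0 < x then x ^- k * expR (- x^-1) else 0.

Lemma bump_germ_ge0 k x : 0 <= bump_germ k x.
Proof.
rewrite /bump_germ; case: ifP => // x0.
by rewrite mulr_ge0 ?expR_ge0// invr_ge0 exprn_ge0// ltW.
Qed.

(** From y^{k+2} / (k+2)! <= e^y at y = 1/x; it gives the derivative at 0. *)
Lemma bump_germ_quad k x : bump_germ k x <= k.+2`!%:R * x ^+ 2.
Proof.
rewrite /bump_germ; case: ifP => [x0|_]; last by rewrite mulr_ge0 ?sqr_ge0.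
have y0 : 0 <= x^-1 by rewrite invr_ge0 ltW.
have h : x ^- k.+2 * expR (- x^-1) <= k.+2`!%:R.
  rewrite expRN ler_pdivrMr ?expR_gt0//.
  have := expR_ge1Dxn k.+1 y0; rewrite exprVn => h.
  rewrite -ler_pdivrMl ?ltr0n ?fact_gt0// mulrC.
  by apply: le_trans h; rewrite lerDr.
rewrite -ler_pdivrMr ?exprn_gt0//.
rewrite mulrAC (le_trans _ h)//.
by rewrite -invfM -exprD addn2.
Qed.

Lemma bump_germ_der k (x : R) :
  is_derive x 1 (bump_germ k) (- k%:R * bump_germ k.+1 x + bump_germ k.+2 x).
Proof.
have [x0|x0|x0] := ltgtP 0 x.
- apply: (@der_near _ (fun y => y ^- k * expR (- y^-1))).
    near=> y; rewrite /bump_germ ifT//; near: y; exact: lt_nbhsr.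
  have x1 : x != 0 by rewrite gt_eqF.
  have d1 : is_derive x 1 (fun y : R => y^-1) (- x ^- 2).
    by have := drv_inv x1 (drv_id x); rewrite mulr1.
  have := drv_mul (drv_pow k d1) (drv_expR (drv_opp d1)).
  rewrite [X in is_derive x 1 X](_ : _ = (fun y => y ^- k * expR (- y^-1))).
    move=> h; apply: (is_derive_eq h); rewrite /bump_germ x0 opprK.
    case: k {h} => [|k]; first by rewrite /= expr0; field.
    rewrite -!exprVn /=; set y := x^-1.
    by rewrite [y ^+ k.+3]exprS [y ^+ k.+2]exprS [y ^+ k.+1]exprS; ring.
  by apply/funext => y; rewrite exprVn.
- apply: (@der_near _ (fun y => 0)).
    near=> y; rewrite /bump_germ ifF//; apply/negbTE; rewrite -leNgt ltW//.
    by near: y; exact: lt_nbhsl.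
  by rewrite /bump_germ !ifF ?mulr0 ?addr0 ?(ltW x0)//; [exact: (drv_cst 0 x)|
    apply/negbTE; rewrite -leNgt ltW..].
- rewrite -x0 /bump_germ ltxx mulr0 addr0.
  apply: (@der_of_quad _ _ _ k.+2`!%:R) => y.
  rewrite ltxx mul0r !subr0 ger0_norm ?bump_germ_ge0//.
  exact: bump_germ_quad.
Unshelve. all: by end_near. Qed.

Lemma smooth1_bump_germ k : smooth1 (bump_germ k).
Proof.
apply: (@func_alg_smooth [set h | exists k, h = bump_germ k]).
  move=> _ [j ->].
  exists (fun x => - j%:R * bump_germ j.+1 x + bump_germ j.+2 x).
    apply: func_alg_add; last by apply: func_alg_base; exists j.+2.
    apply: func_alg_mul; first exact: func_alg_cst.
    by apply: func_alg_base; exists j.+1.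
  by move=> x; exact: bump_germ_der.
by apply: func_alg_base; exists k.
Qed.

(* a smooth approximation, from above, of the indicator of [`]a, b]] *)
Definition smooth_bump (a b : R) (n : nat) (t : R) : R :=
  bump_germ 0 (n%:R * (t - a)) * bump_germ 0 (n%:R * (n%:R * (b - t) + 1)).

Lemma smooth1_opp f : smooth1 f -> smooth1 (fun x => - f x).
Proof.
move=> sf; rewrite (_ : (fun _ => _) = (fun x => -1 * f x)).
  by apply: smooth1_mul => //; exact: smooth1_cst.
by apply/funext => x; rewrite mulN1r.
Qed.

Lemma smooth1_bump a b n : smooth1 (smooth_bump a b n).
Proof.
have s1 c : smooth1 (fun x : R => x - c).
  by apply: smooth1_add; [exact: smooth1_id|exact: smooth1_cst].
have s2 c : smooth1 (fun x : R => c - x).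
  by apply: smooth1_add; [exact: smooth1_cst|apply: smooth1_opp; exact: smooth1_id].
apply: smooth1_mul; (apply: smooth1_comp; first exact: smooth1_bump_germ).
  by apply: smooth1_mul => //; exact: smooth1_cst.
apply: smooth1_mul; first exact: smooth1_cst.
apply: smooth1_add; last exact: smooth1_cst.
by apply: smooth1_mul => //; exact: smooth1_cst.
Qed.

Lemma bump_germ_le1 x : bump_germ 0 x <= 1.
Proof.
rewrite /bump_germ; case: ifP => // x0.
by rewrite expr0 invr1 mul1r expR_le1 oppr_le0 invr_ge0 ltW.
Qed.

Lemma bump_germ_le0 k x : x <= 0 -> bump_germ k x = 0.
Proof. by rewrite /bump_germ => x0; rewrite ifF//; apply/negbTE; rewrite -leNgt. Qed.

Lemma bump_germ_gt0 k x : 0 < x -> 0 < bump_germ k x.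
Proof.
by move=> x0; rewrite /bump_germ x0 mulr_gt0 ?expR_gt0// invr_gt0 exprn_gt0.
Qed.

Lemma bump_ge0 a b n t : 0 <= smooth_bump a b n t.
Proof. by rewrite mulr_ge0// bump_germ_ge0. Qed.

Lemma bump_le1 a b n t : smooth_bump a b n t <= 1.
Proof. by rewrite mulr_ile1 ?bump_germ_ge0 ?bump_germ_le1. Qed.

Lemma bump_out a b n t : ~~ (a < t < b + 1) -> smooth_bump a b n t = 0.
Proof.
rewrite negb_and -!leNgt /smooth_bump => /orP[ta|bt].
  by rewrite bump_germ_le0 ?mul0r// mulr_ge0_le0// subr_le0.
rewrite [X in _ * X]bump_germ_le0 ?mulr0//; case: n => [|n]; first by rewrite mul0r.
rewrite mulr_ge0_le0//.
have n1 : 1 <= n.+1%:R :> R by rewrite ler1n.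
have : n.+1%:R * (b - t) <= n.+1%:R * (-1) by rewrite ler_pM2l//; lra.
by lra.
Qed.

Lemma bump_gt0 a b n t : (0 < n)%N -> a < t <= b -> 0 < smooth_bump a b n t.
Proof.
move=> n0 /andP[ta bt]; rewrite mulr_gt0//; apply: bump_germ_gt0.
  by rewrite mulr_gt0 ?ltr0n ?subr_gt0.
by rewrite mulr_gt0 ?ltr0n// ltr_wpDl// mulr_ge0// subr_ge0.
Qed.

Lemma bump_germ_cvg (c : R) : 0 < c -> bump_germ 0 (n%:R * c) @[n --> \oo] --> (1 : R).
Proof.
move=> c0.
have L : expR (- (c^-1 * n.+1%:R^-1)) @[n --> \oo] --> (1 : R).
  rewrite -[X in _ --> X]expR0; apply: continuous_cvg; first exact: continuous_expR.
  rewrite -[X in _ --> X]oppr0; apply: cvgN; rewrite -[X in _ --> X](mulr0 c^-1).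
  by apply: cvgMr; exact: cvg_harmonic.
rewrite -(cvg_shiftS _); apply: cvg_trans L; apply: near_eq_cvg; near=> n.
rewrite /= /bump_germ ifT; last by rewrite mulr_gt0.
by rewrite expr0 invr1 mul1r invfM mulrC.
Unshelve. all: by end_near. Qed.

Lemma bump_germ_mono x y : x <= y -> bump_germ 0 x <= bump_germ 0 y.
Proof.
rewrite /bump_germ; case: ifP => [x0 xy|_ _]; last exact: bump_germ_ge0.
have y0 := lt_le_trans x0 xy; rewrite y0 !expr0 invr1 !mul1r ler_expR lerN2.
by rewrite lef_pV2.
Qed.

(** The summand 1 in the second factor keeps the limit equal to 1 at t = b; for t > b that factor
    vanishes once 1 <= n (t - b). The limit is thus the exact indicator of a half-open interval, as
    the pi-system of boxes requires. *)
Lemma bump_cvg a b t : smooth_bump a b n t @[n --> \oo] --> (\1_(`]a, b]) t : R).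
Proof.
rewrite indicE; case: (boolP (a < t <= b)) => tab; last first.
  rewrite memNset /=; last by rewrite in_itv/=; exact/negP.
  move: tab; rewrite negb_and -!leNgt -ltNge => /orP[ta|bt].
    under eq_cvg do rewrite bump_out ?negb_and -?leNgt ?ta//.
    exact: cvg_cst.
  apply: cvg_near_cst; near=> n.
  rewrite /smooth_bump [X in _ * X]bump_germ_le0 ?mulr0// mulr_ge0_le0//.
  have tb : 0 < t - b by rewrite subr_gt0.
  suff : 1 <= n%:R * (t - b) by rewrite -opprB mulrN => h; lra.
  rewrite -ler_pdivrMr// div1r.
  by near: n; exact: nbhs_infty_ger.
rewrite mem_set /=; last by rewrite in_itv.
move: tab => /andP[ta bt]; rewrite -[X in _ --> X]mulr1.
apply: cvgM; first by apply: bump_germ_cvg; rewrite subr_gt0.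
have := bump_germ_cvg (@ltr01 R).
move=> /(squeeze_cvgr _); apply; last exact: cvg_cst.
near=> n; rewrite bump_germ_le1 andbT; apply: bump_germ_mono.
by rewrite ler_wpM2l// lerDr mulr_ge0// subr_ge0.
Unshelve. all: by end_near. Qed.

End smooth1.

(** * Smooth functions on R^d built from the coordinates *)

Section smooth_vec.
Context {R : realType} {d : nat}.
Implicit Types (f g : 'rV[R]_d -> R).

(** A syntactic class that is stable under partial derivatives and contains every test function
    constructed below; measurability and local boundedness are proved by induction on it. *)
Inductive smoothV : ('rV[R]_d -> R) -> Prop :=
| smoothV_coord i : smoothV (fun x => x 0 i)
| smoothV_cst c : smoothV (fun=> c)
| smoothV_add f g : smoothV f -> smoothV g -> smoothV (fun x => f x + g x)
| smoothV_mul f g : smoothV f -> smoothV g -> smoothV (fun x => f x * g x)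
| smoothV_comp h f : smooth1 h -> smoothV f -> smoothV (fun x => h (f x)).

Lemma partial_add i f g x : differentiable f x -> differentiable g x ->
  partial i (fun x => f x + g x) x = partial i f x + partial i g x.
Proof.
by move=> df dg; rewrite /partial (@deriveD _ _ _ f g)//; exact: diff_derivable.
Qed.

Lemma partial_mul i f g x : differentiable f x -> differentiable g x ->
  partial i (fun x => f x * g x) x = partial i f x * g x + f x * partial i g x.
Proof.
move=> df dg; rewrite /partial (@deriveM _ _ f g)//; try exact: diff_derivable.
by rewrite /GRing.scale /= addrC mulrC.
Qed.

Lemma partial_comp i (h : R -> R) h' f x : differentiable f x ->
  is_derive (f x) 1 h h' -> partial i (fun x => h (f x)) x = h' * partial i f x.
Proof.
move=> df [dh hh'].
have dh' : differentiable h (f x) by exact/derivable1_diffP.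
rewrite /partial (deriveE _ (differentiable_comp df dh')) (diff_comp df dh') /=.
rewrite -[X in 'd h _ X]mulr1 -[X in 'd h _ X]/(_ *: 1) linearZ/= -!deriveE// hh'.
by rewrite /GRing.scale /= mulrC.
Qed.

Lemma partial_coord i j (x : 'rV[R]_d) : partial i (fun x => x 0 j) x = (i == j)%:R.
Proof.
rewrite /partial /derive; apply: cvg_lim; first exact: norm_hausdorff.
apply: cvg_near_cst; near=> h.
have h0 : h != 0 by near: h; exact: nbhs_dnbhs_neq.
rewrite /= !mxE eqxx addrK /GRing.scale /= mulrA mulVf// mul1r.
by rewrite eq_sym.
Unshelve. all: by end_near. Qed.

Lemma smoothV_diff f : smoothV f ->
  (forall x, differentiable f x) /\ forall i, smoothV (partial i f).
Proof.
elim=> {f}[i|c|f g sf [df pf] sg [dg pg]|f g sf [df pf] sg [dg pg]|h f sh sf [df pf]].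
- split; first by move=> x; exact: differentiable_coord.
  move=> j; rewrite (_ : partial _ _ = (fun=> (j == i)%:R)).
    exact: smoothV_cst.
  by apply/funext => x; exact: partial_coord.
- split; first by move=> x; exact: differentiable_cst.
  move=> j; rewrite (_ : partial _ _ = (fun=> 0)); first exact: smoothV_cst.
  by apply/funext => x; rewrite /partial derive_cst.
- split; first by move=> x; exact: differentiableD.
  move=> j; rewrite (_ : partial _ _ = fun x => partial j f x + partial j g x).
    exact: smoothV_add.
  by apply/funext => x; exact: partial_add.
- split; first by move=> x; exact: differentiableM.
  move=> j; rewrite (_ : partial _ _ =
      fun x => partial j f x * g x + f x * partial j g x).
    by apply: smoothV_add; exact: smoothV_mul.
  by apply/funext => x; exact: partial_mul.
- have [h' sh' hh'] := smooth1_der sh.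
  split.
    move=> x; apply: (@differentiable_comp _ _ _ _ f h) => //.
    by apply/derivable1_diffP; have [] := hh' (f x).
  move=> j; rewrite (_ : partial _ _ = fun x => h' (f x) * partial j f x).
    by apply: smoothV_mul => //; exact: smoothV_comp.
  by apply/funext => x; exact: partial_comp.
Qed.

Lemma smoothV_smooth_on f : smoothV f -> smooth_on setT f.
Proof.
move=> sf s x _; suff /smoothV_diff[] : smoothV (foldr (@partial R d) f s) by [].
by elim: s => //= i s /smoothV_diff[].
Qed.

Lemma smoothV_sum I (r : seq I) (F : I -> 'rV[R]_d -> R) :
  (forall i, smoothV (F i)) -> smoothV (fun x => \sum_(i <- r) F i x).
Proof.
move=> sF; elim: r => [|i r IH].
  by under eq_fun do rewrite big_nil; exact: smoothV_cst.
by under eq_fun do rewrite big_cons; exact: smoothV_add.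
Qed.

Lemma smoothV_prod I (r : seq I) (F : I -> 'rV[R]_d -> R) :
  (forall i, smoothV (F i)) -> smoothV (fun x => \prod_(i <- r) F i x).
Proof.
move=> sF; elim: r => [|i r IH].
  by under eq_fun do rewrite big_nil; exact: smoothV_cst.
by under eq_fun do rewrite big_cons; exact: smoothV_mul.
Qed.

End smooth_vec.

(** * Polar integration *)

Section tuple_measure.
Context {R : realType} {d : nat}.
Local Notation T := (measurableTypeR R).
Local Notation X := (d.-tuple T).

Definition tbox (a b : 'I_d -> R) : set X :=
  [set t | forall i, a i < tnth t i <= b i].

Lemma tbox_bigcap a b : tbox a b =
  \bigcap_(i in [set: 'I_d]) ((fun t => @tnth d T t i) @^-1` `]a i, b i]).
Proof.
by apply/seteqP; split=> t h i; have := h i; rewrite /= in_itv /= ?inE => h'; auto.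
Qed.

Lemma measurable_tbox a b : measurable (tbox a b).
Proof.
rewrite tbox_bigcap; apply: fin_bigcap_measurable; first exact: finite_finset.
move=> i _; rewrite -[X in measurable X]setTI; exact: measurable_tnth.
Qed.

Lemma tboxI : setI_closed [set tbox ab.1 ab.2 | ab in setT].
Proof.
move=> _ _ [[a b] _ <-] [[a' b'] _ <-] /=.
exists ((fun i => Num.max (a i) (a' i)), (fun i => Num.min (b i) (b' i))) => //=.
apply/seteqP; split => t /=.
  move=> h; split => i; have := h i; rewrite gt_max le_min.
    by move=> /andP[/andP[-> _] /andP[-> _]].
  by move=> /andP[/andP[_ ->] /andP[_ ->]].
move=> [h h'] i; have := h i; have := h' i; rewrite gt_max le_min.
by move=> /andP[-> ->] /andP[-> ->].
Qed.

Lemma tbox_cover : \bigcup_k tbox (fun=> - k%:R) (fun=> k%:R) = setT.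
Proof.
rewrite -subTset => t _.
exists (Num.truncn (\sum_i `|tnth t i|)).+1 => //= i.
have h : `|tnth t i| < (Num.truncn (\sum_i `|tnth t i|)).+1%:R.
  apply: le_lt_trans (truncnS_gt _).
  by rewrite (bigD1 i)//= lerDl sumr_ge0.
by rewrite ltrNl (le_lt_trans (ler_norm _)) ?normrN//= (le_trans (ler_norm _))// ltW.
Qed.

Lemma measurable_tuple_tbox :
  @measurable _ X = <<s [set tbox ab.1 ab.2 | ab in setT] >>.
Proof.
apply/seteqP; split; last first.
  apply: smallest_sub; first exact: sigma_algebra_measurable.
  by move=> _ [[a b] _ <-]; exact: measurable_tbox.
apply: smallest_sub; first exact: smallest_sigma_algebra.
move=> A; rewrite -bigcup_seq /= => -[i _ iA].
have : preimage_set_system setT (fun t : X => @tnth d T t i) (@measurable _ T) A.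
  by [].
rewrite -g_sigma_preimageE; apply: smallest_sub.
  exact: smallest_sigma_algebra.
move=> _ [_ [[u v] _ <-] <-] /=; rewrite setTI.
rewrite (_ : _ @^-1` _ = \bigcup_k tbox
    (fun j => if j == i then u else - k%:R) (fun j => if j == i then v else k%:R)).
  apply: sigma_algebra_bigcup => k; apply: sub_sigma_algebra.
  by eexists (_, _).
apply/seteqP; split => t /=; rewrite in_itv /=.
  move=> h; have : setT t by [].
  rewrite -tbox_cover => -[k _ hk]; exists k => // j.
  by case: eqP => [->//|_]; exact: hk.
by move=> [k _ /(_ i)]; rewrite eqxx.
Qed.

Lemma tuple_measure_unique (m1 m2 : {measure set X -> \bar R}) :
  (forall a b, (m1 (tbox a b) < +oo)%E) ->
  (forall a b, m1 (tbox a b) = m2 (tbox a b)) ->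
  forall A, measurable A -> m1 A = m2 A.
Proof.
move=> foo e A mA.
apply: (measure_unique _ (fun k => tbox (fun=> - k%:R) (fun=> k%:R))
  measurable_tuple_tbox) => //.
- exact: tboxI.
- by move=> k; eexists (_, _).
- exact: tbox_cover.
- by move=> _ [[a b] _ <-]; exact: e.
Qed.

Lemma lebesgue_tbox a b :
  lebesgue_tuple R d (tbox a b) = (\prod_i Num.max 0 (b i - a i))%:E.
Proof.
pose A (j : nat) : set T :=
  if insub j is Some i then [set` `](a i), (b i)]] else set0.
have mA j : measurable (A j) by rewrite /A; case: insub.
have := @lebesgue_tuple_box R d A mA.
rewrite (_ : [set t | _] = tbox a b) => [->|]; last first.
  apply/seteqP; split=> t h i; have := h i; rewrite /A valK /= in_itv //=.
rewrite (big_morph EFin EFinM (erefl 1%:E)); apply: eq_bigr => i _.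
rewrite /A valK.
rewrite lebesgue_measure_itv /= lte_fin; case: ltP => h.
  by rewrite -EFinB max_r// subr_ge0 ltW.
by rewrite max_l// subr_le0.
Qed.

Lemma lebesgue_tbox_fin a b : (lebesgue_tuple R d (tbox a b) < +oo)%E.
Proof. by rewrite lebesgue_tbox ltry. Qed.

Definition tperm_coord (p : 'S_d) (t : X) : X := [tuple tnth t (p i) | i < d].

Lemma measurable_tperm_coord p : measurable_fun setT (tperm_coord p).
Proof.
apply/measurable_fun_tnthP => i.
rewrite (_ : _ \o _ = (fun t => @tnth d T t (p i))).
  exact: measurable_tnth.
by apply/funext => t /=; rewrite tnth_mktuple.
Qed.

HB.instance Definition _ p := isMeasurableFun.Build _ _ _ _ _ (measurable_tperm_coord p).

Lemma lebesgue_tperm p A : measurable A ->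
  lebesgue_tuple R d (tperm_coord p @^-1` A) = lebesgue_tuple R d A.
Proof.
move=> mA; symmetry.
apply: (@tuple_measure_unique _ (pushforward (lebesgue_tuple R d) (tperm_coord p))) => //.
  by move=> a b; exact: lebesgue_tbox_fin.
move=> a b.
change (lebesgue_tuple R d (tbox a b) = lebesgue_tuple R d (tperm_coord p @^-1` tbox a b)).
rewrite (_ : _ @^-1` _ = tbox (a \o (p^-1)%g) (b \o (p^-1)%g)).
  rewrite !lebesgue_tbox; congr (_%:E).
  by rewrite [RHS](reindex_inj (@perm_inj _ p)) /=; apply: eq_bigr => i _; rewrite permK.
apply/seteqP; split => t /= h i.
  by have := h (p^-1 i)%g; rewrite tnth_mktuple permKV.
by rewrite tnth_mktuple; have := h (p i); rewrite /= permK.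
Qed.

Definition tscale (r : R) (t : X) : X := [tuple r * tnth t i | i < d].

Lemma measurable_tscale r : measurable_fun setT (tscale r).
Proof.
apply/measurable_fun_tnthP => i.
rewrite (_ : _ \o _ = (fun t => r * @tnth d T t i)).
  by apply: measurable_funM => //; exact: measurable_tnth.
by apply/funext => t /=; rewrite tnth_mktuple.
Qed.

HB.instance Definition _ r := isMeasurableFun.Build _ _ _ _ _ (measurable_tscale r).

Lemma lebesgue_tscale (r : R) A : 0 < r -> measurable A ->
  lebesgue_tuple R d A = ((r ^+ d)%:E * lebesgue_tuple R d (tscale r @^-1` A))%E.
Proof.
move=> r0 mA; have rd : 0 <= r ^+ d by rewrite exprn_ge0// ltW.
apply: (@tuple_measure_unique _
  (mscale (NngNum rd) (pushforward (lebesgue_tuple R d) (tscale r)))) => //.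
  by move=> a b; exact: lebesgue_tbox_fin.
move=> a b; change (lebesgue_tuple R d (tbox a b) =
  ((r ^+ d)%:E * lebesgue_tuple R d (tscale r @^-1` tbox a b))%E).
rewrite (_ : _ @^-1` _ = tbox (fun i => a i / r) (fun i => b i / r)).
  rewrite !lebesgue_tbox -EFinM; congr (_%:E).
  rewrite -[X in X ^+ _]/(r) -[in r ^+ d](card_ord d) -prodr_const -big_split /=.
  apply: eq_bigr => i _; rewrite -mulrBl maxr_pMr ?ltW// mulr0.
  by rewrite mulrCA mulfV ?mulr1// gt_eqF.
by apply/seteqP; split => t /= h i; have := h i; rewrite tnth_mktuple ler_pdivlMr//
  ltr_pdivrMr// (mulrC r).
Qed.

Definition tradius (t : X) : R := enorm (vec t).

Lemma radE t : tradius t = Num.sqrt (\sum_i tnth t i ^+ 2).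
Proof.
by rewrite /tradius /enorm; congr Num.sqrt; apply: eq_bigr => i _; rewrite mxE.
Qed.

Lemma rad_ge0 t : 0 <= tradius t. Proof. exact: sqrtr_ge0. Qed.

Lemma measurable_rad : measurable_fun setT tradius.
Proof.
rewrite (_ : tradius = fun t => Num.sqrt (\sum_i tnth t i ^+ 2)); last first.
  by apply/funext => t; exact: radE.
apply: (@measurableT_comp _ _ _ _ _ _ (@Num.sqrt R)).
  by apply: continuous_measurable_fun; exact: sqrt_continuous.
apply: measurable_sum => i; apply: measurable_funX; exact: measurable_tnth.
Qed.

Lemma rad_scale r t : 0 <= r -> tradius (tscale r t) = r * tradius t.
Proof.
move=> r0; rewrite !radE.
under eq_bigr do rewrite tnth_mktuple exprMn.
by rewrite -mulr_sumr sqrtrM ?sqr_ge0// sqrtr_sqr ger0_norm.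
Qed.

Lemma coord_le_rad t i : `|tnth t i| <= tradius t.
Proof.
rewrite radE -sqrtr_sqr ler_wsqrtr// (bigD1 i)//= lerDl sumr_ge0// => *.
exact: sqr_ge0.
Qed.

Definition ball_vol : R := fine (lebesgue_tuple R d [set t | tradius t <= 1]).

Lemma measurable_rad_le r : measurable [set t | tradius t <= r].
Proof.
rewrite (_ : [set t | _] = tradius @^-1` `]-oo, r]).
  by rewrite -[X in measurable X]setTI; apply: measurable_rad => //; exact: measurable_itv.
by apply/seteqP; split => t /=; rewrite in_itv.
Qed.

Lemma ball_vol1 : lebesgue_tuple R d [set t | tradius t <= 1] = ball_vol%:E.
Proof.
rewrite /ball_vol fineK// ge0_fin_numE//.
apply: le_lt_trans (lebesgue_tbox_fin (fun=> -2) (fun=> 1)).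
apply: le_measure; rewrite ?inE.
- exact: measurable_rad_le.
- exact: measurable_tbox.
- move=> t /= t1 i; have := le_trans (coord_le_rad t i) t1.
  by rewrite ler_norml => /andP[t2 ->]; rewrite andbT (lt_le_trans _ t2)// ltrN2 ltr1n.
Qed.

Lemma ball_vol_gt0 : 0 < ball_vol.
Proof.
rewrite -lte_fin -ball_vol1.
pose e : R := (d.+1%:R)^-1.
have e0 : 0 < e by rewrite invr_gt0.
apply: (@lt_le_trans _ _ (lebesgue_tuple R d (tbox (fun=> 0) (fun=> e)))).
  rewrite lebesgue_tbox lte_fin prodr_gt0// => i _.
  by rewrite subr0 max_r// ltW.
apply: le_measure; rewrite ?inE; [exact: measurable_tbox|exact: measurable_rad_le|].
move=> t /= h; rewrite radE -[X in _ <= X]sqrtr1 ler_wsqrtr//.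
apply: (@le_trans _ _ (\sum_(i < d) e)).
  apply: ler_sum => i _; have /andP[t0 te] := h i.
  apply: (@le_trans _ _ (e * e)); first by rewrite expr2 ler_pM// ltW.
  by rewrite ler_piMl ?(ltW e0)// invf_le1 ?ltr0n// ler1n.
rewrite sumr_const card_ord -mulr_natl ler_pdivrMr ?ltr0n// mul1r ler_nat//.
Qed.

Lemma lebesgue_ball r : 0 < r ->
  lebesgue_tuple R d [set t | tradius t <= r] = (r ^+ d * ball_vol)%:E.
Proof.
move=> r0; rewrite (lebesgue_tscale r0 (measurable_rad_le r)) EFinM -ball_vol1.
congr (_ * lebesgue_tuple R d _)%E; apply/seteqP; split => t /=.
  by rewrite rad_scale ?(ltW r0)// -ler_pdivlMl// mulVf ?gt_eqF.
by rewrite rad_scale ?(ltW r0)// -ler_pdivlMl// mulVf ?gt_eqF.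
Qed.

End tuple_measure.

(** * Integration of radial functions in the variable ln |x| *)

Section polar.
Context {R : realType} {d : nat} (d0 : (0 < d)%N).
Local Notation T := (measurableTypeR R).
Local Notation X := (d.-tuple T).
Local Notation mu := (lebesgue_tuple R d).

Lemma der_FTC (F f : R -> R) (a b : R) : a < b ->
  (forall x, a <= x <= b -> is_derive x 1 F (f x)) ->
  {within `[a, b], continuous f} ->
  (\int[lebesgue_measure]_(x in `]a, b]) (f x)%:E = (F b - F a)%:E)%E.
Proof.
move=> ab dF cf.
have Fc x : a <= x <= b -> {for x, continuous F} by move=> /dF; exact: der_cont.
rewrite integral_itv_obnd_cbnd; last first.
  apply/measurable_EFinP; apply: (@measurable_funS _ _ _ _ `[a, b]) => //.
    by apply: subset_itvr; rewrite bnd_simp.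
  exact: subspace_continuous_measurable_fun.
rewrite (continuous_FTC2 ab cf (F := F)) ?EFinB//.
  split.
  - move=> x; rewrite in_itv /= => /andP[ax xb]; have axb : a <= x <= b by rewrite !ltW.
    by have [] := dF x axb.
  - by apply: cvg_at_right_filter; apply: Fc; rewrite lexx ltW.
  - by apply: cvg_at_left_filter; apply: Fc; rewrite lexx ltW.
move=> x; rewrite in_itv /= => /andP[ax xb].
have axb : a <= x <= b by rewrite !ltW.
by have [_ h] := dF x axb; rewrite derive1E h.
Qed.

(** The volume variable: |x|^d carries Lebesgue measure on R^d to [ball_vol] times Lebesgue measure
    on the positive half-line, so that no density enters the uniqueness argument for measures. *)
Definition radV (t : X) : R := tradius t ^+ d.

Lemma measurable_radV : measurable_fun setT radV.
Proof. by apply: measurable_funX; exact: measurable_rad. Qed.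

(* [radV] with the measurable type on which [lebesgue_measure] lives *)
Definition radVT : X -> T := radV.

Lemma measurable_radVT : measurable_fun setT radVT.
Proof. exact: measurable_radV. Qed.

HB.instance Definition _ := isMeasurableFun.Build _ _ _ _ _ measurable_radVT.

Lemma expR_root (v : R) : 0 < v -> expR (ln v / d%:R) ^+ d = v.
Proof.
move=> v0; rewrite -expRM_natl mulrCA mulfV ?mulr1 ?pnatr_eq0 -?lt0n//.
by rewrite lnK.
Qed.

Lemma measurable_radV_le v : measurable [set t | radV t <= v].
Proof.
rewrite (_ : [set t | _] = radV @^-1` `]-oo, v]).
  by rewrite -[X in measurable X]setTI; exact: measurable_radV.
by apply/seteqP; split => t /=; rewrite in_itv.
Qed.

Lemma lebesgue_radV_le v : 0 < v -> mu [set t | radV t <= v] = (v * ball_vol (d := d))%:E.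
Proof.
move=> v0; rewrite -{2}(expR_root v0) -lebesgue_ball ?expR_gt0//.
congr (lebesgue_tuple R d _); apply/seteqP; split => t /=.
  by rewrite /radV -{1}(expR_root v0) ler_pXn2r// ?nnegrE ?rad_ge0 ?expR_ge0.
by rewrite /radV -{2}(expR_root v0) ler_pXn2r// ?nnegrE ?rad_ge0 ?expR_ge0.
Qed.

Lemma lebesgue_radV_le0 : mu [set t | radV t <= 0] = 0%E.
Proof.
apply/eqP; rewrite eq_le measure_ge0 andbT; apply/lee_addgt0Pr => e e0.
rewrite add0e.
have b0 := @ball_vol_gt0 R d.
have h : 0 < e / ball_vol (R := R) (d := d) by rewrite divr_gt0.
have := lebesgue_radV_le h; rewrite divfK ?gt_eqF// => <-.
apply: le_measure; rewrite ?inE; try exact: measurable_radV_le.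
by move=> t /= /le_trans; apply; exact: ltW.
Qed.

Lemma lebesgue_radV_itv (u v : R) : 0 <= u -> u <= v ->
  mu [set t | u < radV t <= v] = ((v - u) * ball_vol (d := d))%:E.
Proof.
move=> u0 uv.
have le w : 0 <= w -> mu [set t | radV t <= w] = (w * ball_vol (d := d))%:E.
  rewrite le_eqVlt => /predU1P[<-|/lebesgue_radV_le//].
  by rewrite lebesgue_radV_le0 mul0r.
have mD : measurable [set t | u < radV t <= v].
  rewrite (_ : [set t | _] = [set t | radV t <= v] `\` [set t | radV t <= u]).
    by apply: measurableD; exact: measurable_radV_le.
  apply/seteqP; split => t /=; first by move=> /andP[ut ->]; split => //; apply/negP; rewrite -ltNge.
  by move=> [-> /negP]; rewrite -ltNge => ->.
have : mu [set t | radV t <= v] =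
    (mu [set t | (radV t <= u)%R] + mu [set t | (u < radV t <= v)%R])%E.
  rewrite -measureU//; last 2 first.
  - exact: measurable_radV_le.
  - by apply/seteqP; split => t //= [/le_gtF tu]; rewrite tu.
  congr (mu _); apply/seteqP; split => t /=.
    by move=> tv; case: (leP (radV t) u); [left|rewrite tv; right].
  by move=> [/le_trans|/andP[]//]; apply.
rewrite !le//; last exact: le_trans uv.
move=> e; have := congr1 (fun z => z - (u * ball_vol (d := d))%:E)%E e.
by rewrite addeAC subee// add0e -EFinB -mulrBl => <-.
Qed.

Lemma lebesgue_radV (A : set T) : measurable A -> A `<=` `]0, +oo[ ->
  mu (radV @^-1` A) = ((ball_vol (d := d))%:E * lebesgue_measure A)%E.
Proof.
move=> mA A0.
pose I0 : set T := `]0, +oo[%classic.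
have mI : measurable I0 by exact: measurable_itv.
have k0 : 0 <= ball_vol (R := R) (d := d) by rewrite ltW// ball_vol_gt0.
have itvE (a b : R) : `]a, b] `&` I0 = [set` `]Num.max a 0, b]].
  apply/seteqP; split => x /=; rewrite /I0 /= !in_itv /= gt_max andbT.
    by move=> [/andP[-> ->] ->].
  by move=> /andP[/andP[-> ->] ->].
suff : mrestr (pushforward mu radVT) mI A =
       mscale (NngNum k0) (mrestr lebesgue_measure mI) A.
  change ((mu (radV @^-1` (A `&` I0)) =
    (ball_vol (d := d))%:E * lebesgue_measure (A `&` I0))%E -> 
    mu (radV @^-1` A) = ((ball_vol (d := d))%:E * lebesgue_measure A)%E).
  by rewrite (setIidl A0).
have E (a b : R) : mrestr (pushforward mu radVT) mI `]a, b] =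
    ((Num.max 0 (b - Num.max a 0)) * ball_vol (d := d))%:E.
  change (mu (radV @^-1` (`]a, b] `&` I0)) =
    ((Num.max 0 (b - Num.max a 0)) * ball_vol (d := d))%:E).
  rewrite itvE.
  have [h|h] := leP (Num.max a 0) b.
    rewrite [X in (X * _)%:E]max_r ?subr_ge0// -lebesgue_radV_itv//.
      by rewrite le_max lexx orbT.
  rewrite [X in (X * _)%:E]max_l ?subr_le0 ?(ltW h)// mul0r.
  rewrite (_ : _ @^-1` _ = set0) ?measure0//.
  apply/seteqP; split => t //=; rewrite in_itv /= => /andP[h1 h2].
  by have := lt_le_trans h1 h2; rewrite ltNge (ltW h).
pose g (k : nat) : set T := `](- k%:R), k%:R]%classic.
pose m1 : {measure set T -> \bar R} := mrestr (pushforward mu radVT) mI.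
pose m2 : {measure set T -> \bar R} := mscale (NngNum k0) (mrestr lebesgue_measure mI).
apply: (@measure_unique _ R T (@ocitv R) g _ _ _ _ (m1 measurable_radVT) m2) => //.
- exact: ocitvI.
- by move=> k; exact: is_ocitv.
- rewrite -subTset => x _; exists (Num.truncn `|x|).+1 => //=.
  have h := truncnS_gt `|x|.
  rewrite /g /= in_itv /= ltrNl (le_lt_trans (ler_norm _)) ?normrN//=.
  by rewrite (le_trans (ler_norm _))// ltW.
- move=> _ [[a b] _ <-] /=; rewrite E.
  change (((Num.max 0 (b - Num.max a 0)) * ball_vol (d := d))%:E =
    ((ball_vol (d := d))%:E * lebesgue_measure (`]a, b] `&` I0))%E).
  rewrite itvE lebesgue_measure_itv /= lte_fin mulrC EFinM; congr (_ * _)%E.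
  case: ltP => h; first by rewrite max_r// subr_ge0 ltW.
  by rewrite max_l// subr_le0.
- move=> k; change (mrestr (pushforward mu radVT) mI (g k) < +oo)%E.
  by rewrite E ltry.
Qed.

(** At the origin this is the default value of [ln]; statements about it therefore exclude
    [tradius t = 0] or hold almost everywhere. *)
Definition radT (t : X) : R := ln (tradius t).
(** The density |x|^-d turns Lebesgue measure into a multiple of dt for t = ln |x|. The multiple is
    [polar_cst], the area of the unit sphere. *)
Definition radJ (t : X) : R := expR (- d%:R * radT t).
Definition annulus (a b : R) : set X := [set t | expR a < tradius t <= expR b].
Definition polar_cst : R := d%:R * ball_vol (R := R) (d := d).

Lemma polar_cst_gt0 : 0 < polar_cst.
Proof. by rewrite mulr_gt0 ?ltr0n// ball_vol_gt0. Qed.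

Lemma measurable_radT : measurable_fun setT radT.
Proof.
by apply: (@measurableT_comp _ _ _ _ _ _ (@ln R)); [exact: measurable_ln|exact: measurable_rad].
Qed.

Lemma measurable_radJ : measurable_fun setT radJ.
Proof.
apply: (@measurableT_comp _ _ _ _ _ _ (@expR R)); first exact: measurable_expR.
by apply: measurable_funM => //; exact: measurable_radT.
Qed.

Lemma annulus_radT a b t : annulus a b t <-> tradius t != 0 /\ a < radT t <= b.
Proof.
split=> [/andP[h1 h2]|[h0 /andP[h1 h2]]].
  have t0 : 0 < tradius t by apply: lt_trans h1; exact: expR_gt0.
  split; first by rewrite gt_eqF.
  by rewrite /radT -ltr_expR -ler_expR lnK ?posrE// h1.
have t0 : 0 < tradius t by rewrite lt_neqAle eq_sym h0 rad_ge0.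
by rewrite /annulus /= -[tradius t]lnK ?posrE// ltr_expR ler_expR h1.
Qed.

Lemma annulus_radV a b : annulus a b =
  radV @^-1` `](expR (d%:R * a)), (expR (d%:R * b))].
Proof.
by apply/seteqP; split => t; rewrite /annulus /radV /= in_itv /= !expRM_natl
  ltr_pXn2r ?nnegrE ?rad_ge0 ?expR_ge0// ler_pXn2r ?nnegrE ?rad_ge0 ?expR_ge0.
Qed.

Lemma measurable_annulus a b : measurable (annulus a b).
Proof.
by rewrite annulus_radV -[X in measurable X]setTI; exact: measurable_radV.
Qed.

Lemma annulus_gt0 a b t : annulus a b t -> 0 < tradius t.
Proof. by move=> /andP[h _]; apply: lt_trans h; exact: expR_gt0. Qed.

(** Change of variables v = |x|^d, then the fundamental theorem for d psi (ln v / d) as a function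
    of v. *)
Lemma ge0_annulus_FTC (psi psi' : R -> R) (a b : R) : a < b ->
  (forall x : R, is_derive x 1 psi (psi' x)) -> continuous psi' ->
  (forall x, a <= x <= b -> 0 <= psi' x) ->
  (\int[mu]_(t in annulus a b) (radJ t * psi' (radT t))%:E =
    (polar_cst * (psi b - psi a))%:E)%E.
Proof.
move=> ab dpsi cpsi' psi'0.
have dr0 : 0 < d%:R :> R by rewrite ltr0n.
pose al := expR (d%:R * a); pose be := expR (d%:R * b).
have albe : al < be by rewrite ltr_expR ltr_pM2l.
have al0 : 0 < al by exact: expR_gt0.
pose k (v : R) := v^-1 * psi' (ln v / d%:R).
have kc v : 0 < v -> {for v, continuous k}.
  move=> v0; apply: continuousM; first by apply: inv_continuous; rewrite gt_eqF.
  apply: (@continuous_comp _ _ _ (fun v : R => ln v / d%:R) psi'); last exact: cpsi'.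
  apply: continuousM; last exact: cvg_cst.
  exact: continuous_ln.
have kcc : {within `[al, be], continuous k}.
  apply/continuous_within_itvP => //; split.
  - by move=> v; rewrite in_itv /= => /andP[h _]; apply: kc; exact: lt_trans h.
  - by apply: cvg_at_right_filter; exact: kc.
  - by apply: cvg_at_left_filter; apply: kc; exact: lt_trans albe.
have mk : measurable_fun `]al, be] k.
  apply: (@measurable_funS _ _ _ _ `[al, be]) => //.
    by apply: subset_itvr; rewrite bnd_simp.
  exact: subspace_continuous_measurable_fun.
have k0 v : v \in `]al, be]%classic -> (0 <= (k v)%:E)%E.
  rewrite inE /= in_itv /= => /andP[v1 v2]; rewrite lee_fin mulr_ge0//.
    by rewrite invr_ge0 ltW// (lt_trans al0).
  have v0 : 0 < v by exact: lt_trans v1.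
  apply: psi'0; rewrite ler_pdivlMr// ler_pdivrMr// -[leLHS]expRK -[X in _ && (_ <= X)]expRK.
  by rewrite !ler_ln ?posrE ?expR_gt0// ![_ * d%:R]mulrC v2 ltW.
transitivity (\int[mu]_(t in radV @^-1` `]al, be]) ((EFin \o k) \o radV) t)%E.
  rewrite -annulus_radV; apply: eq_integral => t; rewrite inE => /annulus_gt0 t0.
  change ((radJ t * psi' (radT t))%:E = (k (radV t))%:E).
  rewrite /k /radV lnXn// -[_ *+ _]mulr_natl (mulrAC d%:R) mulfV ?mul1r ?gt_eqF//.
  by rewrite /radJ mulNr expRN /radT mulrC expRM_natl lnK// mulrC.
rewrite -(@ge0_integral_pushforward _ _ _ T _ radVT measurable_radVT mu `]al, be] (EFin \o k))//;
  last exact/measurable_EFinP.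
have b0 := ltW (@ball_vol_gt0 R d).
transitivity (\int[mscale (NngNum b0) lebesgue_measure]_(y in `]al, be]) (EFin \o k) y)%E.
  apply: eq_measure_integral => A mA Asub.
  change (mu (radV @^-1` A) = ((ball_vol (d := d))%:E * lebesgue_measure A)%E).
  apply: lebesgue_radV => //; apply: subset_trans Asub _.
  by move=> v /=; rewrite !in_itv /= => /andP[h _]; rewrite andbT (lt_trans al0).
rewrite ge0_integral_mscale//=; last 2 first.
- exact/measurable_EFinP.
- by move=> v hv; apply: k0; rewrite inE.
have dF (v : R) : al <= v <= be ->
    is_derive v 1 (fun v => d%:R * psi (ln v / d%:R)) (k v).
  move=> /andP[v1 _]; have v0 : 0 < v by exact: lt_le_trans v1.
  have h := drv_mul (drv_cst d%:R v) (drv_comp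
    (drv_mul (is_derive1_ln v0) (drv_cst d%:R^-1 v)) (dpsi (ln v / d%:R))).
  apply: (is_derive_eq h); rewrite /k mul0r mulr0 addr0 add0r.
  by field; rewrite !gt_eqF.
rewrite (der_FTC albe dF kcc).
rewrite -EFinM; congr (_%:E).
rewrite /al /be !expRK ![d%:R * _ / _]mulrAC mulfV ?gt_eqF// !mul1r.
by rewrite /polar_cst -mulrBr mulrA (mulrC d%:R).
Qed.

Lemma continuous_bounded_itv (f : R -> R) (a b : R) : continuous f ->
  exists M : R, 0 <= M /\ forall x, a <= x <= b -> `|f x| <= M.
Proof.
move=> cf; have [ab|ba] := leP a b; last first.
  by exists 0; split => // x /andP[/le_trans h /h]; rewrite leNgt ba.
have cn : {within `[a, b], continuous (fun x => `|f x|)}.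
  apply: continuous_subspaceT => x.
  by apply: (@continuous_comp _ _ _ f (fun y => `|y|)); [exact: cf|exact: norm_continuous].
have [c _ H] := EVT_max ab cn.
exists `|f c|; split => // x xab; exact: H.
Qed.

(** Reduction to nonnegative integrands: psi' is the difference of psi' + M and M, where M bounds
    |psi'| on the interval. *)
Lemma annulus_FTC (psi psi' : R -> R) (a b : R) : a < b ->
  (forall x : R, is_derive x 1 psi (psi' x)) -> continuous psi' ->
  mu.-integrable (annulus a b) (fun t => (radJ t * psi' (radT t))%:E) /\
  \int[mu]_(t in annulus a b) (radJ t * psi' (radT t)) =
    polar_cst * (psi b - psi a).
Proof.
move=> ab dpsi cpsi'.
have [M [M0 HM]] := continuous_bounded_itv a b cpsi'.
pose p1 x := psi x + M * x; pose p1' x := psi' x + M.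
have dp1 (x : R) : is_derive x 1 p1 (p1' x).
  apply: (is_derive_eq (drv_add (dpsi x) (drv_mul (drv_cst M x) (drv_id x)))).
  by rewrite mul0r add0r mulr1.
have dp2 (x : R) : is_derive x 1 (fun x => M * x) M.
  by apply: (is_derive_eq (drv_mul (drv_cst M x) (drv_id x))); rewrite mul0r add0r mulr1.
have cp1' : continuous p1' by move=> x; apply: cvgD; [exact: cpsi'|exact: cvg_cst].
have I1 := ge0_annulus_FTC ab dp1 cp1' _.
have I2 := ge0_annulus_FTC ab dp2 (fun x => @cst_continuous _ _ M x) _.
have mT (f : R -> R) : continuous f ->
    measurable_fun (annulus a b) (fun t => (radJ t * f (radT t))%:E).
  move=> cf; apply: measurable_funTS; apply/measurable_EFinP.
  apply: measurable_funM; first exact: measurable_radJ.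
  apply: (@measurableT_comp _ _ _ _ _ _ f); last exact: measurable_radT.
  exact: continuous_measurable_fun.
have p1'0 x : a <= x <= b -> 0 <= p1' x.
  by move=> /HM; rewrite ler_norml /p1' => /andP[h _]; rewrite -lerBlDr sub0r.
have pos (f : R -> R) : (forall x, a <= x <= b -> 0 <= f x) ->
    forall t, annulus a b t -> 0 <= radJ t * f (radT t).
  move=> f0 t /annulus_radT[_ /andP[t1 t2]].
  by rewrite mulr_ge0 ?expR_ge0// f0// t2 ltW.
have int (f : R -> R) c : continuous f -> (forall x, a <= x <= b -> 0 <= f x) ->
    (\int[mu]_(t in annulus a b) (radJ t * f (radT t))%:E = c%:E)%E ->
    mu.-integrable (annulus a b) (fun t => (radJ t * f (radT t))%:E).
  move=> cf f0 e; apply/integrableP; split; first exact: mT.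
  rewrite (eq_integral (fun t => (radJ t * f (radT t))%:E)) ?e ?ltry// => t.
  by rewrite inE => /(pos _ f0) h; rewrite gee0_abs ?lee_fin.
have i1 := int _ _ cp1' p1'0 (I1 p1'0).
have i2 := int _ _ (fun x => @cst_continuous _ _ M x) (fun _ _ => M0) (I2 (fun _ _ => M0)).
have e t : radJ t * psi' (radT t) = radJ t * p1' (radT t) - radJ t * M.
  by rewrite -mulrBr /p1' addrK.
split.
  rewrite (_ : (fun _ => _) = (fun t => (radJ t * p1' (radT t))%:E) \- (fun t => (radJ t * M)%:E))%E.
    by apply: integrableB => //; exact: measurable_annulus.
  by apply/funext => t; rewrite e EFinB.
transitivity (\int[mu]_(t in annulus a b) (radJ t * p1' (radT t) - radJ t * M)).
  by apply: eq_Rintegral => t _; exact: e.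
rewrite RintegralB//; last exact: measurable_annulus.
rewrite /Rintegral (I1 p1'0) (I2 (fun _ _ => M0)) /= -mulrBr /p1; congr (_ * _).
by ring.
Qed.

End polar.

Lemma integrable_dom dd (Y : measurableType dd) (R : realType)
    (m : {measure set Y -> \bar R}) (D : set Y) (f g : Y -> R) :
  measurable D -> measurable_fun D f -> m.-integrable D (EFin \o g) ->
  (forall x, D x -> `|f x| <= `|g x|) -> m.-integrable D (EFin \o f).
Proof.
move=> mD mf ig fg; apply: (@le_integrable _ _ _ m D mD (EFin \o f) (EFin \o g)) => //.
  exact/measurable_EFinP.
Qed.

Lemma EFin_Rintegral dd (Y : measurableType dd) (R : realType)
    (m : {measure set Y -> \bar R}) (D : set Y) (f : Y -> R) :
  measurable D -> m.-integrable D (EFin \o f) ->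
  (\int[m]_(x in D) (f x)%:E)%E = (\int[m]_(x in D) f x)%:E.
Proof. by move=> mD fi; rewrite /Rintegral fineK// integrable_fin_num. Qed.

(** * Functions determined by their integrals over a pi-system *)

Section image_density.
Local Open Scope ereal_scope.
Context d1 d2 (X : measurableType d1) (Y : measurableType d2) (R : realType).
Variables (mu : {measure set X -> \bar R}) (P : X -> Y) (f : X -> \bar R).
Hypotheses (mP : measurable_fun setT P) (mf : measurable_fun setT f)
  (f0 : forall x, 0 <= f x).

Definition image_density (B : set Y) : \bar R := \int[mu]_(x in P @^-1` B) f x.

Let mpre B : measurable B -> measurable (P @^-1` B).
Proof. by move=> mB; rewrite -[X in measurable X]setTI; exact: mP. Qed.

Let image_density0 : image_density set0 = 0.
Proof. by rewrite /image_density preimage_set0 integral_set0. Qed.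

Let image_density_ge0 B : 0 <= image_density B.
Proof. by apply: integral_ge0. Qed.

Let image_density_sigma_additive : semi_sigma_additive image_density.
Proof.
move=> F mF tF mUF; rewrite /image_density preimage_bigcup.
have tF' : trivIset setT (fun i => P @^-1` F i).
  apply/trivIsetP => /= i j _ _ ij; rewrite -preimage_setI.
  by move/trivIsetP : tF => /(_ _ _ _ _ ij) ->//; rewrite preimage_set0.
rewrite ge0_integral_bigcup//; last 2 first.
- by move=> k; exact: mpre.
- exact: measurable_funTS.
by apply: is_cvg_ereal_nneg_natsum_cond => n _ _; exact: integral_ge0.
Qed.

HB.instance Definition _ := isMeasure.Build _ _ _
  image_density image_density0 image_density_ge0 image_density_sigma_additive.

End image_density.

Section vanishing_integrals.
Local Open Scope ereal_scope.
Context d1 d2 (X : measurableType d1) (Y : measurableType d2) (R : realType).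
Variables (mu : {measure set X -> \bar R}) (P : X -> Y) (h : X -> R) (D : set X).
Hypotheses (mP : measurable_fun setT P) (mD : measurable D)
  (ih : mu.-integrable D (EFin \o h)).
Variables (G : set (set Y)) (g : (set Y)^nat).
Hypotheses (mG : measurable = <<s G >>) (GI : setI_closed G)
  (Gg : forall i, G (g i)) (gT : \bigcup_k g k = setT)
  (hG : forall A, G A -> \int[mu]_(x in D `&` P @^-1` A) (h x)%:E = 0).

(** The positive and the negative part of [h] define two measures on [Y], finite on [G], that agree
    on this generating pi-system, hence on all measurable sets. *)
Lemma vanishing_integrals B : measurable B ->
  \int[mu]_(x in D `&` P @^-1` B) (h x)%:E = 0.
Proof.
move=> mB.
have mpre C : measurable C -> measurable (P @^-1` C).
  by move=> mC; rewrite -[X in measurable X]setTI; exact: mP.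
have mh := measurable_int mu ih.
pose fp := (EFin \o h)^\+ \_ D; pose fn := (EFin \o h)^\- \_ D.
have mfp : measurable_fun setT fp.
  by apply/(measurable_restrictT _ mD); exact: measurable_funepos.
have mfn : measurable_fun setT fn.
  by apply/(measurable_restrictT _ mD); exact: measurable_funeneg.
have fp0 x : 0 <= fp x by rewrite /fp patchE; case: ifP.
have fn0 x : 0 <= fn x by rewrite /fn patchE; case: ifP.
have Ep C : measurable C -> \int[mu]_(x in P @^-1` C) fp x =
    \int[mu]_(x in D `&` P @^-1` C) (EFin \o h)^\+ x.
  by move=> mC; rewrite setIC integral_mkcondr.
have En C : measurable C -> \int[mu]_(x in P @^-1` C) fn x =
    \int[mu]_(x in D `&` P @^-1` C) (EFin \o h)^\- x.
  by move=> mC; rewrite setIC integral_mkcondr.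
have fin C : measurable C -> mu.-integrable (D `&` P @^-1` C) (EFin \o h).
  move=> mC; apply: (integrableS mD _ _ ih); last exact: subIsetl.
  by apply: measurableI => //; exact: mpre.
have finp C : measurable C -> \int[mu]_(x in D `&` P @^-1` C) (EFin \o h)^\+ x < +oo.
  move=> mC; apply: integral_funepos_lt_pinfty; last exact: fin.
  by apply: measurableI => //; exact: mpre.
have Gm A : G A -> measurable A.
  by move=> GA; rewrite mG; exact: sub_sigma_algebra.
suff : \int[mu]_(x in P @^-1` B) fp x = \int[mu]_(x in P @^-1` B) fn x.
  rewrite Ep// En// => e; rewrite integralE e subee//.
  by rewrite -e ge0_fin_numE ?finp// integral_ge0.
pose m1 : {measure set Y -> \bar R} := image_density mu P fp.
pose m2 : {measure set Y -> \bar R} := image_density mu P fn.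
apply: (@measure_unique _ R Y G g mG GI Gg gT (m1 mP mfp fp0) (m2 mP mfn fn0)) => //.
- move=> A GA.
  change (\int[mu]_(x in P @^-1` A) fp x = \int[mu]_(x in P @^-1` A) fn x).
  have mA := Gm _ GA; rewrite Ep// En//.
  have := hG GA; rewrite integralE => /eqP; rewrite sube_eq ?add0e; first by move/eqP.
    by rewrite ge0_fin_numE ?finp// integral_ge0.
  rewrite fin_num_adde_defr// ge0_fin_numE ?integral_ge0//.
- move=> k; change (\int[mu]_(x in P @^-1` (g k)) fp x < +oo).
  by have mA := Gm _ (Gg k); rewrite Ep// finp.
Qed.

End vanishing_integrals.

Section box_vanishing.
Context {R : realType} {d : nat}.
Local Notation T := (measurableTypeR R).
Local Notation X := (d.-tuple T).
Local Notation mu := (lebesgue_tuple R d).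

Lemma box_vanishing (h : X -> R) :
  (forall a b, mu.-integrable (tbox a b) (EFin \o h)) ->
  (forall a b, (\int[mu]_(t in tbox a b) (h t)%:E = 0)%E) ->
  {ae mu, forall t, h t = 0}.
Proof.
move=> ih h0.
pose B k : set X := tbox (fun=> - k%:R) (fun=> k%:R).
have aeB k : {ae mu, forall t, B k t -> h t = 0}.
  have mB : measurable (B k) by exact: measurable_tbox.
  have := @integral_ae_eq _ _ _ mu (B k) mB (cst 0%E) (EFin \o h) (ih _ _) (measurable_cst _).
  move=> H; have : ae_eq mu (B k) (EFin \o h) (cst 0%E).
    apply: H => E EB mE; rewrite integral0.
    rewrite -[E](_ : B k `&` id @^-1` E = E); last by rewrite preimage_id setIidr.
    apply: (@vanishing_integrals _ _ X X R mu id h (B k) _ mB (ih _ _)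
      [set tbox ab.1 ab.2 | ab in setT] (fun k => tbox (fun=> - k%:R) (fun=> k%:R))) => //.
    - exact: measurable_tuple_tbox.
    - exact: tboxI.
    - by move=> i; eexists (_, _).
    - exact: tbox_cover.
    - move=> A GA; rewrite preimage_id.
      have [[a b] _ <-] : [set tbox ab.1 ab.2 | ab in setT] (B k `&` A).
        by apply: tboxI => //; eexists (_, _).
      exact: h0.
  by apply: filterS => t H' Bt; have [] := H' Bt.
have : {ae mu, forall t, forall k, B k t -> h t = 0} by exact: ae_foralln.
apply: filterS => t H; have : setT t by [].
by rewrite -tbox_cover => -[k _]; exact: H.
Qed.

End box_vanishing.

Lemma restrE (R : realType) (X : Type) (f : X -> R) (D : set X) t :
  (f \_ D) t = if t \in D then f t else 0.
Proof. by rewrite patchE. Qed.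

(** * Integration by parts over annuli *)

Section annulus_product.
Context {R : realType} {d : nat} (d0 : (0 < d)%N).
Local Notation T := (measurableTypeR R).
Local Notation X := (d.-tuple T).
Local Notation mu := (lebesgue_tuple R d).

Lemma measurable_sphere x : measurable [set t : X | tradius t = x].
Proof.
rewrite (_ : [set t | _] = @tradius R d @^-1` [set x])//.
by rewrite -[X in measurable X]setTI; apply: measurable_rad.
Qed.

Lemma sphere_null x : 0 < x -> mu [set t : X | tradius t = x] = 0%E.
Proof.
move=> x0.
pose v := x ^+ d; have v0 : 0 < v by rewrite exprn_gt0.
apply/eqP; rewrite eq_le measure_ge0 andbT; apply/lee_addgt0Pr => e e0.
rewrite add0e.
have b0 := @ball_vol_gt0 R d.
pose u := Num.max 0 (v - e / ball_vol (R := R) (d := d)).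
have uv : u < v by rewrite gt_max v0 ltrBlDr ltrDl divr_gt0.
have u0 : 0 <= u by rewrite le_max lexx.
apply: (@le_trans _ _ (mu [set t : X | (u < radV t <= v)%R])).
  apply: le_measure.
  - by rewrite inE; exact: measurable_sphere.
  - rewrite inE (_ : [set t : X | u < radV t <= v] = @radV R d @^-1` `]u, v]).
      by rewrite -[X in measurable X]setTI; apply: measurable_radV.
    by apply/seteqP; split => t /=; rewrite in_itv.
  - by move=> t /= tx; rewrite /radV tx -/v lexx uv.
rewrite (lebesgue_radV_itv d0 u0 (ltW uv)) lee_fin -ler_pdivlMr//.
by rewrite lerBlDr -lerBlDl le_max lexx orbT.
Qed.

Definition annulus_int (k : X -> R) (a b : R) : R := \int[mu]_(t in annulus a b) k t.

(** Integration by parts without derivatives: [annulus_int k a (radT t)] is a primitive of [k] in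
    the radial variable. By Fubini the product of the two integrals is a double integral, split
    according to which of the two points has the smaller radius. *)
Lemma annulus_product (k1 k2 : X -> R) (a b : R) : a < b ->
  measurable_fun setT k1 -> measurable_fun setT k2 ->
  mu.-integrable (annulus a b) (EFin \o k1) ->
  mu.-integrable (annulus a b) (EFin \o k2) ->
  mu.-integrable (annulus a b)
    (fun t => (annulus_int k1 a (radT t) * k2 t + annulus_int k2 a (radT t) * k1 t)%:E) /\
  \int[mu]_(t in annulus a b)
    (annulus_int k1 a (radT t) * k2 t + annulus_int k2 a (radT t) * k1 t) =
  annulus_int k1 a b * annulus_int k2 a b.
Proof.
move=> ab mk1 mk2 ik1 ik2.
pose D : set X := annulus a b; have mD : measurable D := measurable_annulus d0 a b.
pose g1 : X -> R := k1 \_ D; pose g2 : X -> R := k2 \_ D.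
have mg1 : measurable_fun setT g1 by apply/(measurable_restrictT _ mD); exact: measurable_funTS.
have mg2 : measurable_fun setT g2 by apply/(measurable_restrictT _ mD); exact: measurable_funTS.
have ig1 : mu.-integrable setT (EFin \o g1).
  by rewrite /g1 -restrict_EFin -integrable_mkcond.
have ig2 : mu.-integrable setT (EFin \o g2).
  by rewrite /g2 -restrict_EFin -integrable_mkcond.
have annT t s : D t -> D s -> annulus a (radT t) s <-> tradius s <= tradius t.
  move=> Dt Ds; rewrite /annulus /=; have t0 := annulus_gt0 Dt.
  rewrite /radT lnK ?posrE//; split=> [/andP[]//|->]; rewrite andbT.
  by have /andP[] := Ds.
(* the integrals over smaller annuli, as integrals over the whole space *)
pose H (s t : X) : R := \1_[set z : X * X | tradius z.1 <= tradius z.2] (s, t).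
have HE s t : H s t = (tradius s <= tradius t)%R%:R.
  rewrite /H indicE; case: (boolP (tradius s <= tradius t)) => h; first by rewrite mem_set.
  by rewrite memNset//=; exact/negP.
have aI (k : X -> R) t : D t ->
    annulus_int k a (radT t) = \int[mu]_s ((k \_ D) s * H s t).
  move=> Dt; rewrite /annulus_int Rintegral_mkcond; apply: eq_Rintegral => s _.
  rewrite !restrE HE.
  have [A|nA] := pselect (annulus a (radT t) s); have [Ds|nDs] := pselect (D s).
  - by rewrite !mem_set// (annT t s Dt Ds).1 // mulr1.
  - exfalso; apply: nDs; move: A => /andP[h1 h2]; rewrite /D /annulus /= h1 /=.
    by apply: le_trans h2 _; have /annulus_radT[_ /andP[_ h]] := Dt; rewrite ler_expR.
  - rewrite memNset// mem_set//; case: (boolP (_ <= _)) => h; last by rewrite mulr0.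
    by exfalso; apply: nA; apply/(annT t s).
  - by rewrite !memNset// mul0r.
have mH : measurable_fun [set: X * X] (fun z => H z.1 z.2).
  rewrite (_ : (fun z => _) = (\1_[set z : X * X | tradius z.1 <= tradius z.2] : X * X -> R)).
    apply: measurable_indic.
    rewrite (_ : [set z | _] = (fun z : X * X => tradius z.1 - tradius z.2) @^-1` `]-oo, 0]).
      rewrite -[X in measurable X]setTI.
      apply: (measurable_funB _ _) => //; first exact: (measurableT_comp measurable_rad measurable_fst).
      exact: (measurableT_comp measurable_rad measurable_snd).
    by apply/seteqP; split => z /=; rewrite in_itv /= subr_le0.
  by apply/funext => -[].
have mpr : measurable_fun [set: X * X] (fun z => g1 z.1 * g2 z.2).
  apply: measurable_funM; first exact: (measurableT_comp mg1 measurable_fst).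
  exact: (measurableT_comp mg2 measurable_snd).
have nrm (g : X -> R) : mu.-integrable setT (EFin \o g) -> measurable_fun setT g ->
    exists2 c : R, 0 <= c & (\int[mu]_t (`|g t|)%:E = c%:E)%E.
  move=> ig mg; have /integrableP[_] := ig.
  rewrite (eq_integral (fun t => (`|g t|)%:E))// => f.
  exists (fine (\int[mu]_t (`|g t|)%:E)); last by rewrite fineK// ge0_fin_numE// integral_ge0.
  by rewrite fine_ge0// integral_ge0.
have [c1 c10 e1] := nrm _ ig1 mg1.
have [c2 c20 e2] := nrm _ ig2 mg2.
have H01 s t : 0 <= H s t <= 1 by rewrite HE ler0n -[X in _ <= X]/(1%:R) ler_nat leq_b1.
have mH1 x : measurable_fun setT (H x) := measurableT_comp mH (measurable_pair1 x).
have mH2 y : measurable_fun setT (H^~ y) := measurableT_comp mH (measurable_pair2 y).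
have bnd (g : X -> R) : mu.-integrable setT (EFin \o g) -> measurable_fun setT g ->
    forall t, mu.-integrable setT (fun s => (g s * H s t)%:E).
  move=> ig mg t.
  apply: (@integrable_dom _ X R mu setT (fun s => g s * H s t) g measurableT _ ig).
    apply: measurable_funM; [exact: mg|exact: mH2].
  move=> s _; rewrite normrM -[leRHS]mulr1 ler_wpM2l//.
  by have /andP[h1 h2] := H01 s t; rewrite ger0_norm.
have bnd1 (g : X -> R) : mu.-integrable setT (EFin \o g) -> measurable_fun setT g ->
    forall t, mu.-integrable setT (fun s => (g s * H t s)%:E).
  move=> ig mg t.
  apply: (@integrable_dom _ X R mu setT (fun s => g s * H t s) g measurableT _ ig).
    apply: measurable_funM; [exact: mg|exact: mH1].
  move=> s _; rewrite normrM -[leRHS]mulr1 ler_wpM2l//.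
  by have /andP[h1 h2] := H01 t s; rewrite ger0_norm.
pose A1 t := \int[mu]_s (g1 s * H s t).
pose A2 t := \int[mu]_s (g2 s * H s t).
have E1 t : (\int[mu]_s (g1 s * H s t)%:E = (A1 t)%:E)%E.
  exact: (EFin_Rintegral measurableT (bnd _ ig1 mg1 t)).
have E2 t : (\int[mu]_s (g2 s * H s t)%:E = (A2 t)%:E)%E.
  exact: (EFin_Rintegral measurableT (bnd _ ig2 mg2 t)).
pose I2 := \int[mu]_s g2 s.
have EI2 : (\int[mu]_s (g2 s)%:E = I2%:E)%E.
  exact: (EFin_Rintegral measurableT ig2).
(* Exchanging the arguments of [H] gives the complementary condition, except on the sphere through
   [s], which is null. *)
have E3 s : D s -> (\int[mu]_t (g2 t * H s t)%:E = (I2 - A2 s)%:E)%E.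
  move=> Ds; have ig2' := bnd _ ig2 mg2 s.
  transitivity (\int[mu]_t ((g2 t)%:E - (g2 t * H t s)%:E))%E; last first.
    by rewrite (integralB measurableT ig2 ig2') EI2 E2 EFinB.
  apply: ae_eq_integral => //.
  - by apply/measurable_EFinP; apply: measurable_funM; [exact: mg2|exact: mH1].
  - apply: emeasurable_funB; first exact/measurable_EFinP.
    exact: measurable_int ig2'.
  exists [set t : X | tradius t = tradius s]; split.
  - exact: measurable_sphere.
  - by apply: sphere_null; exact: annulus_gt0 Ds.
  - move=> t /= h.
    apply/eqP/negPn/negP => ne; apply: h => _.
    rewrite -EFinB !HE; congr (_%:E).
    by case: (ltgtP (tradius s) (tradius t)) ne => //= _ _; rewrite ?mulr1 ?mulr0 ?subr0 ?subrr.
have FFE x : (\int[mu]_y (g1 x * g2 y * H x y)%:E = (g1 x * (I2 - A2 x))%:E)%E.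
  have [Dx|nDx] := pselect (D x); last first.
    rewrite /g1 restrE memNset// mul0r integral0_eq// => y _.
    by rewrite !mul0r.
  under eq_integral do rewrite -mulrA EFinM.
  rewrite (integralZl measurableT (bnd1 _ ig2 mg2 x)).
  by rewrite (E3 x Dx) EFinM.
have FGE y : (\int[mu]_x (g1 x * g2 y * H x y)%:E = (g2 y * A1 y)%:E)%E.
  under eq_integral do rewrite mulrAC mulrC EFinM.
  by rewrite (integralZl measurableT (bnd _ ig1 mg1 y)) E1 EFinM.
have A1c y : `|A1 y| <= c1.
  rewrite /A1; apply: le_trans (le_normr_Rintegral measurableT (bnd _ ig1 mg1 y)) _.
  have -> : c1 = \int[mu]_t `|g1 t| by rewrite /Rintegral e1.
  apply: le_Rintegral => //; last first.
  - move=> s _; rewrite normrM -[leRHS]mulr1 ler_wpM2l//.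
    by have /andP[h1 h2] := H01 s y; rewrite ger0_norm.
  - exact: (integrable_norm ig1).
  - exact: (integrable_norm (bnd _ ig1 mg1 y)).
have g2A y : `|g2 y * A1 y| <= `|c1 * g2 y|.
  by rewrite !normrM mulrC; apply: ler_wpM2r => //; rewrite (ger0_norm c10); exact: A1c.
pose Q (z : X * X) : \bar R := (g1 z.1 * g2 z.2 * H z.1 z.2)%:E.
have mQ : measurable_fun setT Q by apply/measurable_EFinP; exact: measurable_funM.
have iQ : (mu \x mu)%E.-integrable setT Q.
  apply/integrable12ltyP => //.
  apply: (@le_lt_trans _ _ (\int[mu]_x (`|g1 x| * c2)%:E)%E).
    apply: ge0_le_integral => //.
    - by move=> x _; apply: integral_ge0.
    - apply: (measurable_fun_fubini_tonelli_F (abse \o Q)) => //=.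
      exact: measurableT_comp.
    - by apply/measurable_EFinP; apply: measurable_funM => //; exact: measurableT_comp.
    move=> x _; rewrite EFinM -e2 -ge0_integralZl//; last first.
      by apply/measurable_EFinP; exact: measurableT_comp.
    apply: ge0_le_integral => //.
    - by apply: measurableT_comp => //; exact: (measurableT_comp mQ (measurable_pair1 x)).
    - by apply/measurable_EFinP; apply: measurable_funM => //; exact: measurableT_comp.
    move=> y _; rewrite /Q /= lee_fin !normrM -[leRHS]mulr1 ler_wpM2l// ?mulr_ge0//.
    by have /andP[h1 h2] := H01 x y; rewrite ger0_norm.
  under eq_integral do rewrite mulrC EFinM.
  rewrite ge0_integralZl//; last by apply/measurable_EFinP; exact: measurableT_comp.
  by rewrite e1 -EFinM ltry.
have FQ := Fubini iQ.
have FF := integrable_fubini_F iQ.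
have FG0 := measurable_fubini_G iQ.
have FFE' : fubini_F mu Q = (fun x => (g1 x * (I2 - A2 x))%:E) by exact/funext/FFE.
have FGE' : fubini_G mu Q = (fun y => (g2 y * A1 y)%:E) by exact/funext/FGE.
rewrite FFE' in FF; rewrite FGE' in FG0.
have FG : mu.-integrable setT (fun y => (g2 y * A1 y)%:E).
  apply: (@integrable_dom _ X R mu setT _ (fun y => c1 * g2 y) measurableT).
  - exact/measurable_EFinP.
  - exact: (integrableZl measurableT c1 ig2).
  - by move=> y _; exact: g2A.
have key : (\int[mu]_x (g1 x * (I2 - A2 x))%:E = \int[mu]_y (g2 y * A1 y)%:E)%E.
  rewrite -[LHS](_ : (\int[mu]_x fubini_F mu Q x = _)%E); last by rewrite FFE'.
  rewrite -[RHS](_ : (\int[mu]_x fubini_G mu Q x = _)%E); last by rewrite FGE'.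
  exact: FQ.
clear mQ iQ FQ FFE' FGE' Q mpr mH FFE FGE.
have i12 : mu.-integrable setT (fun x => (g1 x * A2 x)%:E).
  rewrite (_ : (fun _ => _) = (fun x => I2%:E * (g1 x)%:E) \- (fun x => (g1 x * (I2 - A2 x))%:E))%E.
    exact: (integrableB measurableT (integrableZl measurableT _ ig1) FF).
  by apply/funext => x; rewrite -EFinM -EFinB; congr (_%:E); ring.
have restr t : ((fun t => annulus_int k1 a (radT t) * k2 t +
     annulus_int k2 a (radT t) * k1 t) \_ D) t = g2 t * A1 t + g1 t * A2 t.
  rewrite restrE /g1 /g2 !restrE; case: ifPn => Dt; last by rewrite !mul0r addr0.
  move: Dt; rewrite inE => Dt.
  by rewrite (aI k1 t Dt) (aI k2 t Dt) -/A1 -/A2 mulrC [X in _ + X]mulrC.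
split.
  rewrite integrable_mkcond// (_ : _ \_ _ =
     (fun t => (g2 t * A1 t)%:E) \+ (fun t => (g1 t * A2 t)%:E))%E.
    exact: (integrableD measurableT FG i12).
  apply/funext => t; rewrite /= -EFinD -restr !patchE.
  by case: ifP.
rewrite Rintegral_mkcond.
transitivity (\int[mu]_t (g2 t * A1 t + g1 t * A2 t)).
  by apply: eq_Rintegral => t _; exact: restr.
rewrite (RintegralD measurableT FG i12).
have -> : annulus_int k1 a b = \int[mu]_t g1 t by rewrite /annulus_int Rintegral_mkcond.
have -> : annulus_int k2 a b = I2 by rewrite /annulus_int Rintegral_mkcond.
have k' : \int[mu]_x (g1 x * (I2 - A2 x)) = \int[mu]_y (g2 y * A1 y).
  by rewrite /Rintegral key.
rewrite -k' -(RintegralD measurableT FF i12).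
rewrite -(RintegralZr _ measurableT ig1); apply: eq_Rintegral => t _.
by ring.
Qed.

End annulus_product.

(** * Square-integrable functions and weak gradients *)

Section L1.
Context {R : realType} {d : nat}.
Local Notation T := (measurableTypeR R).
Local Notation X := (d.-tuple T).
Local Notation mu := (lebesgue_tuple R d).
Implicit Types f g : X -> R.

Definition L1 f := mu.-integrable setT (EFin \o f).

Lemma L1_meas f : L1 f -> measurable_fun setT f.
Proof. by move=> /measurable_int /measurable_EFinP. Qed.

Lemma L1D f g : L1 f -> L1 g -> L1 (fun t => f t + g t).
Proof. exact: (integrableD measurableT). Qed.

Lemma L1Z c f : L1 f -> L1 (fun t => c * f t).
Proof. exact: (integrableZl measurableT c). Qed.

Lemma L1N f : L1 f -> L1 (fun t => - f t).
Proof.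
by move=> /(L1Z (-1)) h; rewrite (_ : (fun _ => _) = fun t => -1 * f t)//; apply/funext => t; rewrite mulN1r.
Qed.

Lemma L1_0 : L1 (fun=> 0).
Proof. exact: integrable0. Qed.

Lemma L1_sum I (r : seq I) (F : I -> X -> R) :
  (forall i, L1 (F i)) -> L1 (fun t => \sum_(i <- r) F i t).
Proof.
move=> h; elim: r => [|i r IH].
  by under eq_fun do rewrite big_nil; exact: L1_0.
by under eq_fun do rewrite big_cons; exact: L1D.
Qed.

Lemma L1_le f g : measurable_fun setT f -> L1 g -> (forall t, `|f t| <= `|g t|) -> L1 f.
Proof. by move=> mf ig fg; exact: (integrable_dom measurableT mf ig). Qed.

Lemma L1_norm f : L1 f -> L1 (fun t => `|f t|).
Proof. exact: integrable_norm. Qed.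

Lemma L1_restrict f (A : set X) : measurable A -> L1 f -> L1 (f \_ A).
Proof.
move=> mA hf; apply: (@L1_le _ f) => //.
  by apply/(measurable_restrictT _ mA); apply: measurable_funTS; exact: L1_meas.
by move=> t; rewrite restrE; case: ifP => // _; rewrite normr0.
Qed.

Lemma L1_on f (A : set X) : measurable A -> L1 f -> mu.-integrable A (EFin \o f).
Proof. by move=> mA hf; exact: (integrableS measurableT mA (@subsetT _ A) hf). Qed.

Definition Int f : R := \int[mu]_t f t.

Lemma IntD f g : L1 f -> L1 g -> Int (fun t => f t + g t) = Int f + Int g.
Proof. exact: (RintegralD measurableT). Qed.

Lemma IntZ c f : L1 f -> Int (fun t => c * f t) = c * Int f.
Proof. by move=> h; exact: (RintegralZl c measurableT h). Qed.

Lemma IntN f : L1 f -> Int (fun t => - f t) = - Int f.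
Proof. by move=> h; rewrite -mulN1r -IntZ//; congr Int; apply/funext => t; rewrite mulN1r. Qed.

Lemma Int_sum I (r : seq I) (F : I -> X -> R) : (forall i, L1 (F i)) ->
  Int (fun t => \sum_(i <- r) F i t) = \sum_(i <- r) Int (F i).
Proof.
move=> h; elim: r => [|i r IH].
  rewrite big_nil; under eq_fun do rewrite big_nil.
  by rewrite /Int /Rintegral integral0.
rewrite big_cons -IH; under eq_fun do rewrite big_cons.
by rewrite IntD//; exact: L1_sum.
Qed.

Lemma Int_ge0 f : (forall t, 0 <= f t) -> 0 <= Int f.
Proof. by move=> h; apply: Rintegral_ge0. Qed.

Lemma Int_le f g : L1 f -> L1 g -> (forall t, f t <= g t) -> Int f <= Int g.
Proof. by move=> hf hg fg; apply: le_Rintegral. Qed.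

Lemma Int_restrict f (A : set X) : \int[mu]_(t in A) f t = Int (f \_ A).
Proof. exact: Rintegral_mkcond. Qed.

Lemma ae_eq_int (f g : X -> \bar R) : measurable_fun setT f -> measurable_fun setT g ->
  {ae mu, forall t, f t = g t} -> (\int[mu]_t f t = \int[mu]_t g t)%E.
Proof.
by move=> mf mg fg; apply: ae_eq_integral => //; apply: filterS fg => t e _.
Qed.

Lemma L1_ae f g : measurable_fun setT g -> L1 f -> {ae mu, forall t, f t = g t} -> L1 g.
Proof.
move=> mg hf fg; apply/integrableP; split; first exact/measurable_EFinP.
have /integrableP[_] := hf.
rewrite (@ae_eq_int _ (fun t => `|(EFin \o g) t|)%E)//.
- by apply: measurableT_comp => //; exact: measurable_int hf.
- by apply: measurableT_comp => //; exact/measurable_EFinP.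
- by apply: filterS fg => t e; rewrite /= e.
Qed.

Lemma Int_ae f g : measurable_fun setT f -> measurable_fun setT g ->
  {ae mu, forall t, f t = g t} -> Int f = Int g.
Proof.
move=> mf mg fg; rewrite /Int /Rintegral; congr fine; apply: ae_eq_int.
- exact/measurable_EFinP.
- exact/measurable_EFinP.
- by apply: filterS fg => t e; rewrite /= e.
Qed.

Lemma Int_ae_le f g : L1 f -> L1 g -> {ae mu, forall t, f t <= g t} -> Int f <= Int g.
Proof.
move=> hf hg fg.
rewrite -subr_ge0 -IntN// -IntD//; last exact: L1N.
have hh : L1 (fun t => g t - f t) by apply: L1D => //; exact: L1N.
rewrite (@Int_ae _ (fun t => `|g t - f t|)).
- exact: Int_ge0.
- exact: L1_meas.
- by apply: L1_meas; exact: L1_norm.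
- by apply: filterS fg => t e; rewrite ger0_norm// subr_ge0.
Qed.

Definition L2 f := measurable_fun setT f /\ L1 (fun t => f t ^+ 2).

Lemma inL2P (f : 'rV[R]_d -> R) : inL2 f <-> L2 (f \o @vec R d).
Proof.
have E (g : X -> R) : (\int[mu]_t (`|(g t)%:E| `^ 2) = \int[mu]_t (`|(g t ^+ 2)%:E|))%E.
  apply: eq_integral => t _; congr (_%:E).
  rewrite [RHS]ger0_norm ?sqr_ge0//.
  by rewrite -[2]/(2%:R) powR_mulrn// real_normK// num_real.
split=> -[mf h]; split => //.
  apply/integrableP; split.
    by apply/measurable_EFinP; apply: measurable_funX.
  rewrite -(E (f \o @vec R d)) -(poweR_Lnorm mu (fun t => (f (vec t))%:E))//.
  by rewrite poweR_lty.
rewrite /finite_norm unlock; apply: poweR_lty.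
rewrite (E (f \o @vec R d)).
by have /integrableP[] := h.
Qed.

Lemma L2_mul f g : L2 f -> L2 g -> L1 (fun t => f t * g t).
Proof.
move=> [mf hf] [mg hg]; apply: L1_le (L1D hf hg) _.
  exact: measurable_funM.
move=> t; rewrite normrM [X in _ <= X]ger0_norm ?addr_ge0 ?sqr_ge0//.
rewrite -[f t ^+ 2]real_normK ?num_real// -[g t ^+ 2]real_normK ?num_real//.
have := sqr_ge0 (`|f t| - `|g t|); have := normr_ge0 (f t); have := normr_ge0 (g t).
by nra.
Qed.

Lemma L2D f g : L2 f -> L2 g -> L2 (fun t => f t + g t).
Proof.
move=> hf hg; have := L2_mul hf hg; case: hf hg => [mf hf] [mg hg] hfg; split.
  exact: measurable_funD.
rewrite (_ : (fun _ => _) = fun t => (f t ^+ 2 + g t ^+ 2) + 2 * (f t * g t)).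
  by apply: L1D; [exact: L1D|exact: L1Z].
by apply/funext => t; ring.
Qed.

Lemma L2Z c f : L2 f -> L2 (fun t => c * f t).
Proof.
move=> [mf hf]; split; first exact: measurable_funM.
rewrite (_ : (fun _ => _) = fun t => c ^+ 2 * f t ^+ 2); first exact: L1Z.
by apply/funext => t; rewrite exprMn.
Qed.

Lemma L2_0 : L2 (fun=> 0).
Proof.
split; first exact: measurable_cst.
by rewrite (_ : (fun _ => _) = fun=> 0) ?expr0n//; exact: L1_0.
Qed.

Lemma L2_sum I (r : seq I) (F : I -> X -> R) :
  (forall i, L2 (F i)) -> L2 (fun t => \sum_(i <- r) F i t).
Proof.
move=> h; elim: r => [|i r IH].
  by under eq_fun do rewrite big_nil; exact: L2_0.
by under eq_fun do rewrite big_cons; exact: L2D.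
Qed.

Lemma L2_ae f g : measurable_fun setT g -> L2 f -> {ae mu, forall t, f t = g t} -> L2 g.
Proof.
move=> mg [mf hf] fg; split=> //; apply: (L1_ae _ hf).
  exact: measurable_funX.
by apply: filterS fg => t ->.
Qed.

Definition bounded_support f := exists M B : R,
  forall t, `|f t| <= B /\ (f t != 0 -> forall i, `|tnth t i| <= M).

Lemma L2_bounded f : measurable_fun setT f -> bounded_support f -> L2 f.
Proof.
move=> mf [M [B h]]; split => //.
pose D : set X := tbox (fun=> - `|M| - 1) (fun=> `|M| + 1).
have mD : measurable D by exact: measurable_tbox.
have i1 : L1 (\1_D : X -> R).
  apply/integrableP; split; first exact/measurable_EFinP/measurable_indic.
  under eq_integral do rewrite /= ger0_norm//.
  by rewrite integral_indic// setIT; exact: lebesgue_tbox_fin.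
apply: L1_le (L1Z (B ^+ 2) i1) _; first exact: measurable_funX.
move=> t; have [h1 h2] := h t.
have [->|ne] := eqVneq (f t) 0; first by rewrite expr0n normr0.
rewrite indicE mem_set ?mulr1.
  rewrite !ger0_norm ?sqr_ge0//.
  rewrite -[f t ^+ 2]real_normK ?num_real//.
  have := normr_ge0 (f t); nra.
move=> i /=; have := h2 ne i; rewrite ler_norml => /andP[]; have := ler_norm M; lra.
Qed.

End L1.

(** * Uniqueness of the weak gradient *)

Section test_functions.
Context {R : realType} {d : nat}.
Local Notation T := (measurableTypeR R).
Local Notation X := (d.-tuple T).
Local Notation mu := (lebesgue_tuple R d).

Lemma smoothV_measurable (f : 'rV[R]_d -> R) : smoothV f ->
  measurable_fun [set: X] (f \o @vec R d).
Proof.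
elim=> {f}[i|c|f g sf mf sg mg|f g sf mf sg mg|h f sh sf mf].
- rewrite (_ : _ \o _ = fun t : X => tnth t i); first exact: measurable_tnth.
  by apply/funext => t; rewrite /= mxE.
- exact: measurable_cst.
- exact: (measurable_funD mf mg).
- exact: (measurable_funM mf mg).
- apply: (@measurableT_comp _ _ _ _ _ _ h) mf.
  by apply: continuous_measurable_fun; exact: smooth1_cont.
Qed.

Lemma smoothV_bounded (f : 'rV[R]_d -> R) (M : R) : smoothV f ->
  exists B : R, forall x : 'rV[R]_d, (forall i, `|x 0 i| <= M) -> `|f x| <= B.
Proof.
elim=> {f}[i|c|f g sf [B1 h1] sg [B2 h2]|f g sf [B1 h1] sg [B2 h2]|h f sh sf [B hB]].
- by exists M.
- by exists `|c|.
- exists (B1 + B2) => x hx; apply: le_trans (ler_normD _ _) _.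
  by rewrite lerD// ?h1// h2.
- by exists (B1 * B2) => x hx; rewrite normrM ler_pM// ?h1// h2.
- have [C [C0 hC]] := continuous_bounded_itv (- B) B (smooth1_cont sh).
  by exists C => x hx; apply: hC; rewrite -ler_norml hB.
Qed.

Lemma enorm_coord (x : 'rV[R]_d) i : `|x 0 i| <= enorm x.
Proof.
rewrite -sqrtr_sqr ler_sqrt ?sumr_ge0// => [|j _]; last exact: sqr_ge0.
by rewrite (bigD1 i)//= lerDl sumr_ge0// => j _; exact: sqr_ge0.
Qed.

Lemma smoothV_bounded_support (f : 'rV[R]_d -> R) (M : R) : smoothV f ->
  (forall x, f x != 0 -> forall i, `|x 0 i| <= M) -> bounded_support (f \o @vec R d : X -> R).
Proof.
move=> sf hf; have [B hB] := smoothV_bounded M sf.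
exists M, (Num.max 0 B) => t; split.
  rewrite /= le_max; have [->|ne] := eqVneq (f (vec t)) 0; first by rewrite normr0 lexx.
  by rewrite hB ?orbT//; exact: hf.
by move=> /= /hf h i; have := h i; rewrite mxE.
Qed.

Lemma smoothV_L2 (f : 'rV[R]_d -> R) (M : R) : smoothV f ->
  (forall x, f x != 0 -> forall i, `|x 0 i| <= M) -> L2 (f \o @vec R d : X -> R).
Proof.
move=> sf hf; apply: L2_bounded; first exact: smoothV_measurable.
exact: smoothV_bounded_support hf.
Qed.

Lemma partial_support (f : 'rV[R]_d -> R) (M : R) i :
  (forall x, M < enorm x -> f x = 0) -> continuous (@enorm R d) ->
  forall x, M < enorm x -> partial i f x = 0.
Proof.
move=> hf ce x Mx; rewrite /partial.
have : \forall y \near x, f y = (fun=> 0) y.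
  have : \forall y \near x, M < enorm y by exact: (cvgr_gt _ (ce x) _ Mx).
  by apply: filterS => y; exact: hf.
move=> /near_eq_derive ->; first exact: derive_cst.
Qed.

Lemma continuous_enorm : continuous (@enorm R d).
Proof.
move=> x; apply: continuous_comp; last exact: sqrt_continuous.
rewrite (_ : (fun x : 'rV[R]_d => _) = \sum_i (fun x : 'rV[R]_d => x 0 i ^+ 2)).
  apply: (big_ind (fun f : 'rV[R]_d -> R => {for x, continuous f})).
  - exact: cst_continuous.
  - by move=> f g cf cg; exact: continuousD.
  - move=> i _; apply: (@continuous_comp _ _ _ (fun x : 'rV[R]_d => x 0 i) (fun y : R => y ^+ 2)).
      exact: coord_continuous.
    exact: exprn_continuous.
by apply/funext => y; rewrite fct_sumE.
Qed.

(** The difference of two gradients is tested with products of smooth bumps that converge to the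
    indicator of a box; by dominated convergence its integral over every box vanishes. *)
Lemma weak_gradient_uniq (f : 'rV[R]_d -> R) G G' i :
  weak_gradient f G -> weak_gradient f G' ->
  {ae mu, forall t, G i (vec t) = G' i (vec t)}.
Proof.
move=> /(_ i)[/inL2P hG WG] /(_ i)[/inL2P hG' WG'].
pose D (t : X) := G i (vec t) + -1 * G' i (vec t).
have hD : L2 D by apply: L2D => //; exact: L2Z.
suff : {ae mu, forall t, D t = 0}.
  by apply: filterS => t /eqP; rewrite /D mulN1r subr_eq0 => /eqP.
have D1 a b : L1 (fun t => `|D t| * \1_(tbox a b) t).
  have : L2 (\1_(tbox a b) : X -> R).
    apply: L2_bounded; first by apply: measurable_indic; exact: measurable_tbox.
    exists (\sum_i (`|a i| + `|b i|)), 1 => t; split.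
      by rewrite indicE; case: (_ \in _); rewrite ?normr0 ?normr1// ler01.
    rewrite indicE; case: (boolP (t \in _)) => [|_]; last by rewrite eqxx.
    rewrite inE => h _ j; apply: (@le_trans _ _ (`|a j| + `|b j|)).
      have /andP[] := h j; rewrite ler_norml.
      have := ler_norm (- a j); rewrite normrN.
      have := ler_norm (b j); have := normr_ge0 (a j); have := normr_ge0 (b j); lra.
    by rewrite [leRHS](bigD1 j)//= lerDl sumr_ge0// => k _; rewrite addr_ge0.
  move=> /(L2_mul hD) /L1_norm h; apply: L1_le h _.
    apply: measurable_funM; first by apply: measurableT_comp => //; case: hD.
    by apply: measurable_indic; exact: measurable_tbox.
  by move=> t; rewrite normr_id !normrM normr_id.
have DE a b t : (D \_ (tbox a b)) t = D t * \1_(tbox a b) t.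
  by rewrite restrE indicE; case: (_ \in _); rewrite ?mulr1 ?mulr0.
have LD a b : L1 (D \_ (tbox a b)).
  apply: L1_le (D1 a b) _.
    apply/(measurable_restrictT _ (measurable_tbox a b)).
    by apply: measurable_funTS; case: hD.
  by move=> t; rewrite DE !normrM normr_id.
apply: box_vanishing => a b.
  by apply/(integrable_mkcond _ (measurable_tbox a b)); rewrite restrict_EFin; exact: LD.
pose q n (x : 'rV[R]_d) := \prod_j smooth_bump (a j) (b j) n (x 0 j).
have sq n : smoothV (q n).
  by apply: smoothV_prod => j; apply: smoothV_comp; [exact: smooth1_bump|exact: smoothV_coord].
have q0 n x : q n x != 0 -> forall j, a j < x 0 j < b j + 1.
  move=> qn j; apply/negPn/negP => /(bump_out n) h; move/negP: qn; apply.
  by rewrite /q (bigD1 j)//= h mul0r.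
have qM n x : q n x != 0 -> forall j, `|x 0 j| <= \sum_j (`|a j| + `|b j| + 1).
  move=> /q0 h j; apply: (@le_trans _ _ (`|a j| + `|b j| + 1)).
    have /andP[] := h j; rewrite ler_norml.
    have := ler_norm (- a j); rewrite normrN.
    have := ler_norm (b j); have := normr_ge0 (a j); have := normr_ge0 (b j); lra.
  by rewrite [leRHS](bigD1 j)//= lerDl sumr_ge0// => k _; rewrite !addr_ge0.
have qt n : test_function (q n).
  split; first exact: smoothV_smooth_on.
  exists (Num.sqrt (\sum_(k < d) (\sum_j (`|a j| + `|b j| + 1)) ^+ 2)) => x hx.
  apply/eqP/negPn/negP => /qM h; move: hx; apply/negP; rewrite -leNgt.
  rewrite ler_sqrt; last by rewrite sumr_ge0// => k _; exact: sqr_ge0.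
  apply: ler_sum => k _; rewrite -[x 0 k ^+ 2]real_normK ?num_real//.
  by rewrite ler_sqr ?nnegrE// sumr_ge0// => j _; rewrite !addr_ge0.
have q2 n : L2 (q n \o @vec R d : X -> R) by apply: smoothV_L2 (qM n).
have q01 n x : 0 <= q n x <= 1.
  rewrite /q; elim/big_ind : _ => [|u v /andP[u0 u1] /andP[v0 v1]|j _].
  - by rewrite ler01 lexx.
  - by rewrite mulr_ge0// mulr_ile1.
  - by rewrite bump_ge0 bump_le1.
have I0 n : Int (fun t => D t * q n (vec t)) = 0.
  rewrite (_ : (fun _ => _) = fun t => G i (vec t) * q n (vec t) +
      -1 * (G' i (vec t) * q n (vec t))).
    rewrite IntD ?IntZ; try by [exact: (L2_mul hG (q2 n))|exact: (L2_mul hG' (q2 n))|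
      apply: L1Z; exact: (L2_mul hG' (q2 n))].
    have := WG _ (qt n); rewrite (WG' _ (qt n)) /integral_Rd => /oppr_inj e.
    by rewrite mulN1r; apply/eqP; rewrite subr_eq0 /Int -e.
  by apply/funext => t; rewrite /D; ring.
pose b' j := b j + 1.
have [|||||] := @dominated_convergence _ X R mu setT measurableT
  (fun n t => (D t * q n (vec t))%:E) (fun t => ((D \_ (tbox a b)) t)%:E)
  (fun t => (`|D t| * \1_(tbox a b') t)%:E).
- move=> n; apply/measurable_EFinP; apply: L1_meas; exact: (L2_mul hD (q2 n)).
- by apply/measurable_EFinP; apply: L1_meas; exact: LD.
- apply: aeW => t _; apply: cvg_EFin; first exact: nearW.
  rewrite DE; apply: cvgM; first exact: cvg_cst.
  rewrite [X in _ --> X](_ : _ = \prod_j (\1_(`]a j, b j]) (tnth t j) : R)).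
    rewrite /q; elim: (index_enum _) => [|j r IH].
      by rewrite big_nil; under eq_cvg do rewrite big_nil; exact: cvg_cst.
    rewrite big_cons; under eq_cvg do rewrite big_cons.
    apply: cvgM; last exact: IH.
    by rewrite mxE; exact: bump_cvg.
  rewrite indicE; case: (boolP (t \in _)) => h.
    rewrite big1// => j _; rewrite indicE mem_set//=.
    by move: h; rewrite inE => h; rewrite in_itv; exact: h.
  apply/esym/eqP; rewrite prodf_seq_eq0.
  apply/hasP; apply: contrapT => hn; move/negP: h; apply; rewrite inE => j.
  apply: contrapT => hj; apply: hn; exists j; first by rewrite mem_index_enum.
  by rewrite /= indicE memNset.
- exact: D1.
- apply: aeW => t n _; rewrite /= lee_fin normrM ler_wpM2l//.
  have /andP[h0 h1] := q01 n (vec t); rewrite ger0_norm// indicE.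
  case: (boolP (t \in _)) => //= h.
  suff -> : q n (vec t) = 0 by [].
  apply/eqP/negPn/negP => /q0 hq; move/negP: h; apply; rewrite inE => j.
  by have /andP[h2 h3] := hq j; move: h2 h3; rewrite mxE => -> /ltW ->.
move=> _ _ hc.
have e : (\int[mu]_t ((D \_ (tbox a b)) t)%:E = 0)%E.
  apply: (cvg_unique _ hc); first exact: ereal_hausdorff.
  apply: cvg_near_cst; apply: nearW => n.
  exact: (etrans (EFin_Rintegral measurableT (L2_mul hD (q2 n))) (congr1 EFin (I0 n))).
by rewrite integral_mkcond -[RHS]e; apply: eq_integral => t _; rewrite !patchE; case: ifP.
Qed.

End test_functions.

(** * Radial profiles of functions in X_rad *)

(** The derivative of th (ln s) is th' (ln s) e^{-ln s}, of the same form, and extension by 0 is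
    harmless because [th] vanishes near minus infinity. *)
Lemma smooth1_ln (R : realType) (th : R -> R) (a : R) : smooth1 th ->
  (forall t, t < a -> th t = 0) -> smooth1 (fun s : R => if 0 < s then th (ln s) else 0).
Proof.
move=> sth th0.
exists [set f | exists th, [/\ smooth1 th, forall t, t < a -> th t = 0 &
  f = fun s : R => if 0 < s then th (ln s) else 0]]; split; first by exists th.
move=> f [{}th [{}sth {}th0 ->]].
have [th' sth' dth] := smooth1_der sth.
exists (fun s : R => if 0 < s then (fun t => th' t * expR (- t)) (ln s) else 0).
  exists (fun t => th' t * expR (- t)); split => //.
    apply: smooth1_mul => //; apply: (@smooth1_comp _ expR (fun t => - t)).
      exact: smooth1_exp.
    by apply: smooth1_opp; exact: smooth1_id.
  move=> t ta; suff -> : th' t = 0 by rewrite mul0r.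
  apply: (der_uniq (dth t)); apply: (@der_near _ (fun=> 0) _ _ _ _ (drv_cst 0 t)).
  near=> y; rewrite th0//; near: y; exact: lt_nbhsl.
move=> s; have [s0|s0] := ltP 0 s.
  apply: (@der_near _ (fun y => th (ln y))).
    near=> y; rewrite ifT//; near: y; exact: lt_nbhsr.
  rewrite expRN lnK ?posrE//.
  exact: (drv_comp (is_derive1_ln s0) (dth _)).
apply: (@der_near _ (fun=> 0) _ _ _ _ (drv_cst 0 s)).
near=> y; case: ifP => // y0; rewrite th0//.
rewrite -[ltRHS]expRK ltr_ln ?posrE ?expR_gt0//.
by near: y; apply: lt_nbhsl; apply: le_lt_trans s0 _; exact: expR_gt0.
Unshelve. all: by end_near. Qed.

Section flux.
Context {R : realType} {d : nat} (d0 : (0 < d)%N).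
Local Notation T := (measurableTypeR R).
Local Notation X := (d.-tuple T).
Local Notation mu := (lebesgue_tuple R d).
Local Notation c0 := (polar_cst (R := R) (d := d)).

Lemma ae_tradius_neq0 : {ae mu, forall t : X, tradius t != 0}.
Proof.
exists [set t : X | radV t <= 0]; split.
- exact: measurable_radV_le.
- exact: lebesgue_radV_le0.
- move=> t /= /negP; rewrite negbK => /eqP h.
  by rewrite /radV h expr0n eqn0Ngt d0.
Qed.

Definition flux (G : 'I_d -> 'rV[R]_d -> R) (t : X) : R := \sum_i G i (vec t) * tnth t i.

Lemma tradius_sq (t : X) : tradius t ^+ 2 = \sum_i (vec t) 0 i ^+ 2.
Proof. by rewrite sqr_sqrtr// sumr_ge0// => i _; exact: sqr_ge0. Qed.

Lemma radT_exp (t : X) : tradius t != 0 -> tradius t = expR (radT t).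
Proof. by move=> h; rewrite lnK// posrE lt_neqAle eq_sym h rad_ge0. Qed.

Lemma flux_cauchy G (t : X) : flux G t ^+ 2 <= (\sum_i G i (vec t) ^+ 2) * tradius t ^+ 2.
Proof.
rewrite radE sqr_sqrtr; last by rewrite sumr_ge0// => i _; exact: sqr_ge0.
rewrite /flux; set a := fun i => G i (vec t); set b := fun i => (tnth t i : R).
change ((\sum_i a i * b i) ^+ 2 <= (\sum_i a i ^+ 2) * (\sum_i b i ^+ 2)).
have : 0 <= \sum_i \sum_j (a i * b j - a j * b i) ^+ 2.
  by apply: sumr_ge0 => i _; apply: sumr_ge0 => j _; exact: sqr_ge0.
suff -> : \sum_i \sum_j (a i * b j - a j * b i) ^+ 2 =
    2 * ((\sum_i a i ^+ 2) * (\sum_i b i ^+ 2)) - 2 * (\sum_i a i * b i) ^+ 2 by lra.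
have e1 : \sum_i \sum_j (a i ^+ 2 * b j ^+ 2) = (\sum_i a i ^+ 2) * (\sum_i b i ^+ 2).
  by rewrite mulr_suml; apply: eq_bigr => i _; rewrite mulr_sumr.
have e2 : \sum_i \sum_j (a j ^+ 2 * b i ^+ 2) = (\sum_i a i ^+ 2) * (\sum_i b i ^+ 2).
  by rewrite exchange_big.
have e3 : \sum_i \sum_j (a i * b i) * (a j * b j) = (\sum_i a i * b i) ^+ 2.
  by rewrite expr2 mulr_suml; apply: eq_bigr => i _; rewrite mulr_sumr.
rewrite -e3 mulr2n mulrDl !mul1r -{1}e1 -e2 mulrDl mul1r.
rewrite -!big_split -sumrB /=; apply: eq_bigr => i _.
by rewrite -!big_split -sumrB /=; apply: eq_bigr => j _; ring.
Qed.

Lemma continuous_radT_measurable (q : R -> R) : continuous q ->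
  measurable_fun [set: X] (fun t => q (radT t)).
Proof.
move=> cq; apply: (@measurableT_comp _ _ _ _ _ _ q); last exact: measurable_radT.
exact: continuous_measurable_fun.
Qed.

(* The vector field x |x|^-d th(ln |x|) has divergence |x|^-d th'(ln |x|). *)
Lemma weak_gradient_radial_test f G (th th' : R -> R) (A B : R) :
  inL2 f -> weak_gradient f G -> smooth1 th ->
  (forall x : R, is_derive x 1 th (th' x)) ->
  (forall t, t < A -> th t = 0) -> (forall t, B < t -> th t = 0) ->
  Int (fun t : X => f (vec t) * (radJ t * th' (radT t))) =
  - Int (fun t : X => flux G t * (radJ t * th (radT t))).
Proof.
move=> /inL2P f2 wG sth dth thA thB.
(* [th1] expresses |x|^-d th (ln |x|) through ln |x|^2: unlike |x|, the function |x|^2 is a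
   polynomial in the coordinates. *)
pose th1 (t : R) := expR (- d%:R / 2 * t) * th (2^-1 * t).
have slin (a : R) : smooth1 (fun t => a * t).
  by apply: smooth1_mul; [exact: smooth1_cst|exact: smooth1_id].
have sth1 : smooth1 th1.
  apply: smooth1_mul; first by apply: (smooth1_comp smooth1_exp); exact: slin.
  by apply: (smooth1_comp sth); exact: slin.
have th10 t : t < 2 * A -> th1 t = 0.
  by move=> tA; rewrite /th1 thA ?mulr0//; lra.
pose Th (s : R) := if 0 < s then th1 (ln s) else 0.
have sTh : smooth1 Th by exact: (smooth1_ln sth1 th10).
have [Th' sTh' dTh] := smooth1_der sTh.
(* The divergence of x Th (|x|^2), at s = |x|^2. *)
have Th'E (s : R) : 0 < s -> d%:R * Th s + 2 * s * Th' s =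
    expR (- d%:R / 2 * ln s) * th' (2^-1 * ln s).
  move=> s0; have : is_derive s 1 Th
      (((- d%:R / 2) * expR (- d%:R / 2 * ln s) * th (2^-1 * ln s) +
       expR (- d%:R / 2 * ln s) * (th' (2^-1 * ln s) * 2^-1)) * s^-1).
    apply: (@der_near _ (fun y => th1 (ln y))).
      near=> y; rewrite /Th ifT//; near: y; exact: lt_nbhsr.
    have dlin (a x : R) : is_derive x 1 (fun t => a * t) a.
      have := drv_mul (drv_cst a x) (drv_id x).
      by rewrite mul0r add0r mulr1.
    have dl (k : R) : is_derive (ln s : R) 1 (fun t => k * t) k by exact: dlin.
    have de := drv_expR (dl (- d%:R / 2)).
    have dt := drv_comp (dl 2^-1) (dth _).
    rewrite [_ * expR _]mulrC; exact: (drv_comp (is_derive1_ln s0) (drv_mul de dt)).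
  move=> /(der_uniq (dTh s)) ->; rewrite /Th s0 /th1; field.
  by rewrite gt_eqF.
pose Q (x : 'rV[R]_d) := \sum_j x 0 j ^+ 2.
have sQ : smoothV Q.
  by apply: smoothV_sum => j; apply: smoothV_mul; exact: smoothV_coord.
pose phi i (x : 'rV[R]_d) := x 0 i * Th (Q x).
have sphi i : smoothV (phi i).
  by apply: smoothV_mul; [exact: smoothV_coord|exact: smoothV_comp].
have Q0 x : 0 <= Q x by apply: sumr_ge0 => j _; exact: sqr_ge0.
have ThB s : expR (2 * B) < s -> Th s = 0.
  move=> hs; rewrite /Th; case: ifP => // s0; rewrite /th1 thB ?mulr0//.
  have : 2 * B < ln s by rewrite -[ltLHS]expRK ltr_ln ?posrE ?expR_gt0//.
  lra.
have phi0 i x : Num.sqrt (expR (2 * B)) < enorm x -> phi i x = 0.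
  move=> hx; rewrite /phi ThB ?mulr0//; move: hx.
  by rewrite /enorm; apply: contraTT; rewrite -!leNgt => /ler_wsqrtr.
have tphi i : test_function (phi i).
  by split; [exact: smoothV_smooth_on|exists (Num.sqrt (expR (2 * B))) => x; exact: phi0].
have phiM i x : phi i x != 0 -> forall j, `|x 0 j| <= Num.sqrt (expR (2 * B)).
  move=> h j; apply: le_trans (enorm_coord x j) _.
  by rewrite leNgt; apply: contraNN h => /(phi0 i) ->.
have pphi i x : partial i (phi i) x = Th (Q x) + 2 * x 0 i ^+ 2 * Th' (Q x).
  have [dQ _] := smoothV_diff sQ.
  have [dc _] := smoothV_diff (@smoothV_coord R d i).
  have [dT _] := smoothV_diff (smoothV_comp sTh sQ).
  rewrite /phi (partial_mul i (dc x) (dT x)) partial_coord eqxx mul1r.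
  rewrite (partial_comp i (dQ x) (dTh (Q x))); congr (_ + _).
  suff -> : partial i Q x = 2 * x 0 i by ring.
  rewrite /Q; have dsq (k : 'I_d) (y : 'rV[R]_d) : differentiable (fun z : 'rV[R]_d => z 0 k ^+ 2) y.
    by have [h _] := smoothV_diff (smoothV_mul (@smoothV_coord R d k) (smoothV_coord k)); exact: h.
  have E r : partial i (fun y : 'rV[R]_d => \sum_(k <- r) y 0 k ^+ 2) x =
      \sum_(k <- r) 2 * (i == k)%:R * x 0 k.
    elim: r => [|k r IH].
      by rewrite big_nil; under eq_fun do rewrite big_nil; rewrite /partial derive_cst.
    rewrite big_cons -IH; under eq_fun do rewrite big_cons.
    rewrite partial_add//; last first.
      suff [h _] : (forall x, differentiable (fun y : 'rV[R]_d => \sum_(k <- r) y 0 k ^+ 2) x) /\ True by [].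
      split=> // y; have [h _] := smoothV_diff (@smoothV_sum R d _ r (fun k x => x 0 k ^+ 2)
        (fun k => smoothV_mul (smoothV_coord k) (smoothV_coord k))); exact: h.
    congr (_ + _); have [dk _] := smoothV_diff (@smoothV_coord R d k).
    by rewrite (partial_mul i (dk x) (dk x)) partial_coord; ring.
  rewrite E (bigD1 i)//= eqxx mulr1 big1 ?addr0// => k /negbTE ki.
  by rewrite eq_sym ki mulr0 mul0r.
have sp i : smoothV (partial i (phi i)) by have [_] := smoothV_diff (sphi i).
have p2 i : L2 (partial i (phi i) \o @vec R d : X -> R).
  apply: (@smoothV_L2 _ _ _ (Num.sqrt (expR (2 * B)))) => // x h j.
  apply: le_trans (enorm_coord x j) _; rewrite leNgt; apply/negP => hx; move: h.
  rewrite (@partial_support _ _ (phi i) (Num.sqrt (expR (2 * B))))//; first by rewrite eqxx.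
    exact: phi0.
  exact: continuous_enorm.
have ph2 i : L2 (phi i \o @vec R d : X -> R) by apply: smoothV_L2 (phiM i).
have G2 i : L2 (G i \o @vec R d) by have [/inL2P] := wG i.
have I1 : Int (fun t : X => f (vec t) * (radJ t * th' (radT t))) =
    Int (fun t : X => \sum_i f (vec t) * partial i (phi i) (vec t)).
  apply: Int_ae.
  - apply: measurable_funM; first by case: f2.
    apply: measurable_funM; first exact: measurable_radJ.
    have [th'' s'' d''] := smooth1_der sth.
    have -> : th' = th'' by apply/funext => x; exact: der_uniq (dth x) (d'' x).
    by apply: continuous_radT_measurable; exact: smooth1_cont.
  - by apply: L1_meas; apply: L1_sum => i; exact: (L2_mul f2 (p2 i)).
  apply: filterS ae_tradius_neq0 => t t0.
  rewrite -mulr_sumr; congr (_ * _).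
  under eq_bigr do rewrite pphi.
  rewrite big_split /= sumr_const card_ord -mulr_suml -mulr_sumr -/(Q (vec t)).
  have Qt : Q (vec t) = expR (2 * radT t).
    by rewrite -[LHS]tradius_sq (radT_exp t0) -expRM_natl.
  rewrite -[Th _ *+ d]mulr_natl Th'E ?Qt ?expR_gt0// expRK /radJ.
  rewrite (_ : - d%:R / 2 * (2 * radT t) = - d%:R * radT t); last by field.
  by rewrite (_ : 2^-1 * (2 * radT t) = radT t)//; field.
have I2 : Int (fun t : X => flux G t * (radJ t * th (radT t))) =
    Int (fun t : X => \sum_i G i (vec t) * phi i (vec t)).
  apply: Int_ae.
  - apply: measurable_funM.
      apply: measurable_sum => i; apply: measurable_funM; last exact: measurable_tnth.
      by case: (G2 i).
    apply: measurable_funM; first exact: measurable_radJ.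
    by apply: continuous_radT_measurable; exact: smooth1_cont.
  - by apply: L1_meas; apply: L1_sum => i; exact: (L2_mul (G2 i) (ph2 i)).
  apply: filterS ae_tradius_neq0 => t t0.
  rewrite /flux mulr_suml; apply: eq_bigr => i _; rewrite -mulrA; congr (_ * _).
  rewrite /phi mxE; congr (_ * _).
  have Qt : Q (vec t) = expR (2 * radT t).
    by rewrite -[LHS]tradius_sq (radT_exp t0) -expRM_natl.
  rewrite Qt /Th expR_gt0 expRK /th1 /radJ.
  rewrite (_ : - d%:R / 2 * (2 * radT t) = - d%:R * radT t); last by field.
  by rewrite (_ : 2^-1 * (2 * radT t) = radT t)//; field.
rewrite I1 I2 (Int_sum _ (fun i => L2_mul f2 (p2 i))) (Int_sum _ (fun i => L2_mul (G2 i) (ph2 i))).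
rewrite -sumrN; apply: eq_bigr => i _.
by have [_ /(_ _ (tphi i))] := wG i.
Unshelve. all: by end_near. Qed.

End flux.

Section radial_profile.
Context {R : realType} {d : nat} (d0 : (0 < d)%N).
Local Notation T := (measurableTypeR R).
Local Notation X := (d.-tuple T).
Local Notation mu := (lebesgue_tuple R d).
Local Notation c0 := (polar_cst (R := R) (d := d)).

(** A measurable choice of a point of radius e^s, through which a radial function becomes a function
    of ln |x|. *)
Definition radpt (s : T) : X := [tuple (expR s / Num.sqrt d%:R : R) | i < d].

Lemma measurable_radpt : measurable_fun setT radpt.
Proof.
apply/measurable_fun_tnthP => i.
rewrite (_ : _ \o _ = fun s : T => (expR s / Num.sqrt d%:R : R)).
  by apply: measurable_funM => //; exact: measurable_expR.
by apply/funext => s; rewrite /= tnth_mktuple.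
Qed.

Lemma tradius_radpt s : tradius (radpt s) = expR s.
Proof.
rewrite radE; under eq_bigr do rewrite tnth_mktuple.
rewrite expr_div_n sqr_sqrtr ?ler0n// sumr_const card_ord -[_ *+ d]mulr_natr divfK ?pnatr_eq0 -?lt0n//.
by rewrite sqrtr_sqr ger0_norm// expR_ge0.
Qed.

Lemma radT_radpt s : radT (radpt s) = s.
Proof. by rewrite /radT tradius_radpt expRK. Qed.

Definition loc_int (k : X -> R) := measurable_fun setT k /\
  forall a b, mu.-integrable (annulus a b) (EFin \o k).

Lemma annulus_empty (k : X -> R) a b : b <= a -> annulus_int k a b = 0.
Proof.
move=> ba; rewrite /annulus_int (_ : annulus a b = set0) ?Rintegral_set0//.
apply/seteqP; split => // t /andP[h1 h2].
by have := lt_le_trans h1 h2; rewrite ltr_expR ltNge ba.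
Qed.

Lemma annulus_split (k : X -> R) a b e : loc_int k -> a <= b -> b <= e ->
  annulus_int k a e = annulus_int k a b + annulus_int k b e.
Proof.
move=> [mk ik] ab be; rewrite /annulus_int.
have E : annulus a e = annulus a b `|` annulus b e :> set X.
  apply/seteqP; split => t.
    move=> /andP[h1 h2]; case: (leP (tradius t) (expR b)) => h.
      by left; rewrite /annulus /= h1 h.
    by right; rewrite /annulus /= h h2.
  move=> [/andP[h1 h2]|/andP[h1 h2]]; rewrite /annulus /=.
    by rewrite h1 (le_trans h2)// ler_expR.
  by rewrite h2 andbT (le_lt_trans _ h1)// ler_expR.
rewrite E; apply: Rintegral_setU.
- exact: measurable_annulus.
- exact: measurable_annulus.
- by rewrite -E; exact: ik.
apply/eqP/seteqP; split => // t /= [/andP[_ h1] /andP[h2 _]].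
by have := le_lt_trans h1 h2; rewrite ltxx.
Qed.

(** One of the two terms always vanishes, since [annulus_int k a b] is 0 for b <= a; this is the
    oriented integral from 0 to s. *)
Definition annulus_prim (k : X -> R) s := annulus_int k 0 s - annulus_int k s 0.

Lemma annulus_primB (k : X -> R) a s : loc_int k -> a <= s ->
  annulus_prim k s - annulus_prim k a = annulus_int k a s.
Proof.
move=> lk as_; rewrite /annulus_prim; case: (leP 0 a) => a0.
  rewrite (annulus_empty k (le_trans a0 as_)) (annulus_empty k a0) (annulus_split lk a0 as_).
  by move: (annulus_int k 0 a) (annulus_int k a s) => u v; lra.
rewrite (annulus_empty k (ltW a0)); case: (leP 0 s) => s0.
  rewrite (annulus_empty k s0) (annulus_split lk (ltW a0) s0).
  by move: (annulus_int k 0 s) (annulus_int k a 0) => u v; lra.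
rewrite (annulus_empty k (ltW s0)) (annulus_split lk as_ (ltW s0)).
by move: (annulus_int k s 0) (annulus_int k a s) => u v; lra.
Qed.

Lemma loc_int_C0 (q : R -> R) : continuous q -> loc_int (fun t => radJ t * q (radT t)).
Proof.
move=> cq; have [Q dQ] := antiderivative cq; split.
  apply: measurable_funM; first exact: measurable_radJ.
  exact: continuous_radT_measurable.
move=> a b; case: (ltP a b) => ab; first exact: (annulus_FTC d0 ab dQ cq).1.
rewrite (_ : annulus a b = set0); first exact: integrable_set0.
apply/seteqP; split => // t /andP[h1 h2].
by have := lt_le_trans h1 h2; rewrite ltr_expR ltNge ab.
Qed.

Lemma loc_intD k1 k2 : loc_int k1 -> loc_int k2 -> loc_int (fun t => k1 t + k2 t).
Proof.
move=> [m1 i1] [m2 i2]; split; first exact: measurable_funD.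
by move=> a b; exact: (integrableD (measurable_annulus d0 a b) (i1 a b) (i2 a b)).
Qed.

Lemma loc_intZ c k : loc_int k -> loc_int (fun t => c * k t).
Proof.
move=> [m1 i1]; split; first exact: measurable_funM.
by move=> a b; exact: (integrableZl (measurable_annulus d0 a b) c (i1 a b)).
Qed.

Lemma annulus_intD k1 k2 a b : loc_int k1 -> loc_int k2 ->
  annulus_int (fun t => k1 t + k2 t) a b = annulus_int k1 a b + annulus_int k2 a b.
Proof.
by move=> [m1 i1] [m2 i2]; exact: (RintegralD (measurable_annulus d0 a b) (i1 a b) (i2 a b)).
Qed.

Lemma annulus_intZ c k a b : loc_int k ->
  annulus_int (fun t => c * k t) a b = c * annulus_int k a b.
Proof.
by move=> [m1 i1]; exact: (RintegralZl c (measurable_annulus d0 a b) (i1 a b)).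
Qed.

Lemma loc_int_L1 k : L1 k -> loc_int k.
Proof.
move=> lk; split; first exact: L1_meas.
by move=> a b; apply: L1_on => //; exact: measurable_annulus.
Qed.

Lemma loc_int_ann (k : X -> R) : measurable_fun setT k ->
  (forall a b, exists2 g : X -> R, L1 g & forall t, annulus a b t -> `|k t| <= `|g t|) -> loc_int k.
Proof.
move=> mk h; split => // a b; have [g ig kg] := h a b.
have mA := @measurable_annulus R d d0 a b.
apply: (@integrable_dom _ X R mu (annulus a b) k g mA) => //.
  exact: measurable_funTS.
exact: L1_on.
Qed.

Lemma L2_annulus a b : L2 (\1_(annulus a b) : X -> R).
Proof.
have mA := @measurable_annulus R d d0 a b.
apply: L2_bounded; first exact: measurable_indic.
exists (expR b), 1 => t; split.
  by rewrite indicE; case: (_ \in _); rewrite ?normr0 ?normr1// ler01.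
rewrite indicE; case: (boolP (t \in _)) => [|_]; last by rewrite eqxx.
by rewrite inE => /andP[_ h] _ i; exact: le_trans (coord_le_rad t i) h.
Qed.

Lemma loc_int_L2 (k : X -> R) (q : R -> R) : L2 k -> continuous q ->
  loc_int (fun t => k t * q (radT t)).
Proof.
move=> k2 cq; apply: loc_int_ann.
  by apply: measurable_funM; [case: k2|exact: continuous_radT_measurable].
move=> a b; have [M [M0 hM]] := continuous_bounded_itv a b cq.
exists (fun t => M * (k t * \1_(annulus a b) t)).
  by apply: L1Z; exact: L2_mul k2 (L2_annulus a b).
move=> t At; rewrite indicE mem_set//= mulr1 mulrC !normrM ler_wpM2r//.
rewrite (ger0_norm M0); apply: hM.
by have /annulus_radT[_ /andP[/ltW -> ->]] := At.
Qed.

Lemma L2_coord_annulus i a b : L2 (fun t : X => tnth t i * \1_(annulus a b) t).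
Proof.
have mA := @measurable_annulus R d d0 a b.
apply: L2_bounded.
  by apply: measurable_funM; [exact: measurable_tnth|exact: measurable_indic].
exists (expR b), (expR b) => t; rewrite indicE.
case: (boolP (t \in _)); last by rewrite mulr0 normr0 eqxx expR_ge0.
rewrite inE mulr1 => /andP[_ h]; split; first exact: le_trans (coord_le_rad t i) h.
by move=> _ j; exact: le_trans (coord_le_rad t j) h.
Qed.

Lemma loc_int_flux f G (q : R -> R) : @weak_gradient R d f G -> continuous q ->
  loc_int (fun t => flux G t * q (radT t)).
Proof.
move=> wG cq; have G2 i : L2 (G i \o @vec R d) by have [/inL2P] := wG i.
have mf : measurable_fun setT (flux G : X -> R).
  apply: measurable_sum => i; apply: measurable_funM; last exact: measurable_tnth.
  by case: (G2 i).
apply: loc_int_ann.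
  by apply: measurable_funM => //; exact: continuous_radT_measurable.
move=> a b; have [M [M0 hM]] := continuous_bounded_itv a b cq.
exists (fun t => M * \sum_i G i (vec t) * (tnth t i * \1_(annulus a b) t)).
  apply: L1Z; apply: L1_sum => i; exact: (L2_mul (G2 i) (L2_coord_annulus i a b)).
move=> t At; rewrite indicE mem_set//= mulrC !normrM.
rewrite (eq_bigr (fun i => G i (vec t) * tnth t i)); last by move=> i _; rewrite mulr1.
rewrite ler_wpM2r// (ger0_norm M0); apply: hM.
by have /annulus_radT[_ /andP[/ltW -> ->]] := At.
Qed.

Lemma annulus_ext (k g : X -> R) a b : (forall t, annulus a b t -> k t = g t) ->
  annulus_int k a b = annulus_int g a b.
Proof. by move=> h; apply: eq_Rintegral => t; rewrite inE => /h. Qed.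

Lemma annulus_ae (k g : X -> R) a b : measurable_fun setT k -> measurable_fun setT g ->
  {ae mu, forall t, k t = g t} -> annulus_int k a b = annulus_int g a b.
Proof.
move=> mk mg h; rewrite /annulus_int /Rintegral; congr fine; apply: ae_eq_integral => //.
- exact: measurable_annulus.
- by apply: measurable_funTS; exact/measurable_EFinP.
- by apply: measurable_funTS; exact/measurable_EFinP.
- by apply: filterS h => t e _; rewrite /= e.
Qed.

(** Integrals of [k] vanish over preimages under [radT] of all Borel sets. As [k] is a function of
    [radT], the set where it is nonnegative is such a preimage, up to the origin. *)
Lemma radial_vanishing (k : X -> R) : loc_int k ->
  (forall t, tradius t != 0 -> k t = k (radpt (radT t))) ->
  (forall a b, annulus_int k a b = 0) -> {ae mu, forall t, k t = 0}.
Proof.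
move=> [mk ik] kr k0.
have mA n : measurable (annulus (- n%:R) n%:R : set X) := measurable_annulus d0 _ _.
have van n (S : set T) : measurable S ->
    (\int[mu]_(t in annulus (- n%:R) n%:R `&` radT @^-1` S) (k t)%:E = 0)%E.
  move=> mS; apply: (@vanishing_integrals _ _ X T R mu radT k (annulus (- n%:R) n%:R)
     _ (mA n) (ik _ _) (@ocitv R) (fun k => `](- k%:R), k%:R]%classic)) => //.
  - exact: measurable_radT.
  - exact: ocitvI.
  - by move=> i; exact: is_ocitv.
  - rewrite -subTset => x _; exists (Num.truncn `|x|).+1 => //=.
    have := truncnS_gt `|x|; rewrite in_itv /=; have := ler_norm x; have := ler_norm (- x).
    by rewrite normrN; move=> h1 h2 h3; apply/andP; split; lra.
  - move=> A /ocitvP[->|[[a b] /= ab ->]]; first by rewrite preimage_set0 setI0 integral_set0.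
    rewrite (_ : _ `&` _ = annulus (Num.max (- n%:R) a) (Num.min n%:R b)).
      rewrite (EFin_Rintegral (measurable_annulus d0 _ _) (ik _ _)).
      by congr (_%:E); exact: k0.
    apply/seteqP; split => t.
      move=> [/annulus_radT[t0 /andP[h1 h2]]]; rewrite /= in_itv /= => /andP[h3 h4].
      by apply/annulus_radT; split => //; rewrite gt_max le_min h1 h2 h3 h4.
    move=> /annulus_radT[t0]; rewrite gt_max le_min => /andP[/andP[h1 h3] /andP[h2 h4]].
    by split; [apply/annulus_radT; rewrite h1 h2|rewrite /= in_itv /= h3 h4].
have mkr : measurable_fun setT (fun s : T => k (radpt s)).
  exact: (measurableT_comp mk measurable_radpt).
have ae_n n : {ae mu, forall t, annulus (- n%:R) n%:R t -> k t = 0}.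
  pose P : set T := [set s | 0 <= k (radpt s)].
  have mP : measurable P.
    rewrite (_ : P = (fun s : T => k (radpt s)) @^-1` `[0, +oo[).
      by rewrite -[X in measurable X]setTI; exact: mkr.
    by apply/seteqP; split => s /=; rewrite in_itv /= andbT.
  have E t : annulus (- n%:R) n%:R t -> k t = k (radpt (radT t)).
    by move=> /annulus_radT[h _]; exact: kr.
  have i1 := van n P mP; have i2 := van n (~` P) (measurableC mP).
  have mi (S : set T) : measurable S -> measurable (annulus (- n%:R) n%:R `&` radT @^-1` S : set X).
    move=> mS; apply: measurableI; first exact: mA.
    by rewrite -[X in measurable X]setTI; exact: measurable_radT.
  have mabs : measurable_fun setT (fun t : X => (`|k t|)%:E).
    by apply/measurable_EFinP; exact: measurableT_comp.
  have : (\int[mu]_(t in annulus (- n%:R) n%:R) `|(k t)%:E| = 0)%E.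
    rewrite (_ : annulus (- n%:R) n%:R = (annulus (- n%:R) n%:R `&` radT @^-1` P) `|`
        (annulus (- n%:R) n%:R `&` radT @^-1` (~` P)) :> set X); last first.
      by rewrite -setIUr preimage_setC setUv setIT.
    rewrite ge0_integral_setU//=; last 4 first.
    - exact: (mi P mP).
    - exact: (mi (~` P) (measurableC mP)).
    - exact: measurable_funTS mabs.
    - by apply/eqP/seteqP; split => // t /= [[_ h] [_]]; exact.
    rewrite -[RHS]adde0; congr (_ + _)%E.
      rewrite -[RHS]i1; apply: eq_integral => t; rewrite inE => -[At h].
      by rewrite ger0_norm// E.
    transitivity (- \int[mu]_(t in annulus (- n%:R) n%:R `&` radT @^-1` (~` P)) (k t)%:E)%E; last by rewrite i2 oppe0.
    rewrite -integralN; last first.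
      apply: integrable_add_def; first exact: (mi _ (measurableC mP)).
      exact: (integrableS (mA n) (mi _ (measurableC mP)) (@subIsetl _ _ _) (ik _ _)).
    apply: eq_integral => t; rewrite inE => -[At h].
    rewrite ler0_norm// E// leNgt; apply/negP => h'; apply: h.
    exact: ltW.
  have mk' : measurable_fun (annulus (- n%:R) n%:R : set X) (EFin \o k).
    by apply: measurable_funTS; exact/measurable_EFinP.
  move=> /(ae_eq_integral_abs mu (mA n) mk'); apply: filterS => t h At.
  by have [] := h At.
have : {ae mu, forall t, forall n : nat, annulus (- n%:R) n%:R t -> k t = 0}.
  exact: ae_foralln.
apply: filterS2 (ae_tradius_neq0 d0) => t t0 h.
have := truncnS_gt `|radT t| => ht.
apply: (h (Num.truncn `|radT t|).+1); apply/annulus_radT; split => //.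
move: ht; have := ler_norm (radT t); have := ler_norm (- radT t).
by rewrite normrN; move=> h1 h2 h3; apply/andP; split; lra.
Qed.

Lemma annulus_int_support (k : X -> R) A B a b : (forall t, tradius t != 0 -> k t != 0 -> A < radT t <= B) ->
  a <= A -> B <= b -> annulus_int k a b = annulus_int k A B.
Proof.
move=> hk aA Bb; rewrite /annulus_int !Int_restrict; congr Int; apply/funext => t.
rewrite !restrE; case: (boolP (t \in annulus a b)) => h1; case: (boolP (t \in annulus A B)) => h2 //.
  apply/eqP; apply: contraNT h2; rewrite inE => ne; apply/annulus_radT.
  by move: h1; rewrite inE => /annulus_radT[h1 _]; split => //; exact: hk.
exfalso; move/negP: h1; apply; move: h2; rewrite !inE => /annulus_radT[t0 /andP[h1 h2]].
by apply/annulus_radT; split => //; rewrite (le_lt_trans aA h1) (le_trans h2 Bb).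
Qed.

Lemma Int_annulus (k : X -> R) A B : measurable_fun setT k ->
  (forall t, tradius t != 0 -> k t != 0 -> A < radT t <= B) -> Int k = annulus_int k A B.
Proof.
move=> mk hk; rewrite /annulus_int Int_restrict; apply: Int_ae => //.
  by apply/(measurable_restrictT _ (measurable_annulus d0 A B)); exact: measurable_funTS.
apply: filterS (ae_tradius_neq0 d0) => t t0; rewrite restrE; case: ifPn => // h.
apply/eqP; apply: contraNT h => ne; rewrite inE; apply/annulus_radT; split => //.
exact: hk.
Qed.

Section profile.
Variables (f : 'rV[R]_d -> R) (G : 'I_d -> 'rV[R]_d -> R).
Hypotheses (f2 : inL2 f) (rf : radial f) (wG : weak_gradient f G).

Let k (t : X) := flux G t * radJ t.

Let ck : continuous (fun t : R => expR (- d%:R * t)).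
Proof.
move=> x; apply: (@continuous_comp _ _ _ (fun t : R => - d%:R * t) expR).
  by apply: continuousM; [exact: cst_continuous|exact: cvg_id].
exact: continuous_expR.
Qed.

Let lk : loc_int k. Proof. exact: (loc_int_flux wG ck). Qed.

Let H := annulus_prim k.

Let lf : loc_int (fun t => f (vec t) * radJ t).
Proof. by move/inL2P : f2 => f2'; exact: (loc_int_L2 f2' ck). Qed.

Let w (t : X) := f (vec t) * radJ t - c0^-1 * (H (radT t) * radJ t).

Let annHE a b (t : X) : a < b -> annulus a b t -> annulus_int k a (radT t) = H (radT t) - H a.
Proof. by move=> ab /annulus_radT[_ /andP[/ltW h _]]; rewrite annulus_primB. Qed.

Let lJ : loc_int (@radJ R d).
Proof.
have := @loc_int_C0 (fun=> 1) (fun x => @cst_continuous _ _ (1 : R) x).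
by rewrite (_ : (fun t => _) = @radJ R d)//; apply/funext => t; rewrite mulr1.
Qed.

Let J_FTC a b (q Q : R -> R) : a < b -> (forall x : R, is_derive x 1 Q (q x)) -> continuous q ->
  annulus_int (fun t : X => radJ t * q (radT t)) a b = c0 * (Q b - Q a).
Proof. by move=> ab dQ cq; exact: (annulus_FTC d0 ab dQ cq).2. Qed.

Let lHJ a b : a < b -> mu.-integrable (annulus a b) (fun t => (H (radT t) * radJ t)%:E).
Proof.
move=> ab; have mA := @measurable_annulus R d d0 a b.
have [i1 _] := annulus_product d0 ab lJ.1 lk.1 (lJ.2 a b) (lk.2 a b).
have cid := fun x : R => @cst_continuous _ _ (1 : R) x.
have J1 s : a < s -> annulus_int (@radJ R d) a s = c0 * (s - a).
  move=> as_; rewrite -(J_FTC as_ (@drv_id R) cid).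
  by apply: annulus_ext => t _; rewrite mulr1.
have i2 : mu.-integrable (annulus a b) (fun t => (c0 * ((radT t - a) * k t))%:E).
  have ci : continuous (fun x : R => (x - a) * expR (- d%:R * x)).
    by cont.
  have h := (loc_intZ c0 (loc_int_flux wG ci)).2 a b.
  apply: (@eq_integrable _ X R mu (annulus a b) mA _ _ _ h) => t _; congr (_%:E).
  by rewrite /k /radJ; ring.
have i3 := integrableB mA i1 i2.
have i4 := integrableD mA i3 (integrableZl mA (H a) (lJ.2 a b)).
apply: (@eq_integrable _ X R mu (annulus a b) mA _ _ _ i4) => t; rewrite inE => At.
rewrite -!EFinN -!EFinD /= (annHE ab At) J1; last by have /annulus_radT[_ /andP[]] := At.
congr (_%:E); move: (H (radT t)) (H a) (k t) (radJ t) (radT t) => x1 x2 x3 x4 x5; ring.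
Qed.

Let mH : measurable_fun setT (fun t : X => H (radT t) * radJ t).
Proof.
have h : {ae mu, forall t : X, True} by apply: aeW.
pose A n : set X := annulus (- n.+1%:R) n.+1%:R.
have -> : setT = \bigcup_n A n `|` [set t : X | tradius t = 0].
  apply/esym; rewrite -subTset => t _; case: (eqVneq (tradius t) 0) => t0; first by right.
  left; exists (Num.truncn `|radT t|) => //; apply/annulus_radT; split => //.
  have := truncnS_gt `|radT t|; have := ler_norm (radT t); have := ler_norm (- radT t).
  by rewrite normrN; move=> h1 h2 h3; apply/andP; split; lra.
apply/measurable_funU.
- by apply: bigcup_measurable => n _; exact: measurable_annulus.
- exact: measurable_sphere.
split.
  apply/measurable_fun_bigcup => [n|n]; first exact: measurable_annulus.
  apply/measurable_EFinP; apply: (measurable_int mu); apply: lHJ.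
  by rewrite ltrNl (le_lt_trans _ (ltr0Sn _ n))// oppr_le0 ler0n.
apply: (@eq_measurable_fun _ _ _ _ _ (fun=> H (ln 0) * expR (- d%:R * ln 0))).
  by move=> t; rewrite inE /= /radJ /radT => ->.
exact: measurable_cst.
Qed.

Let lHJ' : loc_int (fun t => H (radT t) * radJ t).
Proof.
split; first exact: mH.
move=> a b; case: (ltP a b) => ab; first exact: lHJ.
rewrite (_ : annulus a b = set0); first exact: integrable_set0.
apply/seteqP; split => // t /andP[h1 h2].
by have := lt_le_trans h1 h2; rewrite ltr_expR ltNge ab.
Qed.

Let lw : loc_int w.
Proof.
rewrite (_ : w = fun t => f (vec t) * radJ t + (- c0^-1) * (H (radT t) * radJ t)).
  exact: (loc_intD lf (loc_intZ _ lHJ')).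
by apply/funext => t; rewrite /w mulNr.
Qed.

(** The weak gradient turns the integral of [f] against th' into minus that of the flux against th;
    [annulus_product], applied to [radJ q] and [k], does the same for the primitive [H]. The two
    contributions cancel in [w]. *)
Let w_orth a b (th q : R -> R) : a < b -> smooth1 th -> smooth1 q ->
  (forall x : R, is_derive x 1 th (q x)) ->
  (forall t, t <= a -> th t = 0) -> (forall t, b <= t -> th t = 0) -> (forall t, ~~ (a < t <= b) -> q t = 0) ->
  annulus_int (fun t => w t * q (radT t)) a b = 0.
Proof.
move=> ab sth sq dth tha thb qb; have mA := @measurable_annulus R d d0 a b.
have cq := smooth1_cont sq; have cth := smooth1_cont sth.
have thb' t : ~~ (a < t <= b) -> th t = 0.
  by rewrite negb_and -leNgt -ltNge => /orP[|/ltW]; [exact: tha|exact: thb].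
have cJq : continuous (fun x : R => expR (- d%:R * x) * q x).
  by cont.
have cJth : continuous (fun x : R => expR (- d%:R * x) * th x).
  by cont.
have f2' : L2 (f \o @vec R d) by exact/inL2P.
have e1 : annulus_int (fun t : X => f (vec t) * (radJ t * q (radT t))) a b =
    - annulus_int (fun t => flux G t * (radJ t * th (radT t))) a b.
  rewrite -!Int_annulus.
  - by apply: (weak_gradient_radial_test d0 f2 wG sth dth) => t /ltW; [exact: tha|exact: thb].
  - exact: (loc_int_flux wG cJth).1.
  - by move=> t _; apply: contraNT => /thb' ->; rewrite !mulr0.
  - exact: (loc_int_L2 f2' cJq).1.
  - by move=> t _; apply: contraNT => /qb ->; rewrite !mulr0.
have [] := annulus_product d0 ab (loc_int_C0 cq).1 lk.1 ((loc_int_C0 cq).2 a b) (lk.2 a b).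
set Q := (fun t : X => radJ t * q (radT t)) => _.
rewrite (J_FTC ab dth cq) (tha _ (lexx _)) (thb _ (lexx _)) subrr mulr0 mul0r => e2.
pose F t := annulus_int Q a (radT t) * k t + annulus_int k a (radT t) * Q t.
have e3 : annulus_int F a b = annulus_int (fun t => c0 * (flux G t * (radJ t * th (radT t)))
    + ((H (radT t) * radJ t) * q (radT t) - H a * (radJ t * q (radT t)))) a b.
  apply: annulus_ext => t At; rewrite /F (annHE ab At).
  have aT : a < radT t by have /annulus_radT[_ /andP[]] := At.
  rewrite /Q (J_FTC aT dth cq) (tha _ (lexx _)) /k.
  by move: (H (radT t)) (H a) (flux G t) (radJ t) (q (radT t)) (th (radT t)) c0 => x1 x2 x3 x4 x5 x6 x7; ring.
have lHq : loc_int (fun t => (H (radT t) * radJ t) * q (radT t)).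
  apply: loc_int_ann.
    by apply: measurable_funM => //; exact: continuous_radT_measurable.
  move=> a' b'; have [M [M0 hM]] := continuous_bounded_itv a' b' cq.
  exists (fun t => M * ((fun t => H (radT t) * radJ t) \_ (annulus a' b')) t).
    apply: L1Z; rewrite /L1 -restrict_EFin; apply/(integrable_mkcond _ (measurable_annulus d0 a' b')).
    exact: lHJ'.2.
  move=> t At; rewrite restrE mem_set// [X in `|X|]mulrC !normrM ler_wpM2r ?mulr_ge0//.
  rewrite (ger0_norm M0); apply: hM.
  by have /annulus_radT[_ /andP[/ltW -> ->]] := At.
have lJq := loc_int_C0 cq.
have lGt := loc_int_flux wG cJth.
have e4 : annulus_int (fun t : X => (H (radT t) * radJ t) * q (radT t)) a b =
   - (c0 * annulus_int (fun t => flux G t * (radJ t * th (radT t))) a b).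
  apply/eqP; rewrite -addr_eq0 addrC -(annulus_intZ c0 a b lGt) -(annulus_intD a b (loc_intZ c0 lGt) lHq).
  rewrite -[X in _ == X]e2 -/(annulus_int F a b) e3.
  rewrite (_ : (fun t => _ + (_ - _)) = fun t => (c0 * (flux G t * (radJ t * th (radT t)))
    + H (radT t) * radJ t * q (radT t)) + - H a * (radJ t * q (radT t))); last first.
    by apply/funext => t; rewrite mulNr addrA.
  rewrite [X in _ == X]annulus_intD; [|exact: (loc_intD (loc_intZ c0 lGt) lHq)|exact: loc_intZ].
  rewrite [X in _ == _ + X](annulus_intZ (- H a) a b lJq) (J_FTC ab dth cq) (tha _ (lexx _)) (thb _ (lexx _)).
  by rewrite subrr !mulr0 addr0.
have lfq := loc_int_L2 f2' cJq.
rewrite (_ : (fun t => _) = fun t => f (vec t) * (radJ t * q (radT t)) +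
  (- c0^-1) * (H (radT t) * radJ t * q (radT t))); last by apply/funext => t; rewrite /w mulrBl mulNr !mulrA.
rewrite (annulus_intD a b lfq (loc_intZ (- c0^-1) lHq)).
rewrite (annulus_intZ (- c0^-1) a b lHq) e4 e1 mulrN mulNr opprK mulrA mulVf ?mul1r ?addNr//.
by rewrite gt_eqF// polar_cst_gt0.
Unshelve. all: by end_near. Qed.

(** A fixed bump, supported between 0 and 2, of integral [m0] (the points 3 and -3 lie outside its
    support). Subtracting a multiple of it from any other bump leaves the derivative of a function
    of compact support, to which [w_orth] applies. *)
Let rho : R -> R := smooth_bump 0 1 1.

Let ex_prim a b n : exists P, forall x : R, is_derive x 1 P (smooth_bump a b n x).
Proof. by apply: antiderivative; apply: smooth1_cont; exact: smooth1_bump. Qed.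

Let P0 := sval (cid (ex_prim 0 1 1)).
Let dP0 : forall x : R, is_derive x 1 P0 (rho x).
Proof. exact: (svalP (cid (ex_prim 0 1 1))). Qed.

Let m0 := P0 3 - P0 (-3).

Let cst_out (P q : R -> R) A B : (forall x : R, is_derive x 1 P (q x)) ->
  (forall t, ~~ (A < t < B) -> q t = 0) ->
  (forall t, t <= A -> P t = P A) /\ (forall t, B <= t -> P t = P B).
Proof.
move=> dP q0; split=> t ht.
  apply: (@der_is_cst _ _ _ _ ht) => x /andP[_ xA]; rewrite -(q0 x) ?dP//.
  by rewrite negb_and -leNgt xA.
apply/esym/(@der_is_cst _ _ _ _ ht) => x /andP[xB _]; rewrite -(q0 x) ?dP//.
by rewrite negb_and -!leNgt xB orbT.
Qed.

Let m0_gt0 : 0 < m0.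
Proof.
have [h1 h2] := cst_out dP0 (@bump_out R 0 1 1).
rewrite /m0 (h1 (-3)) ?(h2 3); [|by lra|by lra].
rewrite subr_gt0.
have r0 x : 0 <= rho x by exact: bump_ge0.
apply: (@lt_le_trans _ _ (P0 1)).
  by apply: (@der_inc _ P0 rho) => // x /andP[x0 /ltW x1]; apply: bump_gt0; rewrite ?x0.
by apply: (@der_nondec _ P0 rho) => //; lra.
Qed.

Let kap := annulus_int (fun t : X => w t * rho (radT t)) (-3) 3 / (c0 * m0).

Let w_rho a b : a <= 0 -> 2 <= b ->
  annulus_int (fun t : X => w t * rho (radT t)) a b = kap * (c0 * m0).
Proof.
move=> a0 b2; rewrite /kap divfK; last by rewrite mulf_neq0 ?gt_eqF ?polar_cst_gt0.
have h (t : X) : tradius t != 0 -> w t * rho (radT t) != 0 -> 0 < radT t <= 2.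
  move=> _; apply: contraNT => hn; rewrite /rho bump_out ?mulr0//.
  by apply: contra hn => /andP[-> /ltW h]; rewrite /= (le_trans h)//; lra.
rewrite (annulus_int_support h a0 b2); apply/esym/(annulus_int_support h); lra.
Qed.

Let lwq q : continuous q -> loc_int (fun t => w t * q (radT t)).
Proof.
move=> cq; apply: loc_int_ann.
  by apply: measurable_funM; [exact: lw.1|exact: continuous_radT_measurable].
move=> a b; have [M [M0 hM]] := continuous_bounded_itv a b cq.
exists (fun t => M * (w \_ (annulus a b)) t).
  apply: L1Z; rewrite /L1 -restrict_EFin; apply/(integrable_mkcond _ (measurable_annulus d0 a b)).
  exact: lw.2.
move=> t At; rewrite restrE mem_set// [X in `|X|]mulrC !normrM ler_wpM2r//.
rewrite (ger0_norm M0); apply: hM.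
by have /annulus_radT[_ /andP[/ltW -> ->]] := At.
Qed.

Let v (t : X) := w t + - kap * radJ t.

Let lv : loc_int v. Proof. exact: (loc_intD lw (loc_intZ (- kap) lJ)). Qed.

Let v_bump al be n a b : a <= al -> a <= 0 -> be + 1 <= b -> 2 <= b ->
  annulus_int (fun t : X => v t * smooth_bump al be n (radT t)) a b = 0.
Proof.
move=> aal a0 beb b2; set q := smooth_bump al be n; have ab : a < b by lra.
have [Q dQ] := ex_prim al be n; rewrite -/q in dQ.
have sq : smooth1 q by exact: smooth1_bump.
have sr : smooth1 rho by exact: smooth1_bump.
have cq := smooth1_cont sq; have cr := smooth1_cont sr.
have [Q1 Q2] := cst_out dQ (@bump_out R al be n).
have [R1 R2] := cst_out dP0 (@bump_out R 0 1 1).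
pose M := Q b - Q a.
have dth (x : R) : is_derive x 1 (fun t => (Q t - Q a) + - (M / m0) * (P0 t - P0 a))
    (q x + - (M / m0) * rho x).
  have := drv_add (drv_add (dQ x) (drv_cst (- Q a) x))
    (drv_mul (drv_cst (- (M / m0)) x) (drv_add (dP0 x) (drv_cst (- P0 a) x))).
  by rewrite !addr0 mul0r add0r.
have sth' : smooth1 (fun x => q x + - (M / m0) * rho x).
  by apply: smooth1_add => //; apply: smooth1_mul => //; exact: smooth1_cst.
have sth := smooth1_anti dth sth'.
have e0 : annulus_int (fun t : X => w t * (q (radT t) + - (M / m0) * rho (radT t))) a b = 0.
  apply: (w_orth ab sth sth' dth).
  - move=> t ta; rewrite (Q1 t (le_trans ta aal)) (Q1 a aal) (R1 t (le_trans ta a0)) (R1 a a0).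
    by rewrite !subrr mulr0 addr0.
  - move=> t bt; have hb : 1 + 1 <= b by lra.
    have h3 : (1 + 1 <= 3 :> R) by lra.
    have hm3 : (-3 <= 0 :> R) by lra.
    have eP : P0 t = P0 b := etrans (R2 t (le_trans hb bt)) (esym (R2 b hb)).
    have eQ : Q t = Q b := etrans (Q2 t (le_trans beb bt)) (esym (Q2 b beb)).
    have h1 : P0 b - P0 a = m0 by rewrite /m0 (R1 a a0) (R1 _ hm3) (R2 _ h3) (R2 b hb).
    by rewrite eP eQ h1 -/M mulNr divfK ?subrr// gt_eqF.
  - move=> t ht; rewrite /q /rho !bump_out ?mulr0 ?addr0//.
      by apply: contra ht => /andP[h1 h2]; apply/andP; split; lra.
    by apply: contra ht => /andP[h1 h2]; apply/andP; split; lra.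
have e1 : annulus_int (fun t : X => w t * q (radT t)) a b = M * c0 * kap.
  move: e0; rewrite (_ : (fun t : X => _) = fun t => w t * q (radT t) +
    - (M / m0) * (w t * rho (radT t))); last by apply/funext => t; ring.
  rewrite (annulus_intD a b (lwq cq) (loc_intZ (- (M / m0)) (lwq cr))).
  rewrite (annulus_intZ (- (M / m0)) a b (lwq cr)) w_rho// => /eqP.
  rewrite mulNr subr_eq0 => /eqP ->; field.
  by rewrite gt_eqF.
rewrite (_ : (fun t : X => _) = fun t => w t * q (radT t) + - kap * (radJ t * q (radT t))).
  rewrite (annulus_intD a b (lwq cq) (loc_intZ (- kap) (loc_int_C0 cq))) e1.
  by rewrite (annulus_intZ (- kap) a b (loc_int_C0 cq)) (J_FTC ab dQ cq) -/M; ring.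
by apply/funext => t; rewrite /v; ring.
Qed.

Let v0 al be : annulus_int v al be = 0.
Proof.
case: (leP be al) => h; first exact: annulus_empty.
pose a := Num.min al 0; pose b := Num.max (be + 1) 2.
have mA := @measurable_annulus R d d0 a b.
have [|||||] := @dominated_convergence _ X R mu (annulus a b) mA
  (fun n t => (v t * smooth_bump al be n (radT t))%:E)
  (fun t => (v t * \1_(`]al, be]%classic) (radT t))%:E)
  (fun t => (`|v t|)%:E).
- move=> n; apply: measurable_funTS; apply/measurable_EFinP; apply: measurable_funM; first exact: lv.1.
  by apply: continuous_radT_measurable; apply: smooth1_cont; exact: smooth1_bump.
- apply: measurable_funTS; apply/measurable_EFinP; apply: measurable_funM; first exact: lv.1.
  apply: (@measurableT_comp _ _ _ _ _ _ (\1_(`]al, be]%classic) : T -> R)); last exact: measurable_radT.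
  exact: measurable_indic.
- apply: aeW => t _; apply: cvg_EFin; first exact: nearW.
  by apply: cvgM; [exact: cvg_cst|exact: bump_cvg].
- exact: (integrable_norm (lv.2 a b)).
- apply: aeW => t n _; rewrite /= lee_fin normrM -[leRHS]mulr1 ler_wpM2l//.
  by rewrite ger0_norm ?bump_ge0// bump_le1.
move=> _ _ hc.
have vq n : mu.-integrable (annulus a b) (EFin \o (fun t => v t * smooth_bump al be n (radT t))).
  apply: (@integrable_dom _ X R mu (annulus a b) _ v mA) (lv.2 a b) _.
    apply: measurable_funTS; apply: measurable_funM; first exact: lv.1.
    by apply: continuous_radT_measurable; apply: smooth1_cont; exact: smooth1_bump.
  move=> t _; rewrite /= normrM -[leRHS]mulr1 ler_wpM2l//.
  by rewrite ger0_norm ?bump_ge0// bump_le1.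
have e : (\int[mu]_(t in annulus a b) (v t * \1_(`]al, be]%classic) (radT t))%:E = 0)%E.
  apply: (cvg_unique _ hc); first exact: ereal_hausdorff.
  apply: cvg_near_cst; apply: nearW => n.
  rewrite -[RHS](congr1 EFin (@v_bump al be n a b _ _ _ _)) /a /b ?ge_min ?le_max ?lexx ?orbT//.
  exact: (EFin_Rintegral mA (vq n)).
rewrite -[RHS]/(fine 0%E) -e /annulus_int /Rintegral; congr fine.
rewrite integral_mkcond [RHS]integral_mkcond; apply: eq_integral => t _.
rewrite !patchE; case: (boolP (t \in annulus a b)) => h1; case: (boolP (t \in annulus al be)) => h2 //.
- rewrite indicE mem_set ?mulr1//=; move: h2; rewrite inE => /annulus_radT[_].
  by rewrite in_itv.
- rewrite indicE memNset ?mulr0//=; rewrite in_itv => /= h3; move/negP: h2; apply.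
  by rewrite inE; apply/annulus_radT; split => //; move: h1; rewrite inE => /annulus_radT[].
- exfalso; move/negP: h1; apply; move: h2; rewrite !inE => /annulus_radT[t0 /andP[h1 h2]].
  apply/annulus_radT; split => //; rewrite /a /b gt_min le_max h1 /=.
  by apply/orP; left; apply: le_trans h2 _; rewrite lerDl.
Qed.

(** The lemma of du Bois-Reymond in the variable ln |x|: [w], the difference of [f radJ] and the
    primitive of the flux, annihilates derivatives of test functions, hence is the multiple [kap] of
    [radJ] almost everywhere. *)
Lemma radial_profile : exists Gam : R -> R,
  {ae mu, forall t, f (vec t) = Gam (radT t)} /\
  forall a b, a <= b ->
    c0 * (Gam b - Gam a) = annulus_int (fun t => flux G t * radJ t) a b.
Proof.
exists (fun s => c0^-1 * H s + kap); split; last first.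
  move=> a b ab; have c00 : c0 != 0 by rewrite gt_eqF//; exact: polar_cst_gt0.
  rewrite -(annulus_primB lk ab); transitivity (c0 * (c0^-1 * (H b - H a))).
    by congr (_ * _); move: (H b) (H a) c0^-1 kap => x y z e; ring.
  exact: (mulVKf c00).
have rpt (t : X) : tradius t != 0 -> f (vec t) = f (vec (radpt (radT t))).
  move=> t0; apply: rf; rewrite -/(tradius t) -/(tradius (radpt (radT t))).
  by rewrite tradius_radpt -radT_exp.
have vr (t : X) : tradius t != 0 -> v t = v (radpt (radT t)).
  by move=> t0; rewrite /v /w /radJ radT_radpt rpt.
have := radial_vanishing lv vr v0; apply: filterS => t /eqP.
rewrite /v /w => e; have J0 : radJ t != 0 by rewrite gt_eqF// expR_gt0.
have : (f (vec t) - (c0^-1 * H (radT t) + kap)) * radJ t == 0.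
  by rewrite -[X in _ == X](eqP e); apply/eqP; move: (f _) (radJ t) (H _) c0^-1 kap => x1 x2 x3 x4 x5; ring.
by rewrite mulf_eq0 (negbTE J0) orbF subr_eq0 => /eqP.
Qed.

End profile.
End radial_profile.

(** * Calculus of profiles and Hardy's inequality *)

Section prim_pair.
Context {R : realType} {d : nat} (d0 : (0 < d)%N).
Local Notation T := (measurableTypeR R).
Local Notation X := (d.-tuple T).
Local Notation mu := (lebesgue_tuple R d).
Local Notation c0 := (polar_cst (R := R) (d := d)).
Implicit Types (f h : X -> R) (Gam : R -> R).

(* Along the radial variable, [f] has the profile [Gam] and [h] is its
   derivative with respect to ln |x|. *)
Definition prim_pair f h Gam :=
  [/\ measurable_fun setT f, loc_int (fun t => h t * radJ t),
      {ae mu, forall t, f t = Gam (radT t)} &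
      forall a b, a <= b ->
        c0 * (Gam b - Gam a) = annulus_int (fun t => h t * radJ t) a b].

Lemma c0_neq0 : c0 != 0.
Proof. by rewrite gt_eqF//; exact: polar_cst_gt0. Qed.

Lemma integrable_ae_eq (A : set X) (k g : X -> R) : measurable A ->
  measurable_fun setT g -> {ae mu, forall t, A t -> k t = g t} ->
  mu.-integrable A (EFin \o k) ->
  mu.-integrable A (EFin \o g) /\ \int[mu]_(t in A) k t = \int[mu]_(t in A) g t.
Proof.
move=> mA mg kg /integrableP[mk ik].
have mg' : measurable_fun A (EFin \o g) by apply: measurable_funTS; exact/measurable_EFinP.
split; last first.
  rewrite /Rintegral; congr fine; apply: ae_eq_integral => //.
  by apply: filterS kg => t e At; rewrite /= e.
apply/integrableP; split => //.
rewrite (_ : (\int[mu]_(x in A) `|(EFin \o g) x|)%E =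
   (\int[mu]_(x in A) `|(EFin \o k) x|)%E)//.
apply: ae_eq_integral => //; [exact: measurableT_comp|exact: measurableT_comp|].
by apply: filterS kg => t e At; rewrite /= e.
Qed.

Lemma prim_pair_C1 (psi psi' : R -> R) : (forall x : R, is_derive x 1 psi (psi' x)) ->
  continuous psi' -> prim_pair (fun t => psi (radT t)) (fun t => psi' (radT t)) psi.
Proof.
move=> dpsi cpsi'; have E : (fun t : X => psi' (radT t) * radJ t) =
    fun t => radJ t * psi' (radT t) by apply/funext => t; rewrite mulrC.
split.
- by apply: continuous_radT_measurable => x; exact: der_cont (dpsi x).
- by rewrite E; exact: loc_int_C0.
- exact: aeW.
- move=> a b; rewrite le_eqVlt => /orP[/eqP ->|ab].
    by rewrite subrr mulr0 (annulus_empty _ (lexx b)).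
  by rewrite E; have [_ <-] := annulus_FTC d0 ab dpsi cpsi'.
Qed.

Lemma prim_pair_mul f1 h1 G1 f2 h2 G2 : prim_pair f1 h1 G1 -> prim_pair f2 h2 G2 ->
  measurable_fun setT h1 -> measurable_fun setT h2 ->
  prim_pair (fun t => f1 t * f2 t) (fun t => h1 t * f2 t + f1 t * h2 t)
    (fun s => G1 s * G2 s).
Proof.
move=> [mf1 lh1 e1 F1] [mf2 lh2 e2 F2] mh1 mh2.
pose k1 t := h1 t * radJ t; pose k2 t := h2 t * radJ t.
(* The product rule with each profile written as its value at [a] plus its increment, the form in
   which [annulus_product] gives the integral. *)
pose w a t := c0^-1 * (annulus_int k1 a (radT t) * k2 t + annulus_int k2 a (radT t) * k1 t)
  + (G1 a * k2 t + G2 a * k1 t).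
have mw : measurable_fun setT (fun t => (h1 t * f2 t + f1 t * h2 t) * radJ t).
  apply: measurable_funM; last exact: measurable_radJ.
  by apply: measurable_funD; exact: measurable_funM.
have we a b : {ae mu, forall t, annulus a b t ->
    w a t = (h1 t * f2 t + f1 t * h2 t) * radJ t}.
  apply: filterS2 e1 e2 => t E1 E2 /annulus_radT[_ /andP[/ltW aT _]].
  rewrite /w -(F1 _ _ aT) -(F2 _ _ aT) E1 E2 /k1 /k2.
  move: (G1 (radT t)) (G2 (radT t)) (G1 a) (G2 a) (h1 t) (h2 t) (radJ t) c0_neq0.
  by move: c0 => c g1 g2 a1 a2 x1 x2 j cn0; field.
have W a b : a < b -> mu.-integrable (annulus a b) (EFin \o w a) /\
    annulus_int (w a) a b = c0 * (G1 b * G2 b - G1 a * G2 a).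
  move=> ab; have mA := @measurable_annulus R d d0 a b.
  have [i1 v1] := annulus_product d0 ab lh1.1 lh2.1 (lh1.2 a b) (lh2.2 a b).
  have i2 := integrableZl mA (c0^-1) i1.
  have i3 := (loc_intD d0 (loc_intZ d0 (G1 a) lh2) (loc_intZ d0 (G2 a) lh1)).2 a b.
  split; first exact: (integrableD mA i2 i3).
  rewrite [LHS](RintegralD mA i2 i3) (RintegralZl c0^-1 mA i1) v1.
  rewrite -/(annulus_int _ a b) annulus_intD ?annulus_intZ//; try exact: loc_intZ.
  rewrite -(F1 _ _ (ltW ab)) -(F2 _ _ (ltW ab)).
  move: (G1 b) (G2 b) (G1 a) (G2 a) c0_neq0.
  by move: c0 => c g1 g2 a1 a2 cn0; field.
have ann_eq a b : a < b -> mu.-integrable (annulus a b)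
      (EFin \o (fun t => (h1 t * f2 t + f1 t * h2 t) * radJ t)) /\
    annulus_int (fun t => (h1 t * f2 t + f1 t * h2 t) * radJ t) a b = annulus_int (w a) a b.
  move=> ab; have mA := @measurable_annulus R d d0 a b; have [iW _] := W a b ab.
  by have [i1 e] := integrable_ae_eq mA mw (we a b) iW; split; last exact: esym e.
split.
- exact: measurable_funM.
- split => // a b; case: (ltP a b) => ab; first exact: (ann_eq a b ab).1.
  rewrite (_ : annulus a b = set0); first exact: integrable_set0.
  apply/seteqP; split => // t /andP[h3 h4].
  by have := lt_le_trans h3 h4; rewrite ltr_expR ltNge ab.
- by apply: filterS2 e1 e2 => t -> ->.
- move=> a b; rewrite le_eqVlt => /orP[/eqP ->|ab].
    by rewrite subrr mulr0 (annulus_empty _ (lexx b)).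
  by rewrite (ann_eq a b ab).2 (W a b ab).2.
Qed.

Lemma L1_of_annuli (k : X -> R) K : loc_int k -> (forall t, 0 <= k t) ->
  (forall n : nat, annulus_int k (- n%:R) n%:R <= K) -> L1 k.
Proof.
move=> [mk ik] k0 kK; apply/integrableP; split; first exact/measurable_EFinP.
pose A n : set X := annulus (- n%:R) n%:R.
(* The annuli exhaust everything but the origin; with the origin added the convergence is monotone
   at every point. *)
pose B n : set X := A n `|` [set t | tradius t = 0].
have mA n : measurable (A n) := @measurable_annulus R d d0 _ _.
have mB n : measurable (B n) by apply: measurableU => //; exact: measurable_sphere.
pose g n t : \bar R := ((k \_ (B n)) t)%:E.
have g0 n t : [set: X] t -> (0 <= g n t)%E.
  by move=> _; rewrite /g restrE lee_fin; case: ifP.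
have mg n : measurable_fun setT (g n).
  by apply/measurable_EFinP; apply/(measurable_restrictT _ (mB n)); exact: measurable_funTS.
have ndB n m : (n <= m)%N -> B n `<=` B m.
  move=> nm t [|h]; last by right.
  move=> /annulus_radT[t0 /andP[h1 h2]]; left.
  apply/annulus_radT; split => //; have : n%:R <= m%:R :> R by rewrite ler_nat.
  by move=> h3; apply/andP; split; lra.
have ndg t : [set: X] t -> nondecreasing_seq (g ^~ t).
  move=> _ n m nm; rewrite /g !restrE lee_fin; case: ifPn => // tm; last by case: ifP.
  rewrite ifT//; move: tm; rewrite !inE; exact: ndB.
have lg t : limn (g ^~ t) = `|(EFin \o k) t|%E.
  rewrite /= ger0_norm//; apply/cvg_lim; first exact: ereal_hausdorff.
  apply: cvg_near_cst; exists (Num.truncn `|radT t|).+1 => //= n hn.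
  rewrite /g restrE ifT// inE; have [t0|t0] := eqVneq (tradius t) 0; first by right.
  left; apply/annulus_radT; split => //.
  have : `|radT t| < n%:R by apply: lt_le_trans (truncnS_gt _) _; rewrite ler_nat.
  have := ler_norm (radT t); have := ler_norm (- radT t).
  by rewrite normrN; move=> h1 h2 h3; apply/andP; split; lra.
have := monotone_convergence mu measurableT mg g0 ndg.
under eq_integral do rewrite lg.
move=> ->; apply: (@le_lt_trans _ _ K%:E); last exact: ltry.
apply: lime_le.
  apply: ereal_nondecreasing_is_cvgn => n m nm.
  by apply: ge0_le_integral => // t _; [exact: g0|exact: ndg].
apply: nearW => n.
have <- : (\int[mu]_(t in A n) (k t)%:E)%E = (\int[mu]_x g n x)%E.
  rewrite integral_mkcond; apply: ae_eq_int => //.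
    by apply/(measurable_restrictT _ (mA n)); apply: measurable_funTS; exact/measurable_EFinP.
  apply: filterS (ae_tradius_neq0 d0) => t t0; rewrite /g restrE patchE.
  case: ifPn => h1; case: ifPn => h2 //.
    by exfalso; move/negP: h2; apply; rewrite inE; left; move: h1; rewrite inE.
  exfalso; move/negP: h1; apply; rewrite inE; move: h2; rewrite inE => -[//|h].
  by move/eqP: t0; rewrite h.
rewrite (EFin_Rintegral (mA n) (ik _ _)) lee_fin; exact: kK.
Qed.

Lemma Int_limit (k : X -> R) (e : R) : L1 k -> 0 < e -> exists N : R, 0 < N /\
  forall a b : R, a <= - N -> N <= b -> `|Int k - annulus_int k a b| < e.
Proof.
move=> lk e0; have mk := L1_meas lk.
pose A n : set X := annulus (- n%:R) n%:R.
have mA n : measurable (A n) := @measurable_annulus R d d0 _ _.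
pose g n t := `|k t| * (1 - \1_(A n) t).
have g0 n t : 0 <= g n t.
  by rewrite /g mulr_ge0// subr_ge0 indicE; case: (_ \in _); rewrite ?lexx ?ler01.
have mg n : measurable_fun setT (g n).
  apply: measurable_funM; first exact: measurableT_comp.
  by apply: measurable_funB => //; exact: measurable_indic.
have gk n t : g n t <= `|k t|.
  by rewrite /g -[leRHS]mulr1 ler_wpM2l// lerBlDr lerDl indicE; case: (_ \in _).
have lgn n : L1 (g n).
  by apply: (L1_le (mg n) (L1_norm lk)) => t; rewrite normr_id ger0_norm.
have [|||||_ _ hc] := @dominated_convergence _ X R mu setT measurableT
  (fun n t => (g n t)%:E) (fun=> 0%E) (fun t => (`|k t|)%:E).
- by move=> n; exact/measurable_EFinP.
- exact: measurable_cst.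
- apply: filterS (ae_tradius_neq0 d0) => t t0 _.
  apply: cvg_near_cst; exists (Num.truncn `|radT t|).+1 => //= n hn.
  rewrite /g indicE mem_set /= ?subrr ?mulr0//; apply/annulus_radT; split => //.
  have : `|radT t| < n%:R by apply: lt_le_trans (truncnS_gt _) _; rewrite ler_nat.
  have := ler_norm (radT t); have := ler_norm (- radT t).
  by rewrite normrN; move=> h1 h2 h3; apply/andP; split; lra.
- exact: L1_norm.
- by apply: aeW => t n _; rewrite /= lee_fin ger0_norm.
rewrite integral0 in hc.
have /fine_cvg : (fun n => (Int (g n))%:E) @ \oo --> 0%:E.
  apply: cvg_trans hc; apply: near_eq_cvg; apply: nearW => n.
  exact: (EFin_Rintegral measurableT (lgn n)).
move=> /cvgr0Pnorm_lt /(_ _ e0)[n _ hn].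
have {}hn : Int (g n) < e by apply: le_lt_trans (ler_norm _) (hn n (leqnn n)).
exists n.+1%:R; split => // a b an nb; rewrite /annulus_int Int_restrict.
have mAab := @measurable_annulus R d d0 a b.
have lka : L1 (k \_ (annulus a b)) by exact: L1_restrict.
rewrite -IntN// -IntD//; last exact: L1N.
apply: le_lt_trans (le_normr_Rintegral measurableT (L1D lk (L1N lka))) _.
apply: le_lt_trans hn; apply: Int_le => //.
  by apply: L1_norm; apply: L1D => //; exact: L1N.
move=> t; rewrite restrE /g indicE; case: (boolP (t \in annulus a b)) => h.
  by rewrite subrr normr0 g0.
rewrite oppr0 addr0 (_ : (t \in A n) = false) ?subr0 ?mulr1//.
apply: contraNF h; rewrite !inE => /annulus_radT[t0 /andP[h1 h2]].
apply/annulus_radT; split => //; move: an nb; rewrite -natr1 => an nb.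
by apply/andP; split; lra.
Qed.

(** A density that stays above [e] on a half-line in ln |x| is not integrable. This supplies
    endpoints, far out on either side, where boundary terms are small. *)
Lemma small_values (k : X -> R) (N : R -> R) (e M : R) : L1 k -> (forall t, 0 <= k t) ->
  {ae mu, forall t, k t = radJ t * N (radT t)} -> 0 < e ->
  (exists2 s, M <= s & N s < e) /\ (exists2 s, s <= M & N s < e).
Proof.
move=> lk k0 kN e0; have c0p := @polar_cst_gt0 R d d0.
have key (a b : R) : a < b -> (forall s, a < s <= b -> e <= N s) -> c0 * (e * (b - a)) <= Int k.
  move=> ab hN; have mA := @measurable_annulus R d d0 a b.
  have dl (x : R) : is_derive x 1 (fun s => e * s) e.
    by have := drv_mul (drv_cst e x) (drv_id x); rewrite mul0r add0r mulr1.
  have [iJ <-] : mu.-integrable (annulus a b) (fun t => (radJ t * e)%:E) /\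
     \int[mu]_(t in annulus a b) (radJ t * e) = c0 * (e * (b - a)).
    by rewrite mulrBr; exact: (annulus_FTC d0 ab dl (@cont_cst R e)).
  rewrite Int_restrict; apply: Int_ae_le => //.
    rewrite /L1 -restrict_EFin; exact/(integrable_mkcond _ mA).
  apply: filterS kN => t E; rewrite restrE; case: ifPn => // h; rewrite E.
  rewrite ler_wpM2l ?expR_ge0// hN//.
  by move: h; rewrite inE => /annulus_radT[].
pose L := Int k / (c0 * e) + 1.
have L0 : 0 < L.
  have : 0 <= Int k / (c0 * e) by rewrite divr_ge0 ?Int_ge0// mulr_ge0// ltW.
  by rewrite /L => h; rewrite ltr_pwDr.
have big : Int k < c0 * (e * L).
  rewrite mulrA mulrDr mulr1 mulrC divfK; last by rewrite mulf_neq0 ?gt_eqF.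
  by rewrite ltrDl mulr_gt0.
split; apply: contrapT => h.
- have : c0 * (e * (M + L - M)) <= Int k.
    apply: key => [|s /andP[Ms _]]; first by lra.
    by rewrite leNgt; apply/negP => hs; apply: h; exists s => //; exact: ltW.
  by rewrite addrC addKr leNgt big.
- have : c0 * (e * (M - (M - L))) <= Int k.
    apply: key => [|s /andP[_ sM]]; first by lra.
    by rewrite leNgt; apply/negP => hs; apply: h; exists s.
  by rewrite opprB addrC subrK leNgt big.
Qed.

Definition radpow k (t : X) : R := expR (k * radT t).

Lemma measurable_radpow k : measurable_fun setT (radpow k).
Proof.
apply: (@continuous_radT_measurable R d (fun s => expR (k * s))); cont.
Qed.

Lemma radpow_gt0 k t : 0 < radpow k t. Proof. exact: expR_gt0. Qed.

Lemma radpowD k l t : radpow k t * radpow l t = radpow (k + l) t.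
Proof. by rewrite /radpow -expRD mulrDl. Qed.

Lemma radpow2 t : radpow (-2) t = radpow (-1) t ^+ 2.
Proof.
rewrite /radpow [RHS]expr2 -expRD -mulrDl -opprD.
by congr (expR (_ * _)).
Qed.

(** For |x| <= 1 this follows from (f + (2/m) h)^2 >= 0: the derivative of e^{mt} Gam^2 is
    integrated over annuli, and the boundary term at -n has the right sign. For |x| >= 1 the weight
    is at most 1. *)
Lemma hardy f h Gam : (2 < d)%N -> prim_pair f h Gam ->
  L2 f -> L2 (fun t => h t * radpow (-1) t) -> measurable_fun setT h ->
  L2 (fun t => f t * radpow (-1) t).
Proof.
move=> d2 pf f2 h2 mh; have d2r : 2 < d%:R :> R by rewrite ltr_nat.
pose m : R := d%:R - 2; have m0 : 0 < m by rewrite subr_gt0.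
have mf : measurable_fun setT f by case: f2.
split; first by apply: measurable_funM => //; exact: measurable_radpow.
pose k t := f t ^+ 2 * radpow (-2) t.
suff : L1 k.
  rewrite (_ : k = fun t => (f t * radpow (-1) t) ^+ 2)//.
  by apply/funext => t; rewrite /k exprMn radpow2.
have mk : measurable_fun setT k.
  by apply: measurable_funM; [exact: measurable_funX|exact: measurable_radpow].
have k0 t : 0 <= k t by rewrite mulr_ge0 ?sqr_ge0// ltW// radpow_gt0.
pose E2 (s : R) := expR (m * s).
have cE : continuous (fun s : R => expR (m * s) * m) by cont.
have dE (x : R) : is_derive x 1 E2 (expR (m * x) * m).
  apply: drv_expR; have := drv_mul (drv_cst m x) (drv_id x).
  by rewrite mul0r add0r mulr1.
have p2 := prim_pair_mul pf pf mh mh.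
have pE := prim_pair_C1 dE cE.
have mff : measurable_fun setT (fun t => h t * f t + f t * h t).
  by apply: measurable_funD; exact: measurable_funM.
have mE : measurable_fun setT (fun t : X => expR (m * radT t) * m).
  exact: (continuous_radT_measurable cE).
have [_ lp _ pF] := prim_pair_mul pE p2 mE mff.
have hh : L1 (fun t => (h t * radpow (-1) t) ^+ 2) by case: h2.
have ff : L1 (fun t => f t ^+ 2) by case: f2.
have lk : loc_int k.
  apply: loc_int_ann => // a b.
  have [M [M0 hM]] := @continuous_bounded_itv R (fun s => expR (-2 * s)) a b ltac:(cont).
  exists (fun t => M * f t ^+ 2); first exact: L1Z.
  move=> t At; rewrite /k mulrC !normrM ler_wpM2r// (ger0_norm M0); apply: hM.
  by have /annulus_radT[_ /andP[/ltW -> ->]] := At.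
have lhh := loc_int_L1 d0 hh.
(* The integral of (m/2) [k] over |x| <= 1 is at most the boundary term at 0 plus 2/m times the
   energy; [K1] is this bound divided by m/2. *)
pose K1 := (2 / m) * (c0 * (E2 0 * (Gam 0 * Gam 0)) + (2 / m) * Int (fun t => (h t * radpow (-1) t) ^+ 2)).
apply: (@L1_of_annuli k (K1 + Int (fun t => f t ^+ 2)) lk k0) => n.
have n0 : - n%:R <= 0 :> R by rewrite oppr_le0.
rewrite (annulus_split d0 lk n0 (ler0n _ n)); apply: lerD; last first.
  rewrite /annulus_int Int_restrict; apply: Int_le => //.
    by rewrite /L1 -restrict_EFin; apply/(integrable_mkcond _ (measurable_annulus d0 _ _)); exact: lk.2.
  move=> t; rewrite restrE; case: ifPn => [|_]; last exact: sqr_ge0.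
  rewrite inE => /annulus_radT[_ /andP[t0 _]]; rewrite -[leRHS]mulr1 ler_wpM2l ?sqr_ge0//.
  by rewrite /radpow -[leRHS]expR0 ler_expR; move: (radT t) t0 => r r0; lra.
have e1 := pF _ _ n0.
have up : annulus_int (fun t => (m / 2) * k t) (- n%:R) 0 <=
   annulus_int (fun t => (expR (m * radT t) * m * (f t * f t) +
      E2 (radT t) * (h t * f t + f t * h t)) * radJ t + (2 / m) * (h t * radpow (-1) t) ^+ 2) (- n%:R) 0.
  rewrite /annulus_int; apply: le_Rintegral; first exact: measurable_annulus.
  - exact: (loc_intZ d0 (m / 2) lk).2.
  - exact: (loc_intD d0 lp (loc_intZ d0 (2 / m) lhh)).2.
  move=> t _; have EJ : expR (m * radT t) * radJ t = radpow (-2) t.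
    by rewrite /radJ /radpow -expRD; congr expR; rewrite /m; ring.
  rewrite /k /E2 (_ : (expR (m * radT t) * m * (f t * f t) +
      expR (m * radT t) * (h t * f t + f t * h t)) * radJ t =
      (expR (m * radT t) * radJ t) * (m * f t ^+ 2 + 2 * f t * h t)); last by ring.
  rewrite EJ radpow2; move: (f t) (h t) (radpow (-1) t) => x y z.
  rewrite -subr_ge0 (_ : _ - _ = (z ^+ 2) * (m / 2 * (x + 2 / m * y) ^+ 2)).
    by rewrite mulr_ge0 ?sqr_ge0// mulr_ge0 ?sqr_ge0// divr_ge0// ltW.
  by field; rewrite gt_eqF.
rewrite annulus_intZ// in up; rewrite annulus_intD// in up; last exact: loc_intZ.
rewrite [X in _ + X]annulus_intZ// -e1 in up.
have hle : annulus_int (fun t => (h t * radpow (-1) t) ^+ 2) (- n%:R) 0 <=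
    Int (fun t => (h t * radpow (-1) t) ^+ 2).
  rewrite /annulus_int Int_restrict; apply: Int_le => //.
    exact: L1_restrict (measurable_annulus d0 _ _) hh.
  by move=> t; rewrite restrE; case: ifP => // _; exact: sqr_ge0.
have En : 0 <= c0 * (E2 (- n%:R) * (Gam (- n%:R) * Gam (- n%:R))).
  rewrite -expr2; apply: mulr_ge0; first exact: ltW (@polar_cst_gt0 R d d0).
  by apply: mulr_ge0; [exact: expR_ge0|exact: sqr_ge0].
rewrite /K1 -(ler_pM2l (_ : 0 < m / 2)); last by rewrite divr_gt0.
rewrite [leRHS]mulrA (_ : m / 2 * (2 / m) = 1) ?mul1r; last by field; rewrite gt_eqF.
apply: le_trans up _.
have h3 := ler_wpM2l (ltW (divr_gt0 (ltr0Sn R 1) m0)) hle.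
rewrite mulrBr; move: En h3.
move: (annulus_int _ _ _) (Int _) (c0 * _) (c0 * _) => A B C D; lra.
Qed.

End prim_pair.

(** The derivative is continued by constants and integrated; [prim_pair_C1] asks for a function that
    is C^1 on the whole line. *)
Lemma C1_extend (R : realType) (P P' : R -> R) (a b : R) : a <= b ->
  (forall x, a <= x <= b -> is_derive x 1 P (P' x)) ->
  (forall x, a <= x <= b -> {for x, continuous P'}) ->
  exists Q Q', [/\ forall x : R, is_derive x 1 Q (Q' x), continuous Q' &
    forall x, a <= x <= b -> Q x = P x /\ Q' x = P' x].
Proof.
move=> ab dP cP; pose cl (x : R) := Num.max a (Num.min x b).
have cl1 x : a <= cl x <= b by rewrite /cl le_max lexx ge_max ab ge_min lexx orbT.
have cl2 x : a <= x <= b -> cl x = x.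
  by move=> /andP[h1 h2]; rewrite /cl min_l// max_r.
have ccl : continuous cl.
  move=> x; apply: (@continuous_max _ _ (fun=> a) (fun x => Num.min x b)); first exact: cst_continuous.
  by apply: (@continuous_min _ _ (fun x => x) (fun=> b)); [exact: cvg_id|exact: cst_continuous].
have cQ : continuous (fun x => P' (cl x)).
  by move=> x; apply: (@continuous_comp _ _ _ cl P'); [exact: ccl|exact: cP].
have [A dA] := antiderivative cQ.
exists (fun x => A x + (P a - A a)), (fun x => P' (cl x)); split => //.
  by move=> x; have := drv_add (dA x) (drv_cst (P a - A a) x); rewrite addr0.
move=> x xab; rewrite (cl2 x xab); split => //.
have /andP[ax xb] := xab.
have : A a - P a = A x - P x.
  apply: (@der_is_cst R (fun y => A y - P y) a x ax) => y /andP[ay yx].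
  have yab : a <= y <= b by rewrite ay (le_trans yx).
  have := drv_add (dA y) (drv_opp (dP y yab)).
  by rewrite (cl2 y yab) subrr.
lra.
Qed.

(** * Lower bounds from Riccati inequalities *)

Section riccati.
Context {R : realType} {d : nat} (d0 : (0 < d)%N).
Local Notation T := (measurableTypeR R).
Local Notation X := (d.-tuple T).
Local Notation mu := (lebesgue_tuple R d).
Local Notation c0 := (polar_cst (R := R) (d := d)).
Implicit Types (f h : X -> R) (Gam : R -> R).

(** The left side is the integral of the derivative of e^{(d-2)t} P Gam^2. In that derivative 2 P
    Gam Gam' is at most Gam'^2 + P^2 Gam^2, and the Riccati inequality bounds the coefficient of
    Gam^2 by [W]. *)
Lemma riccati_bound f h Gam (W P P' : R -> R) (a b : R) : a <= b ->
  prim_pair f h Gam -> measurable_fun setT h ->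
  loc_int (fun t => (h t ^+ 2 + W (radT t) * f t ^+ 2) * radpow (-2) t) ->
  (forall x, a <= x <= b -> is_derive x 1 P (P' x)) ->
  (forall x, a <= x <= b -> {for x, continuous P'}) ->
  (forall x, a <= x <= b -> P' x + P x ^+ 2 + (d%:R - 2) * P x <= W x) ->
  c0 * (expR ((d%:R - 2) * b) * P b * Gam b ^+ 2 - expR ((d%:R - 2) * a) * P a * Gam a ^+ 2) <=
  annulus_int (fun t => (h t ^+ 2 + W (radT t) * f t ^+ 2) * radpow (-2) t) a b.
Proof.
move=> ab pf mh lk dP cP hP.
have [Q [Q' [dQ cQ' QP]]] := C1_extend ab dP cP.
pose m : R := d%:R - 2; pose psi (s : R) := expR (m * s) * Q s.
pose psi' (s : R) := expR (m * s) * m * Q s + expR (m * s) * Q' s.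
have dpsi (x : R) : is_derive x 1 psi (psi' x).
  apply: drv_mul => //; apply: drv_expR.
  by have := drv_mul (drv_cst m x) (drv_id x); rewrite mul0r add0r mulr1.
have cQ : continuous Q by move=> x; exact: der_cont (dQ x).
have cpsi' : continuous psi' by rewrite /psi'; cont.
have [mf _ _ _] := pf.
have mff : measurable_fun setT (fun t => h t * f t + f t * h t).
  by apply: measurable_funD; exact: measurable_funM.
have p2 := prim_pair_mul d0 pf pf mh mh.
have [_ lp _ pF] := prim_pair_mul d0 (prim_pair_C1 d0 dpsi cpsi') p2 (continuous_radT_measurable cpsi') mff.
have aab : a <= a <= b by rewrite lexx.
have bab : a <= b <= b by rewrite lexx ab.
have -> : c0 * (expR ((d%:R - 2) * b) * P b * Gam b ^+ 2 - expR ((d%:R - 2) * a) * P a * Gam a ^+ 2) =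
   c0 * (psi b * (Gam b * Gam b) - psi a * (Gam a * Gam a)).
  by rewrite /psi !expr2 (QP a aab).1 (QP b bab).1.
rewrite pF//.
have mA := @measurable_annulus R d d0 a b.
apply: (le_Rintegral mA (lp.2 a b) (lk.2 a b)) => t At.
have EJ : expR (m * radT t) * radJ t = radpow (-2) t.
  by rewrite /radJ /radpow -expRD; congr expR; rewrite /m; ring.
have Tab : a <= radT t <= b by have /annulus_radT[_ /andP[/ltW -> ->]] := At.
rewrite /psi /psi' (_ : _ * radJ t = (expR (m * radT t) * radJ t) *
   ((m * Q (radT t) + Q' (radT t)) * f t ^+ 2 + 2 * Q (radT t) * (f t * h t))); last by ring.
rewrite EJ [leRHS]mulrC; apply: ler_wpM2l; first exact: ltW (radpow_gt0 _ _).
have [-> ->] := QP _ Tab; have := hP _ Tab; rewrite -/m.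
clear - R; move: (P _) (P' _) (W _) (f t) (h t) m => p p' w x y mm hw.
have : 0 <= (w - (p' + p ^+ 2 + mm * p)) * x ^+ 2 by rewrite mulr_ge0 ?sqr_ge0// subr_ge0.
have := sqr_ge0 (y - p * x); nra.
Qed.

Definition Xprofile f h Gam := prim_pair f h Gam /\
  [/\ L2 f, L2 (fun t => f t * radpow 1 t), L2 (fun t => f t * radpow (-1) t),
      measurable_fun setT h & L2 (fun t => h t * radpow (-1) t)].

Lemma radpow1 (t : X) : tradius t != 0 -> radpow 1 t = tradius t.
Proof. by move=> t0; rewrite /radpow mul1r -radT_exp. Qed.

Lemma radpow_N2 (t : X) : tradius t != 0 -> radpow (-2) t = (tradius t ^+ 2)^-1.
Proof.
move=> t0; rewrite /radpow mulNr expRN -[2]/(2%:R) mulr_natl -[radT t *+ 2]mulr_natl.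
by rewrite expRM_natl -radT_exp.
Qed.

Lemma flux_L2 (f : 'rV[R]_d -> R) G : weak_gradient f G -> L2 (fun t : X => flux G t * radpow (-1) t).
Proof.
move=> wG; have G2 i : L2 (G i \o @vec R d) by have [/inL2P] := wG i.
have mfl : measurable_fun setT (flux G : X -> R).
  apply: measurable_sum => i; apply: measurable_funM; last exact: measurable_tnth.
  by case: (G2 i).
have mG : measurable_fun setT (fun t => flux G t * radpow (-1) t).
  by apply: measurable_funM => //; exact: measurable_radpow.
have lG : L1 (fun t : X => \sum_i G i (vec t) ^+ 2).
  by apply: L1_sum => i; case: (G2 i).
split => //; apply/integrableP; split.
  by apply/measurable_EFinP; exact: measurable_funX.
have /integrableP[_] := lG; apply: le_lt_trans.
apply: ae_ge0_le_integral => //.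
- by apply: measurableT_comp => //; apply/measurable_EFinP; exact: measurable_funX.
- by apply: measurableT_comp => //; exact: measurable_int lG.
apply: filterS (ae_tradius_neq0 d0) => t t0 _; rewrite /= lee_fin.
rewrite !ger0_norm ?sqr_ge0//; last by apply: sumr_ge0 => i _; exact: sqr_ge0.
rewrite exprMn; apply: le_trans (ler_wpM2r (sqr_ge0 _) (flux_cauchy G t)) _.
rewrite -mulrA (_ : tradius t ^+ 2 * _ = 1) ?mulr1//.
by rewrite -exprMn -radpow1// radpowD subrr /radpow mul0r expR0 expr1n.
Qed.

Lemma Xrad_profile (f : 'rV[R]_d -> R) G : (2 < d)%N -> inXrad f -> weak_gradient f G ->
  exists Gam, Xprofile (fun t => f (vec t)) (flux G) Gam.
Proof.
move=> d2 [[f2 xf2 _] rf] wG.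
have [Gam [ae_f hG]] := radial_profile d0 f2 rf wG.
exists Gam; have h2 := flux_L2 wG.
have mfl : measurable_fun setT (flux G : X -> R).
  have G2 i : L2 (G i \o @vec R d) by have [/inL2P] := wG i.
  apply: measurable_sum => i; apply: measurable_funM; last exact: measurable_tnth.
  by case: (G2 i).
have f2' : L2 (fun t : X => f (vec t)) by exact/inL2P.
have pf : prim_pair (fun t : X => f (vec t)) (flux G) Gam.
  split => //; first by case: f2'.
  have cJ : continuous (fun s : R => expR (- d%:R * s)) by cont.
  exact: (loc_int_flux d0 wG cJ).
split => //; split => //; last exact: hardy pf f2' h2 mfl.
move/inL2P: xf2 => xf2; apply: (L2_ae _ xf2).
  by apply: measurable_funM; [case: f2'|exact: measurable_radpow].
by apply: filterS (ae_tradius_neq0 d0) => t t0; rewrite /= mulrC radpow1.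
Qed.

End riccati.

(** * Measurability of test functions and linearity of the weak gradient *)

Section test_functions.
Context {R : realType} {d : nat}.
Local Notation T := (measurableTypeR R).
Local Notation X := (d.-tuple T).
Local Notation mu := (lebesgue_tuple R d).

(** The sigma-algebra on tuples is the product one: the preimage of an open ray is a countable union
    of boxes with rational corners. *)
Lemma continuous_vec_measurable (phi : 'rV[R]_d -> R) : continuous phi ->
  measurable_fun [set: X] (fun t => phi (vec t)).
Proof.
move=> cphi; apply: (measurability _ (RGenOInfty.measurableE R)) => // _ [_ [y ->] <-].
rewrite setTI.
pose rb (q : {ffun 'I_d -> rat} * {ffun 'I_d -> rat}) : set X :=
  tbox (fun i => ratr (q.1 i)) (fun i => ratr (q.2 i)).
pose U : set X := (fun t => phi (vec t)) @^-1` `]y, +oo[.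
rewrite (_ : _ @^-1` _ = \bigcup_(q in [set: {ffun 'I_d -> rat} * {ffun 'I_d -> rat}])
   (if `[< rb q `<=` U >] then rb q else set0)).
  apply: countable_bigcupT_measurable; first exact: countableP.
  by move=> q; case: ifP => // _; exact: measurable_tbox.
apply/seteqP; split => [t Ut|t [q _]]; last by case: asboolP => // h /h.
have yt : y < phi (vec t) by move: Ut; rewrite /= in_itv /= andbT.
have [e /= e0 he] := (nbhs_ballP _ _).1 (cvgr_gt _ (cphi (vec t)) _ yt).
have ex i : exists q : rat * rat, tnth t i - e < ratr q.1 < tnth t i /\
    tnth t i < ratr q.2 < tnth t i + e.
  have [q1 h1] : exists q, ratr q \in `]tnth t i - e, (tnth t i : R)[.
    by apply: rat_in_itvoo; rewrite ltrBlDr ltrDl.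
  have [q2 h2] : exists q, ratr q \in `](tnth t i : R), tnth t i + e[.
    by apply: rat_in_itvoo; rewrite ltrDl.
  by exists (q1, q2); move: h1 h2; rewrite !in_itv.
have [q hq] := choice ex.
exists (finfun (fun i => (q i).1), finfun (fun i => (q i).2)) => //.
have tin : rb (finfun (fun i => (q i).1), finfun (fun i => (q i).2)) t.
  by move=> i /=; rewrite !ffunE; have [/andP[_ ->] /andP[/ltW -> _]] := hq i.
rewrite asboolT// => t' ht'.
rewrite /U /= in_itv /= andbT; apply: he; split => // j i.
rewrite (ord1 j) !mxE; have := ht' i; rewrite /= !ffunE => /andP[h1 h2].
have [/andP[h3 h4] /andP[h5 h6]] := hq i.
by rewrite /ball /= ltr_norml; apply/andP; split; lra.
Qed.

Lemma continuous_support_bounded (phi : 'rV[R]_d -> R) (M : R) : continuous phi ->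
  (forall x, M < enorm x -> phi x = 0) -> bounded_support (fun t : X => phi (vec t)).
Proof.
move=> cphi hM.
pose B : set 'rV[R]_d := [set v | forall i, `[- `|M|, `|M|]%classic (v ord0 i)].
have cB : compact B by apply: (@rV_compact R d (fun=> `[- `|M|, `|M|]%classic)) => i; exact: segment_compact.
have /compact_bounded[N [_ hN]] : compact (phi @` B).
  by apply: continuous_compact => //; apply: continuous_subspaceT.
have out x : phi x != 0 -> forall i, `|x 0 i| <= `|M|.
  move=> px i; apply: le_trans (enorm_coord x i) _.
  apply: le_trans _ (ler_norm M); rewrite leNgt; apply: contraNN px => /hM ->.
  by rewrite eqxx.
exists `|M|, (Num.max 0 (N + 1)) => t; split; last first.
  by move=> h i; have := out _ h i; rewrite mxE.
rewrite le_max; have [->|h] := eqVneq (phi (vec t)) 0; first by rewrite normr0 lexx.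
apply/orP; right; apply: (hN (N + 1)); first by rewrite ltrDl.
exists (vec t) => // i; rewrite /= in_itv /= -ler_norml.
exact: out.
Qed.

Lemma test_function_cont (phi : 'rV[R]_d -> R) : test_function phi -> continuous phi.
Proof. by move=> [sphi _] x; apply: differentiable_continuous; exact: (sphi [::] x). Qed.

Lemma test_function_partial (phi : 'rV[R]_d -> R) i : test_function phi ->
  test_function (partial i phi).
Proof.
move=> [sphi [M hM]]; split.
  move=> s x _; have := sphi (rcons s i) x I; rewrite -cats1 foldr_cat.
  exact.
exists M; apply: partial_support => //; exact: continuous_enorm.
Qed.

Lemma test_function_L2 (phi : 'rV[R]_d -> R) : test_function phi ->
  L2 (fun t : X => phi (vec t)).
Proof.
move=> tphi; have cphi := test_function_cont tphi; have [_ [M hM]] := tphi.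
apply: L2_bounded; first exact: continuous_vec_measurable.
exact: continuous_support_bounded hM.
Qed.

Lemma weak_gradient_sum k (c : 'I_k -> R) (f : 'I_k -> 'rV[R]_d -> R) G :
  (forall j, inL2 (f j)) -> (forall j, weak_gradient (f j) (G j)) ->
  weak_gradient (lincomb c f) (fun i x => \sum_j c j * G j i x).
Proof.
move=> f2 wG i; split.
  apply/inL2P; apply: (@L2_sum R d _ _ (fun j t => c j * G j i (vec t))) => j.
  by apply: L2Z; have [/inL2P] := wG j i.
move=> phi tphi; have p2 := test_function_L2 tphi.
have q2 := test_function_L2 (test_function_partial i tphi).
rewrite /integral_Rd -!/(Int _).
have e1 : (fun t : X => lincomb c f (vec t) * partial i phi (vec t)) =
    fun t => \sum_j c j * (f j (vec t) * partial i phi (vec t)).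
  by apply/funext => t; rewrite /lincomb mulr_suml; apply: eq_bigr => j _; rewrite mulrA.
have e2 : (fun t : X => (\sum_j c j * G j i (vec t)) * phi (vec t)) =
    fun t => \sum_j c j * (G j i (vec t) * phi (vec t)).
  by apply/funext => t; rewrite mulr_suml; apply: eq_bigr => j _; rewrite mulrA.
have l1 j : L1 (fun t : X => f j (vec t) * partial i phi (vec t)).
  by have /inL2P h := f2 j; exact: (L2_mul h q2).
have l2 j : L1 (fun t : X => G j i (vec t) * phi (vec t)).
  by have [/inL2P h _] := wG j i; exact: (L2_mul h p2).
rewrite e1 e2 (Int_sum _ (fun j => L1Z (c j) (l1 j))) (Int_sum _ (fun j => L1Z (c j) (l2 j))).
rewrite -sumrN; apply: eq_bigr => j _; rewrite (IntZ _ (l1 j)) (IntZ _ (l2 j)) -mulrN.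
by congr (_ * _); have [_ /(_ _ tphi)] := wG j i.
Qed.

End test_functions.

(** * Weak gradients of radial functions that are C^1 off the origin *)

Section line_integrals.
Context {R : realType} {n : nat}.
Local Notation d := n.+1.
Local Notation T := (measurableTypeR R).
Local Notation X := (d.-tuple T).
Local Notation mu := (lebesgue_tuple R d).

Definition line (i : 'I_d) (x : T) (t : n.-tuple T) : X :=
  tperm_coord (tperm ord0 i) (tuple_cons (x, t)).

(** Fubini, after a transposition that brings the coordinate [i] to the front. *)
Lemma Int_lines_eq0 (k : X -> R) i : L1 k ->
  {ae lebesgue_tuple R n, forall t,
    (\int[lebesgue_measure]_x (k (line i x t))%:E = 0)%E} -> Int k = 0.
Proof.
move=> lk hk; pose p := tperm ord0 i.
have mk := L1_meas lk.
pose ph (z : T * n.-tuple T) : X := line i z.1 z.2.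
have mph : measurable_fun setT ph.
  apply: (measurableT_comp (measurable_tperm_coord p)).
  rewrite (_ : (fun z => _) = @tuple_cons R n); first exact: measurable_tuple_cons.
  by apply/funext => -[].
have e1 (f : X -> \bar R) : (\int[mu]_t f t =
    \int[pushforward (lebesgue_measure \x lebesgue_tuple R n)%E ph]_t f t)%E.
  apply: eq_measure_integral => A mA _.
  by rewrite -[LHS](lebesgue_tperm p mA).
have ik : (lebesgue_measure \x lebesgue_tuple R n)%E.-integrable setT (EFin \o k \o ph).
  apply/integrableP; split.
    by apply: measurableT_comp mph; exact/measurable_EFinP.
  have /integrableP[_] := lk; rewrite e1 ge0_integral_pushforward//.
  by apply: measurableT_comp => //; exact/measurable_EFinP.
rewrite /Int /Rintegral e1 integral_pushforward//; last exact/measurable_EFinP.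
rewrite preimage_setT -integral21_prod_meas1//.
rewrite (_ : (\int[_]_x _)%E = 0%E)//.
rewrite (ae_eq_integral (fun=> 0%E))//; first by rewrite integral0.
- exact: (measurable_fubini_G ik).
- by apply: filterS hk => t ht _.
Qed.

Lemma line_coordE (i : 'I_d) x t (j : 'I_d) : tnth (line i x t) j = tnth (tuple_cons (x, t)) (tperm ord0 i j).
Proof. by rewrite tnth_mktuple. Qed.

Lemma line_coord (i : 'I_d) x t : tnth (line i x t) i = x.
Proof. by rewrite line_coordE tpermR tnth0. Qed.

Lemma tradius_line (i : 'I_d) x t :
  tradius (line i x t) = Num.sqrt (tradius t ^+ 2 + x ^+ 2).
Proof.
rewrite radE; congr Num.sqrt.
rewrite (reindex_inj (@perm_inj _ (tperm ord0 i))) /=.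
under eq_bigr do rewrite line_coordE tpermK.
rewrite big_ord_recl tnth0 /= addrC; congr (_ + _).
rewrite radE sqr_sqrtr; last by apply: sumr_ge0 => j _; exact: sqr_ge0.
by apply: eq_bigr => j _; rewrite tnthS.
Qed.

Lemma line_vec (i : 'I_d) (x y : R) t :
  vec (line i (x + y) t) = y *: delta_mx 0 i + vec (line i x t).
Proof.
apply/rowP => j; rewrite !mxE !line_coordE eqxx /=.
case: (eqVneq j i) => [->|ji].
  by rewrite tpermR !tnth0 mulr1 addrC.
rewrite mulr0 add0r; case: (eqVneq j ord0) => [ej|j0].
  rewrite ej tpermL; case: (unliftP ord0 i) => [k ->|e]; first by rewrite !tnthS.
  by move: ji; rewrite ej e eqxx.
have -> : tperm ord0 i j = j by rewrite tpermD// eq_sym.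
by case: (unliftP ord0 j) => [k ->|e]; [rewrite !tnthS|move: j0; rewrite e eqxx].
Qed.

Lemma line_derive (phi : 'rV[R]_d -> R) (i : 'I_d) (x : R) t :
  differentiable phi (vec (line i x t)) ->
  is_derive x 1 (fun x => phi (vec (line i x t))) (partial i phi (vec (line i x t))).
Proof.
move=> dphi; have E : (fun h : R => h^-1 *: (phi (vec (line i (h *: 1 + x) t)) - phi (vec (line i x t)))) =
    (fun h => h^-1 *: (phi (h *: delta_mx 0 i + vec (line i x t)) - phi (vec (line i x t)))).
  apply/funext => h; have -> : h *: (1 : R) = h by rewrite /GRing.scale /= mulr1.
  by rewrite [h + x]addrC line_vec.
have dv : derivable phi (vec (line i x t)) (delta_mx 0 i) by exact: diff_derivable.
split.
  by move: dv; rewrite /derivable -E.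
by rewrite /partial /derive -E.
Qed.

Lemma ln_sqrt_derive (rho x : R) : 0 < rho ->
  is_derive x 1 (fun x => ln (Num.sqrt (rho + x ^+ 2))) (x / (rho + x ^+ 2)).
Proof.
move=> r0; have p y : 0 < rho + y ^+ 2 by rewrite ltr_pwDl// sqr_ge0.
apply: (@der_ext R (fun x => 2^-1 * ln (rho + x ^+ 2))) => [y|].
  rewrite -{1}(sqr_sqrtr (ltW (p y))) lnXn ?sqrtr_gt0// -[ln _ *+ 2]mulr_natl mulrA mulVf ?mul1r//.
have d1 := drv_add (drv_cst rho x) (drv_pow 2 (drv_id x)).
have d2 := drv_mul (drv_cst 2^-1 x) (drv_comp d1 (is_derive1_ln (p x))).
move: d2; set v := (X in is_derive _ _ _ X -> _) => d2.
suff <- : v = x / (rho + x ^+ 2) by [].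
by rewrite /v; field; rewrite gt_eqF.
Qed.

(** The integrand is the derivative, along a line parallel to a coordinate axis, of a function of
    compact support. It is C^1 because the line misses the origin, at distance [tradius t]. *)
Lemma line_parts (F F' : R -> R) (phi : 'rV[R]_d -> R) i t :
  (forall x : R, is_derive x 1 F (F' x)) -> continuous F' -> test_function phi ->
  tradius t != 0 ->
  (\int[lebesgue_measure]_x
     (F (radT (line i x t)) * partial i phi (vec (line i x t)) +
      F' (radT (line i x t)) * tnth (line i x t) i * radpow (-2) (line i x t) *
        phi (vec (line i x t)))%:E = 0)%E.
Proof.
move=> dF cF' tphi t0; have [sphi [M hM]] := tphi.
have rho0 : 0 < tradius t ^+ 2 by rewrite lt0r sqrf_eq0 t0 sqr_ge0.
pose A (x : R) := F (radT (line i x t)) * phi (vec (line i x t)).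
pose A' (x : R) := F' (radT (line i x t)) * (x / (tradius t ^+ 2 + x ^+ 2)) * phi (vec (line i x t)) +
  F (radT (line i x t)) * partial i phi (vec (line i x t)).
have dT (x : R) : is_derive x 1 (fun x => radT (line i x t)) (x / (tradius t ^+ 2 + x ^+ 2)).
  apply: (der_ext _ (ln_sqrt_derive x rho0)) => y.
  by rewrite /radT tradius_line.
have dphi (x : R) := line_derive (sphi [::] (vec (line i x t)) I).
have dpphi (x : R) := line_derive (sphi [:: i] (vec (line i x t)) I).
have dA (x : R) : is_derive x 1 A (A' x) by exact: (drv_mul (drv_comp (dT x) (dF _)) (dphi x)).
have cT : continuous (fun x : R => radT (line i x t)) by move=> x; exact: der_cont (dT x).
have cphi : continuous (fun x : R => phi (vec (line i x t))) by move=> x; exact: der_cont (dphi x).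
have cpphi : continuous (fun x : R => partial i phi (vec (line i x t))).
  by move=> x; exact: der_cont (dpphi x).
have cF : continuous F by move=> x; exact: der_cont (dF x).
have cA' : continuous A'.
  rewrite /A'; apply: cont_add; apply: cont_mul => //.
  - apply: cont_mul; first exact: (cont_comp cT cF').
    apply: cont_mul; first exact: cont_id.
    apply: cont_inv; first by cont.
    by move=> x; rewrite gt_eqF// ltr_pwDl// sqr_ge0.
  - exact: (cont_comp cT cF).
pose N : R := `|M| + 1.
have far (x : R) : ~~ (- N < x <= N) -> M < enorm (vec (line i x t)).
  move=> hx; apply: (@lt_le_trans _ _ N); first by rewrite /N (le_lt_trans (ler_norm M))// ltrDl.
  apply: le_trans _ (coord_le_rad (line i x t) i); rewrite line_coord.
  move: hx; rewrite negb_and -leNgt -ltNge => /orP[h|h].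
    by rewrite ler_normr; apply/orP; right; rewrite lerNr.
  by rewrite ler_normr (ltW h).
have N0 : - N < N by rewrite /N; have := normr_ge0 M; lra.
pose S : set T := `]- N, N]%classic.
rewrite (_ : (\int[_]_x _)%E = (\int[lebesgue_measure]_(x in S) (A' x)%:E)%E).
  rewrite /S (der_FTC N0 (fun x _ => dA x)); last exact: continuous_subspaceT.
  have [_ [M' hM']] := tphi.
  rewrite /A (hM (vec (line i N t))); last first.
    apply: (@lt_le_trans _ _ N); first by rewrite /N (le_lt_trans (ler_norm M))// ltrDl.
    by apply: le_trans _ (coord_le_rad (line i N t) i); rewrite line_coord ler_norm.
  rewrite (hM (vec (line i (- N) t))) ?mulr0 ?subrr//; apply: far.
  by rewrite ltxx.
rewrite [RHS]integral_mkcond; apply: eq_integral => x _.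
rewrite patchE; case: ifPn => h.
  congr (_%:E); rewrite /A' line_coord addrC; congr (_ * _ + _).
  have r0 : 0 < tradius t ^+ 2 + x ^+ 2 by rewrite ltr_pwDl// sqr_ge0.
  have lt0 : tradius (line i x t) != 0 by rewrite tradius_line gt_eqF// sqrtr_gt0.
  rewrite -mulrA; congr (_ * (_ * _)).
  by rewrite radpow_N2// tradius_line sqr_sqrtr// ltW.
have /far hx : ~~ (- N < x <= N) by apply: contra h => hx; rewrite inE /S /= in_itv.
rewrite hM// (@partial_support _ _ phi M)//; first by rewrite !mulr0 addr0.
exact: continuous_enorm.
Qed.

(** In dimension n + 1 >= 2 almost every line parallel to an axis misses the origin, so a
    singularity there does not contribute to the weak gradient as long as both sides are in L^2. *)
Lemma weak_gradient_C1 (F F' : R -> R) : (0 < n)%N ->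
  (forall x : R, is_derive x 1 F (F' x)) -> continuous F' ->
  L2 (fun t : X => F (radT t)) ->
  L2 (fun t : X => F' (radT t) * radpow (-1) t) ->
  weak_gradient (fun x : 'rV[R]_d => F (ln (enorm x)))
    (fun i x => F' (ln (enorm x)) * x 0 i * expR (-2 * ln (enorm x))).
Proof.
move=> n0 dF cF' F2 F2' i.
have EG : (fun t : X => F' (ln (enorm (vec t))) * (vec t) 0 i * expR (-2 * ln (enorm (vec t)))) =
   fun t => F' (radT t) * tnth t i * radpow (-2) t.
  by apply/funext => t; rewrite mxE.
have mG : measurable_fun setT (fun t : X => F' (radT t) * tnth t i * radpow (-2) t).
  apply: measurable_funM; last exact: measurable_radpow.
  apply: measurable_funM; last exact: measurable_tnth.
  exact: continuous_radT_measurable.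
have G2 : L2 (fun t : X => F' (radT t) * tnth t i * radpow (-2) t).
  split => //; case: F2' => mF lF; apply: (L1_le _ lF); first exact: measurable_funX.
  move=> t; rewrite !ger0_norm ?sqr_ge0//.
  have [t0|t0] := eqVneq (tradius t) 0.
    suff -> : tnth t i = 0 by rewrite mulr0 mul0r expr0n sqr_ge0.
    by apply/eqP; rewrite -normr_le0 -t0 coord_le_rad.
  rewrite !exprMn -mulrA ler_wpM2l ?sqr_ge0// radpow_N2// -radpow2 radpow_N2//.
  have p : 0 < tradius t ^+ 2 by rewrite lt0r sqrf_eq0 t0 sqr_ge0.
  have key (a b : R) : 0 < b -> a <= b -> a * b^-1 ^+ 2 <= b^-1.
    move=> b0 ab; have hb : 0 <= b^-1 by rewrite invr_ge0 ltW.
    by rewrite expr2 mulrA ler_piMl// ler_pdivrMr// mul1r.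
  apply: key => //.
  by rewrite -[leLHS]real_normK ?num_real// ler_sqr ?nnegrE ?rad_ge0// coord_le_rad.
split; first by apply/inL2P; rewrite /comp EG.
move=> phi tphi; have p2 := test_function_L2 tphi.
have q2 := test_function_L2 (test_function_partial i tphi).
have l1 := L2_mul F2 q2; have l2 := L2_mul G2 p2.
apply/eqP; rewrite -addr_eq0; apply/eqP.
have := IntD l1 l2; rewrite (@Int_lines_eq0 _ i) //; first last.
- have := @ae_tradius_neq0 R n n0; apply: filterS => t t0.
  exact: line_parts.
- exact: L1D.
move=> ->; congr (_ + _); rewrite /integral_Rd -/(Int _); congr Int.
by apply/funext => t; rewrite mxE.
Qed.

End line_integrals.

(** * The form of L in the radial variable *)

Section forms.
Context {R : realType} {d : nat} (d2 : (2 < d)%N).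
Local Notation T := (measurableTypeR R).
Local Notation X := (d.-tuple T).
Local Notation mu := (lebesgue_tuple R d).
Local Notation c0 := (polar_cst (R := R) (d := d)).
Implicit Types (f g : 'rV[R]_d -> R).

Let d0 : (0 < d)%N. Proof. by rewrite (ltn_trans _ d2). Qed.

(** The origin is a single point, where any value is measurable; the value of [u] there is
    arbitrary. *)
Lemma measurable_off_origin (k g : X -> R) : measurable_fun setT g ->
  (forall t, tradius t != 0 -> k t = g t) -> measurable_fun setT k.
Proof.
move=> mg kg.
have -> : setT = [set t : X | tradius t = 0] `|` ~` [set t : X | tradius t = 0] by rewrite setUv.
have m0 : measurable [set t : X | tradius t = 0] by exact: measurable_sphere.
apply/measurable_funU => //; first exact: measurableC.
split.
  apply: (@eq_measurable_fun _ _ _ _ _ (fun=> k [tuple (0 : R) | i < d])).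
    move=> t; rewrite inE /= => t0; congr k; apply: eq_from_tnth => i; rewrite tnth_mktuple.
    by apply/eqP; rewrite eq_sym -normr_le0 -t0 coord_le_rad.
  exact: measurable_cst.
apply: (@eq_measurable_fun _ _ _ _ _ g); last exact: measurable_funTS.
by move=> t; rewrite inE /= => /eqP t0; rewrite kg.
Qed.

Lemma wgradP f : (exists G, weak_gradient f G) -> weak_gradient f (wgrad f).
Proof. exact: xgetPex. Qed.

Lemma inX_L2 f : inX f -> [/\ L2 (fun t : X => f (vec t)),
  L2 (fun t : X => tradius t * f (vec t)) & weak_gradient f (wgrad f)].
Proof. by move=> [/inL2P f2 /inL2P xf2 /wgradP wf]; split. Qed.

Lemma inXrad_L2 f : inXrad f -> [/\ L2 (fun t : X => f (vec t)),
  L2 (fun t : X => f (vec t) * radpow 1 t), L2 (fun t : X => f (vec t) * radpow (-1) t) &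
  weak_gradient f (wgrad f)].
Proof.
move=> hf; have [/inX_L2[_ _ wf] _] := hf.
by have [Gam [_ [h1 h2 h3 _ _]]] := Xrad_profile d0 d2 hf wf.
Qed.

Lemma wgrad_L2 f i : weak_gradient f (wgrad f) -> L2 (fun t : X => wgrad f i (vec t)).
Proof. by move=> /(_ i)[/inL2P]. Qed.

Lemma L1_wgrad f g : weak_gradient f (wgrad f) -> weak_gradient g (wgrad g) ->
  L1 (fun t : X => \sum_i wgrad f i (vec t) * wgrad g i (vec t)).
Proof.
by move=> wf wg; apply: L1_sum => i; exact: (L2_mul (wgrad_L2 i wf) (wgrad_L2 i wg)).
Qed.

Lemma inXrad_lincomb k (c : 'I_k -> R) (f : 'I_k -> 'rV[R]_d -> R) :
  (forall j, inXrad (f j)) -> inXrad (lincomb c f).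
Proof.
move=> hf; have H j := inX_L2 (hf j).1.
split; last by move=> x y xy; apply: eq_bigr => j _; rewrite ((hf j).2 x y xy).
split.
- by apply/inL2P; apply: (@L2_sum R d _ _ (fun j t => c j * f j (vec t))) => j;
    apply: L2Z; have [] := H j.
- apply/inL2P; rewrite (_ : _ \o _ = fun t => \sum_j c j * (tradius t * f j (vec t))).
    by apply: L2_sum => j; apply: L2Z; have [] := H j.
  by apply/funext => t; rewrite /= /lincomb mulr_sumr; apply: eq_bigr => j _; exact: mulrCA.
- exists (fun i x => \sum_j c j * wgrad (f j) i x).
  apply: weak_gradient_sum => j; last by have [] := H j.
  by have [/inL2P] := H j.
Qed.

Lemma L2_dotE f g : L2_dot f g = Int (fun t : X => f (vec t) * g (vec t)).
Proof. by []. Qed.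

Lemma L2_dotC f g : L2_dot f g = L2_dot g f.
Proof. by rewrite !L2_dotE; congr Int; apply/funext => t; rewrite mulrC. Qed.

Lemma L2_dot_lincomb k (c : 'I_k -> R) (f : 'I_k -> 'rV[R]_d -> R) g :
  (forall j, L2 (fun t : X => f j (vec t))) -> L2 (fun t : X => g (vec t)) ->
  L2_dot (lincomb c f) g = \sum_j c j * L2_dot (f j) g.
Proof.
move=> hf hg; rewrite L2_dotE.
rewrite (_ : (fun t => _) = fun t => \sum_j c j * (f j (vec t) * g (vec t))).
  rewrite (Int_sum _ (fun j => L1Z (c j) (L2_mul (hf j) hg))).
  by apply: eq_bigr => j _; rewrite (IntZ _ (L2_mul (hf j) hg)).
by apply/funext => t; rewrite /lincomb mulr_suml; apply: eq_bigr => j _; rewrite mulrA.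
Qed.

Variables (omega : R) (u : 'rV[R]_d -> R) (V : R -> R) (VM : R).
Hypotheses (cV : continuous V)
  (hV : forall t : X, tradius t != 0 ->
    tradius t ^+ 2 - omega - 3 * u (vec t) ^+ 2 = V (radT t) * radpow (-2) t)
  (bV : forall s, `|V s| <= VM * (1 + expR (2 * s) + expR (4 * s))).

Lemma measurable_V : measurable_fun setT (fun t : X => V (radT t) * radpow (-2) t).
Proof.
by apply: measurable_funM; [exact: continuous_radT_measurable|exact: measurable_radpow].
Qed.

(** The three terms of the bound on [V] correspond to products of f/|x| (in L^2 by Hardy's
    inequality), of f, and of |x| f. *)
Lemma L1_V f g : inXrad f -> inXrad g ->
  L1 (fun t : X => V (radT t) * radpow (-2) t * (f (vec t) * g (vec t))).
Proof.
move=> /inXrad_L2[f1 f2 f3 _] /inXrad_L2[g1 g2 g3 _].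
have lb := L1Z VM (L1D (L1D (L1_norm (L2_mul f3 g3)) (L1_norm (L2_mul f1 g1))) (L1_norm (L2_mul f2 g2))).
apply: (L1_le _ lb).
  apply: measurable_funM; first exact: measurable_V.
  by apply: L1_meas; exact: (L2_mul f1 g1).
move=> t; apply: le_trans _ (ler_norm _).
have E1 : radpow 2 t = radpow 1 t ^+ 2 by rewrite /radpow [RHS]expr2 -expRD -mulrDl.
have e1 : f (vec t) * radpow (-1) t * (g (vec t) * radpow (-1) t) = radpow (-2) t * (f (vec t) * g (vec t)).
  by rewrite radpow2; ring.
have e2 : f (vec t) * radpow 1 t * (g (vec t) * radpow 1 t) = radpow 2 t * (f (vec t) * g (vec t)).
  by rewrite E1; ring.
rewrite e1 e2 !normrM !(ger0_norm (ltW (radpow_gt0 _ _))).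
have e3 : 1 = expR (2 * radT t) * radpow (-2) t by rewrite /radpow -expRD -mulrDl subrr mul0r expR0.
have e4 : radpow 2 t = expR (4 * radT t) * radpow (-2) t.
  by rewrite /radpow -expRD; congr expR; move: (radT t) => r; ring.
rewrite e4 -[X in _ * (_ + X + _)]mul1r {3}e3.
set a := `|f (vec t)| * `|g (vec t)|.
rewrite (_ : VM * _ = VM * (1 + expR (2 * radT t) + expR (4 * radT t)) * radpow (-2) t * a); last by ring.
apply: ler_wpM2r; first by rewrite mulr_ge0.
by apply: ler_wpM2r; [exact: ltW (radpow_gt0 _ _)|exact: bV].
Qed.

Lemma LformE f g : inXrad f -> inXrad g ->
  Lform omega u f g = Int (fun t : X => \sum_i wgrad f i (vec t) * wgrad g i (vec t) +
    V (radT t) * radpow (-2) t * (f (vec t) * g (vec t))).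
Proof.
move=> hf hg; have lV := L1_V hf hg.
have [_ _ _ wf] := inXrad_L2 hf; have [_ _ _ wg] := inXrad_L2 hg.
have lw := L1_wgrad wf wg.
have E (t : X) : tradius t != 0 ->
   (\sum_i wgrad f i (vec t) * wgrad g i (vec t)) + enorm (vec t) ^+ 2 * (f (vec t) * g (vec t))
    - omega * (f (vec t) * g (vec t)) - 3 * u (vec t) ^+ 2 * (f (vec t) * g (vec t)) =
   \sum_i wgrad f i (vec t) * wgrad g i (vec t) +
    V (radT t) * radpow (-2) t * (f (vec t) * g (vec t)).
  by move=> t0; rewrite -(hV t0) /tradius; ring.
apply: Int_ae.
- by apply: (measurable_off_origin _ E); apply: L1_meas; exact: L1D.
- by apply: L1_meas; exact: L1D.
- by apply: filterS (ae_tradius_neq0 d0) => t t0; exact: E.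
Qed.

Lemma LformC f g : Lform omega u f g = Lform omega u g f.
Proof.
rewrite /Lform; congr integral_Rd; apply/funext => x.
rewrite (mulrC (f x)).
by rewrite (eq_bigr (fun i => wgrad g i x * wgrad f i x))// => i _; rewrite mulrC.
Qed.

Lemma wgrad_lincomb k (c : 'I_k -> R) (f : 'I_k -> 'rV[R]_d -> R) : (forall j, inXrad (f j)) ->
  {ae mu, forall t : X, forall i, wgrad (lincomb c f) i (vec t) = \sum_j c j * wgrad (f j) i (vec t)}.
Proof.
move=> hf; have H j := inXrad_L2 (hf j); have [_ _ _ wl] := inXrad_L2 (inXrad_lincomb c hf).
have wf j : weak_gradient (f j) (wgrad (f j)) by have [] := H j.
have f2 j : inL2 (f j) by apply/inL2P; have [] := H j.
by apply: filter_forall => i; exact: (weak_gradient_uniq i wl (weak_gradient_sum c f2 wf)).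
Qed.

Lemma Lform_lincomb k (c : 'I_k -> R) (f : 'I_k -> 'rV[R]_d -> R) g :
  (forall j, inXrad (f j)) -> inXrad g ->
  Lform omega u (lincomb c f) g = \sum_j c j * Lform omega u (f j) g.
Proof.
move=> hf hg; have hl := inXrad_lincomb c hf.
have H j := inXrad_L2 (hf j); have [_ _ _ wg] := inXrad_L2 hg.
have wf j : weak_gradient (f j) (wgrad (f j)) by have [] := H j.
have [_ _ _ wl] := inXrad_L2 hl.
rewrite LformE//.
pose W j (t : X) := \sum_i wgrad (f j) i (vec t) * wgrad g i (vec t) +
    V (radT t) * radpow (-2) t * (f j (vec t) * g (vec t)).
have lW j : L1 (W j) by exact: (L1D (L1_wgrad (wf j) wg) (L1_V (hf j) hg)).
transitivity (Int (fun t : X => \sum_j c j * W j t)).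
  apply: Int_ae.
  - by apply: L1_meas; exact: (L1D (L1_wgrad wl wg) (L1_V hl hg)).
  - by apply: L1_meas; apply: L1_sum => j; exact: L1Z.
  apply: filterS (wgrad_lincomb c hf) => t e.
  rewrite /W; under [RHS]eq_bigr do rewrite mulrDr.
  rewrite big_split /=; congr (_ + _).
    under eq_bigr do rewrite e mulr_suml.
    rewrite exchange_big /=; apply: eq_bigr => j _; rewrite mulr_sumr.
    by apply: eq_bigr => i _; rewrite mulrA.
  by rewrite /lincomb mulr_suml mulr_sumr; apply: eq_bigr => j _; ring.
rewrite (Int_sum _ (fun j => L1Z (c j) (lW j))); apply: eq_bigr => j _.
by rewrite (IntZ _ (lW j)) LformE.
Qed.

(** By Cauchy-Schwarz the flux is at most |x| times the norm of the gradient. Lower bounds for the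
    form can therefore be proved for the radial integral alone. *)
Lemma Lform_ge f : inXrad f -> let h := flux (wgrad f) in exists Gam,
  Xprofile (fun t : X => f (vec t)) h Gam /\
  L1 (fun t : X => (h t ^+ 2 + V (radT t) * f (vec t) ^+ 2) * radpow (-2) t) /\
  Int (fun t : X => (h t ^+ 2 + V (radT t) * f (vec t) ^+ 2) * radpow (-2) t) <= Lform omega u f f.
Proof.
move=> hf h; have [_ _ _ wf] := inXrad_L2 hf.
have [Gam pf] := Xrad_profile d0 d2 hf wf.
exists Gam; split => //.
have [_ [_ _ _ mh [_ lh]]] := pf.
have lV := L1_V hf hf.
have E : (fun t : X => (flux (wgrad f) t ^+ 2 + V (radT t) * f (vec t) ^+ 2) * radpow (-2) t) =
   fun t => (flux (wgrad f) t * radpow (-1) t) ^+ 2 + V (radT t) * radpow (-2) t * (f (vec t) * f (vec t)).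
  by apply/funext => t; rewrite radpow2; ring.
rewrite /h E; split; first exact: L1D.
rewrite LformE//; apply: Int_ae_le.
- exact: L1D.
- by apply: L1D => //; exact: L1_wgrad.
apply: filterS (ae_tradius_neq0 d0) => t t0; apply: lerD => //.
rewrite exprMn; apply: le_trans (ler_wpM2r (sqr_ge0 _) (flux_cauchy (wgrad f) t)) _.
rewrite -mulrA (_ : tradius t ^+ 2 * _ = 1) ?mulr1.
  by apply: ler_sum => i _; rewrite expr2.
by rewrite -exprMn -radpow1// radpowD subrr /radpow mul0r expR0 expr1n.
Qed.

Lemma L2_radial_bounded (q : R -> R) (B b : R) : continuous q ->
  (forall s, `|q s| <= B) -> (forall s, b < s -> q s = 0) -> L2 (fun t : X => q (radT t)).
Proof.
move=> cq qB qb; apply: L2_bounded; first exact: continuous_radT_measurable.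
exists (Num.max 1 (expR b)), B => t; split => // qn i; apply: le_trans (coord_le_rad t i) _.
have [->|t0] := eqVneq (tradius t) 0; first by rewrite le_max ler01.
rewrite le_max (radT_exp t0) ler_expR; apply/orP; right.
by rewrite leNgt; apply: contraNN qn => /qb ->.
Qed.

Lemma L2_radial (q Psi : R -> R) (M : R) : continuous q ->
  (forall s : R, is_derive s 1 Psi (expR (d%:R * s) * q s ^+ 2)) ->
  (forall s, `|Psi s| <= M) -> L2 (fun t : X => q (radT t)).
Proof.
move=> cq dPsi bPsi; split; first exact: continuous_radT_measurable.
have cqq : continuous (fun s : R => expR (d%:R * s) * q s ^+ 2) by cont.
have E : (fun t : X => q (radT t) ^+ 2) = fun t => radJ t * (expR (d%:R * radT t) * q (radT t) ^+ 2).
  by apply/funext => t; rewrite mulrA /radJ -expRD mulNr addNr expR0 mul1r.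
apply: (@L1_of_annuli R d d0 _ (c0 * (2 * M))).
- by rewrite E; exact: (loc_int_C0 d0 cqq).
- by move=> t; exact: sqr_ge0.
case=> [|n].
  rewrite annulus_empty ?oppr0//; apply: mulr_ge0; first exact: ltW (polar_cst_gt0 d0).
  by rewrite mulr_ge0// (le_trans _ (bPsi 0)).
have nn : - n.+1%:R < n.+1%:R :> R.
  by rewrite (@lt_trans _ _ 0)// ?oppr_lt0 ltr0n.
rewrite E; have [_ e] := annulus_FTC d0 nn dPsi cqq.
rewrite /annulus_int e ler_pM2l; last exact: (polar_cst_gt0 d0).
have := bPsi n.+1%:R; have := bPsi (- n.+1%:R); rewrite !ler_norml.
by move: (Psi _) (Psi _) => a b /andP[h1 h2] /andP[h3 h4]; lra.
Qed.

Definition radfun (F : R -> R) : 'rV[R]_d -> R := fun x => F (ln (enorm x)).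

Lemma radfun_inXrad (F F' : R -> R) :
  (forall x : R, is_derive x 1 F (F' x)) -> continuous F' ->
  L2 (fun t : X => F (radT t)) -> L2 (fun t : X => F (radT t) * radpow 1 t) ->
  L2 (fun t : X => F' (radT t) * radpow (-1) t) ->
  inXrad (radfun F) /\
  {ae mu, forall t : X, forall i, wgrad (radfun F) i (vec t) = F' (radT t) * tnth t i * radpow (-2) t}.
Proof.
move=> dF cF' F2 xF2 F2'.
pose G (i : 'I_d) (x : 'rV[R]_d) := F' (ln (enorm x)) * x 0 i * expR (-2 * ln (enorm x)).
have wG : weak_gradient (radfun F) G.
  rewrite /G /radfun; case: d d2 F2 xF2 F2' => // n n2 h1 h2 h3.
  have n0 : (0 < n)%N by case: n n2 {h1 h2 h3}.
  exact: (weak_gradient_C1 n0 dF cF' h1 h3).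
have mF : measurable_fun setT (fun t : X => F (radT t)) by case: F2.
have hX : inX (radfun F).
  split; [exact/inL2P| |by exists G].
  apply/inL2P; apply: (L2_ae _ xF2).
    by apply: measurable_funM => //; exact: measurable_rad.
  by apply: filterS (ae_tradius_neq0 d0) => t t0; rewrite /= radpow1// mulrC.
split; first by split => // x y xy; rewrite /radfun xy.
have [_ _ wf] := inX_L2 hX.
apply: filter_forall => i; apply: filterS (weak_gradient_uniq i wf wG) => t ->.
by rewrite /G mxE.
Qed.

Lemma Lform_radfun (F F' : R -> R) g :
  (forall x : R, is_derive x 1 F (F' x)) -> continuous F' ->
  L2 (fun t : X => F (radT t)) -> L2 (fun t : X => F (radT t) * radpow 1 t) ->
  L2 (fun t : X => F' (radT t) * radpow (-1) t) -> inXrad g ->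
  let k := fun t : X => (F' (radT t) * flux (wgrad g) t + V (radT t) * F (radT t) * g (vec t)) * radpow (-2) t in
  L1 k /\ Lform omega u (radfun F) g = Int k.
Proof.
move=> dF cF' F2 xF2 F2' hg k; have [hf wE] := radfun_inXrad dF cF' F2 xF2 F2'.
have [_ _ _ wf] := inXrad_L2 hf; have [_ _ _ wg] := inXrad_L2 hg.
have Ek : k = fun t => (F' (radT t) * radpow (-1) t) * (flux (wgrad g) t * radpow (-1) t) +
   V (radT t) * radpow (-2) t * (radfun F (vec t) * g (vec t)).
  by apply/funext => t; rewrite /k radpow2 /radfun -/(tradius t) -/(radT t); ring.
have lk : L1 k.
  rewrite Ek; apply: L1D; last exact: L1_V.
  exact: (L2_mul F2' (flux_L2 d0 wg)).
split => //; rewrite LformE//; apply: Int_ae.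
- by apply: L1_meas; exact: (L1D (L1_wgrad wf wg) (L1_V hf hg)).
- exact: L1_meas.
apply: filterS wE => t wE; rewrite Ek; congr (_ + _).
under eq_bigr do rewrite wE.
rewrite -[RHS]mulrA (mulrCA (radpow (-1) t)) -expr2 -radpow2 /flux mulr_suml mulr_sumr.
by apply: eq_bigr => i _; ring.
Qed.

Lemma Lform_radfun_self (F F' : R -> R) :
  (forall x : R, is_derive x 1 F (F' x)) -> continuous F' ->
  L2 (fun t : X => F (radT t)) -> L2 (fun t : X => F (radT t) * radpow 1 t) ->
  L2 (fun t : X => F' (radT t) * radpow (-1) t) ->
  let k := fun t : X => (F' (radT t) ^+ 2 + V (radT t) * F (radT t) ^+ 2) * radpow (-2) t in
  Lform omega u (radfun F) (radfun F) = Int k.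
Proof.
move=> dF cF' F2 xF2 F2' k; have [hf wE] := radfun_inXrad dF cF' F2 xF2 F2'.
have [lk ->] := Lform_radfun dF cF' F2 xF2 F2' hf.
have cF : continuous F by move=> x; exact: der_cont (dF x).
apply: Int_ae; first exact: L1_meas lk.
  apply: measurable_funM; last exact: measurable_radpow.
  by apply: (@continuous_radT_measurable R d (fun s => F' s ^+ 2 + V s * F s ^+ 2)); cont.
apply: filterS2 wE (ae_tradius_neq0 d0) => t wE t0; congr (_ * _).
rewrite /k /radfun -/(tradius t) -/(radT t) -mulrA -expr2; congr (_ + _).
rewrite expr2; congr (_ * _); rewrite /flux.
under eq_bigr do rewrite wE.
rewrite (eq_bigr (fun i => (F' (radT t) * radpow (-2) t) * tnth t i ^+ 2)); last by move=> i _; ring.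
rewrite -mulr_sumr (_ : \sum_i _ = tradius t ^+ 2).
  have e : radpow (-2) t * tradius t ^+ 2 = 1 by rewrite radpow_N2// mulVf ?expf_neq0.
  by rewrite -mulrA e mulr1.
by rewrite radE sqr_sqrtr// sumr_ge0// => i _; exact: sqr_ge0.
Qed.

End forms.

(** * The singular solution in logarithmic coordinates *)

Section radial_derivatives.
Context {R : realType} {d : nat}.
Implicit Types (x : 'rV[R]_d) (i : 'I_d).

Lemma line_is_derive (phi : 'rV[R]_d -> R) x i (h : R) :
  differentiable phi (x + h *: delta_mx 0 i) ->
  is_derive h 1 (fun h : R => phi (x + h *: delta_mx 0 i)) (partial i phi (x + h *: delta_mx 0 i)).
Proof.
move=> dphi; set y := x + _.
have E : (fun k : R => k^-1 *: (phi (x + (k *: (1 : R) + h) *: delta_mx 0 i) - phi y)) =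
    (fun k => k^-1 *: (phi (k *: delta_mx 0 i + y) - phi y)).
  apply/funext => k; have -> : k *: (1 : R) = k by rewrite /GRing.scale /= mulr1.
  by rewrite /y scalerDl addrCA.
have dv : derivable phi y (delta_mx 0 i) by exact: diff_derivable.
split.
  by move: dv; rewrite /derivable -E.
by rewrite /partial /derive -E.
Qed.

Lemma enorm_line x i (h : R) :
  enorm (x + h *: delta_mx 0 i) = Num.sqrt (enorm x ^+ 2 + 2 * h * x 0 i + h ^+ 2).
Proof.
have E y : enorm y ^+ 2 = \sum_j y 0 j ^+ 2 :> R.
  by rewrite sqr_sqrtr// sumr_ge0// => j _; exact: sqr_ge0.
rewrite [LHS]/enorm; congr Num.sqrt; rewrite E.
rewrite (bigD1 i)//= [in RHS](bigD1 i)//= !mxE !eqxx mulr1.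
rewrite (eq_bigr (fun j => x 0 j ^+ 2)); first by ring.
by move=> j ji; rewrite !mxE (negbTE ji) andbF mulr0 addr0.
Qed.

Lemma enorm_gt0 x : (0 < enorm x) = (x != 0).
Proof.
rewrite lt0r sqrtr_ge0 andbT /enorm sqrtr_eq0 -ltNge; apply/idP/idP.
  by apply: contraTneq => ->; rewrite big1 ?ltxx// => i _; rewrite mxE expr0n.
move=> x0; rewrite lt_neqAle sumr_ge0 ?andbT => [|i _]; last exact: sqr_ge0.
apply: contraNN x0 => /eqP/esym/psumr_eq0P h; apply/eqP/rowP => i; rewrite mxE.
by apply/eqP; rewrite -sqrf_eq0; apply/eqP/h => // j _; exact: sqr_ge0.
Qed.

Lemma ln_enorm_line x i (h : R) : x + h *: delta_mx 0 i != 0 ->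
  is_derive h 1 (fun h : R => ln (enorm (x + h *: delta_mx 0 i)))
    ((x 0 i + h) / enorm (x + h *: delta_mx 0 i) ^+ 2).
Proof.
rewrite -enorm_gt0 => y0; pose Q (h : R) := enorm x ^+ 2 + 2 * h * x 0 i + h ^+ 2.
have yE k : enorm (x + k *: delta_mx 0 i) = Num.sqrt (Q k) := enorm_line x i k.
have Q0 : 0 < Q h by move: y0; rewrite yE sqrtr_gt0.
have cQ : continuous Q by rewrite /Q; cont.
have dQ : is_derive h 1 Q (2 * x 0 i + 2 * h).
  have := drv_add (drv_add (drv_cst (enorm x ^+ 2) h)
    (drv_mul (drv_mul (drv_cst 2 h) (drv_id h)) (drv_cst (x 0 i) h))) (drv_pow 2 (drv_id h)).
  by rewrite add0r mul0r add0r mulr0 addr0 !mulr1 expr1.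
have d2 := drv_mul (drv_cst 2^-1 h) (drv_comp dQ (is_derive1_ln Q0)).
apply: (@der_near R (fun k => 2^-1 * ln (Q k))).
  have : \forall k \near h, 0 < Q k by exact: (cvgr_gt _ (cQ h) _ Q0).
  apply: filterS => k Qk; rewrite yE -{1}(sqr_sqrtr (ltW Qk)) lnXn ?sqrtr_gt0//.
  by rewrite -[ln _ *+ 2]mulr_natl mulrA mulVf ?mul1r.
move: d2; set v := (X in is_derive _ _ _ X -> _) => d2.
suff <- : v = (x 0 i + h) / enorm (x + h *: delta_mx 0 i) ^+ 2 by [].
by rewrite /v yE sqr_sqrtr ?ltW//; field; rewrite gt_eqF.
Qed.

Lemma line_neq0_near x i : x != 0 -> \forall h \near (0 : R), x + h *: delta_mx 0 i != 0.
Proof.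
rewrite -enorm_gt0 => x0; pose Q (h : R) := enorm x ^+ 2 + 2 * h * x 0 i + h ^+ 2.
have cQ : continuous Q by rewrite /Q; cont.
have Q0 : 0 < Q 0 by rewrite /Q mulr0 mul0r expr0n !addr0 exprn_gt0.
have : \forall k \near (0 : R), 0 < Q k by exact: (cvgr_gt _ (cQ 0) _ Q0).
by apply: filterS => k Qk; rewrite -enorm_gt0 enorm_line sqrtr_gt0.
Qed.

Variables (u : 'rV[R]_d -> R) (g g1 g2 : R -> R).
Hypotheses (su : smooth_on [set x | x != 0] u) (ug : forall x, x != 0 -> u x = g (ln (enorm x)))
  (dg : forall t : R, is_derive t 1 g (g1 t)) (dg1 : forall t : R, is_derive t 1 g1 (g2 t)).

Lemma partial_radial x i : x != 0 -> partial i u x = g1 (ln (enorm x)) * (x 0 i / enorm x ^+ 2).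
Proof.
move=> x0; have x0' : x + 0 *: delta_mx 0 i != 0 by rewrite scale0r addr0.
have := @line_is_derive u x i 0 (su [::] x0').
have := drv_comp (ln_enorm_line x0') (dg _).
rewrite scale0r addr0 addr0 => h1 h2; apply: (der_uniq h2).
apply: der_near h1; apply: filterS (line_neq0_near i x0) => k k0.
by rewrite ug.
Qed.

Lemma partial2_radial x i : x != 0 -> partial i (partial i u) x =
  g2 (ln (enorm x)) * (x 0 i / enorm x ^+ 2) ^+ 2 +
  g1 (ln (enorm x)) * ((enorm x ^+ 2)^-1 - 2 * x 0 i ^+ 2 / enorm x ^+ 4).
Proof.
move=> x0; have x0' : x + 0 *: delta_mx 0 i != 0 by rewrite scale0r addr0.
have ex0 : 0 < enorm x by rewrite enorm_gt0.
have h2 := @line_is_derive (partial i u) x i 0 (su [:: i] x0').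
pose Q (h : R) := enorm x ^+ 2 + 2 * h * x 0 i + h ^+ 2.
have dQ : is_derive (0 : R) 1 Q (2 * x 0 i).
  have := drv_add (drv_add (drv_cst (enorm x ^+ 2) (0 : R))
    (drv_mul (drv_mul (drv_cst 2 (0 : R)) (drv_id (0 : R))) (drv_cst (x 0 i) (0 : R)))) (drv_pow 2 (drv_id (0 : R))).
  set w := (X in is_derive _ _ _ X -> _) => h; suff <- : w = 2 * x 0 i by [].
  by rewrite /w /=; ring.
have Q0 : Q 0 = enorm x ^+ 2 by rewrite /Q mulr0 mul0r expr0n !addr0.
have Qn0 : Q 0 != 0 by rewrite Q0 expf_neq0// gt_eqF.
have hT := ln_enorm_line x0'.
have h1 := drv_mul (drv_comp hT (dg1 _))
  (drv_mul (drv_add (drv_cst (x 0 i) (0 : R)) (drv_id (0 : R))) (drv_inv Qn0 dQ)).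
rewrite scale0r addr0 in h2.
rewrite (der_uniq h2 (der_near _ h1)).
  rewrite scale0r !addr0 Q0; field.
  by rewrite gt_eqF.
apply: filterS (line_neq0_near i x0) => k k0.
rewrite partial_radial// !mxE !eqxx mulr1; congr (_ * (_ / _)).
rewrite enorm_line sqr_sqrtr//; apply: ltW.
by move: k0; rewrite -enorm_gt0 enorm_line sqrtr_gt0.
Qed.

Lemma laplacian_radial x : x != 0 ->
  laplacian u x = (g2 (ln (enorm x)) + (d%:R - 2) * g1 (ln (enorm x))) / enorm x ^+ 2.
Proof.
move=> x0; rewrite /laplacian; under eq_bigr do rewrite partial2_radial//.
have ex0 : 0 < enorm x by rewrite enorm_gt0.
rewrite (eq_bigr (fun i => (g2 (ln (enorm x)) - 2 * g1 (ln (enorm x))) / enorm x ^+ 4 * x 0 i ^+ 2 +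
   g1 (ln (enorm x)) / enorm x ^+ 2)); last first.
  by move=> i _; field; rewrite gt_eqF.
rewrite big_split /= -mulr_sumr sumr_const card_ord.
have -> : \sum_i x 0 i ^+ 2 = enorm x ^+ 2.
  by rewrite sqr_sqrtr// sumr_ge0// => i _; exact: sqr_ge0.
rewrite -mulr_natl; field.
by rewrite gt_eqF.
Qed.

End radial_derivatives.

Lemma expR_small (R : realType) (k e t1 : R) : 0 < k -> 0 < e ->
  exists2 t, t <= t1 & forall s, s <= t -> expR (k * s) < e.
Proof.
move=> k0 e0; exists (Num.min t1 ((ln e - 1) / k)); first by rewrite ge_min lexx.
move=> s; rewrite le_min => /andP[_]; rewrite ler_pdivlMr// mulrC => h.
rewrite -[ltRHS]lnK ?posrE// ltr_expR; lra.
Qed.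

Lemma exp_diff_bound (R : realType) (p p' : R -> R) (K k t0 t1 : R) : 0 < k -> t0 <= t1 ->
  (forall t, t0 <= t <= t1 -> is_derive t 1 p (p' t)) ->
  (forall t, t0 <= t <= t1 -> `|p' t| <= K * expR (k * t)) ->
  `|p t1 - p t0| <= K / k * (expR (k * t1) - expR (k * t0)).
Proof.
move=> k0 t01 dp hp.
have dE (t : R) : is_derive t 1 (fun t => K / k * expR (k * t)) (K * expR (k * t)).
  have := drv_mul (drv_cst (K / k) t) (drv_expR (drv_mul (drv_cst k t) (drv_id t))).
  set w := (X in is_derive _ _ _ X -> _) => h; suff <- : w = K * expR (k * t) by [].
  by rewrite /w; field; rewrite gt_eqF.
have h1 : K / k * expR (k * t0) - p t0 <= K / k * expR (k * t1) - p t1.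
  apply: (@der_nondec _ (fun t => K / k * expR (k * t) - p t) (fun t => K * expR (k * t) - p' t) _ _ t01).
    by move=> x hx; exact: (drv_add (dE x) (drv_opp (dp x hx))).
  move=> x /andP[/ltW h2 /ltW h3]; rewrite subr_ge0; apply: le_trans (ler_norm _) _.
  by apply: hp; rewrite h2 h3.
have h2 : K / k * expR (k * t0) + p t0 <= K / k * expR (k * t1) + p t1.
  apply: (@der_nondec _ (fun t => K / k * expR (k * t) + p t) (fun t => K * expR (k * t) + p' t) _ _ t01).
    by move=> x hx; exact: (drv_add (dE x) (dp x hx)).
  move=> x /andP[/ltW h2 /ltW h3]; have : - p' x <= K * expR (k * x).
    by apply: le_trans (ler_norm _) _; rewrite normrN; apply: hp; rewrite h2 h3.
  lra.
rewrite ler_norml mulrBr; apply/andP; split; lra.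
Qed.

(** The derivative is integrated from a point far to the left where [p] is small. *)
Lemma decay_at_ninfty (R : realType) (p p' : R -> R) (K k t0 : R) : 0 < k -> 0 <= K ->
  (forall t, t <= t0 -> is_derive t 1 p (p' t)) ->
  (forall t, t <= t0 -> `|p' t| <= K * expR (k * t)) ->
  (forall e t1, 0 < e -> exists2 t, t <= t1 & `|p t| < e) ->
  forall t, t <= t0 -> `|p t| <= K / k * expR (k * t).
Proof.
move=> k0 K0 dp hp sp t tt0; rewrite leNgt; apply/negP => h.
have [t1 t1t h1] := sp (`|p t| - K / k * expR (k * t)) t ltac:(by rewrite subr_gt0).
have := @exp_diff_bound _ p p' K k t1 t k0 t1t.
move=> /(_ (fun x hx => dp x (le_trans (andP hx).2 tt0))).
move=> /(_ (fun x hx => hp x (le_trans (andP hx).2 tt0))).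
have : 0 <= K / k * expR (k * t1) by rewrite mulr_ge0 ?expR_ge0// divr_ge0// ltW.
rewrite mulrBr; have := ler_normD (p t - p t1) (p t1); rewrite subrK; lra.
Qed.

Record sing_profile {R : realType} (d : nat) (omega : R) (f f1 f2 : R -> R) : Prop := SingProfile {
  sp_der : forall t : R, is_derive t 1 f (f1 t);
  sp_der1 : forall t : R, is_derive t 1 f1 (f2 t);
  sp_ode : forall t, f2 t = - (d%:R - 4) * f1 t + (d%:R - 3) * (f t * (1 - f t ^+ 2)) +
    (expR (2 * t) ^+ 2 - omega * expR (2 * t)) * f t;
  sp_pos : forall t, 0 < f t;
  sp_origin : exists C t0 : R, forall t : R, t <= t0 ->
    `|f t - 1| <= C * expR (2 * t) /\ `|f1 t| <= C * expR (2 * t);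
  sp_decay : exists C a : R, 0 < a /\ forall t : R, 0 <= t -> f t <= C * (expR t * expR (- a * expR t))
}.

(* The Emden--Fowler change of variables: u(x) = sqrt(d-3) f(ln|x|) / |x|. *)
Lemma sing_profile_exists {R : realType} (n : nat) (omega : R) (u : 'rV[R]_n.+1 -> R) :
  (5 <= n.+1)%N -> singular_solution omega u -> exists f f1 f2,
    sing_profile n.+1 omega f f1 f2 /\
    forall x, x != 0 -> u x = Num.sqrt (n.+1%:R - 3) * f (ln (enorm x)) * expR (- ln (enorm x)).
Proof.
move=> d5 hu; pose d : R := n.+1%:R; have d5r : 5 <= d by rewrite /d (ler_nat R 5).
pose e0 : 'rV[R]_n.+1 := delta_mx 0 ord0.
have en_e0 r : 0 < r -> enorm (r *: e0) = r :> R.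
  move=> r0; rewrite -[r *: e0]add0r enorm_line mxE !mulr0 addr0.
  rewrite (_ : enorm _ = 0) ?expr0n ?add0r ?sqrtr_sqr ?ger0_norm ?ltW//.
  rewrite /enorm big1 ?sqrtr0// => j _; rewrite mxE expr0n//.
have re0 r : 0 < r -> r *: e0 != 0 by move=> r0; rewrite -enorm_gt0 en_e0.
(* The derivatives of the radial function [u] are read off along the first coordinate axis. *)
pose v k r := iter k (partial ord0) u (r *: e0).
have dv k (r : R) : 0 < r -> is_derive r 1 (v k) (v k.+1 r).
  move=> r0; have h : (0 : 'rV[R]_n.+1) + r *: e0 != 0 by rewrite add0r re0.
  have := @line_is_derive _ _ (iter k (partial ord0) u) 0 ord0 r.
  have E : iter k (partial ord0) u = foldr (partial (d := n.+1)) u (nseq k ord0).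
    by elim: k => //= k ->.
  rewrite {1}E => /(_ (sing_smooth hu (nseq k ord0) h)); rewrite add0r.
  by apply: der_ext => y; rewrite add0r.
have dexp (t : R) : is_derive t 1 (@expR R) (expR t) by exact: is_derive_expR.
pose g t := v 0%N (expR t).
pose g1 t := v 1%N (expR t) * expR t.
pose g2 t := v 2%N (expR t) * expR t * expR t + v 1%N (expR t) * expR t.
have dg (t : R) : is_derive t 1 g (g1 t) := drv_comp (dexp t) (dv 0%N _ (expR_gt0 t)).
have dg1 (t : R) : is_derive t 1 g1 (g2 t) :=
  drv_mul (drv_comp (dexp t) (dv 1%N _ (expR_gt0 t))) (dexp t).
have ug x : x != 0 -> u x = g (ln (enorm x)).
  rewrite -enorm_gt0 => x0; apply: (sing_radial hu).
  by rewrite lnK ?posrE// en_e0.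
have geq t : g2 t + (d - 2) * g1 t =
    (expR (2 * t) ^+ 2 - omega * expR (2 * t)) * g t - expR (2 * t) * g t ^+ 3.
  have x0 := re0 _ (expR_gt0 t).
  have := sing_eq hu x0; rewrite (laplacian_radial (sing_smooth hu) ug dg dg1 x0) ug//.
  rewrite en_e0 ?expR_gt0// expRK -/d expRM_natl.
  have := expR_gt0 t; move: (expR t) (g t) (g1 t) (g2 t) => r x x1 x2 r0 e.
  have {}e : (x2 + (d - 2) * x1) / r ^+ 2 = r ^+ 2 * x - omega * x - x ^+ 3 by move: e; lra.
  have -> : x2 + (d - 2) * x1 = r ^+ 2 * ((x2 + (d - 2) * x1) / r ^+ 2).
    by field; rewrite gt_eqF.
  by rewrite e; ring.
pose K : R := Num.sqrt (d - 3).
have K0 : 0 < K by rewrite sqrtr_gt0; lra.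
have KK : K ^+ 2 = d - 3 by rewrite sqr_sqrtr//; lra.
pose f t := K^-1 * (expR t * g t).
pose f1 t := K^-1 * (expR t * g t + expR t * g1 t).
pose f2 t := K^-1 * ((expR t * g t + expR t * g1 t) + (expR t * g1 t + expR t * g2 t)).
have df (t : R) : is_derive t 1 f (f1 t).
  have := drv_mul (drv_cst K^-1 t) (drv_mul (dexp t) (dg t)).
  by rewrite mul0r add0r.
have df1 (t : R) : is_derive t 1 f1 (f2 t).
  have := drv_mul (drv_cst K^-1 t) (drv_add (drv_mul (dexp t) (dg t)) (drv_mul (dexp t) (dg1 t))).
  by rewrite mul0r add0r.
have fpos t : 0 < f t.
  rewrite /f mulr_gt0 ?invr_gt0// mulr_gt0 ?expR_gt0//.
  exact: (sing_pos hu (re0 _ (expR_gt0 t))).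
have fode t : f2 t = - (d - 4) * f1 t + (d - 3) * (f t * (1 - f t ^+ 2)) +
    (expR (2 * t) ^+ 2 - omega * expR (2 * t)) * f t.
  have e := geq t; rewrite /f2 /f1 /f -KK.
  have E2 : g2 t = (expR (2 * t) ^+ 2 - omega * expR (2 * t)) * g t - expR (2 * t) * g t ^+ 3 -
    (d - 2) * g1 t by rewrite -e; ring.
  rewrite E2 expRM_natl; have Kn0 : K != 0 by rewrite gt_eqF.
  have -> : d = K ^+ 2 + 3 by rewrite KK; ring.
  move: (expR t) (g t) (g1 t) => r x x1; field.
  exact: Kn0.
have fu x : x != 0 -> u x = K * f (ln (enorm x)) * expR (- ln (enorm x)).
  move=> x0; rewrite ug// /f; move: (ln _) => t; rewrite expRN.
  by field; rewrite (gt_eqF K0) (gt_eqF (expR_gt0 t)).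
have [C [t0 [C0 t00 fO]]] : exists C t0, [/\ 0 <= C, t0 <= 0 &
    forall t, t <= t0 -> `|f t - 1| <= C * expR (2 * t)].
  have [C C0] := (eqO_exP _ _ _).1 (sing_origin hu).
  move=> /nbhs_ballP[e /= e00 he].
  exists C, (Num.min 0 (ln (e / 2))); split; [exact: ltW|by rewrite ge_min lexx|].
  move=> t; rewrite le_min => /andP[_ te].
  have x0 := re0 _ (expR_gt0 t).
  have := he (expR t *: e0) _ x0; rewrite en_e0 ?expR_gt0//.
  have -> : u (expR t *: e0) * expR t / Num.sqrt (n.+1%:R - 3) - 1 = f t - 1.
    by rewrite /f /g /v /= -/d -/K; congr (_ - _); rewrite mulrC [expR t * _]mulrC.
  rewrite [`|expR t ^+ 2|]ger0_norm ?exprn_ge0 ?expR_ge0// -expRM_natl; apply.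
  split => // i j; rewrite (ord1 i) !mxE /ball /= sub0r normrN.
  apply: (@le_lt_trans _ _ (expR t)).
    rewrite normrM (ger0_norm (expR_ge0 t)) -[leRHS]mulr1 ler_wpM2l ?expR_ge0//.
    by case: (j == _); rewrite ?normr1 ?normr0 ?lexx ?ler01.
  apply: (@le_lt_trans _ _ (e / 2)).
    by rewrite -[leRHS]lnK ?ler_expR// posrE divr_gt0.
  by rewrite ltr_pdivrMr// mulr_natr mulr2n ltrDl.
exists f, f1, f2; split; last exact: fu.
pose m : R := d - 4; have m1 : 1 <= m by rewrite /m; lra.
(* The behaviour assumed at the origin bounds f - 1 but not its derivative. The equation gives p' =
   O(e^{(m+2)t}), from which f1 = O(e^{2t}) once [p] is known to be small somewhere far to the
   left. *)
pose p t := expR (m * t) * f1 t.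
pose p' t := expR (m * t) * ((d - 3) * (f t * (1 - f t ^+ 2)) +
    (expR (2 * t) ^+ 2 - omega * expR (2 * t)) * f t).
have dp (t : R) : is_derive t 1 p (p' t).
  have := drv_mul (drv_expR (drv_mul (drv_cst m t) (drv_id t))) (df1 t).
  set w := (X in is_derive _ _ _ X -> _) => h; suff <- : w = p' t by [].
  by rewrite /w /p' fode -/m; ring.
pose K1 : R := (d - 3) * (1 + C) * C * (2 + C) + (1 + `|omega|) * (1 + C).
have K10 : 0 <= K1.
  have h1 : 0 <= d - 3 by lra.
  have h2 : 0 <= 1 + C by lra.
  have h3 : 0 <= 2 + C by lra.
  have h4 : 0 <= 1 + `|omega| by rewrite addr_ge0.
  by rewrite /K1; apply: addr_ge0; rewrite !mulr_ge0.
have s1 t : t <= t0 -> 0 < expR (2 * t) <= 1.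
  by move=> tt0; rewrite expR_gt0 -[leRHS]expR0 ler_expR /=; lra.
have hp' t : t <= t0 -> `|p' t| <= K1 * expR ((m + 2) * t).
  move=> tt0; have /andP[h1 h2] := s1 t tt0; have := fO t tt0.
  rewrite (_ : (m + 2) * t = m * t + 2 * t); last by ring.
  move=> h3; rewrite expRD /p' normrM ger0_norm ?expR_ge0// [leRHS]mulrCA.
  apply: ler_wpM2l; first exact: expR_ge0.
  have := normr_ge0 omega; move: h1 h2 h3; move: (expR (2 * t)) (f t) (fpos t) => s x x0 s0 s1' h3 w0.
  have hx : x <= 1 + C.
    have := ler_norm (x - 1); have : C * s <= C by rewrite ler_piMr.
    by lra.
  have h4 : `|1 - x ^+ 2| <= C * (2 + C) * s.
    rewrite (_ : 1 - x ^+ 2 = - ((x - 1) * (x + 1))); last by ring.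
    rewrite normrN normrM [`|x + 1|]ger0_norm; last by lra.
    rewrite (_ : C * (2 + C) * s = (C * s) * (2 + C)); last by ring.
    by apply: ler_pM => //; lra.
  apply: le_trans (ler_normD _ _) _.
  rewrite /K1 [leRHS]mulrDl; apply: lerD.
    rewrite normrM [`|d - 3|]ger0_norm; last by lra.
    rewrite normrM (ger0_norm (ltW x0)).
    rewrite (_ : (d - 3) * (1 + C) * C * (2 + C) * s = (d - 3) * ((1 + C) * (C * (2 + C) * s))); last by ring.
    apply: ler_wpM2l; first by lra.
    by apply: ler_pM => //; exact: ltW.
  rewrite normrM (ger0_norm (ltW x0)) (_ : (1 + `|omega|) * (1 + C) * s = ((1 + `|omega|) * s) * (1 + C)); last by ring.
  apply: ler_pM => //; first exact: ltW.
  apply: le_trans (ler_normB _ _) _; rewrite [`|omega * s|]normrM (ger0_norm (ltW s0)) (ger0_norm (exprn_ge0 2 (ltW s0))) [leRHS]mulrDl mul1r lerD2r.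
  by rewrite expr2 ler_piMr// ltW.
(* The mean value theorem on [t - 1, t] yields points arbitrarily far to the left at which [f1] is
   bounded, while e^{mt} is small. *)
have sp (e t1 : R) : 0 < e -> exists2 t, t <= t1 & `|p t| < e.
  move=> e00; have C1 : 0 < 2 * C + 1 by lra.
  have e0' : 0 < e / (2 * C + 1) by rewrite divr_gt0.
  have [t tt1 ht] := @expR_small R m _ (Num.min t1 t0) (lt_le_trans ltr01 m1) e0'.
  have tt0 : t <= t0 by apply: le_trans tt1 _; rewrite ge_min lexx orbT.
  have [c /andP[c1 c2] hc] := @der_MVT R f f1 (t - 1) t ltac:(by rewrite ltrBlDr ltrDl) (fun x _ => df x).
  exists c; first by apply: le_trans (ltW c2) (le_trans tt1 _); rewrite ge_min lexx.
  have f1c : `|f1 c| <= 2 * C.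
    have e1 : t - (t - 1) = 1 by ring.
    rewrite e1 mulr1 in hc; rewrite -hc.
    have h1 := fO t tt0; have h2 := fO (t - 1) ltac:(lra).
    have /andP[_ h3] := s1 t tt0; have /andP[_ h4] := s1 (t - 1) ltac:(lra).
    have h5 : C * expR (2 * t) <= C by rewrite ler_piMr.
    have h6 : C * expR (2 * (t - 1)) <= C by rewrite ler_piMr.
    have := ler_normB (f t - 1) (f (t - 1) - 1).
    rewrite (_ : f t - 1 - (f (t - 1) - 1) = f t - f (t - 1)); last by ring.
    by lra.
  rewrite /p normrM ger0_norm ?expR_ge0//.
  have := ht c (ltW c2); rewrite ltr_pdivlMr; last by lra.
  move=> h; apply: le_lt_trans h; apply: ler_wpM2l; first exact: expR_ge0.
  by lra.
have m20 : 0 < m + 2 by lra.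
have hp := decay_at_ninfty m20 K10 (fun t _ => dp t) hp' sp.
split => //.
- exists (C + K1 / (m + 2)), t0 => t tt0; have s0 := expR_ge0 (2 * t).
  have k0 : 0 <= K1 / (m + 2) by rewrite divr_ge0// ltW.
  split.
    by apply: le_trans (fO t tt0) _; rewrite ler_wpM2r// lerDl.
  have := hp t tt0; rewrite /p normrM ger0_norm ?expR_ge0// (_ : (m + 2) * t = m * t + 2 * t); last by ring.
  rewrite expRD mulrCA ler_pM2l ?expR_gt0// => h; apply: le_trans h _.
  by rewrite ler_wpM2r// lerDr.
- have [C1 [a [a0 ha]]] := sing_decay hu; exists (K^-1 * C1), a; split => // t tt0.
  have := ha (expR t *: e0); rewrite en_e0 ?expR_gt0// => /(_ _)/= h.
  rewrite /f -mulrA ler_pM2l ?invr_gt0// [C1 * _]mulrCA ler_pM2l ?expR_gt0//; apply: h.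
  by rewrite -expR0 ler_expR.
Unshelve. all: by end_near. Qed.

(** * Monotonicity and bounds for the singular profile *)

Section comparison.
Context {R : realType}.

Lemma first_zero (f : R -> R) (a b : R) : continuous f -> a <= b -> 0 < f a -> f b <= 0 ->
  exists c, [/\ a < c <= b, f c = 0 & forall t, a <= t -> t < c -> 0 < f t].
Proof.
move=> cf ab fa fb; pose S : set R := [set t | a <= t <= b /\ f t <= 0].
have Sb : S b by rewrite /S /= ab lexx.
have lS : has_lbound S by exists a => t [/andP[]].
have iS : has_inf S by split; [exists b|].
pose c := inf S.
have ac : a <= c by apply: lb_le_inf; [exists b|move=> t [/andP[]]].
have cb : c <= b by exact: ge_inf.
have fpos t : a <= t -> t < c -> 0 < f t.
  move=> h1 h2; rewrite ltNge; apply/negP => h3.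
  have St : S t by split => //; rewrite h1 (le_trans (ltW h2)).
  by have := ge_inf lS St; rewrite leNgt h2.
have fc0 : f c <= 0.
  rewrite leNgt; apply/negP => fc.
  have /nbhs_ballP[e /= e0 he] : nbhs c [set t | 0 < f t] by exact: (cvgr_gt _ (cf c) _ fc).
  have [t St tc] := inf_adherent e0 iS.
  have ct : c <= t by exact: ge_inf.
  have := he t; rewrite /ball /= distrC ger0_norm ?subr_ge0// ltrBlDl => /(_ tc).
  by case: St => _; rewrite leNgt => /negP h /h.
have a_c : a < c.
  by rewrite lt_neqAle ac andbT; apply/eqP => e; move: fc0; rewrite -e leNgt fa.
exists c; split; rewrite ?a_c ?cb//.
apply/eqP; rewrite eq_le fc0 /= leNgt; apply/negP => fc.
have /nbhs_ballP[e /= e0 he] : nbhs c [set t | f t < 0] by exact: (cvgr_lt _ (cf c) _ fc).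
pose t := Num.max a (c - e / 2).
have tc : t < c by rewrite gt_max a_c ltrBlDr ltrDl divr_gt0.
have := fpos t; rewrite le_max lexx => /(_ erefl tc) ft.
have := he t; rewrite /ball /= ger0_norm ?subr_ge0 ?ltW// => h.
have : c - t < e.
  have : c - e / 2 <= t by rewrite le_max lexx orbT.
  by have : 0 < e by []; lra.
by move=> /h; rewrite ltNge (ltW ft).
Qed.

(** Zero is only a limit point at minus infinity; with monotonicity this is enough to determine
    signs. *)
Definition vanishing (f : R -> R) := forall e t, 0 < e -> exists2 t', t' <= t & `|f t'| < e.

Lemma vanishing_exp (f : R -> R) (K k t0 : R) : 0 < k ->
  (forall t, t <= t0 -> `|f t| <= K * expR (k * t)) -> vanishing f.
Proof.
move=> k0 hf e t e0; have K1 : 0 < `|K| + 1 by rewrite ltr_pwDr.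
have e1 : 0 < e / (`|K| + 1) by rewrite divr_gt0.
have [t' tt' h] := expR_small (Num.min t t0) k0 e1.
move: tt'; rewrite le_min => /andP[h1 h2]; exists t' => //.
apply: le_lt_trans (hf _ h2) _; have := h t' (lexx _).
rewrite ltr_pdivlMr// mulrC => h3; apply: le_lt_trans _ h3.
by rewrite ler_wpM2r ?expR_ge0// (le_trans (ler_norm K))// lerDl.
Qed.

Lemma inc_from_ninfty (f f' : R -> R) (t2 : R) :
  (forall t, t <= t2 -> is_derive t 1 f (f' t)) -> (forall t, t < t2 -> 0 < f' t) ->
  vanishing f -> forall t, t <= t2 -> 0 < f t.
Proof.
move=> df f0 vf; have inc x y : x < y -> y <= t2 -> f x < f y.
  move=> xy yt; apply: (@der_inc _ f f' x y xy) => z /andP[_ zy].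
    by apply: df; exact: le_trans zy yt.
  by apply: f0; exact: lt_le_trans zy yt.
move=> t tt; have h1 : f (t - 1) < f t by apply: inc => //; rewrite ltrBlDr ltrDl.
suff : 0 <= f (t - 1) by move=> h; exact: le_lt_trans h h1.
rewrite leNgt; apply/negP => neg.
have [t' ht' h] := vf (- f (t - 1)) (t - 2) ltac:(by rewrite oppr_gt0).
have : f t' < f (t - 1) by apply: inc; lra.
move: h; rewrite ltr_norml => /andP[h _]; move: h; rewrite opprK; lra.
Qed.

Lemma nondec_from_ninfty (f f' : R -> R) (t2 : R) :
  (forall t, t <= t2 -> is_derive t 1 f (f' t)) -> (forall t, t < t2 -> 0 <= f' t) ->
  vanishing f -> forall t, t <= t2 -> 0 <= f t.
Proof.
move=> df f0 vf t tt; rewrite leNgt; apply/negP => neg.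
have [t' ht' h] := vf (- f t) t ltac:(by rewrite oppr_gt0).
have : f t' <= f t.
  apply: (@der_nondec _ f f' t' t ht') => z /andP[_ zt].
    by apply: df; exact: le_trans zt tt.
  by apply: f0; exact: lt_le_trans zt tt.
move: h; rewrite ltr_norml => /andP[h _]; move: h; rewrite opprK; lra.
Qed.

Lemma drv_exp_lin (k t : R) : is_derive t 1 (fun t => expR (k * t)) (k * expR (k * t)).
Proof.
have := drv_expR (drv_mul (drv_cst k t) (drv_id t)).
by rewrite mul0r add0r mulr1 mulrC.
Qed.

(* The operator D^2 + (d-4) D + 4(d-8) = (D+4)(D+d-8) is inverted by
   integrating twice from minus infinity. *)
Section positivity.
Variables (d : R) (eta eta1 eta2 p : R -> R) (t1 C : R).
Hypotheses (d10 : 10 <= d) (C0 : 0 <= C)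
  (de : forall t : R, is_derive t 1 eta (eta1 t))
  (de1 : forall t : R, is_derive t 1 eta1 (eta2 t))
  (p0 : forall t, t <= t1 -> 0 <= p t <= 2 * d - 26 + C * expR (2 * t))
  (bnd : exists M t0 : R, forall t, t <= t0 -> `|eta t| <= M /\ `|eta1 t| <= M).

(** [eta] is only bounded near minus infinity, so a small multiple of a strict supersolution [G],
    growing like e^{-2t} there, is added to make it positive far to the left. Up to a first zero of
    the sum [z] both integrations preserve positivity, so e^{(d-8)t} z increases and cannot
    vanish. *)
Lemma positivity :
  (forall t, t <= t1 -> p t * eta t <= eta2 t + (d - 4) * eta1 t + 4 * (d - 8) * eta t) ->
  forall t, t <= t1 -> 0 <= eta t.
Proof.
move=> H; have [M [t0 hM]] := bnd.
have M0 : 0 <= M by have [h _] := hM t0 (lexx _); exact: le_trans h.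
(* The operator applied to [G] is [G] times 4 B^2 s^2 + (2d - 12) B s + 2d - 20; this choice of [B]
   makes the factor exceed the upper bound of [p]. *)
pose B := C / (2 * d - 12); have B0 : 0 <= B by apply: divr_ge0 => //; have : 10 <= d := d10; lra.
pose s t : R := expR (2 * t).
pose G t : R := expR (B * s t - 2 * t).
have ds (t : R) : is_derive t 1 s (2 * s t) := drv_exp_lin 2 t.
have dG (t : R) : is_derive t 1 G ((2 * B * s t - 2) * G t).
  have := drv_expR (drv_add (drv_mul (drv_cst B t) (ds t)) (drv_opp (drv_mul (drv_cst 2 t) (drv_id t)))).
  set w := (X in is_derive _ _ _ X -> _) => h; suff <- : w = (2 * B * s t - 2) * G t by [].
  by rewrite /w /G; ring.
pose G1 t := (2 * B * s t - 2) * G t.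
pose G2 t := (4 * B * s t + (2 * B * s t - 2) ^+ 2) * G t.
have dG1 (t : R) : is_derive t 1 G1 (G2 t).
  have := drv_mul (drv_add (drv_mul (drv_cst (2 * B) t) (ds t)) (drv_cst (- 2) t)) (dG t).
  set w := (X in is_derive _ _ _ X -> _) => h; suff <- : w = G2 t by [].
  by rewrite /w /G2; ring.
have G0 t : 0 < G t by exact: expR_gt0.
have s0 t : 0 < s t by exact: expR_gt0.
have LG t : t <= t1 -> p t * G t < G2 t + (d - 4) * G1 t + 4 * (d - 8) * G t.
  move=> tt; have /andP[_ hp] := p0 tt.
  rewrite /G2 /G1 (_ : _ + _ + _ = (4 * B * s t + (2 * B * s t - 2) ^+ 2 + (d - 4) * (2 * B * s t - 2) + 4 * (d - 8)) * G t); last by ring.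
  rewrite ltr_pM2r//; apply: le_lt_trans hp _; rewrite -/(s t).
  have e : (2 * d - 12) * B = C by rewrite /B mulrC divfK// gt_eqF//; have : 10 <= d := d10; lra.
  rewrite -e; have := sqr_ge0 (B * s t); nra.
suff main (de_ : R) : 0 < de_ -> forall t, t <= t1 -> 0 < eta t + de_ * G t.
  move=> t tt; rewrite leNgt; apply/negP => neg.
  have de0 : 0 < - eta t / (2 * G t) by rewrite divr_gt0 ?oppr_gt0// mulr_gt0.
  have := main _ de0 t tt; rewrite invfM mulrA divfK ?gt_eqF//; lra.
move=> de0; pose z t := eta t + de_ * G t; pose z1 t := eta1 t + de_ * G1 t.
pose z2 t := eta2 t + de_ * G2 t.
have dz (t : R) : is_derive t 1 z (z1 t).
  by have := drv_add (de t) (drv_mul (drv_cst de_ t) (dG t)); rewrite mul0r add0r.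
have dz1 (t : R) : is_derive t 1 z1 (z2 t).
  by have := drv_add (de1 t) (drv_mul (drv_cst de_ t) (dG1 t)); rewrite mul0r add0r.
have Hz t : t <= t1 -> p t * z t < z2 t + (d - 4) * z1 t + 4 * (d - 8) * z t.
  move=> tt; have := H t tt; have := LG t tt; rewrite -(ltr_pM2l de0) /z /z1 /z2.
  move: (eta t) (eta1 t) (eta2 t) (G t) (G1 t) (G2 t) (p t) => x x1 x2 g g1 g2 q; lra.
have cz : continuous z by move=> t; exact: der_cont (dz t).
have [tm [tm0 hz]] : exists tm, (tm <= Num.min t0 0) /\ forall t, t <= tm -> 0 < z t.
  have M1 : 0 < M + 1 by rewrite ltr_wpDl.
  have e0 : 0 < de_ / (M + 1) by rewrite divr_gt0.
  have [tm h1 h2] := @expR_small R 2 _ (Num.min t0 0) ltac:(by []) e0.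
  exists tm; split => // t tt; have := h2 t tt; rewrite (ltr_pdivlMr _ _ M1) => h3.
  have [h4 _] := hM t ltac:(by apply: le_trans tt (le_trans h1 _); rewrite ge_min lexx).
  have h5 : expR (- (2 * t)) <= G t.
    by rewrite /G ler_expR lerDr mulr_ge0// ltW.
  have h6 : M + 1 < de_ * G t.
    apply: lt_le_trans (_ : de_ * expR (- (2 * t)) <= _); last by rewrite ler_pM2l.
    by rewrite expRN ltr_pdivlMr ?expR_gt0// mulrC.
  move: h4; rewrite ler_norml => /andP[h4 _]; rewrite /z; lra.
move=> t tt; rewrite ltNge; apply/negP => neg.
have tmt : tm <= t.
  by rewrite leNgt; apply/negP => /ltW /hz; rewrite /z ltNge neg.
have [c [/andP[tmc ct] zc zpos]] := first_zero cz tmt (hz _ (lexx _)) neg.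
have zp x : x < c -> 0 < z x.
  by move=> xc; case: (leP x tm) => [/hz//|/ltW h]; exact: zpos.
have ct1 : c <= t1 by exact: le_trans ct tt.
pose f x := expR (4 * x) * (z1 x + (d - 8) * z x).
pose f' x := expR (4 * x) * (z2 x + (d - 4) * z1 x + 4 * (d - 8) * z x).
have df (x : R) : is_derive x 1 f (f' x).
  have := drv_mul (drv_exp_lin 4 x) (drv_add (dz1 x) (drv_mul (drv_cst (d - 8) x) (dz x))).
  set w := (X in is_derive _ _ _ X -> _) => h; suff <- : w = f' x by [].
  by rewrite /w /f'; ring.
have vz x : x <= tm -> `|z x| <= (M + de_ * expR B) * expR (- (2 * x)) /\
    `|z1 x| <= (M + de_ * ((2 * B + 2) * expR B)) * expR (- (2 * x)).
  move=> xt; have xm := le_trans xt tm0; move: xm; rewrite le_min => /andP[x0 xn].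
  have [h1 h2] := hM x x0.
  have E1 : 1 <= expR (- (2 * x)) by rewrite -[leLHS]expR0 ler_expR; lra.
  have s1 : s x <= 1 by rewrite /s -[leRHS]expR0 ler_expR; lra.
  have gx : G x <= expR B * expR (- (2 * x)).
    by rewrite /G expRD ler_pM2r ?expR_gt0// ler_expR ler_piMr.
  have hMe : M <= M * expR (- (2 * x)) by rewrite ler_peMr.
  split; apply: le_trans (ler_normD _ _) _; rewrite mulrDl; apply: lerD.
  - exact: le_trans h1 hMe.
  - by rewrite normrM !gtr0_norm// -mulrA ler_pM2l.
  - exact: le_trans h2 hMe.
  - rewrite normrM gtr0_norm// -mulrA ler_pM2l// -mulrA /G1 normrM (gtr0_norm (G0 x)).
    apply: ler_pM => //; first exact: ltW.
    have hB : 0 <= B * s x by rewrite mulr_ge0// ltW.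
    have hB1 : B * s x <= B by rewrite ler_piMr.
    by rewrite ler_norml; apply/andP; split; lra.
have vf : vanishing f.
  pose K := (M + de_ * ((2 * B + 2) * expR B)) + (d - 8) * (M + de_ * expR B).
  apply: (@vanishing_exp f K 2 tm) => // x xt; have [h1 h2] := vz x xt.
  rewrite /f normrM gtr0_norm ?expR_gt0//.
  have -> : K * expR (2 * x) = expR (4 * x) * (K * expR (- (2 * x))).
    by rewrite mulrCA -expRD; congr (_ * expR _); ring.
  rewrite ler_pM2l ?expR_gt0//; apply: le_trans (ler_normD _ _) _.
  rewrite /K [leRHS]mulrDl; apply: lerD => //.
  rewrite normrM -[leRHS]mulrA ger0_norm; last by have : 10 <= d := d10; lra.
  by apply: ler_wpM2l => //; have : 10 <= d := d10; lra.
have fpos := @inc_from_ninfty f f' c (fun x _ => df x) _ vf.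
have {}fpos x : x <= c -> 0 < f x.
  apply: fpos => y yc; rewrite /f' mulr_gt0 ?expR_gt0//.
  have yt1 : y <= t1 := le_trans (ltW yc) ct1.
  apply: le_lt_trans (Hz y yt1); have /andP[py _] := p0 yt1.
  by rewrite mulr_ge0// ltW// zp.
pose g x := expR ((d - 8) * x) * z x.
have dg (x : R) : is_derive x 1 g (expR ((d - 8) * x) * (z1 x + (d - 8) * z x)).
  have := drv_mul (drv_exp_lin (d - 8) x) (dz x).
  set w := (X in is_derive _ _ _ X -> _) => h; suff <- : w = expR ((d - 8) * x) * (z1 x + (d - 8) * z x) by [].
  by rewrite /w; ring.
have : g tm < g c.
  apply: (@der_inc _ g (fun x => expR ((d - 8) * x) * (z1 x + (d - 8) * z x)) tm c tmc) => x.
  move=> /andP[_ /ltW xc]; rewrite mulr_gt0 ?expR_gt0//.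
  by have := fpos x xc; rewrite /f pmulr_rgt0// expR_gt0.
rewrite /g zc mulr0 ltNge => /negP; apply.
by rewrite mulr_ge0 ?expR_ge0// ltW// hz.
Qed.

Lemma positivity_strict :
  (forall t, t <= t1 -> p t * eta t < eta2 t + (d - 4) * eta1 t + 4 * (d - 8) * eta t) ->
  forall t, t <= t1 -> 0 < eta t.
Proof.
move=> H; have [M [t0 hM]] := bnd.
have eta0 := positivity (fun t tt => ltW (H t tt)).
pose f x := expR (4 * x) * (eta1 x + (d - 8) * eta x).
pose f' x := expR (4 * x) * (eta2 x + (d - 4) * eta1 x + 4 * (d - 8) * eta x).
have df (x : R) : is_derive x 1 f (f' x).
  have := drv_mul (drv_exp_lin 4 x) (drv_add (de1 x) (drv_mul (drv_cst (d - 8) x) (de x))).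
  set w := (X in is_derive _ _ _ X -> _) => h; suff <- : w = f' x by [].
  by rewrite /w /f'; ring.
have fpos : forall x, x <= t1 -> 0 < f x.
  apply: (@inc_from_ninfty f f' t1 (fun x _ => df x)).
    move=> y yt; rewrite /f' mulr_gt0 ?expR_gt0//.
    apply: le_lt_trans (H y (ltW yt)); have /andP[py _] := p0 (ltW yt).
    by rewrite mulr_ge0// eta0// ltW.
  apply: (@vanishing_exp f (M + (d - 8) * M) 4 t0) => // x xt; have [h1 h2] := hM x xt.
  rewrite /f normrM gtr0_norm ?expR_gt0// [leRHS]mulrC ler_pM2l ?expR_gt0//.
  apply: le_trans (ler_normD _ _) _; apply: lerD => //.
  rewrite normrM ger0_norm; last by have : 10 <= d := d10; lra.
  by apply: ler_wpM2l => //; have : 10 <= d := d10; lra.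
pose g x := expR ((d - 8) * x) * eta x.
have dg (x : R) : is_derive x 1 g (expR ((d - 8) * x) * (eta1 x + (d - 8) * eta x)).
  have := drv_mul (drv_exp_lin (d - 8) x) (de x).
  set w := (X in is_derive _ _ _ X -> _) => h; suff <- : w = expR ((d - 8) * x) * (eta1 x + (d - 8) * eta x) by [].
  by rewrite /w; ring.
have gpos := @inc_from_ninfty g _ t1 (fun x _ => dg x) _ _.
move=> t tt; have : 0 < g t.
  apply: gpos => //.
    move=> x /ltW xt; rewrite mulr_gt0 ?expR_gt0//.
    by have := fpos x xt; rewrite /f pmulr_rgt0// expR_gt0.
  apply: (@vanishing_exp g M (d - 8) t0) => [|x xt]; first by have : 10 <= d := d10; lra.
  have [h1 h2] := hM x xt.
  by rewrite /g normrM gtr0_norm ?expR_gt0// [leRHS]mulrC ler_pM2l ?expR_gt0.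
by rewrite /g pmulr_rgt0// expR_gt0.
Qed.

End positivity.
End comparison.

(** * Polynomial inequalities for the barrier *)

Ltac pos := repeat (apply: mulr_ge0 || apply: exprn_ge0); by [].
(* runs [tac i j] for all i + j = n *)
Ltac split_sum j j' tac := tac j j'; lazymatch j with O => idtac | S ?k => split_sum k (S j') tac end.

(* The polynomial inequalities are proved by nonnegativity of the coefficients
   in the Bernstein basis, which [lra] recovers from the list of basis elements. *)
Section polynomials.
Context {R : realType}.
Implicit Types D t s w a : R.

(** 2D - 5 times the polynomial 1 + (w / (2D - 5)) s + a s^2 that bounds f^-2 from below. The linear
    coefficient is the one in the expansion of f^-2 at the origin, with s = |x|^2 and w = omega; [a]
    is free. *)
Definition barrier D w a s := (2 * D - 5) + w * s + a * (2 * D - 5) * s ^+ 2.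

(** What remains when the polynomial is inserted in the equation of f^-2, up to the factor s^2 / (2D
    - 5). The term 6D - 6 is the indicial polynomial 4^2 + 4 (D - 4) + 2 (D - 3) of s^2. At s = 0
    and w = D, nonnegativity for large D requires [a] to be at most 1/6 in the limit, the value of
    both choices below at t = 0. *)
Definition barrier_defect D w a s := 2 * w ^+ 2 - 2 * (2 * D - 5) - (6 * D - 6) * a * (2 * D - 5) +
  s * (2 * w * a * (2 * D - 5) - 2 * w) - 2 * a * (2 * D - 5) * s ^+ 2.

(** Here t stands for D - omega. The bound 13/5 is the cut (3D + 7)/20 at D = 15. *)
Lemma defect_ge0_small D t s : 13 <= D -> 0 <= t <= 4 -> 0 <= s <= 13 / 5 ->
  0 <= barrier_defect D (D - t) ((16 - 3 * t) / 96) s.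
Proof.
rewrite -(subr_ge0 13) -(subr_ge0 t) -(subr_ge0 s) /barrier_defect => x0 /andP[t0 b0] /andP[s0 r0].
pose x := D - 13; pose b := 4 - t; pose r := 13 / 5 - s.
split_sum 2%N 0%N ltac:(fun i i' => split_sum 2%N 0%N ltac:(fun j j' => split_sum 2%N 0%N ltac:(fun k k' =>
  have : 0 <= x ^+ k * t ^+ i * b ^+ i' * s ^+ j * r ^+ j' by pos))).
rewrite /x /b /r; lra.
Qed.

(** The range of [s] grows with [D], so the region is cut at s = 4: above it, D - 4s and s - 4 are
    nonnegative coordinates. *)
Lemma defect_ge0_large D t s : 16 <= D -> 0 <= t <= 4 -> 0 <= s <= D / 4 ->
  0 <= barrier_defect D (D - t) ((8 - t) / 48) s.
Proof.
move=> D16; rewrite -(subr_ge0 t) /barrier_defect => /andP[t0 b0] /andP[s0 sD].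
pose b := 4 - t; case: (leP s 4) => s4.
  have x0 : 0 <= D - 16 by lra.
  have r0 : 0 <= 4 - s by lra.
  pose x := D - 16; pose r := 4 - s.
  split_sum 2%N 0%N ltac:(fun i i' => split_sum 2%N 0%N ltac:(fun j j' => split_sum 2%N 0%N ltac:(fun k k' =>
    have : 0 <= x ^+ k * t ^+ i * b ^+ i' * s ^+ j * r ^+ j' by pos))).
  rewrite /x /b /r; lra.
have y0 : 0 <= D - 4 * s by lra.
have r0 : 0 <= s - 4 by lra.
pose y := D - 4 * s; pose r := s - 4.
split_sum 2%N 0%N ltac:(fun i i' => split_sum 4%N 0%N ltac:(fun j j' => split_sum 2%N 0%N ltac:(fun k k' =>
  have : 0 <= y ^+ k * t ^+ i * b ^+ i' * r ^+ j by pos))).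
rewrite /y /b /r; lra.
Qed.

(** Gives the sign of the zeroth-order coefficient in the equation of -f1: the coefficient is
    multiplied by [Z], and f^2 replaced by its bound (2D - 5) / Z. *)
Lemma monotone_defect D t s : 13 <= D -> 0 <= t <= 4 -> 0 <= s <= 13 / 10 ->
  let Z := barrier D (D - t) ((16 - 3 * t) / 96) s in
  0 <= 3 * (D - 3) * (Z - (2 * D - 5)) - ((D - t) * s - s ^+ 2) * Z + (2 * D - 26) * Z.
Proof.
rewrite -(subr_ge0 13) -(subr_ge0 t) -(subr_ge0 s) /barrier => x0 /andP[t0 b0] /andP[s0 r0] /=.
pose x := D - 13; pose b := 4 - t; pose r := 13 / 10 - s.
split_sum 2%N 0%N ltac:(fun i i' => split_sum 4%N 0%N ltac:(fun j j' => split_sum 2%N 0%N ltac:(fun k k' =>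
  have : 0 <= x ^+ k * t ^+ i * b ^+ i' * s ^+ j * r ^+ j' by pos))).
rewrite /x /b /r; lra.
Qed.

(** The condition of [rational_riccati] for a = 1, b = 6, c = 2, multiplied by (2 + s)^2, with f^2
    replaced by (2D - 5) / barrier. The cut at s = 4 is made for the same reason as in
    [defect_ge0_large]. *)
Lemma inner_riccati_large D t s : 16 <= D -> 0 <= t <= 4 -> 0 <= s <= D / 4 ->
  3 * (D - 3) * (2 * D - 5) * (2 + s) ^+ 2 <=
  (- 12 * s + (D - 2 - 2 * s) * (8 + s) * (2 + s) - (8 + s) ^+ 2 + t * s * (2 + s) ^+ 2) *
  barrier D (D - t) ((8 - t) / 48) s.
Proof.
move=> D16; rewrite -(subr_ge0 t) /barrier => /andP[t0 b0] /andP[s0 sD].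
pose b := 4 - t; case: (leP s 4) => s4.
  have x0 : 0 <= D - 16 by lra.
  have r0 : 0 <= 4 - s by lra.
  pose x := D - 16; pose r := 4 - s.
  split_sum 2%N 0%N ltac:(fun i i' => split_sum 5%N 0%N ltac:(fun j j' => split_sum 2%N 0%N ltac:(fun k k' =>
    have : 0 <= x ^+ k * t ^+ i * b ^+ i' * s ^+ j * r ^+ j' by pos))).
  rewrite /x /b /r; lra.
have y0 : 0 <= D - 4 * s by lra.
have r0 : 0 <= s - 4 by lra.
pose y := D - 4 * s; pose r := s - 4.
split_sum 2%N 0%N ltac:(fun i i' => split_sum 6%N 0%N ltac:(fun j j' => split_sum 2%N 0%N ltac:(fun k k' =>
  have : 0 <= y ^+ k * t ^+ i * b ^+ i' * r ^+ j by pos))).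
rewrite /y /b /r; lra.
Qed.

(** The hypothesis of [outer_riccati] at the cut s = D/4, with f^2 replaced by (2D - 5) /
    barrier. *)
Lemma outer_riccati_large D t : 16 <= D -> 0 <= t <= 4 ->
  3 * (D - 3) * (2 * D - 5) <= (4 + t) * (D / 4) * barrier D (D - t) ((8 - t) / 48) (D / 4).
Proof.
rewrite -(subr_ge0 16) -(subr_ge0 t) /barrier => x0 /andP[t0 b0].
pose x := D - 16; pose b := 4 - t.
split_sum 2%N 0%N ltac:(fun i i' => split_sum 4%N 0%N ltac:(fun k k' =>
  have : 0 <= x ^+ k * t ^+ i * b ^+ i' by pos)).
rewrite /x /b; lra.
Qed.

(** The condition of [rational_riccati] for a = 3, b = 2, c = 1, multiplied by (1 + s)^2. It is
    checked separately for each of the three dimensions. *)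
Lemma inner_riccati_small D t s : D = 13 \/ D = 14 \/ D = 15 -> 0 <= t <= 4 ->
    0 <= s <= (3 * D + 7) / 20 ->
  3 * (D - 3) * (2 * D - 5) * (1 + s) ^+ 2 <=
  (- 4 * s + (D - 2 - 2 * s) * (5 + 3 * s) * (1 + s) - (5 + 3 * s) ^+ 2 + t * s * (1 + s) ^+ 2) *
  barrier D (D - t) ((16 - 3 * t) / 96) s.
Proof.
move=> hD; rewrite -(subr_ge0 t) -(subr_ge0 s) /barrier => /andP[t0 b0] /andP[s0 r0].
pose b := 4 - t; pose r := (3 * D + 7) / 20 - s.
split_sum 2%N 0%N ltac:(fun i i' => split_sum 5%N 0%N ltac:(fun j j' =>
  have : 0 <= t ^+ i * b ^+ i' * s ^+ j * r ^+ j' by pos)).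
rewrite /b /r; clear b r; case: hD => [->|[->|->]]; lra.
Qed.

Lemma outer_riccati_small D t : D = 13 \/ D = 14 \/ D = 15 -> 0 <= t <= 4 ->
  let s := (3 * D + 7) / 20 in
  3 * (D - 3) * (2 * D - 5) <= (4 + t) * s * barrier D (D - t) ((16 - 3 * t) / 96) s.
Proof.
move=> hD; rewrite -(subr_ge0 t) /barrier => /andP[t0 b0] /=.
pose b := 4 - t; split_sum 2%N 0%N ltac:(fun i i' => have : 0 <= t ^+ i * b ^+ i' by pos).
rewrite /b; clear b; case: hD => [->|[->|->]]; lra.
Qed.

End polynomials.

(* [f^-2] is a supersolution of the equation that [barrier / (2d-5)] is a
   subsolution of. *)
Lemma barrier_identity {R : realType} (D omega a x y x2 g S : R) : 2 * D - 5 != 0 -> x * g = 1 ->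
  x2 = - (D - 4) * y + (D - 3) * (x * (1 - x ^+ 2)) + (S ^+ 2 - omega * S) * x ->
  let a1 := omega / (2 * D - 5) in
  let eta := g ^+ 2 - (1 + a1 * S + a * S ^+ 2) in
  (6 * y ^+ 2 * g ^+ 4 - 2 * x2 * g ^+ 3 - (4 * a1 * S + 16 * a * S ^+ 2)) +
  (D - 4) * (- 2 * y * g ^+ 3 - (2 * a1 * S + 4 * a * S ^+ 2)) + 4 * (D - 8) * eta =
  (2 * (omega * S - S ^+ 2) + 2 * D - 26) * eta +
  (6 * (y * g ^+ 2) ^+ 2 + S ^+ 2 * (barrier_defect D omega a S / (2 * D - 5))).
Proof.
move=> D0 xg e a1 eta; have e3 : x2 * g ^+ 3 = - (D - 4) * y * g ^+ 3 + (D - 3) * (g ^+ 2 - 1) + (S ^+ 2 - omega * S) * g ^+ 2.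
  transitivity (- (D - 4) * y * g ^+ 3 + (D - 3) * ((x * g) * g ^+ 2 - (x * g) ^+ 3) + (S ^+ 2 - omega * S) * ((x * g) * g ^+ 2)).
    by rewrite e; ring.
  by rewrite xg; ring.
have -> : 2 * x2 * g ^+ 3 = 2 * (x2 * g ^+ 3) by rewrite mulrA.
rewrite e3 /barrier_defect /eta /a1; field; exact: D0.
Qed.

Lemma barrier_gt0 {R : realType} (D omega a S : R) : 0 < 2 * D - 5 -> 0 <= omega -> 0 <= a -> 0 <= S ->
  0 < barrier D omega a S.
Proof.
move=> D0 w0 a0 S0; have := mulr_ge0 w0 S0; have := mulr_ge0 (mulr_ge0 a0 (ltW D0)) (sqr_ge0 S).
rewrite /barrier; lra.
Qed.

(** * Bounds and monotonicity of the profile for 13 <= d *)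

Section profile.
Context {R : realType} (d : nat) (omega : R) (f f1 f2 : R -> R).
Hypotheses (d13 : 13 <= d%:R :> R) (om : d%:R - 4 < omega < d%:R)
  (SP : sing_profile d omega f f1 f2).
Let D : R := d%:R.
Let s (t : R) : R := expR (2 * t).

Let s_gt0 t : 0 < s t.
Proof. exact: expR_gt0. Qed.

Let ds (t : R) : is_derive t 1 s (2 * s t).
Proof. exact: drv_exp_lin. Qed.

Let D13 : 13 <= D := d13.

Lemma profile_near_origin : exists C t0 : R, 0 <= C /\ forall t, t <= t0 ->
  [/\ `|f t - 1| <= C * s t, 1 / 2 <= f t <= 2, `|f1 t| <= 1 / 2 & s t <= 1].
Proof.
have [C [t0 h]] := sp_origin SP.
have C0 : 0 <= C.
  have [h1 _] := h t0 (lexx _); rewrite -(pmulr_lge0 _ (s_gt0 t0)).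
  exact: le_trans (normr_ge0 _) h1.
have e0 : 0 < (2 * (C + 1))^-1 by rewrite invr_gt0 mulr_gt0// ltr_wpDl.
have [t1 h1 h2] := @expR_small R 2 _ (Num.min t0 0) ltac:(by []) e0.
exists C, t1; split => // t tt; move: h1; rewrite le_min => /andP[t10 t11].
have [h3 h4] := h t (le_trans tt t10); have := h2 t tt; rewrite -/(s t) => h5.
have h6 : C * s t <= 1 / 2.
  have C1 : 0 < 2 * (C + 1) by rewrite mulr_gt0// ltr_wpDl.
  move: h5; rewrite -[_^-1]mul1r (ltr_pdivlMr _ _ C1); have := s_gt0 t; nra.
have s1 : s t <= 1 by rewrite /s -[leRHS]expR0 ler_expR; have := le_trans tt t11; lra.
have : `|f t - 1| <= 1 / 2 := le_trans h3 h6.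
rewrite ler_norml => /andP[h7 h8]; split => //; first by apply/andP; split; lra.
exact: le_trans h4 h6.
Qed.

Lemma profile_deficit : exists C : R, 0 <= C /\ forall t, 1 - f t ^+ 2 <= C * s t.
Proof.
have [C [t0 [C0 h0]]] := profile_near_origin.
have i0 : 0 < (s t0)^-1 by rewrite invr_gt0.
exists (3 * C + (s t0)^-1); split; first by rewrite addr_ge0 ?mulr_ge0// ltW.
move=> t; case: (leP t t0) => [/h0[h1 /andP[h2 h3] _ _]|/ltW tt0].
  have := s_gt0 t; move: h1; rewrite ler_norml => /andP[h1 _].
  move: (f t) (s t) (s t0)^-1 i0 h1 h2 h3 => x y z i0 h1 h2 h3 y0.
  have p1 : 0 <= (C * y - (1 - x)) * (1 + x) by apply: mulr_ge0; lra.
  have p2 : 0 <= C * y * (2 - x) by rewrite !mulr_ge0//; lra.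
  by have p3 := mulr_gt0 i0 y0; lra.
have h : 1 <= (s t0)^-1 * s t by rewrite mulrC ler_pdivlMr// mul1r /s ler_expR ler_pM2l.
by have := sqr_ge0 (f t); have := mulr_ge0 C0 (ltW (s_gt0 t)); lra.
Qed.

(** [positivity] for f^-2 minus the polynomial, in the form of [barrier_identity]. Its coefficient 2
    (omega s - s^2) + 2D - 26 is nonnegative because s <= omega and 13 <= D: here the splitting 2 (D
    - 3) = 4 (D - 8) - (2D - 26) behind the factored operator pays off. *)
Lemma barrier_bound (a t1 : R) : 0 <= a ->
  (forall t, t <= t1 -> s t <= omega /\ 0 <= barrier_defect D omega a (s t)) ->
  forall t, t <= t1 -> barrier D omega a (s t) * f t ^+ 2 <= 2 * D - 5.
Proof.
move=> a0 H; pose g t := (f t)^-1; pose a1 := omega / (2 * D - 5).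
have m0 : 0 < 2 * D - 5 by have : 13 <= D := d13; lra.
have w0 : 0 < omega by case/andP: om; rewrite -/D; have : 13 <= D := d13; lra.
have a10 : 0 <= a1 by rewrite divr_ge0// ltW.
have f0 t : f t != 0 by rewrite gt_eqF// (sp_pos SP).
have fg t : f t * g t = 1 by rewrite divff.
have dg (t : R) : is_derive t 1 g (- f1 t * g t ^+ 2).
  have := drv_inv (f0 t) (sp_der SP t); set w := (X in is_derive _ _ _ X -> _) => h.
  suff <- : w = - f1 t * g t ^+ 2 by [].
  by rewrite /w /g exprVn !mulNr mulrC.
pose eta t := g t ^+ 2 - (1 + a1 * s t + a * s t ^+ 2).
pose eta1 t := - 2 * f1 t * g t ^+ 3 - (2 * a1 * s t + 4 * a * s t ^+ 2).
pose eta2 t := 6 * f1 t ^+ 2 * g t ^+ 4 - 2 * f2 t * g t ^+ 3 - (4 * a1 * s t + 16 * a * s t ^+ 2).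
have de (t : R) : is_derive t 1 eta (eta1 t).
  have := drv_add (drv_pow 2 (dg t)) (drv_opp (drv_add (drv_add (drv_cst 1 t) (drv_mul (drv_cst a1 t) (ds t)))
    (drv_mul (drv_cst a t) (drv_pow 2 (ds t))))).
  set w := (X in is_derive _ _ _ X -> _) => h; suff <- : w = eta1 t by [].
  by rewrite /w /eta1; move: (f1 t) (g t) (s t) => x y z; ring.
have de1 (t : R) : is_derive t 1 eta1 (eta2 t).
  have := drv_add (drv_mul (drv_mul (drv_cst (- 2) t) (sp_der1 SP t)) (drv_pow 3 (dg t)))
    (drv_opp (drv_add (drv_mul (drv_cst (2 * a1) t) (ds t)) (drv_mul (drv_cst (4 * a) t) (drv_pow 2 (ds t))))).
  set w := (X in is_derive _ _ _ X -> _) => h; suff <- : w = eta2 t by [].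
  by rewrite /w /eta2; move: (f1 t) (f2 t) (g t) (s t) => x x2 y z; ring.
have eta0 : forall t, t <= t1 -> 0 <= eta t.
  apply: (@positivity R D eta eta1 eta2 (fun t => 2 * (omega * s t - s t ^+ 2) + 2 * D - 26) t1 (2 * omega)) => //.
  - by have : 13 <= D := d13; lra.
  - by rewrite mulr_ge0// ltW.
  - move=> t /H[h1 _]; have := s_gt0 t; have : 13 <= D := d13; rewrite -/(s t) => h2 h3.
    by apply/andP; split; nra.
  - have [C [t0 [_ h]]] := profile_near_origin.
    exists (8 + 2 * a1 + 4 * a), t0 => t /h[_ /andP[h1 h2] h3 h4].
    have g2 : 0 <= g t <= 2.
      rewrite invr_ge0 (ltW (sp_pos SP t)) /= -[leLHS]mul1r ler_pdivrMr ?(sp_pos SP)//; lra.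
    have s0 := s_gt0 t; move: g2 h3 h4 s0; rewrite /eta /eta1; clear - a10 a0.
    move: (g t) (f1 t) (s t) => x y z /andP[x0 x2]; rewrite !ler_norml => /andP[y0 y1] z1 z0.
    have x22 : 0 <= x ^+ 2 <= 4 by apply/andP; split; nra.
    have x32 : 0 <= x ^+ 3 <= 8 by apply/andP; split; [exact: exprn_ge0|rewrite exprS; nra].
    have z2 : 0 <= z ^+ 2 <= 1 by apply/andP; split; nra.
    move: (x ^+ 2) (x ^+ 3) (z ^+ 2) x22 x32 z2 => u v w /andP[u0 u1] /andP[v0 v1] /andP[w0 w1].
    by split; apply/andP; split; nra.
  - move=> t tt; rewrite (barrier_identity a (lt0r_neq0 m0) (fg t) (sp_ode SP t)) lerDl.
    apply: addr_ge0; first by rewrite mulr_ge0// sqr_ge0.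
    by rewrite mulr_ge0 ?sqr_ge0// divr_ge0//; [case: (H t tt)|exact: ltW].
move=> t /eta0; rewrite /eta subr_ge0 => h.
have : (1 + a1 * s t + a * s t ^+ 2) * f t ^+ 2 <= 1.
  apply: le_trans (ler_wpM2r (sqr_ge0 _) h) _.
  by rewrite -exprMn [_ * f t]mulrC fg expr1n.
rewrite -(ler_pM2l m0) mulr1; apply: le_trans; rewrite le_eqVlt; apply/orP; left; apply/eqP.
rewrite /barrier /a1; move: (f t) (s t) => x y; field; exact: lt0r_neq0.
Qed.

Let f3 t := - (D - 4) * f2 t + (D - 3) * (1 - 3 * f t ^+ 2) * f1 t + (s t ^+ 2 - omega * s t) * f1 t +
  (4 * s t ^+ 2 - 2 * omega * s t) * f t.

Lemma profile_der2 (t : R) : is_derive t 1 f2 (f3 t).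
Proof.
apply: (@der_ext _ (fun t => - (D - 4) * f1 t + (D - 3) * (f t * (1 - f t ^+ 2)) + (s t ^+ 2 - omega * s t) * f t)).
  by move=> y; rewrite (sp_ode SP).
have := drv_add (drv_add (drv_mul (drv_cst (- (D - 4)) t) (sp_der1 SP t))
  (drv_mul (drv_cst (D - 3) t) (drv_mul (sp_der SP t) (drv_add (drv_cst 1 t) (drv_opp (drv_pow 2 (sp_der SP t)))))))
  (drv_mul (drv_add (drv_pow 2 (ds t)) (drv_opp (drv_mul (drv_cst omega t) (ds t)))) (sp_der SP t)).
set w := (X in is_derive _ _ _ X -> _) => h; suff <- : w = f3 t by [].
rewrite /w /f3; move: (f t) (f1 t) (f2 t) (s t) => x x1 x2 y; ring.
Qed.

Let tau_bounds : 0 <= D - omega <= 4.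
Proof. by case/andP: om => h1 h2; rewrite /D; apply/andP; split; lra. Qed.

(** Differentiating the equation gives one for -f1 with the source f s (2 omega - 4 s), positive as
    s < omega / 2. The zeroth-order coefficient is nonnegative by the barrier, so
    [positivity_strict] applies. *)
Lemma profile_decreasing_near_origin (t : R) : s t <= 13 / 10 -> f1 t < 0.
Proof.
pose t1 : R := ln (13 / 10) / 2; pose a := (16 - 3 * (D - omega)) / 96.
have st1 : s t1 = 13 / 10.
  by rewrite /s /t1 mulrC divfK// lnK// posrE; lra.
have ss x : (s x <= 13 / 10) = (x <= t1) by rewrite -st1 /s ler_expR ler_pM2l.
rewrite ss => tt; rewrite -oppr_gt0; move: t tt.
have ww : D - (D - omega) = omega by lra.
have bb : forall x, x <= t1 -> barrier D omega a (s x) * f x ^+ 2 <= 2 * D - 5.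
  apply: barrier_bound; first by rewrite /a; have := tau_bounds; lra.
  move=> x; rewrite -ss => h; split; first by case/andP: om; rewrite -/D; have : 13 <= D := d13; lra.
  have := defect_ge0_small d13 tau_bounds (s := s x); rewrite -/D ww; apply.
  by rewrite (ltW (s_gt0 x)) /=; lra.
have [C [t0 [C0 h0]]] := profile_near_origin.
have [C1 [C10 hC1]] := profile_deficit.
pose C' := 3 * (D - 3) * C1.
apply: (@positivity_strict R D (fun t => - f1 t) (fun t => - f2 t) (fun t => - f3 t)
  (fun t => 3 * (D - 3) * (1 - f t ^+ 2) + (s t ^+ 2 - omega * s t) + 2 * D - 26) t1 C').
- by have : 13 <= D := d13; lra.
- have D3 : 0 <= D - 3 by have : 13 <= D := d13; lra.
  by rewrite /C' !mulr_ge0.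
- by move=> t; exact: drv_opp (sp_der1 SP t).
- by move=> t; exact: drv_opp (profile_der2 t).
- move=> t tt; apply/andP; split.
    have d0 : 13 <= D := d13; have [w1 w2] := andP om; rewrite -/D in w1 w2.
    have Z0 : 0 < barrier D omega a (s t).
      have /andP[h1 h2] := tau_bounds.
      by apply: barrier_gt0; rewrite ?(ltW (s_gt0 t))// /a; lra.
    have h2 : 0 <= 3 * (D - 3) * (barrier D omega a (s t) - (2 * D - 5)) -
        (omega * s t - s t ^+ 2) * barrier D omega a (s t) + (2 * D - 26) * barrier D omega a (s t).
      have := monotone_defect d13 tau_bounds (s := s t); rewrite -/D ww /=; apply.
      by rewrite (ltW (s_gt0 t)) ss tt.
    have := bb t tt; move: Z0 h2; move: (barrier D omega a (s t)) (f t ^+ 2) (s t) => Z F x Z0 h1 h2.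
    rewrite -(pmulr_rge0 _ Z0); nra.
  have := hC1 t.
  rewrite -/(s t) /C'; have : s t <= omega.
    by move: tt; rewrite -ss; case/andP: om; rewrite -/D; have : 13 <= D := d13; lra.
  have := s_gt0 t; have : 13 <= D := d13; move: (s t) (f t ^+ 2) => x F h1 h2 h3 h4; nra.
- exists (D + 6 * D + 2 * (1 + omega)), t0 => t /h0[_ /andP[h2 h3] h4 h5]; rewrite !normrN.
  have d0 : 13 <= D := d13; have [w1 w2] := andP om; rewrite -/D in w1 w2; have sp := s_gt0 t.
  split; first by apply: le_trans h4 _; lra.
  rewrite (sp_ode SP) -/D -/(s t); apply: le_trans (ler_normD _ _) _; apply: lerD; last first.
    rewrite normrM mulrC; apply: ler_pM => //; first by rewrite gtr0_norm//; lra.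
    by rewrite ler_norml; apply/andP; split; nra.
  apply: le_trans (ler_normD _ _) _; apply: lerD.
    by move: h4; rewrite !ler_norml => /andP[h6 h7]; apply/andP; split; nra.
  have h6 : - 6 <= f t * (1 - f t ^+ 2) <= 6.
    have : 0 <= f t ^+ 2 <= 4 by apply/andP; split; nra.
    by move: (f t ^+ 2) => F /andP[F0 F1]; apply/andP; split; nra.
  move/andP: h6 => [h6 h7]; move: (f t * _) h6 h7 => x h6 h7.
  by rewrite ler_norml; apply/andP; split; nra.
- move=> t tt; have := s_gt0 t; have := sp_pos SP t; move: tt; rewrite -ss /f3.
  have d0 : 13 <= D := d13; have [w1 w2] := andP om; rewrite -/D in w1 w2; move: w1 w2 d0; clear.
  move: (s t) (f t) (f1 t) (f2 t) => S x y z w1 w2 d0 S1 x0 S0.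
  have : 0 < x * (S * (2 * omega - 4 * S)) by rewrite !mulr_gt0//; lra.
  lra.
Qed.

Lemma profile_fast_decay (n : nat) : exists M : R, 0 < M /\ forall t, 0 <= t -> f t <= M * expR (- (n%:R * t)).
Proof.
have [C [a [a0 h]]] := sp_decay SP.
pose N : R := n.+1%:R; have N0 : 0 < N by rewrite ltr0n.
have k0 : 0 < (N / a) ^+ n.+1 by rewrite exprn_gt0// divr_gt0.
exists ((`|C| + 1) * (N / a) ^+ n.+1); split; first by rewrite mulr_gt0// ltr_wpDl.
move=> t t0; apply: le_trans (h t t0) _; pose X := expR t * expR (- a * expR t).
have X0 : 0 <= X by rewrite mulr_ge0 ?expR_ge0.
apply: le_trans (_ : (`|C| + 1) * X <= _).
  by apply: ler_wpM2r => //; have := ler_norm C; lra.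
rewrite -mulrA; apply: ler_wpM2l; first by have := normr_ge0 C; lra.
have r0 : 0 < expR t := expR_gt0 t; pose y := a / N * expR t.
have y0 : 0 < y by rewrite mulr_gt0// divr_gt0.
have e1 : expR (- a * expR t) = (expR y ^+ n.+1)^-1.
  by rewrite -expRM_natl -expRN /y; congr expR; rewrite -/N; field; exact: lt0r_neq0.
have -> : (N / a) ^+ n.+1 * expR (- (n%:R * t)) = expR t * (y ^+ n.+1)^-1.
  rewrite expRN expRM_natl /y -[N / a]invf_div exprVn.
  have -> : (a / N * expR t) ^+ n.+1 = (a / N) ^+ n.+1 * (expR t * expR t ^+ n) by rewrite [LHS]exprMn -exprS.
  have u0 : (a / N) ^+ n.+1 != 0 by rewrite lt0r_neq0// exprn_gt0// divr_gt0.
  have v0 : expR t ^+ n != 0 by rewrite lt0r_neq0// exprn_gt0.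
  move: (_ ^+ n.+1) (expR t ^+ n) u0 v0 (lt0r_neq0 r0) => u v u0 v0 w0; field.
  by rewrite u0 v0 w0.
rewrite /X e1 ler_pM2l// lef_pV2 ?posrE ?exprn_gt0 ?expR_gt0//.
apply: lerXn2r; rewrite ?nnegrE ?expR_ge0//; first exact: ltW.
by have := expR_ge1Dx y; lra.
Qed.

(** Beyond s = 13/10, at a first zero [c] of [f1] the equation forces s c > omega / 2. From there on
    an energy is nonincreasing; it is negative at [c], which the decay of [f] excludes. *)
Lemma profile_decreasing t : f1 t < 0.
Proof.
case: (leP (s t) (13 / 10)) => [|st]; first exact: profile_decreasing_near_origin.
have d0 : 13 <= D := d13; have [w1 w2] := andP om; rewrite -/D in w1 w2.
rewrite -oppr_gt0 ltNge; apply/negP => neg.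
pose t1 : R := ln (13 / 10) / 2.
have st1 : s t1 = 13 / 10 by rewrite /s /t1 mulrC divfK// lnK// posrE; lra.
have t1t : t1 <= t by rewrite -(@ler_pM2l _ 2)// -ler_expR; move: (ltW st); rewrite -st1.
have cf1 : continuous (fun t => - f1 t) by move=> x; exact: der_cont (drv_opp (sp_der1 SP x)).
have [|c [/andP[t1c ct] /eqP fc neg']] := first_zero cf1 t1t _ neg.
  by rewrite oppr_gt0; apply: profile_decreasing_near_origin; rewrite st1.
rewrite oppr_eq0 in fc; move/eqP: fc => fc.
have sc : 13 / 10 <= s c by rewrite -st1 /s ler_expR ler_pM2l// ltW.
have f2c : 0 <= f2 c.
  rewrite leNgt; apply/negP => f2n.
  have cf2 : {for c, continuous f2} := der_cont (profile_der2 c).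
  have /nbhs_ballP[e /= e0 he] : nbhs c [set x | f2 x < 0] by exact: (cvgr_lt _ cf2 _ f2n).
  pose x := Num.max t1 (c - e / 2).
  have xc : x < c by rewrite gt_max t1c ltrBlDr ltrDl divr_gt0.
  have t1x : t1 <= x by rewrite le_max lexx.
  have : - f1 x < - f1 c.
    apply: (@der_inc _ (fun x => - f1 x) (fun x => - f2 x) x c xc).
      by move=> y _; exact: drv_opp (sp_der1 SP y).
    move=> y /andP[xy yc]; rewrite oppr_gt0; apply: he; rewrite /ball /= ger0_norm ?subr_ge0 ?ltW//.
    have : c - e / 2 <= x by rewrite le_max lexx orbT.
    by have : 0 < e by []; lra.
  by rewrite fc oppr0 ltNge (ltW (neg' x t1x xc)).
have f0 := sp_pos SP.
have Qc : 0 <= (D - 3) * (1 - f c ^+ 2) + s c ^+ 2 - omega * s c.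
  move: f2c; rewrite (sp_ode SP) fc mulr0 add0r -/D -/(s c) => h.
  rewrite -(pmulr_rge0 _ (f0 c)); apply: le_trans h _.
  by move: (f c) (s c) => x y; rewrite le_eqVlt; apply/orP; left; apply/eqP; ring.
(* On [13/10, omega/2] the function s (omega - s) is at least 13/10 (omega - 13/10), which exceeds D
   - 3 since omega > D - 4 and 13 <= D. This contradicts [Qc]. *)
have sw : omega / 2 < s c.
  have F0 : 0 < f c ^+ 2 by rewrite exprn_gt0.
  by rewrite ltNge; apply/negP => h; move: (s c) (f c ^+ 2) sc Qc h F0 => x F h1 h2 h3 h4; nra.
(* The energy of the equation with friction D - 4 and slowly varying potential; its derivative has a
   sign for s >= omega / 2. *)
pose E x := f1 x ^+ 2 / 2 - (D - 3) * (f x ^+ 2 / 2 - f x ^+ 4 / 4) - (s x ^+ 2 - omega * s x) * (f x ^+ 2 / 2).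
pose E' x := - (D - 4) * f1 x ^+ 2 - (2 * s x ^+ 2 - omega * s x) * f x ^+ 2.
have dE (x : R) : is_derive x 1 E (E' x).
  have d1 := drv_mul (drv_pow 2 (sp_der1 SP x)) (drv_cst (2^-1) x).
  have d2 := drv_mul (drv_pow 2 (sp_der SP x)) (drv_cst (2^-1) x).
  have d4 := drv_mul (drv_pow 4 (sp_der SP x)) (drv_cst (4^-1) x).
  have := drv_add (drv_add d1 (drv_opp (drv_mul (drv_cst (D - 3) x) (drv_add d2 (drv_opp d4)))))
    (drv_opp (drv_mul (drv_add (drv_pow 2 (ds x)) (drv_opp (drv_mul (drv_cst omega x) (ds x)))) d2)).
  set w := (X in is_derive _ _ _ X -> _) => h; suff <- : w = E' x by [].
  by rewrite /w /E' (sp_ode SP) -/D -/(s x); move: (f x) (f1 x) (s x) => y y1 z; field.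
have Ec : E c < 0.
  rewrite /E fc; have F0 : 0 < f c ^+ 2 by rewrite exprn_gt0.
  rewrite (_ : f c ^+ 4 = (f c ^+ 2) ^+ 2); last by rewrite -exprM.
  by move: (f c ^+ 2) (s c) F0 Qc => F x F0 h; have := sqr_ge0 F; nra.
have Edec x : c <= x -> E x <= E c.
  move=> cx; rewrite -lerN2; apply: (@der_nondec _ (fun x => - E x) (fun x => - E' x) c x cx).
  move=> y /andP[cy _]; rewrite oppr_ge0 /E'.
  have : omega / 2 <= s y.
    by apply: (le_trans (ltW sw)); rewrite /s ler_expR ler_pM2l// ltW.
  have := sqr_ge0 (f y); have := sqr_ge0 (f1 y); move: (f y ^+ 2) (f1 y ^+ 2) (s y) => a b z a0 b0 z0.
  have p1 : 0 <= a * (z * (2 * z - omega)) by rewrite !mulr_ge0//; lra.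
  have p2 : 0 <= (D - 4) * b by rewrite mulr_ge0//; lra.
  lra.
(* Decay at rate 3, since [E] contains the term e^{4t} f^2. *)
have [M [M0 hM]] := profile_fast_decay 3.
have e0 : 0 < - E c / (M ^+ 2 * D).
  by rewrite divr_gt0 ?oppr_gt0// mulr_gt0// ?exprn_gt0//; lra.
have [t' ht' h'] := @expR_small R 2 _ (Num.min 0 (- c)) ltac:(by []) e0.
have := h' t' (lexx _); rewrite ltr_pdivlMr; last by rewrite mulr_gt0 ?exprn_gt0//; lra.
move: ht'; rewrite le_min => /andP[t'0 t'c].
have := Edec (- t') ltac:(lra); have := hM (- t') ltac:(lra).
have e4 : s (- t') ^+ 2 = expR (- (4 * t')) by rewrite /s -expRM_natl; congr expR; ring.
have -> : expR (- (3%:R * - t')) = expR (3 * t') by congr expR; ring.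
rewrite {1}/E e4 => h1 h2 h3.
have : f (- t') ^+ 2 * (expR (- (4 * t'))) <= M ^+ 2 * expR (2 * t').
  apply: le_trans (_ : (M * expR (3 * t')) ^+ 2 * expR (- (4 * t')) <= _).
    by rewrite ler_pM2r ?expR_gt0// lerXn2r// nnegrE ?mulr_ge0 ?expR_ge0// ltW// f0.
  rewrite exprMn -mulrA -expRM_natl -expRD.
  by have -> : 2%:R * (3 * t') + - (4 * t') = 2 * t' by ring.
have : f (- t') ^+ 2 <= f (- t') ^+ 2 * (expR (- (4 * t'))).
  by rewrite ler_peMr ?sqr_ge0// -[leLHS]expR0 ler_expR; lra.
have := sqr_ge0 (f1 (- t')); have := sqr_ge0 (f (- t')); have := s_gt0 (- t').
rewrite (_ : f (- t') ^+ 4 = (f (- t') ^+ 2) ^+ 2) in h2; last by rewrite -exprM.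
have : D * (M ^+ 2 * expR (2 * t')) < - E c by move: h3; rewrite mulrC -mulrA mulrCA mulrA.
clear h1 h3; move: h2; move: (f (- t') ^+ 2) (f1 (- t') ^+ 2) (s (- t')) (expR (- (4 * t'))) (M ^+ 2 * expR (2 * t')).
move=> F F1 S X K h h3 S0 F0 F10 FX FK.
have p1 : 0 <= D * (K - F * X) by rewrite mulr_ge0//; lra.
have p2 : 0 <= (D - 3) * (F * X - F) by rewrite mulr_ge0//; lra.
have p3 : 0 <= omega * S * F by rewrite !mulr_ge0//; lra.
have p4 : 0 <= (D - 3) * F ^+ 2 by rewrite mulr_ge0 ?sqr_ge0//; lra.
have p5 : 0 <= D * (F * X) by rewrite mulr_ge0//; lra.
lra.
Qed.

Lemma profile_lt1 t : f t < 1.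
Proof.
rewrite -subr_gt0; apply: (@inc_from_ninfty _ (fun t => 1 - f t) (fun t => - f1 t) t _ _ _ t (lexx t)).
- by move=> x _; have := drv_add (drv_cst 1 x) (drv_opp (sp_der SP x)); rewrite add0r.
- by move=> x _; rewrite oppr_gt0 profile_decreasing.
have [C [t0 [C0 h0]]] := profile_near_origin.
by apply: (@vanishing_exp _ _ C 2 t0) => // x /h0[+ _ _ _]; rewrite distrC.
Qed.

(** Where s >= omega the equation makes f + f1 nondecreasing. A positive value would persist,
    whereas f tends to 0 and f1 < 0. *)
Lemma profile_tail : exists T : R, forall t, T <= t -> f t + f1 t <= 0.
Proof.
have d0 : 13 <= D := d13; have [w1 w2] := andP om; rewrite -/D in w1 w2.
pose T : R := ln omega / 2; have sT : s T = omega by rewrite /s /T mulrC divfK// lnK// posrE; lra.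
exists T => t Tt; rewrite leNgt; apply/negP => pos.
have inc x : t <= x -> f t + f1 t <= f x + f1 x.
  move=> tx; apply: (@der_nondec _ (fun t => f t + f1 t) (fun t => f1 t + f2 t) t x tx).
    by move=> y _; exact: drv_add (sp_der SP y) (sp_der1 SP y).
  move=> y /andP[ty _]; rewrite (sp_ode SP) -/D -/(s y).
  have h : omega <= s y by rewrite -sT /s ler_expR ler_pM2l//; lra.
  have := profile_lt1 y; have := sp_pos SP y; have := profile_decreasing y.
  move: (f y) (f1 y) (s y) h => x0 x1 z h h1 h2 h3.
  have q1 : 0 <= (D - 3) * (x0 * (1 - x0 ^+ 2)).
    by apply: mulr_ge0; [lra|apply: mulr_ge0; [exact: ltW|nra]].
  have q2 : 0 <= (z ^+ 2 - omega * z) * x0 by apply: mulr_ge0; [nra|exact: ltW].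
  nra.
have [M [M0 hM]] := profile_fast_decay 1.
have e0 : 0 < (f t + f1 t) / M by rewrite divr_gt0.
have [t' ht' h'] := @expR_small R 1 _ (Num.min 0 (- t)) ltac:(by []) e0.
have := h' t' (lexx _); rewrite ltr_pdivlMr// mul1r.
move: ht'; rewrite le_min => /andP[t'0 t't].
have := inc (- t') ltac:(lra); have := hM (- t') ltac:(lra); rewrite mul1r opprK.
have := profile_decreasing (- t'); lra.
Qed.

(* [f1 e^{-t}] solves the equation linearized at [f] up to a term of constant
   sign beyond the turning point [s = omega / 2]. *)
Definition tail_riccati (t : R) : R := f2 t / f1 t - 1.

Lemma tail_riccatiP (t : R) : exists P' : R, [/\ is_derive t 1 tail_riccati P',
   omega / 2 <= s t -> P' + tail_riccati t ^+ 2 + (D - 2) * tail_riccati t <= s t ^+ 2 - omega * s t - 3 * (D - 3) * f t ^+ 2 &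
   P' = f3 t / f1 t - (f2 t / f1 t) ^+ 2].
Proof.
have f10 := profile_decreasing t; have n0 : f1 t != 0 by rewrite lt_eqF.
exists (f3 t / f1 t - (f2 t / f1 t) ^+ 2); split => //.
  have := drv_add (drv_mul (profile_der2 t) (drv_inv n0 (sp_der1 SP t))) (drv_cst (- 1) t).
  set w := (X in is_derive _ _ _ X -> _) => h; suff <- : w = f3 t / f1 t - (f2 t / f1 t) ^+ 2 by [].
  by rewrite /w; move: (f1 t) (f2 t) (f3 t) n0 => x y z n0; field; exact: n0.
move=> ws; rewrite /tail_riccati.
have -> : f3 t / f1 t - (f2 t / f1 t) ^+ 2 + (f2 t / f1 t - 1) ^+ 2 + (D - 2) * (f2 t / f1 t - 1) =
  s t ^+ 2 - omega * s t - 3 * (D - 3) * f t ^+ 2 + (4 * s t ^+ 2 - 2 * omega * s t) * f t / f1 t.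
  by rewrite /f3; move: (f t) (f1 t) (f2 t) (s t) n0 => x x1 x2 y n0; field; exact: n0.
rewrite gerDl ler_ndivrMr// mul0r mulr_ge0//; last exact: ltW (sp_pos SP t).
by have := s_gt0 t; move: (s t) ws => x h1 h2; nra.
Qed.

(** By [profile_tail], f / f1 stays between -1 and 0. The growth s^2 = |x|^4 is what the square
    integrability of |x| f can absorb in the boundary term at infinity. *)
Lemma tail_riccati_ge : exists C T : R, [/\ 0 <= C, 0 <= T & forall t, T <= t -> - C * s t ^+ 2 <= tail_riccati t].
Proof.
have d0 : 13 <= D := d13; have [w1 w2] := andP om; rewrite -/D in w1 w2.
have [T hT] := profile_tail; exists (2 * D), (Num.max T 0); split; first by lra.
  by rewrite le_max lexx orbT.
move=> t; rewrite ge_max => /andP[/hT h1 t0]; have f10 := profile_decreasing t.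
have n0 : f1 t != 0 by rewrite lt_eqF.
have s1 : 1 <= s t by rewrite /s -[leLHS]expR0 ler_expR; lra.
have f0 := sp_pos SP t; have f1' := profile_lt1 t.
have r1 : - 1 <= f t / f1 t <= 0.
  by rewrite ler_ndivlMr// ler_ndivrMr// mul0r mulN1r; apply/andP; split; lra.
rewrite /tail_riccati (_ : f2 t / f1 t = - (D - 4) + ((D - 3) * (1 - f t ^+ 2) + (s t ^+ 2 - omega * s t)) * (f t / f1 t)); last first.
  by rewrite (sp_ode SP) -/D -/(s t); move: (f t) (f1 t) (s t) n0 => x y z n0; field; exact: n0.
have F1 : 0 <= f t ^+ 2 <= 1 by apply/andP; split; nra.
move: (f t / f1 t) (f t ^+ 2) (s t) r1 F1 s1 => r F x /andP[r0 r1] /andP[F0 F1] s1.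
have x2 : x <= x ^+ 2 by nra.
have : 0 <= (1 + r) * ((D - 3) * (1 - F) + x ^+ 2) by apply: mulr_ge0; [lra|apply: addr_ge0; [apply: mulr_ge0; lra|exact: sqr_ge0]].
have : 0 <= - r * (omega * x) by apply: mulr_ge0; [lra|apply: mulr_ge0; lra].
have : 0 <= (D - 3) * F by apply: mulr_ge0; lra.
nra.
Qed.

End profile.

(** * Riccati inequalities and nonnegativity of the form *)

Section riccati.
Context {R : realType} {d : nat} (d0 : (0 < d)%N).
Local Notation T := (measurableTypeR R).
Local Notation X := (d.-tuple T).
Local Notation mu := (lebesgue_tuple R d).
Local Notation c0 := (polar_cst (R := R) (d := d)).
Variable W : R -> R.

Definition riccati_on (I : R -> Prop) (P : R -> R) := exists P' : R -> R, forall x : R, I x ->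
  [/\ is_derive x 1 P (P' x), {for x, continuous P'} & P' x + P x ^+ 2 + (d%:R - 2) * P x <= W x].

Lemma riccati_on_bound I P (f h : X -> R) Gam (a b : R) : riccati_on I P -> a <= b ->
  (forall x, a <= x <= b -> I x) -> prim_pair f h Gam -> measurable_fun setT h ->
  loc_int (fun t => (h t ^+ 2 + W (radT t) * f t ^+ 2) * radpow (-2) t) ->
  c0 * (expR ((d%:R - 2) * b) * P b * Gam b ^+ 2 - expR ((d%:R - 2) * a) * P a * Gam a ^+ 2) <=
  annulus_int (fun t => (h t ^+ 2 + W (radT t) * f t ^+ 2) * radpow (-2) t) a b.
Proof.
move=> [P' hP] ab hI pf mh lk.
apply: (riccati_bound d0 (P' := P') ab pf mh lk) => x /hI /hP[] //.
Qed.

(* On each piece the form is bounded below by boundary terms; these have the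
   right sign if [P] jumps down or [Gam] vanishes. *)
Lemma riccati_pieces_ge0 (f h : X -> R) Gam (P1 P2 P3 : R -> R) (t1 t2 t3 C : R) :
  Xprofile f h Gam -> L1 (fun t => (h t ^+ 2 + W (radT t) * f t ^+ 2) * radpow (-2) t) ->
  t1 <= t2 -> riccati_on (fun x => x <= t1) P1 -> riccati_on (fun x => t1 <= x <= t2) P2 ->
  riccati_on (fun x => t2 <= x) P3 -> (forall x, x <= t1 -> P1 x <= 0) ->
  P2 t1 <= P1 t1 \/ Gam t1 = 0 -> P3 t2 <= P2 t2 \/ Gam t2 = 0 ->
  (forall x, t3 <= x -> - C * expR (4 * x) <= P3 x) ->
  0 <= Int (fun t => (h t ^+ 2 + W (radT t) * f t ^+ 2) * radpow (-2) t).
Proof.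
move=> [pf [f2 f2p f2m mh h2]] lk t12 r1 r2 r3 P1le j1 j2 P3ge.
set k := (fun t : X => _) in lk *; have lock := loc_int_L1 d0 lk.
rewrite leNgt; apply/negP => neg; pose e := - Int k / 2.
have e0 : 0 < e by rewrite divr_gt0// oppr_gt0.
have [N [N0 hN]] := Int_limit d0 lk e0.
have c0p : 0 < c0 := @polar_cst_gt0 R d d0.
pose C' := `|C| + 1; have C'0 : 0 < C' by rewrite ltr_wpDl.
have CC : - C' <= - C by rewrite lerN2 (le_trans (ler_norm C))// lerDl.
have [_ _ ae_f _] := pf.
have e1 : 0 < e / (c0 * C') by rewrite divr_gt0// mulr_gt0.
(* Integrability of |x|^2 f^2 makes e^{(d+2)b} Gam(b)^2 small at some large [b]; this controls the
   boundary term there because P3 >= - C e^{4b}. *)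
have [[b bM hb] _] : (exists2 b, Num.max N (Num.max t2 t3) <= b &
    expR ((d%:R + 2) * b) * Gam b ^+ 2 < e / (c0 * C')) /\ exists2 b, b <= Num.max N (Num.max t2 t3) &
    expR ((d%:R + 2) * b) * Gam b ^+ 2 < e / (c0 * C').
  apply: (@small_values R d d0 (fun t => (f t * radpow 1 t) ^+ 2)) => //.
  - exact: f2p.2.
  - by move=> t; exact: sqr_ge0.
  apply: filterS ae_f => t ->; rewrite exprMn mulrA /radJ -expRD /radpow -expRM_natl [RHS]mulrC.
  by congr (_ * expR _); move: (radT t) (d%:R) => x y; rewrite mulrDl; ring.
move: bM; rewrite !ge_max => /andP[Nb /andP[t2b t3b]].
pose a := Num.min (- N) t1; have aN : a <= - N by rewrite ge_min lexx.
have at1 : a <= t1 by rewrite ge_min lexx orbT.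
have B1 := riccati_on_bound r1 at1 (fun x hx => (andP hx).2) pf mh lock.
have B2 := riccati_on_bound r2 t12 (fun x hx => hx) pf mh lock.
have B3 := riccati_on_bound r3 t2b (fun x hx => (andP hx).1) pf mh lock.
have S := annulus_split d0 lock at1 (le_trans t12 t2b).
have S' := annulus_split d0 lock t12 t2b.
have := hN a b aN Nb; rewrite S S' ltr_norml => /andP[lim _].
have E1 : - (expR ((d%:R - 2) * a) * P1 a * Gam a ^+ 2) >= 0.
  rewrite oppr_ge0 -mulrA; apply: mulr_ge0_le0; first exact: expR_ge0.
  by apply: mulr_le0_ge0; [exact: P1le|exact: sqr_ge0].
have jump (x P Q : R) : Q <= P \/ Gam x = 0 ->
    0 <= expR ((d%:R - 2) * x) * P * Gam x ^+ 2 - expR ((d%:R - 2) * x) * Q * Gam x ^+ 2.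
  case=> [h'|->]; last by rewrite expr0n /= !mulr0 subrr.
  have := mulr_ge0 (mulr_ge0 (expR_ge0 ((d%:R - 2) * x)) (_ : 0 <= P - Q)) (sqr_ge0 (Gam x)).
  by rewrite mulrBr mulrBl subr_ge0; apply.
have J1 := jump _ _ _ j1; have J2 := jump _ _ _ j2.
have E3 : - (e / c0) < expR ((d%:R - 2) * b) * P3 b * Gam b ^+ 2.
  have h3 := P3ge b t3b.
  apply: lt_le_trans (_ : - C' * (expR ((d%:R + 2) * b) * Gam b ^+ 2) <= _).
    have -> : e / c0 = C' * (e / (c0 * C')).
      have aux (x y z : R) : x != 0 -> y != 0 -> z / x = y * (z / (x * y)).
        by move=> x0 y0; field; rewrite x0 y0.
      by apply: aux; exact: lt0r_neq0.
    by rewrite mulNr ltrN2 ltr_pM2l.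
  have -> : (d%:R + 2) * b = (d%:R - 2) * b + 4 * b by ring.
  rewrite expRD; have g0 := sqr_ge0 (Gam b); have x0 := expR_gt0 ((d%:R - 2) * b).
  have y0 := expR_gt0 (4 * b);
  move: (Gam b ^+ 2) (expR ((d%:R - 2) * b)) (expR (4 * b)) (P3 b) g0 x0 y0 h3 => g x y p g0 x0 y0 h3.
  rewrite (_ : - C' * (x * y * g) = x * (- C' * y) * g); last by ring.
  apply: ler_wpM2r => //; apply: ler_wpM2l; first exact: ltW.
  by apply: le_trans h3; rewrite ler_wpM2r// ltW.
have : - e < c0 * (expR ((d%:R - 2) * b) * P3 b * Gam b ^+ 2).
  by move: E3; rewrite -(ltr_pM2l c0p) mulrN mulrCA divff ?mulr1// lt0r_neq0.
have aux (x1 x2 x3 u1 u2 u3 u4 u5 u6 : R) : c0 * (u1 - u2) <= x1 -> c0 * (u3 - u4) <= x2 ->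
    c0 * (u5 - u6) <= x3 -> 0 <= - u2 -> 0 <= u1 - u4 -> 0 <= u3 - u6 -> c0 * u5 <= x1 + (x2 + x3).
  move=> h1 h2' h3 p1 p2 p3; apply: le_trans (lerD h1 (lerD h2' h3)).
  rewrite -!mulrDr ler_pM2l//; move: p1 p2 p3; clear; lra.
have := aux _ _ _ _ _ _ _ _ _ B1 B2 B3 E1 J1 J2 => h1 h3.
have := lt_le_trans h3 h1; rewrite /e; move: lim; rewrite /e.
move: (annulus_int k a t1 + _) (Int k) => A I; clear; lra.
Qed.

End riccati.

(** * Explicit solutions of the Riccati inequality *)

Section pieces.
Context {R : realType} (d : nat) (omega : R) (f f1 f2 : R -> R).
Hypotheses (d13 : 13 <= d%:R :> R) (om : d%:R - 4 < omega < d%:R)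
  (SP : sing_profile d omega f f1 f2).
Let D : R := d%:R.
Let s (t : R) : R := expR (2 * t).

Definition profile_potential (t : R) : R := expR (2 * t) ^+ 2 - omega * expR (2 * t) - 3 * (d%:R - 3) * f t ^+ 2.

Let s_gt0 t : 0 < s t.
Proof. exact: expR_gt0. Qed.

Let ds (t : R) : is_derive t 1 s (2 * s t).
Proof. exact: drv_exp_lin. Qed.

(** The term - s is the logarithmic derivative of the Gaussian e^{-s/2}, with s = |x|^2. It removes
    s^2 from the potential and leaves the stated condition on epsilon = a + b / (c + s). *)
Lemma rational_riccati (I : R -> Prop) (a b c : R) :
  (forall x, I x -> c + s x != 0 /\
    3 * (D - 3) * f x ^+ 2 <= - 2 * b * s x / (c + s x) ^+ 2 + (D - 2 - 2 * s x) * (a + b / (c + s x))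
      - (a + b / (c + s x)) ^+ 2 + (D - omega) * s x) ->
  riccati_on (d := d) profile_potential I (fun x => - s x - (a + b / (c + s x))).
Proof.
move=> H; pose P' x := - 2 * s x + 2 * b * s x * (c + s x) ^- 2.
exists P' => x /H[n0 hx]; have dc := drv_add (drv_cst c x) (ds x).
have di := @drv_inv R (fun y => c + s y) x _ n0 dc.
split.
- have := drv_add (drv_opp (ds x)) (drv_opp (drv_add (drv_cst a x) (drv_mul (drv_cst b x) di))).
  set w := (X in is_derive _ _ _ X -> _) => h; suff <- : w = P' x by [].
  by rewrite /w /P'; move: (s x) (_ ^- 2) => y z; ring.
- have n02 : (c + s x) ^+ 2 != 0 by rewrite expf_neq0.
  exact: (der_cont (drv_add (drv_mul (drv_cst (- 2) x) (ds x))
    (drv_mul (drv_mul (drv_cst (2 * b) x) (ds x)) (@drv_inv R (fun y => (c + s y) ^+ 2) x _ n02 (drv_pow 2 dc))))).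
rewrite /profile_potential -/D -/(s x) /P'.
by move: hx; move: (s x) (f x ^+ 2) (b / (c + s x)) (_ ^- 2) => y F z v hx; lra.
Qed.

Let tau_bounds : 0 <= D - omega <= 4.
Proof. by case/andP: om => h1 h2; rewrite /D; apply/andP; split; lra. Qed.

Let ww : D - (D - omega) = omega.
Proof. by lra. Qed.

Let s_ln (x : R) : 0 < x -> s (ln x / 2) = x.
Proof. by move=> x0; rewrite /s mulrC divfK// lnK. Qed.

Let s_le x y : (s x <= s y) = (x <= y).
Proof. by rewrite /s ler_expR ler_pM2l. Qed.

(* [epsilon = 4 s / (d - 2 s) = -2 - d / (s - d / 2)] turns the Riccati inequality
   into a condition on [f^2 / s]. *)
Lemma outer_riccati (t1 t2 : R) : s t2 = omega / 2 ->
  3 * (D - 3) * f t1 ^+ 2 <= (4 + (D - omega)) * s t1 ->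
  riccati_on (d := d) profile_potential (fun x => t1 <= x <= t2)
    (fun x => - s x - (- 2 + - D / (- (D / 2) + s x))).
Proof.
have d0 : 13 <= D := d13; have [w1 w2] := andP om; rewrite -/D in w1 w2.
move=> st2 h; apply: rational_riccati => x /andP[t1x xt2].
have sx : s x <= omega / 2 by rewrite -st2 s_le.
have n0 : D - 2 * s x != 0 by rewrite lt0r_neq0//; lra.
split; first by rewrite ltr0_neq0//; lra.
have -> : - 2 * - D * s x / (- (D / 2) + s x) ^+ 2 +
  (D - 2 - 2 * s x) * (- 2 + - D / (- (D / 2) + s x)) -
  (- 2 + - D / (- (D / 2) + s x)) ^+ 2 + (D - omega) * s x = (4 + (D - omega)) * s x.
  have n1 : - (D / 2) + s x != 0 by rewrite ltr0_neq0//; lra.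
  by move: (s x) sx n1 => y sx n1; field; rewrite ltr0_neq0//; lra.
apply: le_trans (_ : 3 * (D - 3) * f t1 ^+ 2 <= _).
  rewrite ler_pM2l; last by lra.
  rewrite lerXn2r ?nnegrE ?(ltW (sp_pos SP _))// -lerN2.
  apply: (@der_nondec _ (fun y => - f y) (fun y => - f1 y) t1 x t1x).
    by move=> y _; exact: drv_opp (sp_der SP y).
  by move=> y _; rewrite oppr_ge0 ltW// (profile_decreasing d13 om SP).
apply: le_trans h _; rewrite ler_pM2l; last by lra.
by rewrite s_le.
Qed.

Lemma tail_riccati_on (t2 : R) : s t2 = omega / 2 ->
  riccati_on (d := d) profile_potential (fun x => t2 <= x) (tail_riccati f1 f2).
Proof.
move=> st2; have f10 := profile_decreasing d13 om SP.
have dd := profile_der2 SP.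
pose f3 t := - (D - 4) * f2 t + (D - 3) * (1 - 3 * f t ^+ 2) * f1 t +
  (s t ^+ 2 - omega * s t) * f1 t + (4 * s t ^+ 2 - 2 * omega * s t) * f t.
exists (fun t => f3 t / f1 t - (f2 t / f1 t) ^+ 2) => x t2x.
have [P' [h1 h2 h3]] := tail_riccatiP d13 om SP x.
split; first by rewrite -/(s x) /f3 -h3.
  have n0 : f1 x != 0 by rewrite lt_eqF.
  have i0 := drv_inv n0 (sp_der1 SP x).
  have d3 := drv_add (drv_add (drv_add (drv_mul (drv_cst (- (D - 4)) x) (dd x))
   (drv_mul (drv_mul (drv_cst (D - 3) x) (drv_add (drv_cst 1 x) (drv_opp (drv_mul (drv_cst 3 x) (drv_pow 2 (sp_der SP x)))))) (sp_der1 SP x)))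
   (drv_mul (drv_add (drv_pow 2 (ds x)) (drv_opp (drv_mul (drv_cst omega x) (ds x)))) (sp_der1 SP x)))
   (drv_mul (drv_add (drv_mul (drv_cst 4 x) (drv_pow 2 (ds x))) (drv_opp (drv_mul (drv_cst (2 * omega) x) (ds x)))) (sp_der SP x)).
  exact: (der_cont (drv_add (drv_mul d3 i0) (drv_opp (drv_pow 2 (drv_mul (dd x) i0))))).
by rewrite /profile_potential -/D -/(s x) /f3 -h3; apply: h2; rewrite -st2 s_le.
Qed.

(* With [jump] (16 <= d) the pieces can be glued at [t1] without a zero of [Gam]. *)
Lemma profile_riccati_pieces (jump : bool) :
  (if jump then is_true (16 <= D) else D = 13 \/ D = 14 \/ D = 15) ->
  exists (t1 t2 t3 C : R) (P1 P2 P3 : R -> R),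
  [/\ t1 <= t2, riccati_on (d := d) profile_potential (fun x => x <= t1) P1,
   riccati_on (d := d) profile_potential (fun x => t1 <= x <= t2) P2 &
   riccati_on (d := d) profile_potential (fun x => t2 <= x) P3] /\
  [/\ forall x, x <= t1 -> P1 x <= 0, jump -> P2 t1 <= P1 t1 &
   forall x, t3 <= x -> - C * expR (4 * x) <= P3 x].
Proof.
move=> hj; have d0 : 13 <= D := d13; have [w1 w2] := andP om; rewrite -/D in w1 w2.
have /andP[tau0 tau4] := tau_bounds.
(* At s = D/4 the outer solution equals - D/4 - 2 and the inner one - D/4 - 1 - 6 / (2 + D/4), which
   is at least as large when 16 <= D. For D = 13, 14, 15 the cut (3D + 7)/20 is a place where both
   the inner and the outer inequality hold. *)
pose s1 := if jump then D / 4 else (3 * D + 7) / 20.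
pose A := if jump then (8 - (D - omega)) / 48 else (16 - 3 * (D - omega)) / 96.
have s10 : 0 < s1 by rewrite /s1; case: (jump); lra.
have s1w : s1 <= omega / 2 by rewrite /s1; case: (jump) hj => hj; [lra|case: hj => [|[]] hj; lra].
have w0 : 0 < omega / 2 by lra.
pose t1 : R := ln s1 / 2; pose t2 : R := ln (omega / 2) / 2.
have st1 : s t1 = s1 := s_ln s10; have st2 : s t2 = omega / 2 := s_ln w0.
have A0 : 0 <= A by rewrite /A; case: (jump); lra.
have bar x : x <= t1 -> barrier D omega A (s x) * f x ^+ 2 <= 2 * D - 5.
  apply: (barrier_bound d13 om SP A0) => y; rewrite -s_le st1 => yt; split.
    by apply: (le_trans yt); lra.
  have ys := ltW (s_gt0 y); rewrite -ww; move: yt; rewrite /A /s1; case: (jump) hj => hj yt.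
    by apply: defect_ge0_large; rewrite ?tau_bounds// ys yt.
  apply: defect_ge0_small; rewrite ?tau_bounds// ys /=; apply: le_trans yt _.
  by case: hj => [|[]] hj; lra.
have barp x : 0 < barrier D omega A (s x).
  by apply: barrier_gt0; rewrite ?(ltW (s_gt0 x))//; lra.
have [C [t3 [C0 t30 hC]]] := tail_riccati_ge d13 om SP.
have h2 : 3 * (D - 3) * f t1 ^+ 2 <= (4 + (D - omega)) * s t1.
  rewrite -(ler_pM2l (barp t1)); apply: le_trans (_ : 3 * (D - 3) * (2 * D - 5) <= _).
    by rewrite mulrCA ler_pM2l; [exact: bar|lra].
  rewrite [leRHS]mulrC st1 -ww /A /s1; case: (jump) hj => hj.
    by rewrite ww; have := outer_riccati_large hj tau_bounds; rewrite ww.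
  by have := outer_riccati_small hj tau_bounds; rewrite /= !ww.
have r2 := outer_riccati st2 h2; have r3 := tail_riccati_on st2.
have inner (a b c : R) : 0 < c -> (forall x, x <= t1 ->
    3 * (D - 3) * (2 * D - 5) <=
   (- 2 * b * s x / (c + s x) ^+ 2 + (D - 2 - 2 * s x) * (a + b / (c + s x))
      - (a + b / (c + s x)) ^+ 2 + (D - omega) * s x) * barrier D omega A (s x)) ->
   riccati_on (d := d) profile_potential (fun x => x <= t1) (fun x => - s x - (a + b / (c + s x))).
  move=> c0 hb; apply: rational_riccati => x xt; split; first by rewrite lt0r_neq0// addr_gt0.
  rewrite -(ler_pM2r (barp x)); apply: le_trans (hb x xt).
  by rewrite -[leLHS]mulrA ler_pM2l; [rewrite mulrC; exact: bar|lra].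
pose P1 (x : R) := if jump then - s x - (1 + 6 / (2 + s x)) else - s x - (3 + 2 / (1 + s x)).
have hx x : x <= t1 -> 0 <= s x <= s1 by rewrite -s_le st1 (ltW (s_gt0 x)).
have r1 : riccati_on (d := d) profile_potential (fun x => x <= t1) P1.
  rewrite /P1; case: (jump) hj @s1 @A @t1 s10 s1w st1 A0 bar barp h2 r2 inner hx {P1} => hj s1 A t1 s10 s1w st1 A0 bar barp h2 r2 inner hx.
    apply: inner => // x xt.
    have h : 3 * (D - 3) * (2 * D - 5) * (2 + s x) ^+ 2 <= (- 12 * s x + (D - 2 - 2 * s x) * (8 + s x) * (2 + s x)
        - (8 + s x) ^+ 2 + (D - omega) * s x * (2 + s x) ^+ 2) * barrier D omega A (s x).
      by have := inner_riccati_large hj tau_bounds (hx x xt); rewrite ww; apply.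
    move: (s_gt0 x) (barp x) h; move: (barrier D omega A (s x)) (s x) => Z y y0 Z0 h.
    have c2 : 0 < (2 + y) ^+ 2 by rewrite exprn_gt0//; lra.
    rewrite -(ler_pM2r c2); apply: le_trans h _; rewrite le_eqVlt; apply/orP; left; apply/eqP.
    by field; rewrite lt0r_neq0//; lra.
  apply: inner => // x xt.
    have h : 3 * (D - 3) * (2 * D - 5) * (1 + s x) ^+ 2 <= (- 4 * s x + (D - 2 - 2 * s x) * (5 + 3 * s x) * (1 + s x)
        - (5 + 3 * s x) ^+ 2 + (D - omega) * s x * (1 + s x) ^+ 2) * barrier D omega A (s x).
      by have := inner_riccati_small hj tau_bounds (hx x xt); rewrite ww; apply.
    move: (s_gt0 x) (barp x) h; move: (barrier D omega A (s x)) (s x) => Z y y0 Z0 h.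
  have c2 : 0 < (1 + y) ^+ 2 by rewrite exprn_gt0//; lra.
  rewrite -(ler_pM2r c2); apply: le_trans h _; rewrite le_eqVlt; apply/orP; left; apply/eqP.
  by field; rewrite lt0r_neq0//; lra.
exists t1, t2, t3, C, P1, (fun x => - s x - (- 2 + - D / (- (D / 2) + s x))), (tail_riccati f1 f2).
split; first by split => //; rewrite -s_le st1 st2.
split.
- move=> x _; have := s_gt0 x; rewrite /P1; have i0 c : 0 < c -> 0 <= (c + s x)^-1.
    by move=> c0; rewrite invr_ge0 addr_ge0 ?ltW.
  by case: (jump); [have := i0 2 ltac:(by [])|have := i0 1 ltac:(by [])]; lra.
- move=> jT; rewrite /P1 st1 /s1 jT; rewrite jT in hj.
  have -> : - (D / 4) - (- 2 + - D / (- (D / 2) + D / 4)) = - (D / 4) - 2.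
    have -> : - (D / 2) + D / 4 = - (D / 4) by lra.
    have -> : - D / - (D / 4) = 4 by rewrite invrN mulrNN invfM invrK mulrA divff ?mul1r// lt0r_neq0//; lra.
    lra.
  have : 6 / (2 + D / 4) <= 1 by rewrite ler_pdivrMr; lra.
  lra.
- by move=> x /hC; rewrite /s -expRM_natl (_ : 2%:R * (2 * x) = 4 * x)//; ring.
Qed.

End pieces.

(** * The ground state for 13 <= d *)

Section tends_to_zero.
Context {R : realType}.
Implicit Types f g : R -> R.

Definition tends0 f := forall e : R, 0 < e -> exists t0 : R, forall t : R, t <= t0 -> `|f t| < e.

Lemma tends0_add f g : tends0 f -> tends0 g -> tends0 (fun t => f t + g t).
Proof.
move=> hf hg e e0; have e2 : 0 < e / 2 by rewrite divr_gt0.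
have [t1 h1] := hf _ e2; have [t2 h2] := hg _ e2.
exists (Num.min t1 t2) => t; rewrite le_min => /andP[/h1 h3 /h2 h4].
by apply: le_lt_trans (ler_normD _ _) _; rewrite [e]splitr ltrD.
Qed.

Lemma tends0_opp f : tends0 f -> tends0 (fun t => - f t).
Proof. by move=> hf e /hf[t1 h1]; exists t1 => t /h1; rewrite normrN. Qed.

Lemma tends0_le f g : (forall t, `|f t| <= g t) -> tends0 g -> tends0 f.
Proof.
move=> fg hg e /hg[t1 h1]; exists t1 => t /h1; apply: le_lt_trans.
exact: le_trans (fg t) (ler_norm _).
Qed.

Lemma tends0_exp f (K k t0 : R) : 0 < k -> (forall t, t <= t0 -> `|f t| <= K * expR (k * t)) -> tends0 f.
Proof.
move=> k0 hf e e0; have K1 : 0 < `|K| + 1 by rewrite ltr_wpDl.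
have e1 : 0 < e / (`|K| + 1) by rewrite divr_gt0.
have [t1 h1 h2] := expR_small t0 k0 e1; exists t1 => t tt.
apply: le_lt_trans (hf t (le_trans tt h1)) _; have := h2 t tt; rewrite ltr_pdivlMr// mulrC.
by apply: le_lt_trans; rewrite ler_wpM2r ?expR_ge0// (le_trans (ler_norm K))// lerDl.
Qed.

Lemma tends0_vanishing f : tends0 f -> vanishing f.
Proof.
move=> hf e t /hf[t1 h1]; exists (Num.min t t1); first by rewrite ge_min lexx.
by apply: h1; rewrite ge_min lexx orbT.
Qed.

Lemma prim_bound (F f b b' : R -> R) : (forall t : R, is_derive t 1 F (f t)) ->
  (forall t : R, is_derive t 1 b (b' t)) -> (forall t, `|f t| <= b' t) -> tends0 F -> tends0 b ->
  forall t, `|F t| <= b t.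
Proof.
move=> dF db fb F0 b0 t.
have h1 : 0 <= b t + F t.
  apply: (@nondec_from_ninfty _ (fun t => b t + F t) (fun t => b' t + f t) t _ _ _ t (lexx t)).
  - by move=> x _; have := fb x; rewrite ler_norml => /andP[h _]; lra.
  - exact: tends0_vanishing (tends0_add b0 F0).
have h2 : 0 <= b t + - F t.
  apply: (@nondec_from_ninfty _ (fun t => b t + - F t) (fun t => b' t + - f t) t _ _ _ t (lexx t)).
  - by move=> x _; have := fb x; rewrite ler_norml => /andP[_ h]; lra.
  - exact: tends0_vanishing (tends0_add b0 (tends0_opp F0)).
by rewrite ler_norml; apply/andP; split; lra.
Qed.

(** For a primitive [G], the functions G + b and G - b are monotone in opposite directions, so the
    infimum of G + b is the limit of [G] at minus infinity; it is subtracted. *)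
Lemma prim_exists (f b b' : R -> R) : continuous f -> (forall t : R, is_derive t 1 b (b' t)) ->
  (forall t, `|f t| <= b' t) -> tends0 b ->
  exists F : R -> R, (forall t : R, is_derive t 1 F (f t)) /\ tends0 F.
Proof.
move=> cf db fb b0; have [G dG] : exists G : R -> R, forall x : R, is_derive x 1 G (f x) := antiderivative cf.
have b'0 t : 0 <= b' t by exact: le_trans (normr_ge0 _) (fb t).
have bp t : 0 <= b t.
  apply: (@nondec_from_ninfty _ b b' t) => //; exact: tends0_vanishing.
have up x y : x <= y -> G x + b x <= G y + b y.
  move=> xy; apply: (@der_nondec _ (fun t => G t + b t) (fun t => f t + b' t) x y xy).
  by move=> z _; have := fb z; rewrite ler_norml => /andP[h _]; lra.
have dn x y : x <= y -> G y - b y <= G x - b x.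
  move=> xy; rewrite -lerN2; apply: (@der_nondec _ (fun t => - (G t - b t)) (fun t => - (f t - b' t)) x y xy).
  by move=> z _; have := fb z; rewrite ler_norml => /andP[_ h]; lra.
pose S : set R := range (fun t => G t + b t).
have lb t : lbound S (G t - b t).
  move=> _ [x _ <-]; case: (leP t x) => tx.
    by have := up t x tx; have := bp t; lra.
  by have := dn x t (ltW tx); have := bp x; lra.
have S0 : S !=set0 by exists (G 0 + b 0), 0.
exists (fun t => G t - inf S); split.
  by move=> t; have := drv_add (dG t) (drv_cst (- inf S) t); rewrite addr0.
apply: tends0_le b0 => t; rewrite ler_norml; apply/andP; split.
  have h : inf S <= G t + b t by apply: ge_inf; [exists (G t - b t); exact: lb|exists t].
  by move: h; clear; move: (inf S) => i h; lra.
have h : G t - b t <= inf S by apply: lb_le_inf => //; exact: lb.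
by move: h; clear; move: (inf S) => i h; lra.
Qed.

End tends_to_zero.

(* Solutions of [H'' + m H' = q H] with [H = 1] at minus infinity, by Picard
   iteration in the norm with weight [exp (B (s + s^2))], [s = exp (2 t)]. *)
Section volterra.
Context {R : realType}.
Variables (m K : R).
Hypotheses (m0 : 0 < m) (K0 : 0 < K).
Let s (t : R) : R := expR (2 * t).
Let B : R := K / (m + 2).
Definition weight (t : R) : R := expR (B * (s t + s t ^+ 2)).
Local Notation w := weight.

Let s_gt0 t : 0 < s t. Proof. exact: expR_gt0. Qed.
Let ds (t : R) : is_derive t 1 s (2 * s t). Proof. exact: drv_exp_lin. Qed.
Let B0 : 0 < B. Proof. by rewrite divr_gt0// addr_gt0. Qed.

Let dw (t : R) : is_derive t 1 w (B * (2 * s t + 4 * s t ^+ 2) * w t).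
Proof.
have := drv_expR (drv_mul (drv_cst B t) (drv_add (ds t) (drv_pow 2 (ds t)))).
set v := (X in is_derive _ _ _ X -> _) => h; suff <- : v = B * (2 * s t + 4 * s t ^+ 2) * w t by [].
by rewrite /v -/(w t); move: (s t) (w t) => x y; ring.
Qed.

Lemma weight_gt0 t : 0 < w t. Proof. exact: expR_gt0. Qed.

Lemma weight_ge1 t : 1 <= w t.
Proof. by rewrite /weight -[leLHS]expR0 ler_expR mulr_ge0 ?addr_ge0 ?exprn_ge0// ltW. Qed.

Lemma weight_le x y : x <= y -> w x <= w y.
Proof.
move=> xy; have h : s x <= s y by rewrite /s ler_expR ler_pM2l.
by rewrite /weight ler_expR ler_pM2l// lerD// lerXn2r// nnegrE ltW.
Qed.

Let near t : t <= 0 -> s t <= 1 /\ w t <= expR (B * 2).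
Proof.
move=> t0; have s1 : s t <= 1 by rewrite /s -[leRHS]expR0 ler_expR; lra.
split => //; rewrite /weight ler_expR ler_pM2l//; have : s t ^+ 2 <= 1 by rewrite expr_le1// ltW.
by lra.
Qed.

Let tends0_w1 : tends0 (fun t => w t - 1).
Proof.
apply: (@tends0_exp _ _ (B * 2 * expR (B * 2)) 2 0) => // t t0; have [s1 w2] := near t0.
rewrite ger0_norm ?subr_ge0 ?weight_ge1//.
have h : w t - 1 <= B * (s t + s t ^+ 2) * w t.
  have := expR_ge1Dx (- (B * (s t + s t ^+ 2))); rewrite expRN -/(w t) => h.
  have := ler_wpM2r (ltW (weight_gt0 t)) h; rewrite mulVf ?lt0r_neq0 ?weight_gt0// mulrDl mul1r mulNr; lra.
apply: le_trans h _; rewrite -/(s t).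
apply: le_trans (_ : B * (2 * s t) * expR (B * 2) <= _); last first.
  by rewrite le_eqVlt; apply/orP; left; apply/eqP; move: (s t) (expR _) => x y; ring.
apply: ler_pM => //; last 1 first.
- by rewrite ler_pM2l//; have := s_gt0 t; nra.
- by rewrite mulr_ge0 ?addr_ge0 ?exprn_ge0// ltW.
- exact: ltW (weight_gt0 t).
Qed.

(** [b1] and, below, [b2] are explicit majorants: their derivatives dominate the integrands of the
    first and of the second integration from minus infinity. *)
Let b1 (N t : R) := N / (m + 2) * (expR (m * t) * ((s t + s t ^+ 2) * w t)).

Let db1 N (t : R) : is_derive t 1 (b1 N) (N / (m + 2) * (expR (m * t) *
  ((m * (s t + s t ^+ 2) + (2 * s t + 4 * s t ^+ 2) + (s t + s t ^+ 2) * (B * (2 * s t + 4 * s t ^+ 2))) * w t))).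
Proof.
have := drv_mul (drv_cst (N / (m + 2)) t) (drv_mul (drv_exp_lin m t) (drv_mul (drv_add (ds t) (drv_pow 2 (ds t))) (dw t))).
set v := (X in is_derive _ _ _ X -> _) => h.
suff <- : v = N / (m + 2) * (expR (m * t) * ((m * (s t + s t ^+ 2) + (2 * s t + 4 * s t ^+ 2) + (s t + s t ^+ 2) * (B * (2 * s t + 4 * s t ^+ 2))) * w t)) by [].
by rewrite /v; move: (s t) (w t) (expR _) (N / _) => x y z c; ring.
Qed.

Let b1_ge N t : 0 <= N -> expR (m * t) * (N * ((s t + s t ^+ 2) * w t)) <= N / (m + 2) * (expR (m * t) *
  ((m * (s t + s t ^+ 2) + (2 * s t + 4 * s t ^+ 2) + (s t + s t ^+ 2) * (B * (2 * s t + 4 * s t ^+ 2))) * w t)).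
Proof.
move=> N0; have m2 : 0 < m + 2 by rewrite addr_gt0.
have -> : expR (m * t) * (N * ((s t + s t ^+ 2) * w t)) = N / (m + 2) * (expR (m * t) * ((m + 2) * (s t + s t ^+ 2) * w t)).
  by move: (s t) (w t) (expR _) => x y z; field; exact: lt0r_neq0.
apply: ler_wpM2l; first by rewrite divr_ge0// ltW.
rewrite ler_pM2l ?expR_gt0// ler_pM2r ?weight_gt0//.
have := s_gt0 t; move: (s t) => x x0; have := exprn_gt0 2 x0 => x2.
have : 0 <= (x + x ^+ 2) * (B * (2 * x + 4 * x ^+ 2)).
  have h1 : 0 <= x + x ^+ 2 by lra.
  have h2 : 0 <= 2 * x + 4 * x ^+ 2 by lra.
  exact: mulr_ge0 h1 (mulr_ge0 (ltW B0) h2).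
lra.
Qed.

Let tends0_b1 N : 0 <= N -> tends0 (b1 N).
Proof.
move=> N0; have m2 : 0 < m + 2 by rewrite addr_gt0.
apply: (@tends0_exp _ _ (N / (m + 2) * (2 * expR (B * 2))) m 0) => // t t0; have [s1 w2] := near t0.
have s0 := s_gt0 t; rewrite ger0_norm; last first.
  have h1 : 0 <= s t + s t ^+ 2 by rewrite addr_ge0 ?exprn_ge0// ltW.
  have h2 : 0 <= N / (m + 2) by rewrite divr_ge0// ltW.
  exact: mulr_ge0 h2 (mulr_ge0 (expR_ge0 _) (mulr_ge0 h1 (ltW (weight_gt0 t)))).
rewrite /b1 -[leRHS]mulrA; apply: ler_wpM2l; first by rewrite divr_ge0// ltW.
rewrite mulrC ler_pM2r ?expR_gt0//; apply: ler_pM => //.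
- by rewrite addr_ge0 ?exprn_ge0// ltW.
- exact: ltW (weight_gt0 t).
have h : s t ^+ 2 <= 1 by rewrite expr_le1// ltW.
lra.
Qed.

Let b2 (N t : R) := N / (2 * K) * (w t - 1).

Let db2 N (t : R) : is_derive t 1 (b2 N) (N / (2 * K) * (B * (2 * s t + 4 * s t ^+ 2) * w t)).
Proof.
have := drv_mul (drv_cst (N / (2 * K)) t) (drv_add (dw t) (drv_cst (- 1) t)).
by rewrite mul0r add0r addr0.
Qed.

Let b2_ge N t : 0 <= N -> N / (m + 2) * ((s t + s t ^+ 2) * w t) <=
  N / (2 * K) * (B * (2 * s t + 4 * s t ^+ 2) * w t).
Proof.
move=> N0; have m2 : 0 < m + 2 by rewrite addr_gt0.
have -> : N / (2 * K) * (B * (2 * s t + 4 * s t ^+ 2) * w t) = N / (m + 2) * ((s t + 2 * s t ^+ 2) * w t).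
  by rewrite /B; move: (s t) (w t) => y z; field; rewrite !lt0r_neq0.
apply: ler_wpM2l; first by rewrite divr_ge0// ltW.
by rewrite ler_pM2r ?weight_gt0//; have := exprn_gt0 2 (s_gt0 t); lra.
Qed.

Let tends0_b2 N : 0 <= N -> tends0 (b2 N).
Proof.
move=> N0; have c0 : 0 <= N / (2 * K) by rewrite divr_ge0// ltW// mulr_gt0.
have c1 : 0 < N / (2 * K) + 1 by rewrite ltr_wpDl.
move=> e e0; have e1 : 0 < e / (N / (2 * K) + 1) by rewrite divr_gt0.
have [t0 ht] := tends0_w1 e1; exists t0 => x /ht; rewrite (ltr_pdivlMr _ _ c1).
rewrite normrM (ger0_norm c0) mulrC; apply: le_lt_trans; apply: ler_wpM2r => //.
by rewrite lerDl.
Qed.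

(** The equation E'' + m E' = g in integrated form, with zero data at minus infinity. *)
Definition double_prim (E E1 g : R -> R) := [/\ forall t : R, is_derive t 1 E (E1 t),
  forall t : R, is_derive t 1 (fun t => expR (m * t) * E1 t) (expR (m * t) * g t),
  tends0 E & tends0 (fun t => expR (m * t) * E1 t)].

(** For g = q H with |H| <= M w one takes N = K M, and the result is at most (M / 2) w: the weight
    is chosen so that the Picard map contracts by the factor 1/2. *)
Lemma double_prim_bound E E1 g N : 0 <= N -> double_prim E E1 g ->
  (forall t, `|g t| <= N * ((s t + s t ^+ 2) * w t)) ->
  forall t, `|E1 t| <= N / (m + 2) * ((s t + s t ^+ 2) * w t) /\ `|E t| <= N / (2 * K) * (w t - 1).
Proof.
move=> N0 [dE dE1 E0 E10] hg; have m2 : 0 < m + 2 by rewrite addr_gt0.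
have h1 t : `|E1 t| <= N / (m + 2) * ((s t + s t ^+ 2) * w t).
  have := prim_bound dE1 (db1 N) _ E10 (tends0_b1 N0) t.
  rewrite normrM gtr0_norm ?expR_gt0// /b1 mulrCA ler_pM2l ?expR_gt0//; apply => x.
  rewrite normrM gtr0_norm ?expR_gt0//; apply: le_trans (b1_ge x N0).
  by rewrite ler_pM2l ?expR_gt0.
move=> t; split => //.
exact: (prim_bound dE (db2 N) (fun x => le_trans (h1 x) (b2_ge x N0)) E0 (tends0_b2 N0)).
Qed.

Lemma double_prim_exists g N : continuous g -> 0 <= N ->
  (forall t, `|g t| <= N * ((s t + s t ^+ 2) * w t)) -> exists E E1, double_prim E E1 g.
Proof.
move=> cg N0 hg; have m2 : 0 < m + 2 by rewrite addr_gt0.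
have c1 : continuous (fun t => expR (m * t) * g t) by cont.
have [I [dI I0]] : exists I : R -> R, (forall t : R, is_derive t 1 I (expR (m * t) * g t)) /\ tends0 I.
  apply: (prim_exists c1 (db1 N) _ (tends0_b1 N0)) => x.
  rewrite normrM gtr0_norm ?expR_gt0//; apply: le_trans (b1_ge x N0).
  by rewrite ler_pM2l ?expR_gt0.
pose E1 t := expR (- m * t) * I t.
have EI t : expR (m * t) * E1 t = I t by rewrite /E1 mulrA -expRD mulNr subrr expR0 mul1r.
have dI' (t : R) : is_derive t 1 (fun t => expR (m * t) * E1 t) (expR (m * t) * g t).
  by apply: der_ext (dI t) => x; rewrite EI.
have I0' : tends0 (fun t => expR (m * t) * E1 t).
  by move=> e /I0[t0 h]; exists t0 => t; rewrite EI; exact: h.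
have h1 t : `|E1 t| <= N / (m + 2) * ((s t + s t ^+ 2) * w t).
  have := prim_bound dI' (db1 N) _ I0' (tends0_b1 N0) t.
  rewrite normrM gtr0_norm ?expR_gt0// /b1 mulrCA ler_pM2l ?expR_gt0//; apply => x.
  rewrite normrM gtr0_norm ?expR_gt0//; apply: le_trans (b1_ge x N0).
  by rewrite ler_pM2l ?expR_gt0.
have cI : continuous I by move=> x; exact: der_cont (dI x).
have cE1 : continuous E1 by rewrite /E1; cont.
have [E [dE E0]] := prim_exists cE1 (db2 N) (fun x => le_trans (h1 x) (b2_ge x N0)) (tends0_b2 N0).
by exists E, E1; split.
Qed.

Lemma double_prim_sub E E1 g F F1 k : double_prim E E1 g -> double_prim F F1 k ->
  double_prim (fun t => E t - F t) (fun t => E1 t - F1 t) (fun t => g t - k t).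
Proof.
move=> [e1 e2 e3 e4] [f1 f2 f3 f4].
have X (a b c : R) : c * (a - b) = c * a - c * b by rewrite mulrBr.
split.
- by move=> t; exact: drv_add (e1 t) (drv_opp (f1 t)).
- by move=> t; rewrite X; apply: der_ext (drv_add (e2 t) (drv_opp (f2 t))) => x; rewrite X.
- exact: tends0_add e3 (tends0_opp f3).
- move=> e /(tends0_add e4 (tends0_opp f4))[t0 h]; exists t0 => t /h.
  by rewrite X.
Qed.

Definition frobenius (q H H1 : R -> R) := double_prim (fun t => H t - 1) H1 (fun t => q t * H t) /\
  forall t, `|H t| <= w t.

Let dyadic (e : R) : 0 < e -> exists n : nat, 2 ^- n < e.
Proof.
move=> e0; have [n hn] : exists n : nat, e^-1 < n%:R.
  by exists (Num.truncn e^-1).+1; rewrite truncnS_gt.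
exists n; rewrite -[ltRHS]invrK ltf_pV2 ?posrE ?invr_gt0 ?exprn_gt0//.
apply: lt_trans hn _; rewrite -natrX ltr_nat; exact: ltn_expl.
Qed.

Let small (a b : R) : 0 <= b -> (forall n : nat, a <= 2 ^- n * b) -> a <= 0.
Proof.
move=> b0 h; rewrite leNgt; apply/negP => a0.
have bp : 0 < b + 1 by rewrite ltr_wpDl.
have [n hn] := dyadic (divr_gt0 a0 bp).
move: hn; rewrite (ltr_pdivlMr _ _ bp) => hn; have := h n.
have : 0 < 2 ^- n :> R by rewrite invr_gt0 exprn_gt0.
by move: (2 ^- n) hn => x hn x0; nra.
Qed.

Let near3 (a b c e z : R) : `|a - c| < z / 3 -> `|c - e| < z / 3 -> `|b - e| < z / 3 -> `|a - b| < z.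
Proof.
rewrite !ltr_norml => /andP[h1 h2] /andP[h3 h4] /andP[h5 h6]; apply/andP; split; lra.
Qed.

Lemma frobenius_exists (q : R -> R) : continuous q ->
  (forall t, `|q t| <= K * (s t + s t ^+ 2)) -> exists H H1, frobenius q H H1.
Proof.
move=> cq hq; have sp t : 0 < s t + s t ^+ 2 by rewrite addr_gt0 ?exprn_gt0.
have qg (g : R -> R) M : (forall t, `|g t| <= M * w t) -> forall t, `|q t * g t| <= K * M * ((s t + s t ^+ 2) * w t).
  move=> hg t; rewrite normrM; have -> : K * M * ((s t + s t ^+ 2) * w t) = K * (s t + s t ^+ 2) * (M * w t) by ring.
  exact: ler_pM.
(* The Picard map [J] is chosen on all functions at once; on those that are not continuous or not
   bounded by a multiple of [w] its value is arbitrary. *)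
have step (g : R -> R) : exists E : R -> R, continuous g -> (exists2 M : R, 0 <= M & forall t, `|g t| <= M * w t) ->
    exists E1, double_prim E E1 (fun t => q t * g t).
  have [[cg [M M0 hg]]|no] := pselect (continuous g /\ exists2 M : R, 0 <= M & forall t, `|g t| <= M * w t).
    have [E [E1 h]] := double_prim_exists (cont_mul cq cg) (mulr_ge0 (ltW K0) M0) (qg g M hg).
    by exists E => _ _; exists E1.
  by exists g => cg hg; exfalso; apply: no.
have [J hJ] := choice step.
have Jb g k M N : continuous g -> (forall t, `|g t| <= M * w t) -> continuous k -> (forall t, `|k t| <= M * w t) ->
    0 <= M -> 0 <= N -> (forall t, `|g t - k t| <= N * w t) -> forall t, `|J g t - J k t| <= N / 2 * (w t - 1).
  move=> cg hg ck hk M0 N0 hN t; have [E1 dg] := hJ g cg (ex_intro2 _ _ M M0 hg).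
  have [F1 dk] := hJ k ck (ex_intro2 _ _ M M0 hk).
  have hD x : `|q x * g x - q x * k x| <= K * N * ((s x + s x ^+ 2) * w x).
    by rewrite -mulrBr; exact: (qg (fun x => g x - k x) N hN).
  have [_] := double_prim_bound (mulr_ge0 (ltW K0) N0) (double_prim_sub dg dk) hD t.
  rewrite (_ : K * N / (2 * K) = N / 2)//; field; exact: lt0r_neq0.
have J0 (g : R -> R) M : continuous g -> 0 <= M -> (forall t, `|g t| <= M * w t) ->
    continuous (J g) /\ forall t, `|J g t| <= M / 2 * (w t - 1).
  move=> cg M0 hg; have [E1 dg] := hJ g cg (ex_intro2 _ _ M M0 hg); split.
    by move=> t; case: dg => h _ _ _; exact: der_cont (h t).
  move=> t; have [_] := double_prim_bound (mulr_ge0 (ltW K0) M0) dg (qg g M hg) t.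
  rewrite (_ : K * M / (2 * K) = M / 2)//; field; exact: lt0r_neq0.
pose H n := iter n (fun g t => 1 + J g t) (fun=> 1).
have w1 := weight_ge1.
have Hn n : continuous (H n) /\ forall t, `|H n t| <= 1 * w t.
  elim: n => [|n [cH bH]] /=; first by split; [exact: cont_cst|move=> t; rewrite normr1 mul1r].
  have [c1 b1'] := J0 _ 1 cH ler01 bH; split; first exact: cont_add (@cont_cst R 1) c1.
  move=> t; apply: le_trans (ler_normD _ _) _; rewrite normr1.
  by have := b1' t; have := w1 t; lra.
have Hd n t : `|H n.+1 t - H n t| <= 2 ^- n.+1 * w t.
  elim: n t => [|n IH] t /=.
    rewrite addrAC subrr add0r; have [_ h] := J0 _ 1 (Hn 0%N).1 ler01 (Hn 0%N).2.
    by apply: le_trans (h t) _; rewrite expr1; have := w1 t; lra.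
  have -> : 1 + J (H n.+1) t - (1 + J (H n) t) = J (H n.+1) t - J (H n) t by lra.
  apply: le_trans (Jb _ _ 1 (2 ^- n.+1) (Hn n.+1).1 (Hn n.+1).2 (Hn n).1 (Hn n).2 ler01 _ IH t) _.
    by rewrite invr_ge0 exprn_ge0.
  rewrite (exprS 2 n.+1) invfM (mulrC (2^-1)); apply: ler_wpM2l.
    by rewrite mulr_ge0// invr_ge0 exprn_ge0.
  by rewrite gerBl.
(* The iterates lie between a nondecreasing and a nonincreasing sequence at distance 2^-n w from
   them; the limit is defined as the supremum of the lower one. *)
pose u n t := H n t - 2 ^- n * w t; pose v n t := H n t + 2 ^- n * w t.
have half n t : 2 ^- n * w t = 2 * (2 ^- n.+1 * w t).
  by rewrite mulrA exprS invfM mulrA divff ?mul1r.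
have un t : {homo u ^~ t : n p / (n <= p)%N >-> n <= p}.
  apply: homo_leq => [x|x y z h1 h2|n]; [exact: lexx|exact: le_trans h1 h2|].
  by have := Hd n t; rewrite /u (half n) ler_norml => /andP[h _]; lra.
have vn t : {homo v ^~ t : n p / (n <= p)%N >-> p <= n}.
  apply: homo_leq => [x|x y z h1 h2|n]; [exact: lexx|exact: le_trans h2 h1|].
  by have := Hd n t; rewrite /v (half n) ler_norml => /andP[_ h]; lra.
have uv n p t : u n t <= v p t.
  apply: le_trans (un t _ _ (leq_maxl n p)) _; apply: le_trans _ (vn t _ _ (leq_maxr n p)).
  rewrite /u /v; have : 0 <= 2 ^- maxn n p * w t by rewrite mulr_ge0 ?invr_ge0 ?exprn_ge0// ltW// weight_gt0.
  lra.
pose L t := sup (range (u ^~ t)).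
have Lb n t : `|L t - H n t| <= 2 ^- n * w t.
  have h1 : u n t <= L t by apply: ub_le_sup; [exists (v 0%N t) => _ [p _ <-]|exists n].
  have h2 : L t <= v n t by apply: ge_sup; [exists (u 0%N t), 0%N|move=> _ [p _ <-]].
  by move: h1 h2; rewrite /u /v => h1 h2; rewrite ler_norml; apply/andP; split; lra.
have Lw t : `|L t| <= 1 * w t.
  have : `|L t| - w t <= 0; last by lra.
  apply: (@small _ (w t)); first exact: ltW (weight_gt0 t).
  move=> n; have [_ /(_ t) h] := Hn n; have := Lb n t.
  by have := ler_normD (L t - H n t) (H n t); rewrite subrK; lra.
have cL : continuous L.
  move=> x; apply/cvgrPdist_lt => e e0; have e3 : 0 < e / 3 / w (x + 1) by rewrite !divr_gt0 ?weight_gt0.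
  have [n hn] := dyadic e3; have [cH _] := Hn n.
  have hn' y : y <= x + 1 -> `|L y - H n y| < e / 3.
    move=> yx; apply: le_lt_trans (Lb n y) _; move: hn; rewrite ltr_pdivlMr ?weight_gt0// => hn.
    apply: le_lt_trans _ hn; apply: ler_wpM2l; first by rewrite invr_ge0 exprn_ge0.
    exact: weight_le.
  have e3' : 0 < e / 3 by rewrite divr_gt0.
  have := cH x; move=> /cvgrPdist_lt /(_ _ e3') near1.
  have near2 : \forall y \near x, y < x + 1 by apply: lt_nbhsl; rewrite ltrDl.
  near=> y; have h1 : `|H n x - H n y| < e / 3 by near: y.
  have yx : y <= x + 1 by apply: ltW; near: y.
  have h2 := hn' x ltac:(by rewrite lerDl); have h3 := hn' y yx.
  exact: near3 h2 h1 h3.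
have fixL t : J L t = L t - 1.
  apply/eqP; rewrite -subr_eq0 -normr_le0; apply: (@small _ (w t)); first exact: ltW (weight_gt0 t).
  move=> n; have := Lb n.+1 t; rewrite /= (half n).
  have := Jb _ _ 1 (2 ^- n) cL Lw (Hn n).1 (Hn n).2 ler01 _ (Lb n) t => /(_ _).
  rewrite invr_ge0 exprn_ge0// => /(_ erefl).
  have : 2 ^- n / 2 * (w t - 1) <= 2 ^- n.+1 * w t.
    rewrite exprS invfM (mulrC 2^-1); apply: ler_wpM2l; last by rewrite gerBl.
    by rewrite mulr_ge0// invr_ge0 exprn_ge0.
  move: (2 ^- n.+1 * w t) (2 ^- n / 2 * _) => a b h1 h2 h3.
  have -> : J L t - (L t - 1) = (J L t - J (H n) t) - (L t - (1 + J (H n) t)) by lra.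
  by apply: le_trans (ler_normB _ _) _; lra.
have [E1 dE] := hJ L cL (ex_intro2 _ _ 1 ler01 Lw).
exists L, E1; split; last by move=> t; rewrite -[w t]mul1r.
by have <- : J L = fun t => L t - 1 by apply/funext.
Unshelve. all: by end_near. Qed.

(** A bound M w for the difference of the solutions improves to (M/2 + de/(2K)) w. Iterating from
    the trivial bound leads to the fixed point M = de/K. *)
Lemma frobenius_stable (q q' : R -> R) (de : R) H H1 H' H1' : 0 <= de ->
  (forall t, `|q t| <= K * (s t + s t ^+ 2)) -> (forall t, `|q t - q' t| <= de * (s t + s t ^+ 2)) ->
  frobenius q H H1 -> frobenius q' H' H1' -> forall t,
  `|H t - H' t| <= de / K * w t /\ `|H1 t - H1' t| <= 2 * de / (m + 2) * ((s t + s t ^+ 2) * w t).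
Proof.
move=> de0 hq hqq [dH bH] [dH' bH'].
have dE := double_prim_sub dH dH'.
have est (M : R) : 0 <= M -> (forall t, `|H t - H' t| <= M * w t) -> forall t,
    `|H1 t - H1' t| <= (K * M + de) / (m + 2) * ((s t + s t ^+ 2) * w t) /\
    `|H t - H' t| <= (M / 2 + de / (2 * K)) * w t.
  move=> M0 hM t; have KM : 0 <= K * M + de by rewrite addr_ge0 ?mulr_ge0// ltW.
  have [||h1 h2] := double_prim_bound (N := K * M + de) _ dE _ t; [by []| |split => //].
    move=> x; have -> : q x * H x - q' x * H' x = q x * (H x - H' x) + (q x - q' x) * H' x by ring.
    apply: le_trans (ler_normD _ _) _; rewrite !normrM mulrDl; apply: lerD.
      rewrite (_ : K * M * _ = K * (s x + s x ^+ 2) * (M * w x)); last by ring.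
      exact: ler_pM.
    by rewrite mulrA; exact: ler_pM.
  have -> : H t - H' t = H t - 1 - (H' t - 1) by lra.
  apply: le_trans h2 _; rewrite (_ : (K * M + de) / (2 * K) = M / 2 + de / (2 * K)); last by field; exact: lt0r_neq0.
  apply: ler_wpM2l; last by rewrite gerBl.
  by rewrite addr_ge0 ?divr_ge0 ?mulr_ge0// ltW.
have dK : 0 <= de / K by rewrite divr_ge0// ltW.
have it n t : `|H t - H' t| <= (2 * 2 ^- n + de / K) * w t.
  elim: n t => [|n IH] t.
    rewrite expr0 invr1 mulr1; apply: le_trans (ler_normB _ _) _.
    have := bH t; have := bH' t; have := mulr_ge0 dK (ltW (weight_gt0 t)); lra.
  have M0 : 0 <= 2 * 2 ^- n + de / K by rewrite addr_ge0// mulr_ge0// invr_ge0 exprn_ge0.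
  have [_] := est _ M0 IH t.
  rewrite (_ : (2 * 2 ^- n + de / K) / 2 + de / (2 * K) = 2 * 2 ^- n.+1 + de / K)//.
  rewrite exprS; have : 2 ^+ n != 0 :> R by rewrite expf_neq0.
  by move: (2 ^+ n) => x x0; field; rewrite x0 lt0r_neq0.
have fin t : `|H t - H' t| <= de / K * w t.
  rewrite -subr_le0; apply: (@small _ (2 * w t)); first by rewrite mulr_ge0// ltW// weight_gt0.
  by move=> n; have := it n t; rewrite mulrDl mulrA (mulrC _ 2); lra.
move=> t; split => //; have [h _] := est _ dK fin t.
apply: le_trans h _; rewrite (_ : K * (de / K) + de = 2 * de)//; field; exact: lt0r_neq0.
Qed.

End volterra.

(** * Positivity of the regular solution *)

Section frobenius_positivity.
Context {R : realType}.
Variables (m K : R) (q H H1 : R -> R).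
Hypotheses (m0 : 0 < m) (K0 : 0 < K) (cq : continuous q) (FH : frobenius m K q H H1).

Lemma frobenius_der (t : R) : is_derive t 1 H (H1 t).
Proof.
have [[h _ _ _] _] := FH; have := drv_add (h t) (drv_cst 1 t); rewrite addr0.
by apply: der_ext => x; rewrite subrK.
Qed.

Lemma frobenius_der1 (t : R) : is_derive t 1 (fun t => expR (m * t) * H1 t) (expR (m * t) * (q t * H t)).
Proof. by have [[_ h _ _] _] := FH. Qed.

Lemma frobenius_der2 (t : R) : is_derive t 1 H1 (q t * H t - m * H1 t).
Proof.
have := drv_mul (drv_exp_lin (- m) t) (frobenius_der1 t).
set w := (X in is_derive _ _ _ X -> _) => h; have e : expR (- m * t) * expR (m * t) = 1.
  by rewrite -expRD mulNr addNr expR0.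
have <- : w = q t * H t - m * H1 t.
  transitivity ((expR (- m * t) * expR (m * t)) * (q t * H t - m * H1 t)); last by rewrite e mul1r.
  by rewrite /w; move: (expR _) (expR _) (H1 t) (q t) (H t) => x y z u v; ring.
by apply: der_ext h => x; rewrite mulrA -expRD mulNr addNr expR0 mul1r.
Qed.

Lemma frobenius_near : exists t0 : R, forall t, t <= t0 -> 1 / 2 <= H t <= 2.
Proof.
have [[_ _ h _] _] := FH; have [t0 ht] := h (1 / 2) ltac:(by []).
exists t0 => t /ht; rewrite ltr_norml => /andP[h1 h2]; apply/andP; split; lra.
Qed.

Let cH : continuous H. Proof. by move=> t; exact: der_cont (frobenius_der t). Qed.

Lemma frobenius_ge0 : (forall t, 0 <= q t) -> forall t, 0 <= H t.
Proof.
move=> q0 t; rewrite leNgt; apply/negP => neg; have [tm hm] := frobenius_near.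
have tmt : tm <= t.
  by rewrite leNgt; apply/negP => /ltW /hm /andP[h _]; lra.
have Hm : 0 < H tm by have /andP[h _] := hm tm (lexx _); lra.
have [c [/andP[tmc _] Hc pos]] := first_zero cH tmt Hm (ltW neg).
have {}pos x : x < c -> 0 <= H x.
  move=> xc; case: (leP x tm) => [/hm/andP[h _]|/ltW h]; first by lra.
  by apply: ltW; exact: pos.
have h1 x : x <= c -> 0 <= H1 x.
  move=> xc; rewrite -(pmulr_rge0 _ (expR_gt0 (m * x))).
  apply: (@nondec_from_ninfty _ _ _ c (fun t _ => frobenius_der1 t)) => // [y yc|].
    by rewrite mulr_ge0 ?expR_ge0// mulr_ge0// pos.
  by apply: tends0_vanishing; have [[_ _ _ h] _] := FH.
have : H tm <= H c.
  apply: (@der_nondec _ H H1 tm c (ltW tmc)) => [x _|x /andP[_ /ltW]]; first exact: frobenius_der.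
  exact: h1.
by rewrite Hc leNgt Hm.
Qed.

(** Where q >= 0 and H > 0, e^{mt} H1 is nondecreasing; once positive it stays so, and [H]
    increases. *)
Lemma frobenius_persist (t1 : R) : (forall t, t1 <= t -> 0 <= q t) -> (forall t, t <= t1 -> 0 < H t) ->
  0 < H1 t1 -> forall t, 0 <= H t.
Proof.
move=> q0 pos H10 t; case: (leP t t1) => [/pos/ltW//|/ltW t1t].
rewrite leNgt; apply/negP => neg.
have [c [/andP[t1c _] Hc pos']] := first_zero cH t1t (pos _ (lexx _)) (ltW neg).
have h1 x : t1 <= x -> x <= c -> 0 <= H1 x.
  move=> t1x xc; rewrite -(pmulr_rge0 _ (expR_gt0 (m * x))).
  have : expR (m * t1) * H1 t1 <= expR (m * x) * H1 x.
    apply: (@der_nondec _ (fun t => expR (m * t) * H1 t) (fun t => expR (m * t) * (q t * H t)) t1 x t1x).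
      by move=> y _; exact: frobenius_der1.
    move=> y /andP[t1y yx]; rewrite mulr_ge0 ?expR_ge0// mulr_ge0 ?q0 ?(ltW t1y)//.
    by rewrite ltW// pos' ?(ltW t1y)//; exact: lt_le_trans yx xc.
  by apply: le_trans; rewrite mulr_ge0 ?expR_ge0// ltW.
have : H t1 <= H c.
  apply: (@der_nondec _ H H1 t1 c (ltW t1c)) => [x _|x /andP[/ltW h /ltW h']]; first exact: frobenius_der.
  exact: h1.
by rewrite Hc leNgt pos.
Qed.

(* A nonnegative solution has no zero: there it would have zero Cauchy data. *)
Lemma frobenius_gt0 : (forall t, 0 <= H t) -> forall t, 0 < H t.
Proof.
move=> H0 c; rewrite lt_neqAle H0 andbT; apply/eqP => Hc; move/esym: Hc => Hc.
have H1c : H1 c = 0.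
  apply: der_uniq (frobenius_der c) _.
  apply: (@derive1_at_min _ H (c - 1) (c + 1)) => [|t _||t _].
  - by lra.
  - by case: (frobenius_der t).
  - by rewrite in_itv /=; apply/andP; split; lra.
  - by rewrite Hc.
have [t0 ht] := frobenius_near; pose tm := Num.min t0 c.
have tmc : tm <= c by rewrite ge_min lexx orbT.
have Hm : 1 / 2 <= H tm by have /andP[] := ht tm ltac:(by rewrite ge_min lexx).
have [Q [Q0 hQ]] := continuous_bounded_itv tm c cq.
(* Gronwall's argument backwards: with this rate, (H^2 + H1^2) e^{Lt} is nondecreasing on [tm, c],
   so it cannot go from a positive value to 0. *)
pose L := 1 + Q + 2 * m; pose y t := H t ^+ 2 + H1 t ^+ 2.
pose z t := y t * expR (L * t).
pose z' t := (2 * H t * H1 t + 2 * H1 t * (q t * H t - m * H1 t) + L * y t) * expR (L * t).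
have dz (t : R) : is_derive t 1 z (z' t).
  have := drv_mul (drv_add (drv_pow 2 (frobenius_der t)) (drv_pow 2 (frobenius_der2 t))) (drv_exp_lin L t).
  set w := (X in is_derive _ _ _ X -> _) => h; suff <- : w = z' t by [].
  by rewrite /w /z' /y; move: (expR _) (H1 t) (q t) (H t) => e a b u; ring.
have : z tm <= z c.
  apply: (@der_nondec _ z z' tm c tmc) => // t /andP[/ltW h1 /ltW h2].
  rewrite /z' mulr_ge0 ?expR_ge0// /y /L; have := hQ t ltac:(by rewrite h1 h2).
  rewrite ler_norml; move: (H1 t) (q t) (H t) => a b u /andP[b1 b2].
  have p1 : 0 <= (a + u) ^+ 2 by exact: sqr_ge0.
  have p2 : 0 <= (Q + b) * (a + u) ^+ 2 by rewrite mulr_ge0 ?sqr_ge0//; lra.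
  have p3 : 0 <= (Q - b) * (a - u) ^+ 2 by rewrite mulr_ge0 ?sqr_ge0//; lra.
  have p4 : 0 <= m * u ^+ 2 by rewrite mulr_ge0 ?sqr_ge0// ltW.
  lra.
rewrite /z {2}/y Hc H1c expr0n /= addr0 mul0r leNgt => /negP; apply.
by rewrite mulr_gt0 ?expR_gt0// /y ltr_pwDl ?sqr_ge0// exprn_gt0//; lra.
Qed.

Lemma frobenius_lower (t1 : R) : (forall t, 0 < H t) -> exists2 e : R, 0 < e & forall t, t <= t1 -> e <= H t.
Proof.
move=> pos; have [t0 ht] := frobenius_near; pose tm := Num.min t0 t1.
have tmt1 : tm <= t1 by rewrite ge_min lexx orbT.
have [c _ hc] := EVT_min tmt1 (@continuous_subspaceT _ _ `[tm, t1] H cH).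
exists (Num.min (1 / 2) (H c)); first by rewrite lt_min pos andbT.
move=> t tt; rewrite ge_min; case: (leP t tm) => h.
  by move: h; rewrite le_min => /andP[/ht/andP[-> _]].
by rewrite (hc t) ?orbT// in_itv /= (ltW h).
Qed.

End frobenius_positivity.

(** * The shooting argument *)

Section ground_state.
Context {R : realType} (d : nat) (omega : R) (f f1 f2 : R -> R).
Hypotheses (d13 : 13 <= d%:R :> R) (om : d%:R - 4 < omega < d%:R)
  (SP : sing_profile d omega f f1 f2).
Let D : R := d%:R.
Let s (t : R) : R := expR (2 * t).

(* [F = e^{(m - (d-2)) t / 2} H] solves [F'' + (d-2) F' = (V - lambda s) F]
   if [H'' + m H' = ground_potential * H]. *)
Definition frob_exp : R := Num.sqrt (d%:R ^+ 2 - 16 * d%:R + 40).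
Definition ground_potential (lambda t : R) : R :=
  3 * (d%:R - 3) * (1 - f t ^+ 2) + (expR (2 * t) ^+ 2 - omega * expR (2 * t)) - lambda * expR (2 * t).
Local Notation m := frob_exp.
Local Notation q := ground_potential.

Let d0 : 13 <= D := d13.
Let w1 : D - 4 < omega. Proof. by case/andP: om. Qed.
Let w2 : omega < D. Proof. by case/andP: om. Qed.
Let s_gt0 t : 0 < s t. Proof. exact: expR_gt0. Qed.
Let ds (t : R) : is_derive t 1 s (2 * s t). Proof. exact: drv_exp_lin. Qed.

(** D^2 - 16 D + 40 is the discriminant both of x^2 + (D - 2) x + 3 (D - 3), the indicial equation
    of L at the origin, and of x^2 + (D - 4) x + 2 (D - 3), that of the equation of [f] linearized
    at 1. *)
Lemma frob_exp_sqr : m ^+ 2 = D ^+ 2 - 16 * D + 40.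
Proof. by rewrite sqr_sqrtr// -/D; have := d0; nra. Qed.

Lemma frob_exp_bounds : 0 < m < D - 4.
Proof.
have h := frob_exp_sqr; have mp : 0 <= m := sqrtr_ge0 _; have := d0 => h0.
have m1 : 0 < m.
  by rewrite lt_neqAle mp andbT; apply/eqP => e; move: h; rewrite -e expr0n /=; nra.
by rewrite m1 /=; nra.
Qed.

Lemma continuous_ground_potential lambda : continuous (q lambda).
Proof.
have cf : continuous f by move=> x; exact: der_cont (sp_der SP x).
have cs : continuous (fun t : R => expR (2 * t)) by cont.
rewrite /ground_potential; apply: cont_add; last by apply: cont_opp; apply: cont_mul cs; exact: cont_cst.
apply: cont_add; first by apply: cont_mul; [exact: cont_cst|apply: cont_add; [exact: cont_cst|apply: cont_opp; exact: cont_pow]].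
apply: cont_add; first exact: cont_pow.
by apply: cont_opp; apply: cont_mul cs; exact: cont_cst.
Qed.

Lemma ground_potential_bound : exists2 K : R, 0 < K &
  forall lambda t, `|lambda| <= omega + 1 -> `|q lambda t| <= K * (s t + s t ^+ 2).
Proof.
have [C [C0 hC]] := profile_deficit SP; have [h0 h1 h2] := And3 d0 w1 w2.
exists (3 * (D - 3) * C + 2 * omega + 2); first by have p : 0 <= (D - 3) * C; [rewrite mulr_ge0//; lra|lra].
move=> la t hla; have := hC t; have := profile_lt1 d13 om SP t; have := sp_pos SP t; rewrite -/(s t) => f0 fl hD.
have F1 : 0 <= 1 - f t ^+ 2 by nra.
move: hla; rewrite !ler_norml /ground_potential -/D -/(s t) => /andP[l1 l2].
have := s_gt0 t; move: (1 - f t ^+ 2) (s t) F1 hD => F x F1 hD x0; have x2 := exprn_gt0 2 x0.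
have p1 : 0 <= (D - 3) * F by rewrite mulr_ge0//; lra.
have p2 : 0 <= (D - 3) * (C * x - F) by rewrite mulr_ge0//; lra.
have p3 : 0 <= (D - 3) * C * x ^+ 2 by rewrite !mulr_ge0//; lra.
have p4 : 0 <= (omega + 1 - la) * x by rewrite !mulr_ge0//; lra.
have p5 : 0 <= (omega + 1 + la) * x by rewrite !mulr_ge0//; lra.
have p6 : 0 <= omega * x by rewrite !mulr_ge0//; lra.
have p7 : 0 <= omega * x ^+ 2 by rewrite !mulr_ge0//; lra.
by apply/andP; split; lra.
Qed.

(* Wronskian with [u] itself, which is a positive decaying solution of
   [-Delta u + (x^2 - omega - u^2) u = 0]. *)
Lemma ground_eigenvalue_lt0 K lambda H H1 : 0 < K -> frobenius m K (q lambda) H H1 ->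
  (forall t, 0 <= H t) -> lambda < 0.
Proof.
move=> K0 FH H0; rewrite ltNge; apply/negP => l0.
have [h0 h1 h2] := And3 d0 w1 w2; have /andP[m0 mD] := frob_exp_bounds.
have Hp := frobenius_gt0 m0 (@continuous_ground_potential lambda) FH H0.
(* The factor e^{bt} turns the coefficient D - 4 in the equation of [f] into [m], the one in the
   equation of [H], so that the Wronskian can be formed. *)
pose b := (D - 4 - m) / 2; have b0 : 0 < b by rewrite /b; lra.
have bb : b ^+ 2 + m * b = 2 * (D - 3) by have := frob_exp_sqr; rewrite /b; lra.
pose G t := expR (b * t) * f t; pose G1 t := expR (b * t) * (b * f t + f1 t).
have dG (t : R) : is_derive t 1 G (G1 t).
  have := drv_mul (drv_exp_lin b t) (sp_der SP t).
  set w := (X in is_derive _ _ _ X -> _) => h; suff <- : w = G1 t by [].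
  by rewrite /w /G1; ring.
have dG1 (t : R) : is_derive t 1 (fun t => expR (m * t) * G1 t)
    (expR (m * t) * ((2 * (D - 3) + (D - 3) * (1 - f t ^+ 2) + (s t ^+ 2 - omega * s t)) * G t)).
  have := drv_mul (drv_exp_lin m t) (drv_mul (drv_exp_lin b t) (drv_add (drv_mul (drv_cst b t) (sp_der SP t)) (sp_der1 SP t))).
  set w := (X in is_derive _ _ _ X -> _) => h.
  suff <- : w = expR (m * t) * ((2 * (D - 3) + (D - 3) * (1 - f t ^+ 2) + (s t ^+ 2 - omega * s t)) * G t) by [].
  rewrite /w (sp_ode SP) -/D -/(s t) -bb /G; move: (expR _) (expR _) (s t) (f t) (f1 t) => e1 e2 x y z.
  by rewrite /b; field.
pose Wr t := expR (m * t) * H1 t * G t - H t * (expR (m * t) * G1 t).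
pose Wr' t := - (expR (m * t) * (H t * G t) * (2 * (D - 3) * f t ^+ 2 + lambda * s t)).
have dWr (t : R) : is_derive t 1 Wr (Wr' t).
  have := drv_add (drv_mul (frobenius_der1 FH t) (dG t)) (drv_opp (drv_mul (frobenius_der FH t) (dG1 t))).
  set w := (X in is_derive _ _ _ X -> _) => h; suff <- : w = Wr' t by [].
  rewrite /w /Wr' /ground_potential -/D -/(s t); move: (expR _) (s t) (f t) (G t) (G1 t) (H t) (H1 t) => e x y g g1 u v.
  by ring.
have G0 t : 0 < G t by rewrite mulr_gt0 ?expR_gt0// (sp_pos SP).
have Wneg t : 0 < - Wr' t.
  rewrite /Wr' opprK; apply: mulr_gt0; first exact: mulr_gt0 (expR_gt0 _) (mulr_gt0 (Hp t) (G0 t)).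
  apply: ltr_pwDl; last by rewrite mulr_ge0// ltW.
  by rewrite !mulr_gt0 ?exprn_gt0 ?(sp_pos SP)//; lra.
have vW : vanishing (fun t => - Wr t).
  apply: tends0_vanishing; apply: tends0_opp.
  have [[_ _ _ tI] _] := FH; have [t0 ht0] := frobenius_near FH.
  have [C [t3 [_ ht3]]] := profile_near_origin SP.
  move=> e e0; have e2 : 0 < e / 2 by rewrite divr_gt0.
  have [t4 ht4] := tI _ e2.
  have e5 : 0 < e / 2 / (2 * (b + 1)) by rewrite !divr_gt0// mulr_gt0//; lra.
  have [t5 h5 ht5] := expR_small (Num.min 0 (Num.min t0 (Num.min t3 t4))) m0 e5.
  exists t5 => t tt; have := le_trans tt h5; rewrite !le_min => /andP[tz /andP[tt0 /andP[tt3 tt4]]].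
  have /andP[_ Hle] := ht0 t tt0; have [_ _ f1b _] := ht3 t tt3; have I4 := ht4 t tt4.
  have := ht5 t tt; rewrite ltr_pdivlMr ?mulr_gt0//; last by lra.
  move=> em; have fl := profile_lt1 d13 om SP t; have fp := sp_pos SP t.
  have eb : expR (b * t) <= 1 by rewrite -[leRHS]expR0 ler_expR; nra.
  have Gl : G t <= 1 by rewrite -[leRHS]mulr1; apply: ler_pM => //; rewrite ?expR_ge0// ltW.
  have G1l : `|G1 t| <= b + 1.
    rewrite /G1 normrM (gtr0_norm (expR_gt0 _)) -[leRHS]mul1r; apply: ler_pM => //.
    apply: le_trans (ler_normD _ _) _; apply: lerD; last by apply: le_trans f1b _; lra.
    by rewrite normrM !gtr0_norm// ger_pMr// ltW.
  apply: le_lt_trans (ler_normB _ _) _; rewrite [e]splitr; apply: ltr_leD.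
    rewrite normrM (gtr0_norm (G0 t)); apply: le_lt_trans _ I4.
    exact: ler_piMr (normr_ge0 _) Gl.
  rewrite [`|H t * _|]normrM [`|expR (m * t) * _|]normrM (gtr0_norm (Hp t)) (gtr0_norm (expR_gt0 _)).
  have := normr_ge0 (G1 t); have := Hp t; have := expR_gt0 (m * t).
  move: (`|G1 t| : R) (H t) (expR (m * t)) Hle G1l em => g u x Hle G1l em x0 u0 g0.
  apply: le_trans (_ : 2 * (x * (b + 1)) <= _); last by lra.
  by apply: ler_pM => //; [exact: ltW|rewrite mulr_ge0// ltW|apply: ler_pM => //; exact: ltW].
have Winc := @inc_from_ninfty _ (fun t => - Wr t) (fun t => - Wr' t).
have W0 : 0 < - Wr 0 by apply: (Winc 0) => // t _; exact: drv_opp (dWr t).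
pose de := - Wr 0.
have Wde t : 0 <= t -> Wr t <= - de.
  move=> t0; rewrite lerNr; apply: (@der_nondec _ (fun t => - Wr t) (fun t => - Wr' t) 0 t t0).
  by move=> x _; exact: ltW.
(* The Wronskian stays below a negative constant while e^{mt} G^2 tends to 0, so the ratio H / G
   decreases at least linearly and would become negative. *)
pose r t := H t * (G t)^-1.
pose r' t := H1 t * (G t)^-1 + H t * (- (G t) ^- 2 * G1 t).
have dr (t : R) : is_derive t 1 r (r' t).
  exact: (drv_mul (frobenius_der FH t) (drv_inv (lt0r_neq0 (G0 t)) (dG t))).
have r'E t : r' t = Wr t * (expR (m * t) * G t ^+ 2)^-1.
  rewrite /r' /Wr; have := lt0r_neq0 (G0 t); have := lt0r_neq0 (expR_gt0 (m * t)).
  move: (expR _) (G t) (G1 t) (H t) (H1 t) => e g g1 u v e0 g0; field.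
  by rewrite e0 g0.
(* A rate of decay far above the growth rate m + 2b = D - 4 of the exponential factors. *)
have [M [M0 hM]] := profile_fast_decay SP (3 * d).
have e0 : 0 < de / M ^+ 2 by rewrite divr_gt0 ?exprn_gt0.
have [t' ht' h'] := @expR_small R 1 _ 0 ltac:(by []) e0.
pose T := - t'; have T0 : 0 <= T by rewrite /T oppr_ge0.
have small t : T <= t -> expR (m * t) * G t ^+ 2 <= de.
  move=> Tt; have t0 := le_trans T0 Tt; have := h' (- t) ltac:(by rewrite lerNl).
  rewrite ltr_pdivlMr ?exprn_gt0// mul1r => /ltW h; apply: le_trans h.
  have fM := hM t t0; have fp := sp_pos SP t.
  rewrite /G exprMn; apply: le_trans (_ : expR (m * t) * (expR (b * t) ^+ 2 * (M * expR (- ((3 * d)%:R * t))) ^+ 2) <= _).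
    rewrite ler_pM2l ?expR_gt0// ler_pM2l ?exprn_gt0 ?expR_gt0//.
    by rewrite lerXn2r// nnegrE ?mulr_ge0 ?expR_ge0// ltW.
  rewrite exprMn -!expRM_natl.
  rewrite (_ : expR (m * t) * _ = expR (m * t) * expR (2%:R * (b * t)) * expR (2%:R * - ((3 * d)%:R * t)) * M ^+ 2); last by ring.
  rewrite -!expRD ler_pM2r ?exprn_gt0// ler_expR natrM -/D /b.
  by move: m t0 => x t0; nra.
have dec t : T <= t -> r' t <= - 1.
  move=> Tt; rewrite r'E; have t0 := le_trans T0 Tt; have := small t Tt; have := Wde t t0.
  have p0 : 0 < expR (m * t) * G t ^+ 2 by rewrite mulr_gt0 ?expR_gt0 ?exprn_gt0.
  by move: (expR _ * _) (Wr t) p0 => x y p0 h3 h4; rewrite ler_pdivrMr//; lra.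
have rp t : 0 < r t by rewrite mulr_gt0 ?invr_gt0.
have : - r T - T <= - r (T + r T) - (T + r T).
  apply: (@der_nondec _ (fun t => - r t - t) (fun t => - r' t - 1)); first by rewrite lerDl ltW.
  by move=> x /andP[/ltW Tx _]; have := dec x Tx; lra.
by have := rp (T + r T); lra.
Qed.

(** The eigenvalue [ls] is the supremum of the [lambda] whose regular solution stays nonnegative.
    Continuous dependence on [lambda] keeps this property at [ls]; if [H1] were positive somewhere
    beyond [T], where the potential is nonnegative, a slightly larger [lambda] would have it too. So
    [H] is nonincreasing there. *)
Lemma ground_state : exists (lambda T N : R) (H H1 : R -> R),
  [/\ lambda < 0, forall t, 0 < H t, forall t, T <= t -> H1 t <= 0 & forall t, t <= 0 -> `|H t| <= N /\ `|H1 t| <= N] /\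
  ((forall t : R, is_derive t 1 H (H1 t)) /\ forall t : R, is_derive t 1 H1 (q lambda t * H t - m * H1 t)).
Proof.
have [h0 h1 h2] := And3 d0 w1 w2; have /andP[m0 mD] := frob_exp_bounds.
have [K K0 hK] := ground_potential_bound.
have ex la : exists HH : (R -> R) * (R -> R), `|la| <= omega + 1 -> frobenius m K (q la) HH.1 HH.2.
  have [hla|] := leP `|la| (omega + 1); last by exists (f, f).
  have [H [H1 h]] := frobenius_exists m0 K0 (@continuous_ground_potential la) (fun t => hK la t hla).
  by exists (H, H1).
have [S hS] := choice ex.
(* For lambda = - omega the potential is nonnegative, so [A] is not empty. The upper limit 1 keeps
   [lambda] in the range of [ground_potential_bound] and leaves room above the negative elements of
   [A]. *)
pose A : set R := [set la | - omega <= la <= 1 /\ forall t, 0 <= (S la).1 t].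
have rng la : - omega <= la <= 1 -> `|la| <= omega + 1.
  by move=> /andP[? ?]; rewrite ler_norml; apply/andP; split; lra.
have A0 : A (- omega).
  have r0 : - omega <= - omega <= 1 by apply/andP; split; lra.
  split => //; apply: (frobenius_ge0 (hS _ (rng _ r0))) => t.
  rewrite /ground_potential -/D -/(s t); have := profile_lt1 d13 om SP t; have := sp_pos SP t => f0 fl.
  have p1 : 0 <= (D - 3) * (1 - f t ^+ 2) by rewrite mulr_ge0//; [lra|nra].
  by have := sqr_ge0 (s t); lra.
have An la : A la -> la < 0.
  by move=> [r0 hA]; exact: (ground_eigenvalue_lt0 K0 (hS la (rng la r0)) hA).
have ubA : has_ubound A by exists 0 => la /An /ltW.
pose ls := sup A.
have lsA : ls <= 0 by apply: ge_sup; [exists (- omega)|move=> la /An /ltW].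
have lsw : - omega <= ls by exact: ub_le_sup.
have r1 : - omega <= ls <= 1 by rewrite lsw /=; lra.
have Fs := hS ls (rng _ r1).
have stable la : - omega <= la <= 1 -> forall t,
  `|(S la).1 t - (S ls).1 t| <= `|ls - la| / K * weight m K t /\
  `|(S la).2 t - (S ls).2 t| <= 2 * `|ls - la| / (m + 2) * ((s t + s t ^+ 2) * weight m K t).
  move=> r0 t; apply: (frobenius_stable m0 K0 (normr_ge0 _) (fun t => hK la t (rng _ r0)) _ (hS _ (rng _ r0)) Fs) => x.
  have -> : q la x - q ls x = (ls - la) * s x by rewrite /ground_potential -/(s x); ring.
  rewrite normrM (gtr0_norm (s_gt0 x)); apply: ler_wpM2l => //.
  by rewrite lerDl exprn_ge0// ltW.
have Hs0 t : 0 <= (S ls).1 t.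
  rewrite leNgt; apply/negP => neg; have w0 := weight_gt0 m K t.
  have e0 : 0 < - (S ls).1 t * K / weight m K t by rewrite divr_gt0// mulr_gt0// oppr_gt0.
  have [la Ala hla] := sup_adherent e0 (conj (ex_intro _ _ A0) ubA).
  have lals : la <= ls by exact: ub_le_sup.
  have [r0 /(_ t) Hla] := Ala; have [h _] := stable la r0 t.
  have : `|ls - la| / K * weight m K t < - (S ls).1 t.
    rewrite ger0_norm ?subr_ge0//; move: hla; rewrite -/ls ltrBlDl -ltrBlDr => hla.
    by move: hla; rewrite ltr_pdivlMr// => hla; rewrite mulrAC ltr_pdivrMr.
  by move: h; rewrite ler_norml => /andP[_ h]; lra.
have Hsp := frobenius_gt0 m0 (@continuous_ground_potential ls) Fs Hs0.
have ls0 : ls < 0 by exact: (ground_eigenvalue_lt0 K0 Fs Hs0).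
pose T : R := ln (omega + 1) / 2.
have sT t : T <= t -> omega + 1 <= s t.
  move=> Tt; have <- : s T = omega + 1 by rewrite /s /T mulrC divfK// lnK// posrE; lra.
  by rewrite /s ler_expR ler_pM2l.
have qT la t : la <= 1 -> T <= t -> 0 <= q la t.
  move=> la1 /sT; rewrite /ground_potential -/D -/(s t); have := profile_lt1 d13 om SP t; have := sp_pos SP t => f0 fl.
  have p1 : 0 <= (D - 3) * (1 - f t ^+ 2) by rewrite mulr_ge0//; [lra|nra].
  by have := s_gt0 t; move: (s t) => x x0 hx; nra.
have HT t : T <= t -> (S ls).2 t <= 0.
  move=> Tt; rewrite leNgt; apply/negP => pos.
  have [e e0 he] := frobenius_lower Fs t Hsp; have w0 := weight_gt0 m K t.
  pose c2 := (s t + s t ^+ 2) * weight m K t.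
  have c20 : 0 < c2 by rewrite mulr_gt0// addr_gt0 ?exprn_gt0.
  pose a1 := e * K / weight m K t; pose a2 := (S ls).2 t * (m + 2) / (2 * c2).
  (* So small that at [ls + x] the solution is still positive up to [t] and increasing at [t];
     [frobenius_persist] then puts [ls + x] in [A]. *)
  pose x := Num.min (- ls) (Num.min a1 a2) / 2.
  have m20 : 0 < m + 2 by lra.
  have a10 : 0 < a1 by exact: divr_gt0 (mulr_gt0 e0 K0) w0.
  have a20 : 0 < a2 by apply: divr_gt0; [exact: mulr_gt0|rewrite mulr_gt0].
  have mn0 : 0 < Num.min (- ls) (Num.min a1 a2) by rewrite !lt_min oppr_gt0 ls0 a10.
  have x0 : 0 < x by rewrite /x divr_gt0.
  have : x < Num.min (- ls) (Num.min a1 a2).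
    by rewrite /x ltr_pdivrMr// ltr_pMr// ltr1n.
  rewrite !lt_min => /andP[xl /andP[xe xs]].
  have r0 : - omega <= ls + x <= 1 by apply/andP; split; lra.
  have absx : `|ls - (ls + x)| = x by rewrite opprD addrA subrr add0r normrN gtr0_norm.
  have Fx := hS _ (rng _ r0).
  have : A (ls + x).
    split => //; apply: (@frobenius_persist R m K (q (ls + x)) (S (ls + x)).1 (S (ls + x)).2 Fx t) => [y ty|y yt|].
    - by apply: qT; [case/andP: r0|exact: le_trans Tt ty].
    - have [] := stable _ r0 y; rewrite absx => h _.
      have : x / K * weight m K y < e.
        apply: le_lt_trans (_ : x / K * weight m K t < _).
          by apply: ler_wpM2l; [rewrite divr_ge0// ltW|exact: weight_le].
        by move: xe; rewrite ltr_pdivlMr// => xe; rewrite mulrAC ltr_pdivrMr.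
      by have := he y yt; move: h; rewrite ler_norml => /andP[h _]; lra.
    have [_] := stable _ r0 t; rewrite absx -/c2 => h.
    have : 2 * x / (m + 2) * c2 < (S ls).2 t.
      have c22 : 0 < 2 * c2 by rewrite pmulr_rgt0.
      move: xs; rewrite /a2 (ltr_pdivlMr _ _ c22) => xs.
      by rewrite mulrAC (ltr_pdivrMr _ _ m20) (_ : 2 * x * c2 = x * (2 * c2)) // -mulrA mulrCA.
    by move: h; rewrite ler_norml => /andP[h _]; lra.
  by move=> /(ub_le_sup ubA); rewrite -/ls; lra.
have [_ wb] := Fs.
have m20 : 0 < m + 2 by lra.
exists ls, T, (weight m K 0 * (1 + K / (m + 2) * 2)), (S ls).1, (S ls).2.
split; last by split; [exact: frobenius_der Fs|exact: frobenius_der2 Fs].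
split => // t t0; have wt : weight m K t <= weight m K 0 by exact: weight_le.
have w0 := weight_gt0 m K t; have c0 : 0 <= K / (m + 2) by rewrite divr_ge0// ltW.
have w00 : 0 <= weight m K 0 by exact: ltW (weight_gt0 _ _ _).
have s1 : s t <= 1 by rewrite /s -[leRHS]expR0 ler_expR; lra.
have sp : 0 < s t + s t ^+ 2 by rewrite addr_gt0 ?exprn_gt0.
have p1 : 0 <= weight m K 0 * (K / (m + 2) * 2) := mulr_ge0 w00 (mulr_ge0 c0 (ler0n _ 2)).
split; first by rewrite mulrDr mulr1; apply: le_trans (wb t) _; lra.
have [h _] := double_prim_bound m0 K0 (ltW K0) Fs.1 (fun x => ltac:(
  rewrite normrM mulrA; apply: ler_pM => //; apply: hK; exact: rng)) t.
apply: le_trans h _; rewrite mulrDr mulr1 -/(s t).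
apply: le_trans (_ : K / (m + 2) * (2 * weight m K 0) <= _); last by lra.
have s0 : 0 <= s t by exact: expR_ge0.
have s2 : s t + s t ^+ 2 <= 2 by move: (s t) s0 s1 => x x0 x1; nra.
exact: (ler_wpM2l c0 (ler_pM (ltW sp) (ltW w0) s2 wt)).
Qed.

End ground_state.

(** * From solutions of the radial equation to eigenfunctions *)

Section radial_eigenfunctions.
Context {R : realType} {d : nat} (d2 : (2 < d)%N).
Local Notation T := (measurableTypeR R).
Local Notation X := (d.-tuple T).
Local Notation mu := (lebesgue_tuple R d).
Local Notation c0 := (polar_cst (R := R) (d := d)).
Variables (omega : R) (u : 'rV[R]_d -> R) (V : R -> R) (VM : R).
Hypotheses (cV : continuous V)
  (hV : forall t : X, tradius t != 0 ->
    tradius t ^+ 2 - omega - 3 * u (vec t) ^+ 2 = V (radT t) * radpow (-2) t)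
  (bV : forall s, `|V s| <= VM * (1 + expR (2 * s) + expR (4 * s))).

Let d0 : (0 < d)%N. Proof. by rewrite (ltn_trans _ d2). Qed.

Lemma not_ae_False : ~ {ae mu, forall t : X, False}.
Proof.
move=> aeF; have d1 (x : R) : is_derive x 1 (fun y : R => y) 1 := drv_id x.
have [_ h] := annulus_FTC d0 (ltr01 : (0 : R) < 1) d1 (@cont_cst R 1).
have mJ : measurable_fun setT (fun t : X => radJ t * 1).
  by apply: measurable_funM; [exact: measurable_radJ|exact: measurable_cst].
have ae0 : {ae mu, forall t : X, radJ t * 1 = 0} by apply: filterS aeF.
have m0 : measurable_fun setT (fun _ : X => 0 : R) by exact: measurable_cst.
have := annulus_ae d0 0 1 mJ m0 ae0.
rewrite {1}/annulus_int h subr0 mulr1 /annulus_int Rintegral_cst ?mul0r; last exact: measurable_annulus.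
by move/eqP; rewrite (negbTE (c0_neq0 d0)).
Qed.

(** The integrand of the form minus that of lambda times the scalar product is [radJ] times the
    derivative of e^{(d-2)s} F' Gam. Its integrals over annuli are boundary terms, which
    [small_values] makes small along suitable endpoints since F'/|x| and g/|x| are in L^2. *)
Lemma radial_eigenfunction (lambda : R) (F F' F'' : R -> R) :
  (forall x : R, is_derive x 1 F (F' x)) -> (forall x : R, is_derive x 1 F' (F'' x)) ->
  continuous F'' -> (forall x, F'' x + (d%:R - 2) * F' x = (V x - lambda * expR (2 * x)) * F x) ->
  (forall x, 0 < F x) ->
  L2 (fun t : X => F (radT t)) -> L2 (fun t : X => F (radT t) * radpow 1 t) ->
  L2 (fun t : X => F' (radT t) * radpow (-1) t) ->
  L_eigenfunction omega u lambda (radfun (d := d) F).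
Proof.
move=> dF dF' cF'' ode Fpos F2 xF2 F2'.
have cF' : continuous F' by move=> x; exact: der_cont (dF' x).
have [hX _] := radfun_inXrad d2 dF cF' F2 xF2 F2'.
split => //.
  by move=> ae0; apply: not_ae_False; apply: filterS ae0 => t h; have := Fpos (ln (enorm (vec t))); rewrite /radfun in h; rewrite h ltxx.
move=> g hg; have [lk ->] := Lform_radfun d2 cV hV bV dF cF' F2 xF2 F2' hg.
have [_ _ _ wg] := inXrad_L2 d2 hg.
have [Gam [pg [g2 g2p g2m mh h2]]] := Xrad_profile d0 d2 hg wg.
set k := (fun t : X => _) in lk *.
have lFg : L1 (fun t : X => F (radT t) * g (vec t)) := L2_mul F2 g2.
have -> : L2_dot (radfun F) g = Int (fun t : X => F (radT t) * g (vec t)) by [].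
apply/eqP; rewrite -subr_eq0 -mulN1r -(IntZ lambda lFg) -(IntZ (-1) (L1Z lambda lFg)).
have lk' := L1D lk (L1Z (-1) (L1Z lambda lFg)).
rewrite -(IntD lk (L1Z (-1) (L1Z lambda lFg))).
set k' := (fun t : X => _) in lk' *.
pose m : R := d%:R - 2; pose psi (s : R) := expR (m * s) * F' s.
pose psi' (s : R) := expR (m * s) * ((V s - lambda * expR (2 * s)) * F s).
have dpsi (x : R) : is_derive x 1 psi (psi' x).
  have := drv_mul (drv_expR (drv_mul (drv_cst m x) (drv_id x))) (dF' x).
  set w := (Y in is_derive _ _ _ Y -> _) => h; suff <- : w = psi' x by [].
  by rewrite /w /psi' -ode -/m; move: (expR _) (F' x) (F'' x) => a b c; ring.
have cF : continuous F by move=> x; exact: der_cont (dF x).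
have ce (c : R) : continuous (fun s : R => expR (c * s)).
  by apply: cont_exp; apply: cont_mul; [exact: cont_cst|exact: cont_id].
have cpsi' : continuous psi'.
  apply: cont_mul (ce _) _; apply: cont_mul _ cF; apply: cont_add cV _.
  by apply: cont_opp; apply: cont_mul (ce _); exact: cont_cst.
have mpsi' : measurable_fun setT (fun t : X => psi' (radT t)) by exact: continuous_radT_measurable.
have [_ _ _ ann] := prim_pair_mul d0 (prim_pair_C1 d0 dpsi cpsi') pg mpsi' mh.
have Ek (t : X) : k' t = (psi' (radT t) * g (vec t) + psi (radT t) * flux (wgrad g) t) * radJ t.
  have e1 : radpow (-2) t = expR (m * radT t) * radJ t.
    by rewrite /radpow /radJ -expRD; congr expR; rewrite /m; ring.
  have e2 : expR (2 * radT t) * radpow (-2) t = 1.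
    by rewrite /radpow -expRD -mulrDl subrr mul0r expR0.
  have e3 : lambda * (F (radT t) * g (vec t)) = lambda * (F (radT t) * g (vec t)) * (expR (2 * radT t) * radpow (-2) t).
    by rewrite e2 mulr1.
  rewrite /k' e3 /k e1 /psi' /psi.
  move: (expR (m * _)) (expR (2 * _)) (radJ t) (F _) (F' _) (V _) (g _) (flux _ t) => x1 x2 x3 x4 x5 x6 x7 x8.
  by ring.
pose N (s : R) := expR (m * s) * (F' s ^+ 2 + Gam s ^+ 2).
pose kN (t : X) := (F' (radT t) * radpow (-1) t) ^+ 2 + (g (vec t) * radpow (-1) t) ^+ 2.
have lN : L1 kN by exact: L1D F2'.2 g2m.2.
have kN0 t : 0 <= kN t by rewrite addr_ge0 ?sqr_ge0.
have aeN : {ae mu, forall t, kN t = radJ t * N (radT t)}.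
  have [_ _ ae_g _] := pg; apply: filterS ae_g => t et.
  have e1 : radpow (-1) t ^+ 2 = expR (m * radT t) * radJ t.
    by rewrite -radpow2 /radpow /radJ -expRD; congr expR; rewrite /m; ring.
  by rewrite /kN /N !exprMn e1 et; move: (expR _) (radJ t) (F' _) (Gam _) => a b c e; ring.
have psiN s : `|psi s * Gam s| <= N s.
  rewrite /psi /N -mulrA normrM gtr0_norm ?expR_gt0// ler_pM2l ?expR_gt0// ler_norml.
  by move: (F' s) (Gam s) => a b; apply/andP; split; [have := sqr_ge0 (a + b)|have := sqr_ge0 (a - b)]; nra.
rewrite -normr_le0 leNgt; apply/negP => pos.
have c0p : 0 < c0 := @polar_cst_gt0 R d d0.
have e0 : 0 < `|Int k'| / 3 by rewrite divr_gt0.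
have [M [M0 hM]] := Int_limit d0 lk' e0.
have e1 : 0 < `|Int k'| / 3 / c0 by rewrite divr_gt0.
have [[b Mb Nb] _] := small_values d0 M lN kN0 aeN e1.
have [_ [a Ma Na]] := small_values d0 (- M) lN kN0 aeN e1.
have ab : a <= b by rewrite (le_trans Ma)// (le_trans _ Mb)// ge0_cp// ltW.
have := hM a b Ma Mb; rewrite (@annulus_ext R d k' _ a b (fun t _ => Ek t)) -(ann a b ab).
have n1 : `|c0 * (psi b * Gam b)| < `|Int k'| / 3.
  rewrite normrM (gtr0_norm c0p) mulrC -ltr_pdivlMr//; exact: le_lt_trans (psiN b) Nb.
have n2 : `|c0 * (psi a * Gam a)| < `|Int k'| / 3.
  rewrite normrM (gtr0_norm c0p) mulrC -ltr_pdivlMr//; exact: le_lt_trans (psiN a) Na.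
have aux (i x y : R) : `|x| < `|i| / 3 -> `|y| < `|i| / 3 -> `|i - (x - y)| < `|i| / 3 -> False.
  have := ler_normD (i - (x - y)) (x - y); rewrite subrK; have := ler_normB x y; lra.
by rewrite mulrBr => h; exact: aux n1 n2 h.
Qed.

(** Near minus infinity [g] is dominated by an exponential, near plus infinity by the derivative of
    a function that is bounded above. *)
Lemma bounded_primitive (g B B' : R -> R) (N k T0 T1 M : R) : continuous g -> (forall t, 0 <= g t) ->
  0 < k -> (forall t, t <= T0 -> g t <= N * expR (k * t)) -> (forall t : R, is_derive t 1 B (B' t)) ->
  (forall t, T1 <= t -> g t <= B' t) -> (forall t, T1 <= t -> B t <= M) -> 
  exists (Psi : R -> R) (M' : R), (forall t : R, is_derive t 1 Psi (g t)) /\ forall t, `|Psi t| <= M'.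
Proof.
move=> cg g0 k0 gN dB gB BM; have [Psi dP] : exists Psi : R -> R, forall x : R, is_derive x 1 Psi (g x) := antiderivative cg.
have inc x y : x <= y -> Psi x <= Psi y.
  by move=> xy; apply: (@der_nondec _ Psi g x y xy).
have N0 : 0 <= N by rewrite -(pmulr_lge0 _ (expR_gt0 (k * T0))); exact: le_trans (g0 T0) (gN T0 (lexx _)).
have dE (t : R) : is_derive t 1 (fun t => N / k * expR (k * t)) (N * expR (k * t)).
  have := drv_mul (drv_cst (N / k) t) (drv_expR (drv_mul (drv_cst k t) (drv_id t))).
  set w := (Y in is_derive _ _ _ Y -> _) => h; suff <- : w = N * expR (k * t) by [].
  by rewrite /w; field; rewrite gt_eqF.
exists Psi, (`|Psi T0| + N / k * expR (k * T0) + `|Psi T1| + `|M - B T1|); split => // t.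
have Nk : 0 <= N / k by rewrite divr_ge0// ltW.
have lo : Psi T0 - N / k * expR (k * T0) <= Psi t.
  case: (leP t T0) => [tT|/ltW/inc]; last by have := mulr_ge0 Nk (expR_ge0 (k * T0)); lra.
  have : N / k * expR (k * t) - Psi t <= N / k * expR (k * T0) - Psi T0.
    apply: (@der_nondec _ (fun t => N / k * expR (k * t) - Psi t) (fun t => N * expR (k * t) - g t) t T0 tT).
    by move=> x /andP[_ /ltW/gN]; rewrite subr_ge0.
  by have := mulr_ge0 Nk (expR_ge0 (k * t)); lra.
have hi : Psi t <= Psi T1 + `|M - B T1|.
  case: (leP T1 t) => [tT|/ltW/inc]; last by have := normr_ge0 (M - B T1); lra.
  have : B T1 - Psi T1 <= B t - Psi t.
    apply: (@der_nondec _ (fun t => B t - Psi t) (fun t => B' t - g t) T1 t tT).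
    by move=> x /andP[/ltW/gB + _]; rewrite subr_ge0.
  by have := BM t tT; have := ler_norm (M - B T1); lra.
have := mulr_ge0 Nk (expR_ge0 (k * T0)); have := normr_ge0 (M - B T1).
have := normr_ge0 (Psi T0); have := normr_ge0 (Psi T1); have := ler_norm (Psi T1).
have : - Psi T0 <= `|Psi T0| by rewrite -normrN ler_norm.
move: (`|Psi T0| : R) (`|Psi T1| : R) (`|M - B T1| : R) lo hi => y z v; move: (N / k * _) (Psi t) (Psi T0) (Psi T1) => x p p0 p1.
by move=> *; rewrite ler_norml; apply/andP; split; lra.
Qed.

End radial_eigenfunctions.

Section ground_eigenfunction.
Context {R : realType} {d : nat}.
Local Notation T := (measurableTypeR R).
Local Notation X := (d.-tuple T).
Variables (omega : R) (u : 'rV[R]_d -> R) (f f1 f2 : R -> R) (VM : R).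
Hypotheses (d13 : 13 <= d%:R :> R) (om : d%:R - 4 < omega < d%:R)
  (SP : sing_profile d omega f f1 f2).
Local Notation V := (profile_potential d omega f).
Hypotheses (cV : continuous V)
  (hV : forall t : X, tradius t != 0 ->
    tradius t ^+ 2 - omega - 3 * u (vec t) ^+ 2 = V (radT t) * radpow (-2) t)
  (bV : forall s, `|V s| <= VM * (1 + expR (2 * s) + expR (4 * s))).
Local Notation m := (@frob_exp R d).
Let D : R := d%:R.

Lemma ground_eigenfunction : exists (lambda : R) (F : R -> R), lambda < 0 /\
  L_eigenfunction omega u lambda (radfun (d := d) F).
Proof.
have h0 : 13 <= D := d13; have [w1 w2] := andP om; rewrite -/D in w1 w2.
have d2 : (2 < d)%N by rewrite -(ltr_nat R); lra.
have [la [T0 [N [H [H1 [[la0 Hp HT HN] [dH dH1]]]]]]] := ground_state d13 om SP.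
have /andP[m0 mD] := frob_exp_bounds d13; have mm := @frob_exp_sqr R d d13; rewrite -/D in mm mD.
pose s (t : R) : R := expR (2 * t).
pose q := ground_potential d omega f la.
have cq : continuous q := @continuous_ground_potential _ _ _ _ _ _ SP la.
pose al := (m - (D - 2)) / 2.
have alE : al ^+ 2 + (D - 2) * al = - (3 * (D - 3)) by rewrite /al; lra.
have al2 : 2 * al = m - (D - 2) by rewrite /al; lra.
clearbody al.
pose F t := expR (al * t) * H t; pose F' t := expR (al * t) * (al * H t + H1 t).
pose F'' t := expR (al * t) * (al ^+ 2 * H t + 2 * al * H1 t + (q t * H t - m * H1 t)).
have dF (t : R) : is_derive t 1 F (F' t).
  have := drv_mul (drv_exp_lin al t) (dH t).
  set w := (Y in is_derive _ _ _ Y -> _) => h; suff <- : w = F' t by [].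
  by rewrite /w /F'; ring.
have dF' (t : R) : is_derive t 1 F' (F'' t).
  have := drv_mul (drv_exp_lin al t) (drv_add (drv_mul (drv_cst al t) (dH t)) (dH1 t)).
  rewrite -/q; set w := (Y in is_derive _ _ _ Y -> _) => h; suff <- : w = F'' t by [].
  by rewrite /w /F''; move: (expR _) (H t) (H1 t) (q t) => a b c e; ring.
have cH : continuous H by move=> x; exact: der_cont (dH x).
have cH1 : continuous H1 by move=> x; exact: der_cont (dH1 x).
have ce (c : R) : continuous (fun s : R => expR (c * s)).
  by apply: cont_exp; apply: cont_mul; [exact: cont_cst|exact: cont_id].
have cF : continuous F by move=> x; exact: der_cont (dF x).
have cF' : continuous F' by move=> x; exact: der_cont (dF' x).
have cc (c : R) (h : R -> R) : continuous h -> continuous (fun t => c * h t).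
  by move=> ch; apply: cont_mul ch; exact: cont_cst.
have cF'' : continuous F''.
  apply: cont_mul (ce _) _; apply: cont_add; first by apply: cont_add; exact: cc.
  by apply: cont_add; [exact: cont_mul|apply: cont_opp; exact: cc].
have ode t : F'' t + (D - 2) * F' t = (V t - la * expR (2 * t)) * F t.
  have qE : q t = V t + 3 * (D - 3) - la * expR (2 * t).
    by rewrite /q /ground_potential /profile_potential -/D; ring.
  transitivity (expR (al * t) * ((al ^+ 2 + (D - 2) * al) * H t + (2 * al + (D - 2) - m) * H1 t + q t * H t)).
    by rewrite /F'' /F'; move: (expR _) (H t) (H1 t) (q t) => a b c e; ring.
  have -> : 2 * al + (D - 2) - m = 0 by lra.
  by rewrite alE qE /F; move: (V t) (expR _) (expR _) => a b c; ring.
have Fp t : 0 < F t by rewrite mulr_gt0 ?expR_gt0.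
(* [e^{mt} H H'] is negative and nondecreasing beyond [T1] *)
pose c : R := 2 + 4 * al ^+ 2; have c2 : 2 <= c by rewrite /c; have := sqr_ge0 al; lra.
pose B t := c * (expR (m * t) * (H t * H1 t)).
pose B' t := c * (expR (m * t) * (H1 t ^+ 2 + q t * H t ^+ 2)).
have dB (t : R) : is_derive t 1 B (B' t).
  have := drv_mul (drv_cst c t) (drv_mul (drv_exp_lin m t) (drv_mul (dH t) (dH1 t))).
  rewrite -/q; set w := (Y in is_derive _ _ _ Y -> _) => h; suff <- : w = B' t by [].
  by rewrite /w /B'; move: (expR _) (H t) (H1 t) (q t) => a b e k; ring.
pose T1 := Num.max T0 (ln (2 * omega) / 2).
have sT t : T1 <= t -> 2 * omega <= s t.
  rewrite ge_max => /andP[_ tt]; have <- : s (ln (2 * omega) / 2) = 2 * omega.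
    by rewrite /s mulrC divfK// lnK// posrE; lra.
  by rewrite /s ler_expR ler_pM2l.
have BM t : T1 <= t -> B t <= 0.
  rewrite ge_max => /andP[/HT h _]; rewrite /B; apply: mulr_ge0_le0; first by lra.
  by apply: mulr_ge0_le0; [exact: expR_ge0|apply: mulr_ge0_le0 => //; exact: ltW].
have qT t : T1 <= t -> s t ^+ 2 / 2 <= q t.
  move=> /sT; rewrite /q /ground_potential -/D -/(s t).
  have := profile_lt1 d13 om SP t; have := sp_pos SP t => f0 fl.
  have p1 : 0 <= (D - 3) * (1 - f t ^+ 2) by rewrite mulr_ge0//; [lra|nra].
  move: (s t) => x hx.
  have p2 : 0 <= x * (x - 2 * omega) by rewrite mulr_ge0//; lra.
  have p3 : 0 <= - la * x by rewrite mulr_ge0//; lra.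
  lra.
have NN : 0 <= N by have [h _] := HN 0 (lexx _); exact: le_trans h.
(* Common to the three integrability claims: the radial density of g^2 is e^{mt} K, with [K] bounded
   near minus infinity and dominated near plus infinity by H1^2 + q H^2, whose multiple by e^{mt} is
   the derivative of e^{mt} H H1 <= 0. No asymptotics of [H] is involved. *)
have main (g K : R -> R) : continuous g -> (forall t, expR (D * t) * g t ^+ 2 = expR (m * t) * K t) ->
    (forall t, s t <= 1 -> H t ^+ 2 <= N ^+ 2 -> H1 t ^+ 2 <= N ^+ 2 -> K t <= (2 + 2 * al ^+ 2) * N ^+ 2) ->
    (forall t, 1 <= s t -> s t ^+ 2 / 2 <= q t -> K t <= c * (H1 t ^+ 2 + q t * H t ^+ 2)) ->
    L2 (fun t : X => g (radT t)).
  move=> cg gK Klo Khi; pose G t := expR (D * t) * g t ^+ 2.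
  have cG : continuous G by apply: cont_mul (ce _) _; exact: cont_pow.
  have G0 t : 0 <= G t by rewrite mulr_ge0 ?expR_ge0 ?sqr_ge0.
  have lo t : t <= 0 -> G t <= (2 + 2 * al ^+ 2) * N ^+ 2 * expR (m * t).
    move=> t0; rewrite /G gK mulrC ler_pM2r ?expR_gt0//; have [n1 n2] := HN t t0; apply: Klo.
    - by rewrite /s -[leRHS]expR0 ler_expR; lra.
    - by rewrite -real_normK ?num_real// lerXn2r// nnegrE.
    - by rewrite -[H1 t ^+ 2]real_normK ?num_real// lerXn2r// nnegrE.
  have hi t : T1 <= t -> G t <= B' t.
    move=> tt; rewrite /G gK /B' mulrCA ler_pM2l ?expR_gt0//; apply: Khi; last exact: qT.
    by have := sT t tt; lra.
  have [Psi [M' [dP bP]]] := bounded_primitive cG G0 m0 lo dB hi BM.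
  exact: (L2_radial d2 cg dP bP).
have ee (a b : R) : D + 2 * al + b = m + a -> forall t, expR (D * t) * (expR (al * t) ^+ 2 * expR (b * t)) = expR (m * t) * expR (a * t).
  by move=> e t; rewrite -expRM_natl -!expRD; congr expR; rewrite -mulrDl -e; ring.
have s0 t : 0 < s t by exact: expR_gt0.
exists la, F; split => //; apply: (radial_eigenfunction d2 cV hV bV dF dF' cF'' ode Fp).
- apply: (main F (fun t => s t * H t ^+ 2)) => // t.
  + rewrite exprMn mulrA mulrA; congr (_ * _).
    have e2 : D + 2 * al + 0 = m + 2 by rewrite al2; lra.
    rewrite -(ee _ _ e2 t).
    by rewrite mul0r expR0 mulr1.
  + move=> s1 h1 _; have := s0 t; have := sqr_ge0 (H t); have := mulr_ge0 (sqr_ge0 al) (sqr_ge0 N).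
    by move: (s t) (H t ^+ 2) s1 h1 => x y s1 h1 h2 h3 h4; nra.
  move=> s1 qs; have h0' := sqr_ge0 (H t); have h1' := sqr_ge0 (H1 t).
  have q0 : 0 <= q t by apply: le_trans qs; rewrite divr_ge0 ?sqr_ge0.
  have p1 : 0 <= (s t ^+ 2 - s t) * H t ^+ 2 by rewrite mulr_ge0//; nra.
  have p2 : 0 <= (q t - s t ^+ 2 / 2) * H t ^+ 2 by rewrite mulr_ge0// subr_ge0.
  have p3 : 0 <= (c - 2) * (H1 t ^+ 2 + q t * H t ^+ 2).
    by apply: mulr_ge0; [lra|apply: addr_ge0 => //; exact: mulr_ge0].
  by move: (s t) (H t ^+ 2) (H1 t ^+ 2) (q t) p1 p2 p3 h1' => x y z w p1 p2 p3 h1'; lra.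
- apply: (main (fun t => F t * expR (1 * t)) (fun t => s t ^+ 2 * H t ^+ 2)) => [|t|t|t].
  + exact: cont_mul cF (ce _).
  + rewrite /F !exprMn; have e2 : D + 2 * al + 2 = m + 4 by rewrite al2; lra.
    have -> : s t ^+ 2 = expR (4 * t) by rewrite /s -expRM_natl; congr expR; ring.
    rewrite mulrA -(ee _ _ e2 t).
    rewrite -[expR (1 * t) ^+ 2]expRM_natl mul1r.
    by move: (expR _) (expR _) (expR _) (H t) => x y z w; ring.
  + move=> s1 h1 _; have := s0 t; have := sqr_ge0 (H t); have := mulr_ge0 (sqr_ge0 al) (sqr_ge0 N).
    move=> h2 h3 h4; have h5 : s t ^+ 2 <= 1 by rewrite expr_le1// ltW.
    by have := sqr_ge0 (s t); move: (s t ^+ 2) (H t ^+ 2) h1 h2 h3 h5 => x y h1 h2 h3 h5 h6; nra.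
  move=> s1 qs; have h0' := sqr_ge0 (H t); have h1' := sqr_ge0 (H1 t).
  have q0 : 0 <= q t by apply: le_trans qs; rewrite divr_ge0 ?sqr_ge0.
  have p2 : 0 <= (q t - s t ^+ 2 / 2) * H t ^+ 2 by rewrite mulr_ge0// subr_ge0.
  have p3 : 0 <= (c - 2) * (H1 t ^+ 2 + q t * H t ^+ 2).
    by apply: mulr_ge0; [lra|apply: addr_ge0 => //; exact: mulr_ge0].
  by move: (s t ^+ 2) (H t ^+ 2) (H1 t ^+ 2) (q t) p2 p3 h1' => x y z w p2 p3 h1'; lra.
apply: (main (fun t => F' t * expR (- 1 * t)) (fun t => (al * H t + H1 t) ^+ 2)) => [|t|t|t].
- exact: cont_mul cF' (ce _).
- rewrite /F' !exprMn; have e2 : D + 2 * al + -2 = m + 0 by rewrite al2; lra.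
  have e0 : expR (m * t) = expR (m * t) * expR (0 * t) by rewrite mul0r expR0 mulr1.
  rewrite e0 -(ee _ _ e2 t).
  have -> : expR (- 1 * t) ^+ 2 = expR (- 2 * t) by rewrite -expRM_natl; congr expR; ring.
  by move: (expR _) (expR _) (expR _) (_ + H1 t) => x y z w; ring.
- move=> s1 h1 h2; have p1 : 0 <= (al * H t - H1 t) ^+ 2 by exact: sqr_ge0.
  have p2 : 0 <= al ^+ 2 * (N ^+ 2 - H t ^+ 2) by rewrite mulr_ge0 ?sqr_ge0// subr_ge0.
  by move: (H t) (H1 t) p1 p2 h2 => x y p1 p2 h2; lra.
move=> s1 qs; have h0' := sqr_ge0 (H t); have h1' := sqr_ge0 (H1 t).
have q0 : 0 <= q t by apply: le_trans qs; rewrite divr_ge0 ?sqr_ge0.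
have p1 : 0 <= (al * H t - H1 t) ^+ 2 by exact: sqr_ge0.
have s2 : 1 <= s t ^+ 2 by rewrite expr_ge1// ltW.
have p2 : 0 <= al ^+ 2 * ((q t - 1 / 2) * H t ^+ 2).
  by rewrite mulr_ge0 ?sqr_ge0// mulr_ge0//; lra.
have p3 : 0 <= q t * H t ^+ 2 by exact: mulr_ge0.
have p4 : 0 <= al ^+ 2 * H1 t ^+ 2 by rewrite mulr_ge0 ?sqr_ge0.
rewrite /c; move: (H t) (H1 t) (q t) p1 p2 p3 p4 h1' => x y w p1 p2 p3 p4 h1'; lra.
Qed.

End ground_eigenfunction.

(** * Counting eigenvalues *)

Section eigenvalue_count.
Context {R : realType} {d : nat} (d2 : (2 < d)%N).
Local Notation T := (measurableTypeR R).
Local Notation X := (d.-tuple T).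
Local Notation mu := (lebesgue_tuple R d).
Local Notation c0 := (polar_cst (R := R) (d := d)).
Variables (omega : R) (u : 'rV[R]_d -> R) (V : R -> R) (VM : R).
Hypotheses (cV : continuous V)
  (hV : forall t : X, tradius t != 0 ->
    tradius t ^+ 2 - omega - 3 * u (vec t) ^+ 2 = V (radT t) * radpow (-2) t)
  (bV : forall s, `|V s| <= VM * (1 + expR (2 * s) + expR (4 * s))).

Let d0 : (0 < d)%N. Proof. by rewrite (ltn_trans _ d2). Qed.

Lemma annulus_int_sum k (c : 'I_k -> R) (g : 'I_k -> X -> R) (r : seq 'I_k) a b :
  (forall j, loc_int (g j)) -> loc_int (fun t => \sum_(j <- r) c j * g j t) /\
  annulus_int (fun t => \sum_(j <- r) c j * g j t) a b = \sum_(j <- r) c j * annulus_int (g j) a b.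
Proof.
move=> lg; elim: r => [|j r [IH1 IH2]].
  have E : (fun t => \sum_(j <- [::]) c j * g j t) = (fun=> 0 : R) by apply/funext => t; rewrite big_nil.
  rewrite E big_nil; split; first exact: (loc_int_L1 d0 (@L1_0 R d)).
  by rewrite /annulus_int Rintegral_cst ?mul0r//; exact: measurable_annulus.
have E : (fun t => \sum_(i <- j :: r) c i * g i t) = (fun t => c j * g j t + \sum_(i <- r) c i * g i t).
  by apply/funext => t; rewrite big_cons.
have lj := loc_intZ d0 (c j) (lg j).
by rewrite E big_cons -IH2 -(annulus_intZ d0 (c j) a b (lg j)) -(annulus_intD d0 a b lj IH1); split => //; exact: loc_intD.
Qed.

Lemma prim_pair_lincomb k (c : 'I_k -> R) (f : 'I_k -> 'rV[R]_d -> R) (Gam : 'I_k -> R -> R) :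
  (forall j, inXrad (f j)) ->
  (forall j, prim_pair (fun t : X => f j (vec t)) (flux (wgrad (f j))) (Gam j)) ->
  prim_pair (fun t : X => lincomb c f (vec t)) (flux (wgrad (lincomb c f))) (fun s => \sum_j c j * Gam j s).
Proof.
move=> hf pf; have hl := inXrad_lincomb c hf; have [l2 _ _ wl] := inXrad_L2 d2 hl.
have cJ : continuous (fun s : R => expR (- d%:R * s)).
  by apply: cont_exp; apply: cont_mul; [exact: cont_cst|exact: cont_id].
have ll := loc_int_flux d0 wl cJ.
split => //; first by case: l2.
- have : {ae mu, forall t : X, forall j, f j (vec t) = Gam j (radT t)}.
    by apply: filter_forall => j; have [] := pf j.
  by apply: filterS => t e; apply: eq_bigr => j _; rewrite e.
move=> a b ab; have lj j : loc_int (fun t : X => flux (wgrad (f j)) t * radJ t) by have [] := pf j.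
have [ls es] := annulus_int_sum c (index_enum _) a b lj.
transitivity (\sum_j c j * annulus_int (fun t : X => flux (wgrad (f j)) t * radJ t) a b).
  rewrite -sumrB mulr_sumr; apply: eq_bigr => j _; have [_ _ _ <-//] := pf j.
  by rewrite -mulrBr mulrCA.
rewrite -es; apply: (annulus_ae d0); [by case: ls|by case: ll|].
apply: filterS (wgrad_lincomb d2 c hf) => t e; rewrite /flux.
under eq_bigr do rewrite mulr_suml mulr_sumr.
rewrite exchange_big /= mulr_suml; apply: eq_bigr => i _; rewrite e.
by rewrite !mulr_suml; apply: eq_bigr => j _; rewrite !mulrA.
Qed.

Lemma Int_sqr_eq0 (g : X -> R) : L2 g -> Int (fun t => g t * g t) = 0 -> {ae mu, forall t, g t = 0}.
Proof.
move=> g2 g0; have lg := L2_mul g2 g2; have mgg := L1_meas lg.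
have : (\int[mu]_t `|(g t * g t)%:E| = 0)%E.
  rewrite -[RHS](_ : (Int (fun t => g t * g t))%:E = 0%E); last by rewrite g0.
  rewrite /Int -EFin_Rintegral; [|exact: measurableT|exact: lg].
  by apply: eq_integral => t _; rewrite gee0_abs// lee_fin -expr2 sqr_ge0.
have mg : measurable_fun setT (fun t => (g t * g t)%:E) by exact/measurable_EFinP.
move=> h0; have := (ae_eq_integral_abs mu measurableT mg).1 h0; apply: filterS => t /(_ I).
by move=> [] /eqP; rewrite mulf_eq0 orbb => /eqP.
Qed.

(* [k] eigenfunctions and [n < k] conditions: some combination vanishes at the
   cuts, so the form is nonnegative there; but the form is negative on every
   nonzero combination of eigenfunctions. *)
Lemma eigenvalue_count_le n (z : 'I_n -> R) k (f : 'I_k -> 'rV[R]_d -> R) (lambda : 'I_k -> R) :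
  (forall g Gam, inXrad g -> Xprofile (fun t : X => g (vec t)) (flux (wgrad g)) Gam ->
    (forall i, Gam (z i) = 0) -> 0 <= Lform omega u g g) ->
  L2_free f -> (forall j, lambda j < 0 /\ L_eigenfunction omega u (lambda j) (f j)) -> (k <= n)%N.
Proof.
move=> nonneg free eig; rewrite leqNgt; apply/negP => nk.
have hf j : inXrad (f j) by have [_ []] := eig j.
have prof j : exists Gam, prim_pair (fun t : X => f j (vec t)) (flux (wgrad (f j))) Gam.
  have [_ _ _ wf] := inXrad_L2 d2 (hf j).
  by have [Gam [pf _]] := Xrad_profile d0 d2 (hf j) wf; exists Gam.
have [Gam hGam] := choice prof.
pose M : 'M[R]_(k, n) := \matrix_(j, i) Gam j (z i).
have [v vk v0] : exists2 v : 'rV[R]_k, (v <= kermx M)%MS & v != 0.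
  apply/rowV0Pn; rewrite kermx_eq0 /row_free; apply/eqP => rk.
  by have := rank_leq_col M; rewrite rk leqNgt nk.
move/sub_kermxP: vk => vM; pose c (j : 'I_k) : R := v 0 j.
have hl := inXrad_lincomb c hf; have [l2 _ _ wl] := inXrad_L2 d2 hl.
have [Gl [_ xl]] := Xrad_profile d0 d2 hl wl.
have pl := prim_pair_lincomb c hf hGam.
have : 0 <= Lform omega u (lincomb c f) (lincomb c f).
  apply: (nonneg _ (fun s => \sum_j c j * Gam j s) hl) => [|i]; first by split.
  have /matrixP/(_ 0 i) := vM; rewrite !mxE => e; rewrite -[RHS]e.
  by apply: eq_bigr => j _; rewrite mxE.
have f2 j : L2 (fun t : X => f j (vec t)) by have [] := inXrad_L2 d2 (hf j).
(* With these weights the form of the combination is minus a square norm. Eigenfunctions of distinct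
   eigenvalues are orthogonal, and those of a common eigenvalue are treated without orthogonalizing
   them. *)
pose w j := Num.sqrt (- lambda j) * c j.
have g2 : L2 (fun t : X => lincomb w f (vec t)) by have [] := inXrad_L2 d2 (inXrad_lincomb w hf).
have dots i j : lambda i * L2_dot (f i) (f j) = - (Num.sqrt (- lambda i) * Num.sqrt (- lambda j)) * L2_dot (f i) (f j).
  have [li [_ _ ei]] := eig i; have [lj [_ _ ej]] := eig j.
  have e := ei _ (hf j); rewrite LformC ej// L2_dotC in e.
  have [ij|ij] := eqVneq (lambda i) (lambda j).
    by rewrite ij -expr2 sqr_sqrtr ?opprK// oppr_ge0 -ij ltW.
  have -> : L2_dot (f i) (f j) = 0; last by rewrite !mulr0.
  apply/eqP; have /eqP := e; rewrite -subr_eq0 -mulrBl mulf_eq0 subr_eq0 eq_sym (negbTE ij) /=.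
  by rewrite L2_dotC.
have -> : Lform omega u (lincomb c f) (lincomb c f) = - L2_dot (lincomb w f) (lincomb w f).
  rewrite (Lform_lincomb d2 cV hV bV c hf hl) (L2_dot_lincomb w f2 g2) -sumrN.
  apply: eq_bigr => i _; have [_ [_ _ ei]] := eig i; rewrite (ei _ hl).
  rewrite (L2_dotC (f i)) (L2_dot_lincomb c f2 (f2 i)) (L2_dotC (f i)) (L2_dot_lincomb w f2 (f2 i)).
  rewrite mulrA [in RHS]mulr_sumr mulr_sumr -sumrN; apply: eq_bigr => j _.
  rewrite (L2_dotC (f j)) /w.
  transitivity (c i * c j * (lambda i * L2_dot (f i) (f j))); first by ring.
  by rewrite dots; ring.
rewrite oppr_ge0 => le0.
have dot0 : L2_dot (lincomb w f) (lincomb w f) = 0.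
  apply/eqP; rewrite eq_le le0 /=; rewrite L2_dotE; apply: Int_ge0 => t.
  by rewrite -expr2 sqr_ge0.
have w0 := free w (Int_sqr_eq0 g2 dot0).
move/eqP: v0; apply; apply/rowP => j; rewrite mxE.
have := w0 j; rewrite /w => /eqP; rewrite mulf_eq0 sqrtr_eq0 oppr_le0 => /orP[h|/eqP//].
by have [l0 _] := eig j; move: h; rewrite leNgt l0.
Qed.

End eigenvalue_count.

(** * The potential in logarithmic coordinates *)

Section potential.
Context {R : realType} (d : nat) (omega : R) (f f1 f2 : R -> R) (SP : sing_profile d omega f f1 f2).
Local Notation V := (profile_potential d omega f).

Lemma continuous_profile : continuous f.
Proof. by move=> x; exact: der_cont (sp_der SP x). Qed.

Lemma continuous_profile_potential : continuous V.
Proof.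
have cs : continuous (fun t : R => expR (2 * t)).
  by apply: cont_exp; apply: cont_mul; [exact: cont_cst|exact: cont_id].
apply: cont_add.
  apply: cont_add; first exact: cont_pow cs.
  by apply: cont_opp; apply: cont_mul cs; exact: cont_cst.
by apply: cont_opp; apply: cont_mul; [exact: cont_cst|exact: cont_pow continuous_profile].
Qed.

Lemma profile_bounded : exists M, forall t, f t <= M.
Proof.
have [C [t0 h0]] := sp_origin SP; have [C' [a [a0 h1]]] := sp_decay SP.
pose t1 := Num.min t0 0; have t10 : t1 <= 0 by rewrite ge_min lexx orbT.
have cf : {within `[t1, 0], continuous f} by apply: continuous_subspaceT; exact: continuous_profile.
have [x _ hx] := EVT_max t10 cf.
exists (Num.max (1 + `|C|) (Num.max (f x) (`|C'| / a))) => t; rewrite !le_max.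
have [tt1|tt1] := leP t t1.
  have t00 : t <= t0 by apply: le_trans tt1 _; rewrite ge_min lexx.
  apply/orP; left; have [h _] := h0 t t00.
  have e1 : expR (2 * t) <= 1 by rewrite -[leRHS]expR0 ler_expR; lra.
  rewrite -lerBlDl; apply: le_trans (ler_norm _) _; apply: le_trans h _.
  apply: (@le_trans _ _ (`|C| * expR (2 * t))); first by rewrite ler_wpM2r ?expR_ge0 ?ler_norm.
  by rewrite ler_piMr.
have [tle0|tgt0] := leP t 0.
  by apply/orP; right; apply/orP; left; apply: hx; rewrite in_itv /= (ltW tt1) tle0.
apply/orP; right; apply/orP; right; apply: le_trans (h1 t (ltW tgt0)) _.
have e := expR_gt0 t; apply: (@le_trans _ _ (`|C'| * (expR t * expR (- a * expR t)))).
  by rewrite ler_wpM2r ?ler_norm// mulr_ge0 ?expR_ge0.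
apply: ler_wpM2l => //; rewrite mulNr expRN ler_pdivrMr ?expR_gt0// mulrC ler_pdivlMr//.
rewrite mulrC; apply: le_trans (expR_ge1Dx _); lra.
Qed.

Lemma profile_potential_bound : exists VM, forall s, `|V s| <= VM * (1 + expR (2 * s) + expR (4 * s)).
Proof.
have [M hM] := profile_bounded.
exists (1 + `|omega| + 3 * `|d%:R - 3| * M ^+ 2) => s; rewrite /profile_potential.
have e1 := expR_gt0 (2 * s).
have -> : expR (4 * s) = expR (2 * s) ^+ 2 by rewrite -expRM_natl; congr expR; lra.
have fM : f s ^+ 2 <= M ^+ 2.
  by rewrite ler_sqr ?nnegrE ?(ltW (sp_pos SP s))// (le_trans (ltW (sp_pos SP s)) (hM s)).
apply: le_trans (ler_normB _ _) _; apply: le_trans (lerD (ler_normB _ _) (lexx _)) _.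
rewrite (ger0_norm (sqr_ge0 (expR _))) (normrM omega) (normrM _ (f s ^+ 2)) (normrM 3).
rewrite (ger0_norm (ltW e1)) (@ger0_norm _ 3)// (ger0_norm (sqr_ge0 (f s))).
have w0 := normr_ge0 omega; have g0 := normr_ge0 (d%:R - 3 : R).
have : 3 * `|d%:R - 3| * f s ^+ 2 <= 3 * `|d%:R - 3| * M ^+ 2 by rewrite ler_wpM2l// mulr_ge0.
have k0 : 0 <= 3 * `|d%:R - 3| * M ^+ 2 by rewrite mulr_ge0 ?sqr_ge0// mulr_ge0.
move: (3 * `|d%:R - 3| * M ^+ 2) (3 * _ * _) k0 => k l k0 lk.
move: (expR (2 * s)) e1 (`|omega|) w0 => r r0 w w0.
have := mulr_ge0 k0 (ltW r0); have := mulr_ge0 k0 (sqr_ge0 r); have := mulr_ge0 w0 (sqr_ge0 r); nra.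
Qed.

Lemma profile_potentialE (u : 'rV[R]_d -> R) : 3 <= d%:R :> R ->
  (forall x, x != 0 -> u x = Num.sqrt (d%:R - 3) * f (ln (enorm x)) * expR (- ln (enorm x))) ->
  forall t : d.-tuple (measurableTypeR R), tradius t != 0 ->
    tradius t ^+ 2 - omega - 3 * u (vec t) ^+ 2 = V (radT t) * radpow (-2) t.
Proof.
move=> d3 hu t t0; have d0 : (0 < d)%N by rewrite -(ltr_nat R); lra.
have t0' := radT_exp t0.
have x0 : vec t != 0.
  rewrite -enorm_gt0 -/(tradius t) t0' expR_gt0//.
rewrite (hu _ x0) -/(tradius t) -/(radT t) t0' /profile_potential /radpow.
rewrite !exprMn sqr_sqrtr; last by lra.
rewrite mulNr.
have -> : expR (- (2 * radT t)) = expR (- radT t) ^+ 2 by rewrite -expRM_natl; congr expR; lra.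
rewrite expRM_natl.
have e : expR (radT t) * expR (- radT t) = 1 by rewrite -expRD subrr expR0.
move: (f _) (expR (radT t)) (expR (- _)) e => x r r' e.
have e2 : r ^+ 2 * r' ^+ 2 = 1 by rewrite -exprMn e expr1n.
have -> : ((r ^+ 2) ^+ 2 - omega * r ^+ 2 - 3 * (d%:R - 3) * x ^+ 2) * r' ^+ 2 =
  (r ^+ 2 * r' ^+ 2) * r ^+ 2 - omega * (r ^+ 2 * r' ^+ 2) - 3 * (d%:R - 3) * x ^+ 2 * r' ^+ 2 by ring.
by rewrite e2; ring.
Qed.

End potential.

(** * The Morse index for 13 <= d *)

Section large_dimension.
Context {R : realType} {d : nat}.
Local Notation T := (measurableTypeR R).
Local Notation X := (d.-tuple T).
Variables (omega : R) (u : 'rV[R]_d -> R) (f f1 f2 : R -> R) (VM : R).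
Hypotheses (d13 : 13 <= d%:R :> R) (om : d%:R - 4 < omega < d%:R)
  (SP : sing_profile d omega f f1 f2).
Local Notation V := (profile_potential d omega f).
Hypotheses (hV : forall t : X, tradius t != 0 ->
    tradius t ^+ 2 - omega - 3 * u (vec t) ^+ 2 = V (radT t) * radpow (-2) t)
  (bV : forall s, `|V s| <= VM * (1 + expR (2 * s) + expR (4 * s))).

Let d2 : (2 < d)%N. Proof. by rewrite -(ltr_nat R); have h := d13; lra. Qed.
Let d0 : (0 < d)%N. Proof. by rewrite (ltn_trans _ d2). Qed.
Let cV : continuous V. Proof. exact: continuous_profile_potential SP. Qed.

Lemma profile_Lform_ge0 (jump : bool) :
  (if jump then is_true (16 <= d%:R :> R) else d%:R = 13 :> R \/ d%:R = 14 :> R \/ d%:R = 15 :> R) ->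
  exists t1 t2 : R, forall (g : 'rV[R]_d -> R) Gam, inXrad g ->
    Xprofile (fun t : X => g (vec t)) (flux (wgrad g)) Gam ->
    jump \/ Gam t1 = 0 -> Gam t2 = 0 -> 0 <= Lform omega u g g.
Proof.
move=> hj; have [t1 [t2 [t3 [C [P1 [P2 [P3 [[t12 r1 r2 r3] [P10 hjump P3ge]]]]]]]]] := profile_riccati_pieces d13 om SP hj.
exists t1, t2 => g Gam hg pg g1 g2; have [_ [_ [lk le]]] := Lform_ge d2 cV hV bV hg.
apply: le_trans le; apply: (riccati_pieces_ge0 d0 pg lk t12 r1 r2 r3 P10 _ _ P3ge); last by right.
by case: g1 => [j|]; [left; exact: hjump|right].
Qed.

(** The term - omega |x|^2 of the logarithmic potential is compensated by omega times the L^2 norm.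
    The constant P = - (D - 2)/2 minimizes P^2 + (D - 2) P, with value - (D - 2)^2 / 4, which is at
    most - 3 (D - 3) here. *)
Lemma Lform_bounded_below : form_bounded_below omega u.
Proof.
exists omega => g hg; have [Gam [pg [lk le]]] := Lform_ge d2 cV hV bV hg.
have [g2 _ _ _] := inXrad_L2 d2 hg; have lg := L2_mul g2 g2.
have h0 : 13 <= d%:R :> R := d13.
pose D : R := d%:R; pose W s := V s + omega * expR (2 * s).
have r : riccati_on (d := d) W (fun=> True) (fun=> - (D - 2) / 2).
  exists (fun=> 0) => x _; split; [exact: drv_cst|exact: cst_continuous|].
  rewrite /W /profile_potential -/D; have := profile_lt1 d13 om SP x; have := sp_pos SP x.
  rewrite -/D in h0; move: (f x) D h0 (expR (2 * x)) => y E h s y0 y1.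
  have : y ^+ 2 <= 1 by nra.
  have E0 : 0 <= 3 * (E - 3) by lra.
  move=> /(ler_wpM2l E0); rewrite mulr1; have := sqr_ge0 s; have := sqr_ge0 (E - 13).
  by move: (3 * (E - 3) * y ^+ 2) => l; rewrite !expr2; lra.
have rI I : riccati_on (d := d) W I (fun=> - (D - 2) / 2) by have [P' hP] := r; exists P' => x _; exact: hP.
pose k := fun t : X => (flux (wgrad g) t ^+ 2 + W (radT t) * g (vec t) ^+ 2) * radpow (-2) t.
have Ek : k = fun t : X => (flux (wgrad g) t ^+ 2 + V (radT t) * g (vec t) ^+ 2) * radpow (-2) t +
    omega * (g (vec t) * g (vec t)).
  apply/funext => t; rewrite /k /W.
  have e : expR (2 * radT t) * radpow (-2) t = 1 by rewrite /radpow -expRD -mulrDl subrr mul0r expR0.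
  move: (flux _ _) (V _) (g _) (expR _) (radpow _ _) e => a b c s p e.
  transitivity ((a ^+ 2 + b * c ^+ 2) * p + omega * c ^+ 2 * (s * p)); first by ring.
  by rewrite e; ring.
have lk' : L1 k by rewrite Ek; apply: L1D => //; exact: L1Z.
have : 0 <= Int k.
  apply: (riccati_pieces_ge0 d0 (W := W) pg lk' (lexx 0) (rI _) (rI _) (rI _) (C := (D - 2) / 2) (t3 := 0)).
  - by move=> x _; rewrite -/D in h0; lra.
  - by left.
  - by left.
  move=> x x0; have : 1 <= expR (4 * x) by rewrite -[leLHS]expR0 ler_expR; lra.
  by rewrite -/D in h0; move=> e; nra.
rewrite Ek (IntD lk (L1Z omega lg)) (IntZ _ lg) -L2_dotE => h.
by move: le; lra.
Qed.

Lemma eigenvalue_count_ge1 : (1%:R%:E <= negative_eigenvalue_count omega u)%E.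
Proof.
have [la [F [la0 eF]]] := ground_eigenfunction d13 om SP cV hV bV.
apply: ereal_sup_ubound; exists 1%N, (fun=> radfun F), (fun=> la); split => //.
move=> c h j; apply/eqP; apply: contraT => cj; have [_ + _] := eF; case.
apply: filterS h => t; rewrite /lincomb big_ord1 => /eqP; rewrite mulf_eq0 => /orP[|/eqP//].
by rewrite (ord1 ord0) -(ord1 j) (negbTE cj).
Qed.

Lemma eigenvalue_count_le_jump k (g : 'I_k -> 'rV[R]_d -> R) (lambda : 'I_k -> R) : L2_free g ->
  (forall j, lambda j < 0 /\ L_eigenfunction omega u (lambda j) (g j)) ->
  (16 <= d%:R :> R -> (k <= 1)%N) /\
  (d%:R = 13 :> R \/ d%:R = 14 :> R \/ d%:R = 15 :> R -> (k <= 2)%N).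
Proof.
move=> free eig; split => hd.
  have [t1 [t2 h]] := profile_Lform_ge0 (jump := true) hd.
  apply: (eigenvalue_count_le (n := 1) d2 cV hV bV (z := fun=> t2) _ free eig) => q Gam hq pq z0.
  by apply: (h q Gam hq pq); [left|exact: (z0 ord0)].
have [t1 [t2 h]] := profile_Lform_ge0 (jump := false) hd.
apply: (eigenvalue_count_le (n := 2) d2 cV hV bV (z := fun i => if i == ord0 then t1 else t2) _ free eig) => q Gam hq pq z0.
by apply: (h q Gam hq pq); [right; exact: (z0 ord0)|exact: (z0 (lift ord0 ord0))].
Qed.

Lemma morse_index_large :
  (16 <= d%:R :> R -> morse_index omega u = 1%E) /\
  (d%:R = 13 :> R \/ d%:R = 14 :> R \/ d%:R = 15 :> R ->
   morse_index omega u = 1%E \/ morse_index omega u = 2%:E).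
Proof.
have -> : morse_index omega u = negative_eigenvalue_count omega u.
  by rewrite /morse_index; case: asboolP => // h; case: h; exact: Lform_bounded_below.
have ge1 := eigenvalue_count_ge1; split => hd.
  apply/eqP; rewrite eq_le ge1 andbT; apply: ge_ereal_sup => _ [k [g [la [-> free eig]]]].
  by rewrite lee_fin (ler_nat R k 1); exact: (eigenvalue_count_le_jump free eig).1.
have le2 : (negative_eigenvalue_count omega u <= 2%:E)%E.
  apply: ge_ereal_sup => _ [k [g [la [-> free eig]]]].
  by rewrite lee_fin (ler_nat R k 2); exact: (eigenvalue_count_le_jump free eig).2.
(* The supremum is over integers at most 2, so it is 2 if two independent eigenfunctions exist and
   at most 1 otherwise. *)
have [[g [la [free eig]]]|no] := pselect (exists (g : 'I_2 -> 'rV[R]_d -> R) (la : 'I_2 -> R),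
    L2_free g /\ forall j, la j < 0 /\ L_eigenfunction omega u (la j) (g j)).
  right; apply/eqP; rewrite eq_le le2 /=; apply: ereal_sup_ubound.
  by exists 2%N, g, la.
left; apply/eqP; rewrite eq_le ge1 andbT; apply: ge_ereal_sup => _ [k [g [la [-> free eig]]]].
rewrite lee_fin (ler_nat R k 1) leqNgt; apply/negP => k1.
have k2 : k = 2%N by apply/eqP; rewrite eqn_leq k1 andbT; exact: (eigenvalue_count_le_jump free eig).2.
by case: no; subst k; exists g, la.
Qed.

End large_dimension.

(** * Trial functions for d <= 12 *)

Section pos_part.
Context {R : realType}.
Implicit Types x y : R.

Lemma drv_pos_part_sqr y : is_derive y 1 (fun y : R => Num.max y 0 ^+ 2) (2 * Num.max y 0).
Proof.
apply: (@der_of_quad _ _ _ _ 1) => x.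
have M (z : R) : (0 <= z /\ Num.max z 0 = z) \/ (z < 0 /\ Num.max z 0 = 0).
  by case: (leP 0 z) => h; [left|right].
have := sqr_ge0 x; have := sqr_ge0 y; have := sqr_ge0 (x - y); rewrite !expr2.
case: (M y) => -[y0 ->]; case: (M x) => -[x0 ->]; rewrite ler_norml => h1 h2 h3.
- by apply/andP; split; lra.
- have := mulr_ge0_le0 y0 (ltW x0) => h4; by apply/andP; split; lra.
- have := mulr_ge0_le0 x0 (ltW y0) => h4; by apply/andP; split; lra.
- by apply/andP; split; lra.
Qed.

Lemma continuous_pos_part : continuous (fun y : R => Num.max y 0).
Proof. by move=> x; apply: (@continuous_max _ _ (fun y => y) (fun=> 0)); [exact: cvg_id|exact: cst_continuous]. Qed.

(** The squared positive part is C^1 with compact support and polynomial on its support, so that its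
    energy has an explicit primitive. *)
Definition well (c N t : R) : R := Num.max (N ^+ 2 - (t - c) ^+ 2) 0 ^+ 2.
Definition well' (c N t : R) : R := - (4 * (t - c) * Num.max (N ^+ 2 - (t - c) ^+ 2) 0).

Lemma drv_well (c N t : R) : is_derive t 1 (well c N) (well' c N t).
Proof.
have d1 := drv_add (drv_id t) (drv_cst (- c) t).
have d2 := drv_add (drv_cst (N ^+ 2) t) (drv_opp (drv_mul d1 d1)).
have := drv_comp d2 (drv_pos_part_sqr _).
set w := (Y in is_derive _ _ _ Y -> _) => h.
have -> : well' c N t = w by rewrite /w /well' expr2; ring.
by apply: der_ext h => y; rewrite /well !expr2.
Qed.

Lemma well_out c N t : 0 <= N -> ~~ (c - N <= t <= c + N) -> well c N t = 0 /\ well' c N t = 0.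
Proof.
move=> N0 h; rewrite /well /well' max_r ?expr0n ?mulr0 ?oppr0//.
by move: h; rewrite negb_and -!ltNge => /orP[h|h]; nra.
Qed.

Lemma continuous_well' c N : continuous (well' c N).
Proof.
have c1 : continuous (fun t : R => t - c) by apply: cont_add; [exact: cont_id|exact: cont_cst].
apply: cont_opp; apply: cont_mul; first by apply: cont_mul => //; exact: cont_cst.
apply: (cont_comp _ continuous_pos_part); apply: cont_add; first exact: cont_cst.
by apply: cont_opp; exact: cont_pow.
Qed.

(* The energy of [well] against the constant potential -de: a primitive of
   [B'^2 - m B B' - de B^2] for [B = (N^2 - x^2)^2]. *)
Definition well_energy (m de N x : R) : R :=
  16 * (N ^+ 4 * x ^+ 3 / 3 - 2 * N ^+ 2 * x ^+ 5 / 5 + x ^+ 7 / 7) - m / 2 * (N ^+ 2 - x ^+ 2) ^+ 4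
  - de * (N ^+ 8 * x - 4 * N ^+ 6 * x ^+ 3 / 3 + 6 * N ^+ 4 * x ^+ 5 / 5 - 4 * N ^+ 2 * x ^+ 7 / 7 + x ^+ 9 / 9).

Definition well_density (m de N x : R) : R :=
  (4 * x * (N ^+ 2 - x ^+ 2)) ^+ 2 + m * (N ^+ 2 - x ^+ 2) ^+ 2 * (4 * x * (N ^+ 2 - x ^+ 2))
  - de * (N ^+ 2 - x ^+ 2) ^+ 4.

Lemma drv_well_energy m de N (x : R) : is_derive x 1 (well_energy m de N) (well_density m de N x).
Proof.
have P n : is_derive x 1 (fun y : R => y ^+ n) (n%:R * x ^+ n.-1).
  have := drv_pow n (drv_id x); rewrite mulr1; set w := (Y in is_derive _ _ _ Y -> _) => h.
  by suff <- : w = n%:R * x ^+ n.-1 by []; rewrite /w ?mulr_natl.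
have S (k : R) n := drv_mul (drv_cst k x) (P n).
have E1 := drv_mul (drv_cst 16 x) (drv_add (S (N ^+ 4 / 3) 3%N) (drv_add (S (- (2 * N ^+ 2 / 5)) 5%N) (S (1 / 7) 7%N))).
have E2 := drv_mul (drv_cst (- (m / 2)) x) (drv_pow 4 (drv_add (drv_cst (N ^+ 2) x) (drv_opp (P 2%N)))).
have E3 := drv_mul (drv_cst (- de) x) (drv_add (S (N ^+ 8) 1%N) (drv_add (S (- (4 * N ^+ 6 / 3)) 3%N)
   (drv_add (S (6 * N ^+ 4 / 5) 5%N) (drv_add (S (- (4 * N ^+ 2 / 7)) 7%N) (S (1 / 9) 9%N))))).
have := drv_add E1 (drv_add E2 E3); set w := (Y in is_derive _ _ _ Y -> _) => h.
suff -> : well_density m de N x = w by apply: der_ext h => y; rewrite /well_energy expr1; field.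
by rewrite /w /well_density /=; field.
Qed.

(** The quotient of the integrals of B'^2 and B^2 is 3 / N^2 for B = (N^2 - x^2)^2; the term with
    [m] integrates to 0. *)
Lemma well_energy_lt0 m de N : 0 < N -> 3 < de * N ^+ 2 ->
  well_energy m de N N - well_energy m de N (- N) < 0.
Proof.
move=> N0 h; have [k k0 ->] : exists2 k : R, 0 < k &
    well_energy m de N N - well_energy m de N (- N) = k * N ^+ 7 * (3 - de * N ^+ 2).
  by exists ((16 * 16) / (9 * 35)); [lra|rewrite /well_energy; field].
by rewrite pmulr_rlt0 ?subr_lt0// mulr_gt0// exprn_gt0.
Qed.

End pos_part.

Section wells.
Context {R : realType} {d : nat} (d2 : (2 < d)%N).
Local Notation T := (measurableTypeR R).
Local Notation X := (d.-tuple T).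
Local Notation mu := (lebesgue_tuple R d).
Local Notation c0 := (polar_cst (R := R) (d := d)).
Let d0 : (0 < d)%N. Proof. by rewrite (ltn_trans _ d2). Qed.
Let m : R := d%:R - 2.

Lemma L2_radial_compact (q : R -> R) (a b : R) : continuous q ->
  (forall s, ~~ (a <= s <= b) -> q s = 0) -> L2 (fun t : X => q (radT t)).
Proof.
move=> cq q0; have [M [M0 hM]] := continuous_bounded_itv a b cq.
apply: (L2_radial_bounded (B := M) (b := b) cq) => s.
  by case: (boolP (a <= s <= b)) => [/hM//|/q0 ->]; rewrite normr0.
by move=> bs; apply: q0; rewrite negb_and -!ltNge bs orbT.
Qed.

(** The factor e^{-mt/2}, with m = d - 2, cancels the weight e^{mt} of the energy and turns F'^2
    into B'^2 - m B B' + (m/2)^2 B^2: the Hardy constant appears as a shift of the potential. *)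
Definition trial (c N t : R) : R := expR (- (m / 2) * t) * well c N t.
Definition trial' (c N t : R) : R := expR (- (m / 2) * t) * (well' c N t - m / 2 * well c N t).

Lemma drv_trial (c N t : R) : is_derive t 1 (trial c N) (trial' c N t).
Proof.
have := drv_mul (drv_exp_lin (- (m / 2)) t) (drv_well c N t).
set w := (Y in is_derive _ _ _ Y -> _) => h; suff -> : trial' c N t = w by [].
by rewrite /w /trial'; ring.
Qed.

Lemma continuous_trial (c N : R) : continuous (trial c N).
Proof. by move=> x; exact: der_cont (drv_trial c N x). Qed.

Let ce (k : R) : continuous (fun s : R => expR (k * s)).
Proof. by apply: cont_exp; apply: cont_mul; [exact: cont_cst|exact: cont_id]. Qed.

Lemma continuous_trial' (c N : R) : continuous (trial' c N).
Proof.
rewrite /trial'; apply: cont_mul; first exact: ce.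
apply: cont_add; first exact: continuous_well'.
apply: cont_opp; apply: cont_mul; first exact: cont_cst.
by move=> x; exact: der_cont (drv_well c N x).
Qed.

Section one_well.
Variables (c N : R).
Hypothesis N0 : 0 < N.

Lemma trial_out t : ~~ (c - N <= t <= c + N) -> trial c N t = 0 /\ trial' c N t = 0.
Proof. by move=> /(well_out (ltW N0))[h1 h2]; rewrite /trial /trial' h1 h2 !(mulr0, subr0). Qed.

Let cut (q : R -> R) : continuous q -> (forall t, ~~ (c - N <= t <= c + N) -> q t = 0) ->
  L2 (fun t : X => q (radT t)).
Proof. by move=> cq q0; exact: L2_radial_compact cq q0. Qed.

Lemma trial_L2 : [/\ L2 (fun t : X => trial c N (radT t)),
  L2 (fun t : X => trial c N (radT t) * radpow 1 t), L2 (fun t : X => trial c N (radT t) * radpow (-1) t) &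
  L2 (fun t : X => trial' c N (radT t) * radpow (-1) t)].
Proof.
split.
- by apply: cut => [|t /trial_out[]//]; exact: continuous_trial.
- apply: (cut (q := fun s => trial c N s * expR (1 * s))) => [|t /trial_out[-> _]]; last by rewrite mul0r.
  by apply: cont_mul; [exact: continuous_trial|exact: ce].
- apply: (cut (q := fun s => trial c N s * expR (-1 * s))) => [|t /trial_out[-> _]]; last by rewrite mul0r.
  by apply: cont_mul; [exact: continuous_trial|exact: ce].
apply: (cut (q := fun s => trial' c N s * expR (-1 * s))) => [|t /trial_out[_ ->]]; last by rewrite mul0r.
by apply: cont_mul; [exact: continuous_trial'|exact: ce].
Qed.

Lemma trial_energy_lt0 (W : R -> R) (de : R) : continuous W -> 3 < de * N ^+ 2 ->
  (forall t, c - N <= t <= c + N -> W t <= - (m / 2) ^+ 2 - de) ->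
  let k := fun t : X => (trial' c N (radT t) ^+ 2 + W (radT t) * trial c N (radT t) ^+ 2) * radpow (-2) t in
  L1 k /\ Int k < 0.
Proof.
move=> cW hN hW k; have [h1 h2 h3 h4] := trial_L2.
have WF : L2 (fun t : X => (W (radT t) * trial c N (radT t)) * radpow (-1) t).
  apply: (cut (q := fun s => W s * trial c N s * expR (-1 * s))) => [|t /trial_out[-> _]]; last by rewrite mulr0 mul0r.
  by apply: cont_mul; [apply: cont_mul => //; exact: continuous_trial|exact: ce].
have lk : L1 k.
  have -> : k = fun t => (trial' c N (radT t) * radpow (-1) t) * (trial' c N (radT t) * radpow (-1) t) +
     (W (radT t) * trial c N (radT t) * radpow (-1) t) * (trial c N (radT t) * radpow (-1) t).
    by apply/funext => t; rewrite /k radpow2; ring.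
  by apply: L1D; [exact: L2_mul|exact: L2_mul].
split => //.
(* Annuli are open at their inner end; the interval is enlarged by 1 to contain the closed
   support. *)
pose A := c - N - 1; pose B := c + N; have AB : c - N < c + N by have h0 : 0 < N := N0; lra.
have sup (t : X) : tradius t != 0 -> k t != 0 -> A < radT t <= B.
  move=> _; apply: contraNT => h; rewrite /k.
  have [|-> ->] := @trial_out (radT t); last by rewrite expr0n /= mulr0 addr0 mul0r.
  by apply: contraNN h => /andP[e1 ->]; rewrite andbT /A; lra.
rewrite (Int_annulus d0 (L1_meas lk) sup).
have lock := loc_int_L1 d0 lk.
have e1 : A <= c - N by rewrite /A; lra.
rewrite (annulus_split d0 lock e1 (ltW AB)) (annulus_ext (g := fun=> 0)); last first.
  move=> t /annulus_radT[_ /andP[_ le]]; rewrite /k.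
  have [s0|/trial_out[-> ->]] := boolP (c - N <= radT t <= c + N); last by rewrite expr0n /= mulr0 addr0 mul0r.
  have e : radT t = c - N by apply/eqP; rewrite eq_le le; case/andP: s0.
  rewrite e /trial' /trial /well' /well.
  have -> : N ^+ 2 - (c - N - c) ^+ 2 = 0 by ring.
  have -> : Num.max 0 0 = 0 :> R by rewrite maxxx.
  by rewrite !expr2; ring.
rewrite /annulus_int Rintegral_cst ?mul0r ?add0r; last exact: measurable_annulus.
pose q s := well_density m de N (s - c).
have cq : continuous q.
  have c1 : continuous (fun t : R => t - c) by apply: cont_add; [exact: cont_id|exact: cont_cst].
  apply: (cont_comp c1); rewrite /well_density.
  have c2 : continuous (fun x : R => N ^+ 2 - x ^+ 2).
    by apply: cont_add; [exact: cont_cst|apply: cont_opp; apply: cont_pow; exact: cont_id].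
  have c3 : continuous (fun x : R => 4 * x * (N ^+ 2 - x ^+ 2)).
    by apply: cont_mul c2; apply: cont_mul; [exact: cont_cst|exact: cont_id].
  apply: cont_add; last by apply: cont_opp; apply: cont_mul; [exact: cont_cst|exact: cont_pow].
  apply: cont_add; first exact: cont_pow.
  by apply: cont_mul c3; apply: cont_mul; [exact: cont_cst|exact: cont_pow].
have dQ (s : R) : is_derive s 1 (fun s => well_energy m de N (s - c)) (q s).
  have := drv_comp (drv_add (drv_id s) (drv_cst (- c) s)) (drv_well_energy m de N (s - c)).
  by rewrite addr0 mulr1.
have [lq eq] := annulus_FTC d0 AB dQ cq.
apply: (@le_lt_trans _ _ (\int[mu]_(t in annulus (c - N) (c + N)) (radJ t * q (radT t)))).
  apply: (le_Rintegral (measurable_annulus d0 _ _) (lock.2 _ _) lq) => t /annulus_radT[_ /andP[/ltW t1 t2]].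
  have tc : c - N <= radT t <= c + N by rewrite t1 t2.
  have EJ : expR (- (m / 2) * radT t) ^+ 2 * radpow (-2) t = radJ t.
    by rewrite -expRM_natl /radJ /radpow -expRD; congr expR; rewrite /m -mulr_natl; move: (radT t) => r; field.
  rewrite /k /trial /trial' -EJ /q /well_density /well /well' max_l; last by nra.
  have := hW _ tc; have := radpow_gt0 (-2) t; move: (radpow (-2) t) (expR _) => p a p0.
  move: (W _) (radT t - c) m => w x mm hw.
  set y := N ^+ 2 - x ^+ 2.
  have h : 0 <= (- (mm / 2) ^+ 2 - de - w) * y ^+ 4 * (a ^+ 2 * p).
    apply: mulr_ge0; first by apply: mulr_ge0; [rewrite subr_ge0|rewrite exprn_even_ge0].
    by apply: mulr_ge0; [exact: sqr_ge0|exact: ltW].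
  rewrite -subr_ge0 (_ : _ - _ = (- (mm / 2) ^+ 2 - de - w) * y ^+ 4 * (a ^+ 2 * p))//.
  by field.
rewrite eq pmulr_rlt0; last exact: (polar_cst_gt0 d0).
have -> : c + N - c = N by ring.
have -> : c - N - c = - N by ring.
exact: well_energy_lt0.
Qed.

End one_well.
End wells.

(** * The Morse index for d <= 12 *)

Section small_dimension.
Context {R : realType} {d : nat}.
Local Notation T := (measurableTypeR R).
Local Notation X := (d.-tuple T).
Local Notation mu := (lebesgue_tuple R d).
Variables (omega : R) (u : 'rV[R]_d -> R) (f f1 f2 : R -> R) (VM : R).
Hypotheses (d5 : 5 <= d%:R :> R) (d12 : d%:R <= 12 :> R) (SP : sing_profile d omega f f1 f2).
Local Notation V := (profile_potential d omega f).
Hypotheses (hV : forall t : X, tradius t != 0 ->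
    tradius t ^+ 2 - omega - 3 * u (vec t) ^+ 2 = V (radT t) * radpow (-2) t)
  (bV : forall s, `|V s| <= VM * (1 + expR (2 * s) + expR (4 * s))).

Let d2 : (2 < d)%N. Proof. by rewrite -(ltr_nat R); have h := d5; lra. Qed.
Let d0 : (0 < d)%N. Proof. by rewrite (ltn_trans _ d2). Qed.
Let cV : continuous V. Proof. exact: continuous_profile_potential SP. Qed.
Let D : R := d%:R.

(* Here 3 (D - 3) exceeds the Hardy constant (D - 2)^2 / 4. *)
Lemma subcritical_potential (C : R) : exists2 de : R, 0 < de & exists T0 : R, forall t, t <= T0 ->
  V t + C * expR (2 * t) <= - ((D - 2) / 2) ^+ 2 - de.
Proof.
have h5 : 5 <= D := d5; have h12 : D <= 12 := d12.
pose g := 3 * (D - 3) - ((D - 2) / 2) ^+ 2; have g0 : 0 < g.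
  (* Indeed 4 g = (D - 5) (12 - D) + (20 - D). *)
  have h : 0 <= (D - 5) * (12 - D) by rewrite mulr_ge0 ?subr_ge0.
  by rewrite /g expr2; lra.
exists (g / 2); first by rewrite divr_gt0.
have [K [t0 hK]] := sp_origin SP.
pose Q := 1 + `|C| + `|omega| + 6 * (D - 3) * `|K|.
have Q1 : 1 <= Q.
  have := normr_ge0 C; have := normr_ge0 omega; have : 0 <= 6 * (D - 3) * `|K| by rewrite mulr_ge0//; lra.
  by rewrite /Q; lra.
have Q0 : 0 < Q by lra.
have e0 : 0 < Num.min 1 (g / (2 * Q)) by rewrite lt_min ltr01 divr_gt0// mulr_gt0.
have [T0 T0t hT] := @expR_small R 2 _ t0 ltac:(lra) e0.
exists T0 => t tT; have := hT t tT; rewrite lt_min => /andP[s1].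
rewrite ltr_pdivlMr ?mulr_gt0// => s2; have [hf _] := hK t (le_trans tT T0t).
have s0 := expR_gt0 (2 * t); move: s0 s1 s2 hf; rewrite /profile_potential -/D.
move: (expR _) => s s0 s1 s2 hf.
have {}hf : `|f t - 1| <= `|K| * s by apply: le_trans hf _; rewrite ler_wpM2r ?ler_norm// ltW.
have f2s : 1 - 2 * `|K| * s <= f t ^+ 2.
  have := sqr_ge0 (f t - 1); move: hf; rewrite ler_norml => /andP[a b]; rewrite !expr2; lra.
have Cs : C * s <= `|C| * s by rewrite ler_wpM2r ?ler_norm// ltW.
have os : - omega * s <= `|omega| * s by rewrite ler_wpM2r ?(ltW s0)// -normrN ler_norm.
have D3 : 0 <= 3 * (D - 3) by lra.
have := ler_wpM2l D3 f2s => f2s'.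
have ss : s ^+ 2 <= s by rewrite expr2 ler_piMl// ltW.
have gE : ((D - 2) / 2) ^+ 2 = 3 * (D - 3) - g by rewrite /g; ring.
rewrite gE; move: f2s'; move: (f t ^+ 2) => y f2s'.
have QE : Q * s = s + `|C| * s + `|omega| * s + 6 * (D - 3) * `|K| * s by rewrite /Q; ring.
have {}f2s' : 3 * (D - 3) - 6 * (D - 3) * `|K| * s <= 3 * (D - 3) * y by move: f2s'; lra.
move: (6 * (D - 3) * `|K| * s) (3 * (D - 3) * y) (`|C| * s) (`|omega| * s) QE f2s' Cs os => k1 k2 k3 k4 QE h1 h2 h3.
have : 2 * (Q * s) < g by rewrite mulrA mulrC.
by rewrite QE; lra.
Qed.

Local Notation tfun c N := (radfun (d := d) (trial (d := d) c N)).

Lemma trial_inXrad (c N : R) : 0 < N -> inXrad (tfun c N) /\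
  {ae mu, forall t : X, forall i, wgrad (tfun c N) i (vec t) = trial' (d := d) c N (radT t) * tnth t i * radpow (-2) t}.
Proof.
move=> N0; have [h1 h2 h3 h4] := @trial_L2 R d c N N0.
by apply: (radfun_inXrad d2 (@drv_trial R d c N) (@continuous_trial' R d c N)).
Qed.

Lemma trial_Lform_lt0 (C de c N : R) : 0 < N -> 3 < de * N ^+ 2 ->
  (forall t, t <= c + N -> V t + C * expR (2 * t) <= - ((D - 2) / 2) ^+ 2 - de) ->
  Lform omega u (tfun c N) (tfun c N) + C * L2_dot (tfun c N) (tfun c N) < 0.
Proof.
move=> N0 hN hW; have [h1 h2 h3 h4] := @trial_L2 R d c N N0.
pose W (t : R) := V t + C * expR (2 * t).
have cW : continuous W.
  apply: cont_add => //; apply: cont_mul; first exact: cont_cst.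
  by apply: cont_exp; apply: cont_mul; [exact: cont_cst|exact: cont_id].
have [lk neg] := trial_energy_lt0 d2 N0 cW hN (fun t h => hW t (andP h).2).
have lg := L2_mul h1 h1.
rewrite (Lform_radfun_self d2 cV hV bV (@drv_trial R d c N) (@continuous_trial' R d c N) h1 h2 h4) L2_dotE.
have lC := L1Z C lg.
suff -> : Int (fun t : X => (trial' (d := d) c N (radT t) ^+ 2 + V (radT t) * trial (d := d) c N (radT t) ^+ 2) * radpow (-2) t) =
  Int (fun t : X => (trial' (d := d) c N (radT t) ^+ 2 + W (radT t) * trial (d := d) c N (radT t) ^+ 2) * radpow (-2) t) -
  C * Int (fun t : X => trial (d := d) c N (radT t) * trial (d := d) c N (radT t)) by rewrite subrK.
rewrite -(IntZ C lg) -(IntN lC) -(IntD lk (L1N lC)); congr Int; apply/funext => t.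
have e : expR (2 * radT t) * radpow (-2) t = 1 by rewrite /radpow -expRD -mulrDl subrr mul0r expR0.
rewrite /W; move: (trial' _ _ _) (V _) (trial _ _ _) (expR _) (radpow _ _) e => a b x s p e.
transitivity ((a ^+ 2 + b * x ^+ 2) * p + C * x ^+ 2 * (s * p) - C * (x * x)); last by ring.
by rewrite e; ring.
Qed.

Lemma trial_Lform_cross (c c' N : R) : 0 < N -> c + N < c' - N ->
  Lform omega u (tfun c N) (tfun c' N) = 0.
Proof.
move=> N0 cc; have [h w] := trial_inXrad c N0; have [h' w'] := trial_inXrad c' N0.
rewrite (LformE d2 cV hV bV h h').
have [_ _ _ g] := inXrad_L2 d2 h; have [_ _ _ g'] := inXrad_L2 d2 h'.
transitivity (Int (fun _ : X => 0 : R)); last by rewrite /Int /Rintegral integral0.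
apply: Int_ae; [|exact: measurable_cst|].
  by apply: L1_meas; apply: L1D; [exact: L1_wgrad|exact: (L1_V d2 cV bV h h')].
apply: filterS2 w w' => t w w'.
rewrite /radfun -/(tradius t) -/(radT t); under eq_bigr do rewrite w w'.
have [/andP[_ le]|out] := boolP (c - N <= radT t <= c + N).
  have [|-> ->] := @trial_out R d c' N N0 (radT t).
    by rewrite negb_and -!ltNge (le_lt_trans le cc).
  by rewrite big1 ?mulr0 ?addr0// => i _; rewrite !mul0r mulr0.
have [-> ->] := @trial_out R d c N N0 (radT t) out.
by rewrite big1 ?mul0r ?mulr0 ?addr0// => i _; rewrite !mul0r.
Qed.

Lemma form_not_bounded_below : ~ form_bounded_below omega u.
Proof.
move=> [C hC]; have [de de0 [T0 hT]] := subcritical_potential C.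
pose N := 1 + 3 / de; have N1 : 1 <= N by rewrite /N lerDl divr_ge0// ltW.
have N0 : 0 < N by lra.
have hN : 3 < de * N ^+ 2.
  have : de * N = de + 3 by rewrite /N mulrDr mulr1 mulrC divfK ?gt_eqF.
  by rewrite expr2 mulrA => ->; nra.
have := @trial_Lform_lt0 C de (T0 - N) N N0 hN _.
rewrite subrK => /(_ hT); have := hC _ (trial_inXrad (T0 - N) N0).1.
move: (Lform _ _ _ _) (L2_dot _ _) => a b; rewrite mulNr; lra.
Qed.

Lemma form_negative_index_infty : form_negative_index omega u = +oo%E.
Proof.
have [de de0 [T0 hT]] := subcritical_potential 0.
pose N := 1 + 3 / de; have N1 : 1 <= N by rewrite /N lerDl divr_ge0// ltW.
have N0 : 0 < N by lra.
have hN : 3 < de * N ^+ 2.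
  have : de * N = de + 3 by rewrite /N mulrDr mulr1 mulrC divfK ?gt_eqF.
  by rewrite expr2 mulrA => ->; nra.
suff ge k : (k%:R%:E <= form_negative_index omega u)%E.
  by apply/eqyP => A A0; apply: le_trans (ge (Num.bound A)); rewrite lee_fin ltW// archi_boundP// ltW.
(* Centres at distance 3N for supports of length 2N, hence disjoint, all to the left of [T0], where
   the potential is below the Hardy threshold. *)
pose z (j : nat) := T0 - N - 3 * N * j%:R; pose F (j : 'I_k) := tfun (z j) N.
have hF j : inXrad (F j) := (trial_inXrad _ N0).1.
have cross (i j : 'I_k) : i != j -> Lform omega u (F i) (F j) = 0.
  move=> ij; wlog lt : i j ij / (i < j)%N.
    move=> h; case: (ltngtP i j) => [|ji|/ord_inj e]; [exact: h| |by rewrite e eqxx in ij].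
    by rewrite LformC; apply: h; rewrite // eq_sym.
  rewrite LformC; apply: trial_Lform_cross => //; rewrite /z.
  have : (i%:R + 1 <= j%:R :> R) by rewrite natr1 ler_nat.
  by move=> h; nra.
apply: ereal_sup_ubound; exists k, F; split => // c [j0 cj0].
rewrite (Lform_lincomb d2 cV hV bV c hF (inXrad_lincomb c hF)).
have E i : c i * Lform omega u (F i) (lincomb c F) = c i ^+ 2 * Lform omega u (F i) (F i).
  rewrite LformC (Lform_lincomb d2 cV hV bV c hF (hF i)) (bigD1 i)//= big1 ?addr0 ?mulrA//.
  by move=> j ji; rewrite cross ?mulr0// .
under eq_bigr do rewrite E.
have neg i : Lform omega u (F i) (F i) < 0.
  have := @trial_Lform_lt0 0 de (z i) N N0 hN; rewrite mul0r addr0; apply => t th; apply: hT.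
  apply: le_trans th _; rewrite /z; have : 0 <= 3 * N * i%:R by rewrite mulr_ge0 ?ler0n// mulr_ge0// ltW.
  lra.
rewrite (bigD1 j0)//=; apply: ltr_wnDr.
  by apply: sumr_le0 => i _; apply: mulr_ge0_le0; [exact: sqr_ge0|exact: ltW].
by rewrite pmulr_rlt0// exprn_even_gt0.
Qed.

Lemma morse_index_small : morse_index omega u = +oo%E.
Proof.
rewrite /morse_index; case: asboolP => [/form_not_bounded_below//|_].
exact: form_negative_index_infty.
Qed.

End small_dimension.

Theorem theorem1p2 (R : realType) (d : nat) (omega : R) (u : 'rV[R]_d -> R)
    (hd : (5 <= d)%N) (homega : d%:R - 4 < omega < d%:R)
    (hu : singular_solution omega u) :
  [/\ (d <= 12)%N -> morse_index omega u = +oo%E,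
      (13 <= d <= 15)%N ->
        morse_index omega u = 1%E \/ morse_index omega u = 2%:E &
      (16 <= d)%N -> morse_index omega u = 1%E].
Proof.
case: d omega u hd homega hu => // n omega u hd homega hu.
have [f [f1 [f2 [SP uE]]]] := sing_profile_exists hd hu.
have h5 : 5 <= n.+1%:R :> R by rewrite (ler_nat R 5).
have h3 : 3 <= n.+1%:R :> R by apply: le_trans h5; lra.
have hV := profile_potentialE omega h3 uE.
have [VM bV] := profile_potential_bound SP.
split=> hn.
- by apply: (morse_index_small h5 _ SP hV bV); rewrite (ler_nat R _ 12).
- have h13 : 13 <= n.+1%:R :> R by rewrite (ler_nat R 13); case/andP: hn.
  apply: (morse_index_large h13 homega SP hV bV).2.
  have : (n.+1 == 13) || (n.+1 == 14) || (n.+1 == 15).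
    by move: hn; clear -n; do 15!case: n => [|n] //.
  by move=> /orP[/orP[]|] /eqP ->; [left|right; left|right; right].
- apply: (morse_index_large _ homega SP hV bV).1; rewrite ?(ler_nat R 16)//.
  by rewrite (ler_nat R 13) (leq_trans _ hn).
Qed.
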